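(* Let $g\in\mathbb{C}[x_1,x_2,x_3,x_4]$ be the homogeneous polynomial of degree $8$ defined in the context. Then: (a) $\mathcal{Z}(g)$ is an irreducible surface of degree $8$ in $\mathbf{P}^3(\mathbb{C})$ with exactly $44$ singular points, which are all quotient singularities of type $D_4$. (b) If $k\ge 1$, then $\mathcal{Z}(g[k])$ is an irreducible surface of degree $8k$ whose singular locus has dimension $0$ and contains at least $44k^3$ quotient singularities of type $D_4$. (c) $\mathcal{Z}(g[2])$ is an irreducible surface of degree $16$ with exactly $472$ singular points: $24$ quotient singularities of type $A_1$, $96$ quotient singularities of type $A_2$ and $352$ quotient singularities of type $D_4$. (d) $\mathcal{Z}(g[3])$ is an irreducible surface of degree $24$ in $\mathbf{P}^3(\mathbb{C})$ with exactly $1440$ singular points, which are all quotient singularities of type $D_4$. The automorphism group of $\mathcal{Z}(g[3])$ contains at least $25920$ elements and acts transitively on the $1440$ singular points.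
   Context: Notation. For a homogeneous $f\in\mathbb{C}[x_1,x_2,x_3,x_4]$, $\mathcal{Z}(f)\subset\mathbf{P}^3(\mathbb{C})$ is the projective hypersurface defined by $f$. For a natural number $k$, $f[k]$ denotes the homogeneous polynomial $f(x_1^k,x_2^k,x_3^k,x_4^k)$. Quotient singularities: a point of a surface is a quotient singularity of type $A_n$ (resp. $D_4$) if the surface is, locally analytically at that point, isomorphic to the germ at the origin of $\{x^2+y^2+z^{n+1}=0\}\subset\mathbb{C}^3$ (resp. $\{x^2+y^2z+z^3=0\}\subset\mathbb{C}^3$). The group $W_1$ is the subgroup of $\mathrm{GL}_4(\mathbb{C})$ generated by $$s_1=\begin{pmatrix}0&1&0&0\\1&0&0&0\\0&0&1&0\\0&0&0&-1\end{pmatrix},\quad s_2=\begin{pmatrix}1&0&0&0\\0&0&1&0\\0&1&0&0\\0&0&0&-1\end{pmatrix},\quad s_3=\begin{pmatrix}-1&0&0&0\\0&1&0&0\\0&0&0&1\\0&0&1&0\end{pmatrix}.$$ It acts on $\mathbb{C}[x_1,x_2,x_3,x_4]$ by linear substitution of the variables. For a partition $\lambda=(\lambda_1\ge\lambda_2\ge\lambda_3\ge\lambda_4\ge 0)$ of $8$ of length at most $4$, let $\Omega_\lambda^-$ be the orbit (a set of signed monomials) of $x_1^{\lambda_1}x_2^{\lambda_2}x_3^{\lambda_3}x_4^{\lambda_4}$ under $W_1$, and let $m_\lambda^-=\sum_{m\in\Omega_\lambda^-}m$ (sum over the distinct elements of the orbit). Partitions are abbreviated by writing their nonzero parts consecutively,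 e.g. $m_{611}^-=m_{(6,1,1,0)}^-$; for instance $m_{611}^-=x_1^6x_2x_3+x_1^6x_2x_4-x_1^6x_3x_4+x_1x_2^6x_3-x_1x_2^6x_4+x_2^6x_3x_4+x_1x_2x_3^6+x_1x_3^6x_4-x_2x_3^6x_4-x_1x_2x_4^6-x_1x_3x_4^6-x_2x_3x_4^6$. The polynomial $g$ is $$g=m_8^- -6\,m_{62}^- -60\,m_{611}^- +2240\,m_{521}^- -14\,m_{44}^- +10180\,m_{431}^- +40412\,m_{422}^- -23440\,m_{4211}^- +111980\,m_{332}^- +154704\,m_{2222}^-.$$ *)

(* Defs.v *)
From HB Require Import structures.
From mathcomp Require Import all_boot all_order all_algebra.
From mathcomp Require Import mathcomp_extra boolp classical_sets functions.
From mathcomp Require Import cardinality fsbigop reals.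
From mathcomp Require Import topology normedtype derive.
From mathcomp Require Import complex.
From mathcomp.multinomials Require mpoly.
(* The notations of mpoly clash with those of MathComp-Analysis. *)
Import -(notations) mpoly.

Set Implicit Arguments.
Unset Strict Implicit.
Unset Printing Implicit Defensive.

Import Order.TTheory GRing.Theory Num.Theory.
Import numFieldNormedType.Exports.

Local Open Scope classical_set_scope.
Local Open Scope ring_scope.

(* For R : realType, R[i] is the field of complex numbers. *)
Definition complexes (R : realType) : numClosedFieldType := R[i].

Section ProjectiveSpace.
Variable C : numClosedFieldType.

Definition poly4 := mpoly 4 C.

Definition homogeneous (d : nat) (f : poly4) : Prop :=
  f \is ishomog1 d [the measure _ of mdeg].

Definition evalv (f : poly4) (x : 'rV[C]_4) : C := meval (fun i => x 0 i) f.

(* Points of P^3 are the lines through 0 in C^4. *)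
Definition P3 := {V : {vspace 'rV[C]_4} | \dim V == 1%N}.

Definition vanishes_at (f : poly4) (p : P3) : Prop :=
  forall x, x \in val p -> evalv f x = 0.

Definition zeros (f : poly4) : set P3 := [set p | vanishes_at f p].

Definition singular_locus (f : poly4) : set P3 :=
  [set p | zeros f p /\ forall i : 'I_4, vanishes_at (mderiv i f) p].

Definition zariski_closed (X : set P3) : Prop :=
  exists S : set poly4, (forall f, S f -> exists d, homogeneous d f) /\
    X = [set p | forall f, S f -> vanishes_at f p].

Definition irreducible_closed (X : set P3) : Prop :=
  [/\ zariski_closed X, X !=set0 &
    forall A B : set P3, zariski_closed A -> zariski_closed B ->
      X `<=` A `|` B -> X `<=` A \/ X `<=` B].

(* Krull dimension: n is the maximal length of a strictly increasing chain of
   irreducible closed subsets of X. *)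
Definition irreducible_chain (X : set P3) (n : nat) : Prop :=
  exists Y : nat -> set P3,
    (forall i, (i <= n)%N -> irreducible_closed (Y i) /\ Y i `<=` X) /\
    (forall i, (i < n)%N -> Y i `<` Y i.+1).

Definition zariski_dim (X : set P3) (n : nat) : Prop :=
  irreducible_chain X n /\ ~ irreducible_chain X n.+1.

(* Besides the irreducibility of the closed set zeros f, the last clause says
   that f generates the homogeneous ideal of zeros f (the hypersurface is
   reduced), so that d really is the degree of that surface. *)
Definition irreducible_surface (f : poly4) (d : nat) : Prop :=
  [/\ homogeneous d f, f != 0, irreducible_closed (zeros f) &
    forall (e : nat) (h : poly4), homogeneous e h -> zeros f `<=` zeros h ->
      exists q : poly4, h = q * f].

(* Locally at each point, phi is given by four forms of the same degree. *)
Definition regular_map (X Y : set P3) (phi : X -> Y) : Prop :=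
  forall x : X, exists (d : nat) (F : 'I_4 -> poly4),
    [/\ forall i, homogeneous d (F i),
        exists i, ~ vanishes_at (F i) (val x) &
        forall y : X, (exists i, ~ vanishes_at (F i) (val y)) ->
          forall v, v \in val (val y) ->
            \row_i evalv (F i) v \in val (val (phi y))].

Definition automorphisms (X : set P3) : set (X -> X) :=
  [set phi | regular_map phi /\
    exists psi : X -> X, [/\ regular_map psi, cancel phi psi & cancel psi phi]].

Definition automorphisms_transitive_on (X S : set P3) : Prop :=
  (forall phi : X -> X, automorphisms phi ->
    forall x : X, S (val x) -> S (val (phi x))) /\
  (forall x y : X, S (val x) -> S (val y) ->
    exists phi : X -> X, automorphisms phi /\ phi x = y).

Definition subst_pow (k : nat) (f : poly4) : poly4 :=
  comp_mpoly [tuple (mpolyX C (mnm1 i)) ^+ k | i < 4] f.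

End ProjectiveSpace.

Arguments automorphisms {C} X.

Section Germs.
Variable C : numClosedFieldType.
Implicit Types (X Y : set 'rV[C]_3) (a b : 'rV[C]_3).

(* differentiable is complex differentiability, since 'rV[C]_3 is viewed as a
   normed space over C. *)
Definition holomorphic_near (phi : 'rV[C]_3 -> 'rV[C]_3) a : Prop :=
  \forall x \near a, differentiable phi x.

(* Isomorphism of the (reduced) analytic germs (X, a) and (Y, b): morphisms are
   restrictions of holomorphic maps of the ambient spaces. *)
Definition germ_iso X a Y b : Prop :=
  exists phi psi : 'rV[C]_3 -> 'rV[C]_3,
    [/\ holomorphic_near phi a /\ phi a = b,
        holomorphic_near psi b /\ psi b = a,
        \forall x \near a, X x -> Y (phi x) /\ psi (phi x) = x &
        \forall y \near b, Y y -> X (psi y) /\ phi (psi y) = y].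

(* Homogeneous coordinates of the point with affine coordinates a in the
   standard chart where the i-th coordinate is 1. *)
Definition chart (i : 'I_4) a : 'rV[C]_4 :=
  \row_j (if unlift i j is Some k then a 0 k else 1).

Definition chart_preimage (i : 'I_4) (Z : set (P3 C)) : set 'rV[C]_3 :=
  [set a | exists p, Z p /\ chart i a \in val p].

Definition has_germ (Z : set (P3 C)) (p : P3 C) Y : Prop :=
  exists (i : 'I_4) a,
    chart i a \in val p /\ germ_iso (chart_preimage i Z) a Y 0.

Definition A_germ (n : nat) : set 'rV[C]_3 :=
  [set v | v 0 0 ^+ 2 + v 0 1 ^+ 2 + v 0 2 ^+ n.+1 = 0].

Definition D4_germ : set 'rV[C]_3 :=
  [set v | v 0 0 ^+ 2 + v 0 1 ^+ 2 * v 0 2 + v 0 2 ^+ 3 = 0].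

Definition singularities_of_type Y (f : poly4 C) : set (P3 C) :=
  [set p | singular_locus f p /\ has_germ (zeros f) p Y].

End Germs.

Arguments A_germ C n : clear implicits.
Arguments D4_germ C : clear implicits.

Section TheOctic.
Variable C : numClosedFieldType.

Definition mat4 (rows : seq (seq C)) : 'M[C]_4 :=
  \matrix_(i < 4, j < 4) nth 0 (nth [::] rows i) j.

Definition s1 : 'M[C]_4 := mat4
  [:: [:: 0; 1; 0;  0];
      [:: 1; 0; 0;  0];
      [:: 0; 0; 1;  0];
      [:: 0; 0; 0; -1]].

Definition s2 : 'M[C]_4 := mat4
  [:: [:: 1; 0; 0;  0];
      [:: 0; 0; 1;  0];
      [:: 0; 1; 0;  0];
      [:: 0; 0; 0; -1]].

Definition s3 : 'M[C]_4 := mat4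
  [:: [:: -1; 0; 0; 0];
      [::  0; 1; 0; 0];
      [::  0; 0; 0; 1];
      [::  0; 0; 1; 0]].

Inductive W1 : 'M[C]_4 -> Prop :=
| W1_s1 : W1 s1
| W1_s2 : W1 s2
| W1_s3 : W1 s3
| W1_one : W1 1%:M
| W1_mul A B : W1 A -> W1 B -> W1 (A *m B)
| W1_inv A : W1 A -> W1 (invmx A).

(* x_i is replaced by the i-th entry of A x. As the generators of W1 are
   symmetric involutions, orbits under W1 do not depend on whether one uses A,
   its transpose or its inverse here. *)
Definition mx_subst (A : 'M[C]_4) (f : poly4 C) : poly4 C :=
  comp_mpoly [tuple \sum_(j < 4) A i j *: mpolyX C (mnm1 j) | i < 4] f.

Definition monomial (a b c d : nat) : poly4 C :=
  mpolyX C (Multinom [tuple of [:: a; b; c; d]]).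

Definition Omega_minus (a b c d : nat) : set (poly4 C) :=
  [set mx_subst A (monomial a b c d) | A in W1].

Definition m_minus (a b c d : nat) : poly4 C :=
  \sum_(m \in Omega_minus a b c d) m.

Definition octic : poly4 C :=
  m_minus 8 0 0 0
  - 6%:R *: m_minus 6 2 0 0
  - 60%:R *: m_minus 6 1 1 0
  + 2240%:R *: m_minus 5 2 1 0
  - 14%:R *: m_minus 4 4 0 0
  + 10180%:R *: m_minus 4 3 1 0
  + 40412%:R *: m_minus 4 2 2 0
  - 23440%:R *: m_minus 4 2 1 1
  + 111980%:R *: m_minus 3 3 2 0
  + 154704%:R *: m_minus 2 2 2 2.

End TheOctic.

(* Main.v *)
(* Write g for the octic and call a zero x of g[k] critical when x_i D_i g vanishes
   at (x_1^k, ..., x_4^k) for all i, which for k > 1 means singular. The form g[3]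
   is invariant under W_1, under the diagonal matrices of cube roots of unity and
   under one reflection of order three (g is a polynomial in the invariants of the
   reflection group of order 648 on the first three coordinates, and in x_4). By a
   Jacobian determinant, a critical point lies on a mirror, so it can be moved into a
   coordinate plane, and by the same argument in that plane to the point
   (1 : -i : 0 : 0). Hence the singular points of g[3] form one orbit, and those of
   every g[k] are the points over a list of 80 points: 44, 24 and 12 of them with
   four, three and two nonzero coordinates. In suitable affine coordinates
   g is x^2 A + y B + z E near (1 : -i : 0 : 0) with A, B, E units, so pulling back
   by powers gives x^2 + y^a + z^b = 0, and the germs A_1, A_2, D_4 are told apart
   by their tangent vectors. A surface with isolated singularities is irreducible
   since two components would meet along a curve of singular points. *)
Require Import Defs.
From HB Require Import structures.
From Stdlib Require Import ZArith Lia.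
From mathcomp Require Import all_boot all_order all_algebra.
From mathcomp Require Import mathcomp_extra boolp classical_sets functions.
From mathcomp Require Import cardinality fsbigop reals.
From mathcomp Require Import topology normedtype landau derive.
From mathcomp Require Import separable cyclotomic ring ssrZ.
From mathcomp.multinomials Require mpoly.
Import -(notations) mpoly.
Set Implicit Arguments.
Unset Strict Implicit.
Unset Printing Implicit Defensive.
Import Order.TTheory GRing.Theory Num.Theory.
Import numFieldNormedType.Exports.

(** * Polynomial rings over a factorial domain are factorial *)

Section Factorial.
Local Open Scope ring_scope.

(** The form g[3] is an invariant of degree 24 of the Shephard-Todd group G_32, whose degrees are
    12, 18, 24, 30. Its 40 mirrors are the 4 coordinate planes and 36 planes on which one of four
    cubics, each taken at the cubes of three coordinates, vanishes. The group is never enumerated: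
    critical points off the mirrors are excluded because a Jacobian determinant is a constant times
    the square of a product of these cubics, and 25920 = 1440 * 18 automorphisms arise as an orbit
    times a stabilizer. Results for g[3] pass to every g[k] because criticality of x depends only on
    the k-th powers of its coordinates. For k = 1 critical is weaker than singular, and the
    derivative of g normal to a coordinate plane discards the 36 listed points on such planes. The
    A_2 points of g[2] need a form with cubes in three variables and a square in the fourth, because
    the reflection acts only after cubing. The base field is algebraically closed but not assumed
    complete, so solutions of equations with parameters come from algebraic closure instead of a
    contraction. *)

Definition divides (D : idomainType) (a b : D) := exists c, b = c * a.

Definition irreducible_elt (D : idomainType) (a : D) :=
  [/\ a != 0, a \isn't a GRing.unit &
    forall b c, a = b * c -> b \is a GRing.unit \/ c \is a GRing.unit].

Definition prime_elt (D : idomainType) (a : D) :=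
  [/\ a != 0, a \isn't a GRing.unit &
    forall b c, divides a (b * c) -> divides a b \/ divides a c].

(** Plays the part of the number of prime factors: nonunits have positive value, so splitting one
    off lowers [mu]. Descent on [mu] replaces the chain condition on principal ideals. *)
Definition additive_degree (D : idomainType) (mu : D -> nat) :=
  (forall a b, a != 0 -> b != 0 -> mu (a * b) = (mu a + mu b)%N) /\
  (forall a, a != 0 -> mu a = 0%N -> a \is a GRing.unit).

Definition factorial_domain (D : idomainType) :=
  (exists mu : D -> nat, additive_degree mu) /\
  (forall a : D, irreducible_elt a -> prime_elt a).

Lemma divides_refl (D : idomainType) (a : D) : divides a a.
Proof. by exists 1; rewrite mul1r. Qed.

Lemma divides_mull (D : idomainType) (a b c : D) :
  divides a b -> divides a (c * b).
Proof. by move=> [x ->]; exists (c * x); rewrite mulrA. Qed.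

Lemma divides_mulr (D : idomainType) (a b c : D) :
  divides a b -> divides a (b * c).
Proof. by rewrite mulrC; apply: divides_mull. Qed.

Lemma dividesD (D : idomainType) (a b c : D) :
  divides a b -> divides a c -> divides a (b + c).
Proof. by move=> [x ->] [y ->]; exists (x + y); rewrite mulrDl. Qed.

Lemma irreducible_factor (D : idomainType) (mu : D -> nat) (a : D) :
  additive_degree mu -> a != 0 -> a \isn't a GRing.unit ->
  exists p, irreducible_elt p /\ divides p a.
Proof.
move=> [muM mu0]; have [n] := ubnP (mu a); elim: n a => // n IH a lt_an a0 aU.
have [irra|] := pselect (irreducible_elt a).
  by exists a; split=> //; apply: divides_refl.
move=> /not_and3P[|/negP|]; rewrite ?a0 ?aU // => /existsNP[b /existsNP[c]].
move=> /not_implyP[ea /not_orP[/negP bU /negP cU]].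
have [b0 c0] : b != 0 /\ c != 0.
  by split; apply: contra_neq a0 => e; rewrite ea e ?mul0r ?mulr0.
have muc : (0 < mu c)%N by rewrite lt0n; apply: contra_notN (elimN idP cU) => /eqP/mu0->.
have [||//|p [irrp pb]] := IH b _ _ _ => //.
  by rewrite -ltnS (leq_trans _ lt_an) // ltnS ea muM // -addn1 leq_add2l.
by exists p; split=> //; rewrite ea; apply: divides_mulr.
Qed.

Section PolyFactorial.
Variable D : idomainType.
Implicit Types (p c : D) (a b u v : {poly D}).

(** Instead of passing to the quotient by p: p divides the product of the constant coefficients,
    hence one of them. Removing that coefficient and dividing by 'X leaves a smaller product still
    divisible by p. *)
Lemma prime_elt_polyC p : prime_elt p -> prime_elt p%:P.
Proof.
move=> [p0 pU pP]; split; first by rewrite polyC_eq0.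
  by rewrite poly_unitE negb_and coefC eqxx /= pU orbT.
move=> a b; have [n] := ubnP (size a + size b)%N.
elim: n a b => // n IH a b lt_n dab.
have [->|a0] := eqVneq a 0; first by left; exists 0; rewrite mul0r.
have [->|b0] := eqVneq b 0; first by right; exists 0; rewrite mul0r.
have aE := poly_take_drop 1 a; have bE := poly_take_drop 1 b.
set a' := drop_poly 1 a in aE; set b' := drop_poly 1 b in bE.
have t1 (q : {poly D}) : take_poly 1 q = (q`_0)%:P.
  apply/polyP=> i; rewrite coef_take_poly coefC.
  by case: i => [|i].
rewrite !t1 expr1 in aE bE.
have sd (q : {poly D}) : q != 0 -> (size (drop_poly 1 q) < size q)%N.
  by move=> q0; rewrite size_drop_poly subn1 ltn_predL size_poly_gt0.
have [c Ec] := dab.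
have : divides p (a`_0 * b`_0).
  by exists c`_0; have := congr1 (fun q : {poly D} => q`_0) Ec; rewrite /= coef0M coefMC.
have dC (q : {poly D}) : divides p q`_0 -> divides p%:P (q`_0)%:P.
  by move=> [x ->]; exists x%:P; rewrite polyCM.
have pX (q : {poly D}) : divides p%:P (q * 'X) -> divides p%:P q.
  move=> [x e]; exists (drop_poly 1 x); apply/polyP=> i.
  have := congr1 (fun q : {poly D} => q`_i.+1) e.
  by rewrite /= coefMX /= !coefMC coef_drop_poly addn1.
move=> /pP[/dC da|/dC db].
  have : divides p%:P (a' * b).
    apply: pX; rewrite mulrAC -[a' * 'X](addKr (a`_0)%:P) aE mulrDl.
    by apply: dividesD => //; rewrite mulNr -mulrN; apply: divides_mulr.
  move=> /IH[||d]; first by rewrite -ltnS (leq_trans _ lt_n) // ltnS ltn_add2r sd.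
    by left; rewrite -aE; apply: dividesD => //; apply: divides_mulr.
  by right.
have : divides p%:P (a * b').
  apply: pX; rewrite -mulrA -[b' * 'X](addKr (b`_0)%:P) bE mulrDr.
  by apply: dividesD => //; rewrite mulrN -mulNr; apply: divides_mull.
move=> /IH[||d]; first by rewrite -ltnS (leq_trans _ lt_n) // ltnS ltn_add2l sd.
  by left.
by right; rewrite -bE; apply: dividesD => //; apply: divides_mulr.
Qed.

Let scale_mulC c p a : (c * p) *: a = (c *: a) * p%:P.
Proof. by rewrite [RHS]mulrC mul_polyC scalerA mulrC. Qed.

Hypothesis fD : factorial_domain D.

Lemma nonunit_prime_factor (mu : D -> nat) (c : D) : additive_degree mu ->
  c != 0 -> c \isn't a GRing.unit ->
  exists p d, [/\ prime_elt p, c = d * p, d != 0 & (mu d < mu c)%N].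
Proof.
move=> am c0 cU; have [p [irrp [d e]]] := irreducible_factor am c0 cU.
have d0 : d != 0 by apply: contra_neq c0 => d0; rewrite e d0 mul0r.
exists p, d; split=> //; first exact: (fD.2).
case: am => muM mu0; case: irrp => p0 pU _.
rewrite e muM // -addn1 leq_add2l lt0n.
by apply: contraNneq pU; apply: mu0.
Qed.

(** Gauss's lemma in the form used below. Each prime factor of c stays prime in the polynomial ring,
    so it divides u or v and can be cancelled there without changing sizes. *)
Lemma gauss_factor c a u v : c != 0 -> c *: a = u * v ->
  exists u' v', [/\ a = u' * v', size u' = size u & size v' = size v].
Proof.
have [mu am] := fD.1.
have [n] := ubnP (mu c); elim: n c u v => // n IH c u v lt_n c0 e.
have [cU|cU] := boolP (c \is a GRing.unit).
  exists (c^-1 *: u), v; split=> //; last by rewrite size_scale ?invr_eq0.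
  by rewrite -scalerAl -e scalerA mulVr // scale1r.
have [p [d [[p0 pU pP] ec d0 lt_d]]] := nonunit_prime_factor am c0 cU.
have : divides p%:P (u * v).
  by rewrite -e ec scale_mulC; exists (d *: a).
have szp (q : {poly D}) : size (q * p%:P) = size q by rewrite mulrC mul_polyC size_scale.
have pI (q q' : {poly D}) : q * p%:P = q' * p%:P -> q = q' by apply: mulIf; rewrite polyC_eq0.
have lt_dn : (mu d < n)%N by rewrite -ltnS (leq_trans _ lt_n).
have [_ _ pP'] := prime_elt_polyC (And3 p0 pU pP).
move=> /pP'[[u1 eu]|[v1 ev]].
  have [|u' [v' [? ? ?]]] := IH d u1 v lt_dn d0.
    by apply: pI; rewrite mulrAC -eu -e ec scale_mulC.
  by exists u', v'; split=> //; rewrite eu szp.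
have [|u' [v' [? ? ?]]] := IH d u v1 lt_dn d0.
  by apply: pI; rewrite -mulrA -ev -e ec scale_mulC.
by exists u', v'; split=> //; rewrite ev szp.
Qed.

(** A prime factor p of c divides the cofactor of b or b itself. The latter would make b associated
    to a constant, against its positive degree, so p is cancelled from the cofactor. *)
Lemma gauss_cancel c a b : irreducible_elt b -> (1 < size b)%N -> c != 0 ->
  divides b (c *: a) -> divides b a.
Proof.
move=> [b0 bU bP] sb; have [mu am] := fD.1.
have [n] := ubnP (mu c); elim: n c => // n IH c lt_n c0 [z e].
have [cU|cU] := boolP (c \is a GRing.unit).
  by exists (c^-1 *: z); rewrite -scalerAl -e scalerA mulVr // scale1r.
have [p [d [[p0 pU pP] ec d0 lt_d]]] := nonunit_prime_factor am c0 cU.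
have [_ pU' pP'] := prime_elt_polyC (And3 p0 pU pP).
have : divides p%:P (z * b).
  by rewrite -e ec scale_mulC; exists (d *: a).
have pI (q q' : {poly D}) : q * p%:P = q' * p%:P -> q = q' by apply: mulIf; rewrite polyC_eq0.
move=> /pP'[[z1 ez]|[b1 eb]]; last first.
  have [b1U|pU''] := bP _ _ eb; last by rewrite pU'' in pU'.
  move: sb; rewrite eb mulrC mul_polyC size_scale //.
  by rewrite poly_unitE in b1U; case/andP: b1U => /eqP->.
apply: (IH d) => //; first by rewrite -ltnS (leq_trans _ lt_n).
exists z1; apply: pI.
by rewrite mulrAC -ez -e ec scale_mulC.
Qed.

(** Constants are handled in D. A nonconstant b is compared with x by [gcdp], that is over the
    fraction field: a nonconstant gcd is b up to constants, so b divides x; otherwise a Bezout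
    identity with a constant right side shows that b divides a constant multiple of y.
    [gauss_cancel] removes the constants. *)
Lemma irreducible_poly_prime b : irreducible_elt b -> prime_elt b.
Proof.
move=> irrb; have [b0 bU bP] := irrb; have [sb|] := leqP (size b) 1.
  have [c ec] : exists c, b = c%:P by exists b`_0; apply: size1_polyC.
  rewrite ec; apply: prime_elt_polyC; apply: (fD.2).
  have ? : c != 0 by apply: contra_neq b0; rewrite ec => ->.
  split=> // [|x y exy].
    by move: bU; rewrite ec poly_unitE size_polyC coefC /= -polyC_eq0 -ec b0.
  have [||] := bP x%:P y%:P; first by rewrite ec exy polyCM.
    by rewrite poly_unitE coefC => /andP[_ ?]; left.
  by rewrite poly_unitE coefC => /andP[_ ?]; right.
move=> sb; split=> // x y dxy.
have [sg|] := leqP (size (gcdp b x)) 1; last first.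
  move=> sg; left.
  (* Divisibility holds only after multiplication by a nonzero constant c; [gauss_factor] makes it a
     genuine factorization of b, whose first factor must be a unit. *)
  have /Pdiv.Idomain.dvdpP[[c q] /= c0 eb] := dvdp_gcdl b x.
  have /Pdiv.Idomain.dvdpP[[c' q'] /= c0' ex] := dvdp_gcdr b x.
  have [u [v [euv su sv]]] := gauss_factor c0 eb.
  have uU : u \is a GRing.unit.
    have [//|vU] := bP _ _ euv; move: sg; rewrite -sv.
    by move: vU; rewrite poly_unitE => /andP[/eqP->].
  have [k ek] : exists k, q = k%:P.
    exists q`_0; apply: size1_polyC; rewrite -su.
    by move: uU; rewrite poly_unitE => /andP[/eqP->].
  have k0 : k != 0.
    apply: contra_neq b0 => k0; move/eqP: eb.
    by rewrite ek k0 mul0r -mul_polyC mulf_eq0 polyC_eq0 (negPf c0) => /eqP.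
  apply: (@gauss_cancel (k * c')) => //; first by rewrite mulf_neq0.
  exists (c *: q'); rewrite -scalerA ex scalerAr -(mul_polyC k) -ek -eb.
  by rewrite -scalerAr -scalerAl.
have : coprimep b x.
  by rewrite /coprimep eqn_leq sg /= size_poly_gt0 gcdp_eq0 negb_and b0.
move=> /Bezout_coprimepP[[u v] /= euv].
have [e e0 ee] : exists2 e, e != 0 & u * b + v * x = e%:P.
  move: euv; rewrite -size_poly_eq1 => /size_poly1P[e e0 ->]; by exists e.
right; apply: (@gauss_cancel e) => //; rewrite -mul_polyC -ee mulrDl.
apply: dividesD; last by rewrite -mulrA; apply: divides_mull.
by rewrite mulrAC; apply/divides_mull/divides_refl.
Qed.

Lemma factorial_poly : factorial_domain {poly D}.
Proof.
split; last exact: irreducible_poly_prime.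
have [mu [muM mu0]] := fD.1.
(* The degree alone would not detect nonunit constants, hence the second summand. *)
exists (fun a => ((size a).-1 + mu (lead_coef a))%N); split=> [a b a0 b0|a a0].
  rewrite lead_coefM muM ?lead_coef_eq0 // size_mul //.
  by rewrite -size_poly_gt0 in a0; rewrite -size_poly_gt0 in b0;
     case: (size a) a0 => // i _; case: (size b) b0 => // j _;
     rewrite addSn addnS /= addnACA.
move=> /eqP; rewrite addn_eq0 => /andP[/eqP sa /eqP ma].
have sa1 : size a = 1%N.
  by move: a0 sa; rewrite -size_poly_gt0; case: (size a) => // -[].
rewrite poly_unitE sa1 eqxx /=.
by have := mu0 _ _ ma; rewrite lead_coef_eq0 lead_coefE sa1 /=; apply.
Qed.

End PolyFactorial.

Lemma factorial_field (F : fieldType) : factorial_domain F.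
Proof.
split; first by exists (fun=> 0%N); split=> // a a0 _; rewrite unitfE.
by move=> a [a0]; rewrite unitfE a0.
Qed.

Lemma factorial_iso (D E : idomainType) (f : {rmorphism D -> E})
  (g : {rmorphism E -> D}) : cancel f g -> cancel g f ->
  factorial_domain E -> factorial_domain D.
Proof.
move=> fK gK [[mu [muM mu0]] irrE].
have f0 a : (f a == 0) = (a == 0) by apply/eqP/eqP => [e|->]; rewrite ?rmorph0 // -(fK a) e rmorph0.
have fU a : (f a \is a GRing.unit) = (a \is a GRing.unit).
  by apply/idP/idP => [|/(rmorph_unit f)//]; move=> /(rmorph_unit g); rewrite fK.
split.
  exists (mu \o f); split=> [a b a0 b0|a a0 /=].
    by rewrite /= rmorphM muM ?f0.
  by move=> /mu0; rewrite f0 fU; apply.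
move=> a [a0 aU aP].
have [|_ _ pP] := irrE (f a).
  split; rewrite ?f0 ?fU // => b c e.
  have [] := aP (g b) (g c); first by rewrite -rmorphM -e fK.
    by rewrite -fU gK; left.
  by rewrite -fU gK; right.
split=> // b c [d e].
have [|[x ex]|[x ex]] := pP (f b) (f c).
- by exists (f d); rewrite -!rmorphM e.
- by left; exists (g x); rewrite -[b]fK ex rmorphM fK.
- by right; exists (g x); rewrite -[c]fK ex rmorphM fK.
Qed.

End Factorial.

(** * Polynomials in several variables, with the last variable singled out *)

Section MPoly.
Local Open Scope ring_scope.

Lemma mpoly_ring_ind (n : nat) (R : comNzRingType) (P : mpoly n R -> Prop) :
  (forall c, P (mpolyC n c)) -> (forall i, P (mpolyX R (mnm1 i))) ->
  (forall p q, P p -> P q -> P (p + q)) ->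
  (forall p q, P p -> P q -> P (p * q)) -> forall p, P p.
Proof.
move=> PC PX PD PM p; rewrite [p]mpolyE.
apply: (@big_ind _ P) => [||m _]; [by rewrite -mpolyC0|exact: PD|].
rewrite -mul_mpolyC; apply: (PM) => //; rewrite mpolyXE_id.
apply: (@big_ind _ P) => [||i _]; [by rewrite -mpolyC1|exact: (PM)|].
elim: (m i) => [|k IH]; first by rewrite expr0 -mpolyC1.
by rewrite exprS; apply: (PM).
Qed.

Lemma mpoly_morph_ext (n : nat) (R : comNzRingType) (S : nzRingType)
  (f g : {rmorphism mpoly n R -> S}) :
  (forall c, f (mpolyC n c) = g (mpolyC n c)) ->
  (forall i, f (mpolyX R (mnm1 i)) = g (mpolyX R (mnm1 i))) -> f =1 g.
Proof.
move=> fgC fgX; elim/mpoly_ring_ind => // p q ep eq.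
  by rewrite !rmorphD ep eq.
by rewrite !rmorphM ep eq.
Qed.

Definition widen1 n : 'I_n -> 'I_n.+1 := widen_ord (leqnSn n).

Lemma ord_widenP n (P : 'I_n.+1 -> Prop) :
  (forall i, P (widen1 i)) -> P ord_max -> forall i, P i.
Proof.
move=> Pw Pm i; have [lt|ge] := ltnP i n.
  by have -> : i = widen1 (Ordinal lt) by apply: val_inj.
have -> // : i = ord_max; apply: val_inj; apply/eqP.
by rewrite eqn_leq ge -ltnS ltn_ord.
Qed.

Section Muni.
Variables (n : nat) (R : comNzRingType).

Lemma muniX_widen (i : 'I_n) :
  muni (mpolyX R (mnm1 (widen1 i))) = (mpolyX R (mnm1 i))%:P.
Proof.
rewrite /muni mmapX mmap1U; case: splitP => [j /= e|[j jP] /= e].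
  by congr (mpolyX _ (mnm1 _))%:P; apply: val_inj.
by have := ltn_ord i; rewrite e ltnNge leq_addr.
Qed.

Lemma muniX_max : muni (mpolyX R (mnm1 (@ord_max n))) = 'X.
Proof.
rewrite /muni mmapX mmap1U; case: splitP => [j /= e|//].
by have := ltn_ord j; rewrite -e ltnn.
Qed.

Definition of_muni : {poly mpoly n R} -> mpoly n.+1 R :=
  horner_eval (mpolyX R (mnm1 (@ord_max n))) \o map_poly (@mwiden n R).

HB.instance Definition _ := GRing.RMorphism.on of_muni.

Lemma of_muniE p : of_muni p = (map_poly (@mwiden n R) p).[mpolyX R (mnm1 (@ord_max n))].
Proof. by []. Qed.

Lemma muniK : cancel (@muni n R) of_muni.
Proof.
apply: (@mpoly_morph_ext _ _ _ (of_muni \o @muni n R) idfun) => [c|] /=.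
  by rewrite muniC of_muniE map_polyC hornerC /= mwidenC.
apply: ord_widenP => [i|] /=.
  by rewrite muniX_widen of_muniE map_polyC hornerC /= mwidenX mnmwiden1.
by rewrite muniX_max of_muniE map_polyX hornerX.
Qed.

Lemma mwiden_muni p : muni (@mwiden n R p) = p%:P.
Proof.
apply: (@mpoly_morph_ext _ _ _ (@muni n R \o @mwiden n R) polyC) => [c|i] /=.
  by rewrite mwidenC muniC.
by rewrite mwidenX mnmwiden1 muniX_widen.
Qed.

Lemma of_muniK : cancel of_muni (@muni n R).
Proof.
elim/poly_ind => [|p c IH]; first by rewrite !rmorph0.
rewrite !rmorphD !rmorphM /= IH; congr (_ * _ + _).
  by rewrite of_muniE map_polyX hornerX muniX_max.
by rewrite of_muniE map_polyC hornerC /= mwiden_muni.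
Qed.

Lemma meval_muni (x : 'I_n.+1 -> R) p :
  meval x p = (map_poly (meval (x \o @widen1 n)) (muni p)).[x ord_max].
Proof.
pose f : {rmorphism _ -> _} :=
  horner_eval (x ord_max) \o map_poly (meval (x \o @widen1 n)) \o @muni n R.
apply: (@mpoly_morph_ext _ _ _ (meval x) f) => [c|] /=.
  by rewrite muniC /horner_eval map_polyC hornerC /= !mevalC.
apply: ord_widenP => [i|].
  by rewrite muniX_widen /horner_eval map_polyC hornerC /= !mevalXU.
by rewrite muniX_max /horner_eval map_polyX hornerX mevalXU.
Qed.

End Muni.

Lemma meval0K (F : fieldType) : cancel (@meval 0 F (fun=> 0)) (@mpolyC 0 F).
Proof.
elim/mpoly_ring_ind => [c|[]//|p q ep eq|p q ep eq]; first by rewrite mevalC.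
  by rewrite mevalD mpolyCD ep eq.
by rewrite mevalM mpolyCM ep eq.
Qed.

Lemma factorial_mpoly (F : fieldType) n : factorial_domain (mpoly n F).
Proof.
elim: n => [|n IH].
  apply: (@factorial_iso (mpoly 0 F) F (meval (fun=> 0)) (@mpolyC 0 F)).
  - exact: meval0K.
  - by move=> c; apply: mevalC.
  exact: factorial_field.
apply: (@factorial_iso (mpoly n.+1 F) {poly mpoly n F} (@muni n F) (@of_muni n F)).
- exact: muniK.
- exact: of_muniK.
exact: factorial_poly.
Qed.

Lemma mpoly_unit_const (F : fieldType) n (p : mpoly n F) :
  p \is a GRing.unit -> exists2 c, c != 0 & p = mpolyC n c.
Proof. by move=> /andP[/eqP e u0]; exists (mcoeff (@mnm0 n) p) => //; rewrite -unitfE. Qed.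

(** By induction the leading coefficient in the last variable is nonzero at some y; over y a nonzero
    polynomial in one variable remains, and an algebraically closed field contains a point that is
    not a root. *)
Lemma mpoly_nonzero_eval (F : closedFieldType) n (p : mpoly n F) :
  p != 0 -> exists x, meval x p != 0.
Proof.
elim: n p => [|n IH] p p0.
  exists (fun=> 0); apply: contra_neq p0 => e.
  by rewrite -[p]meval0K e mpolyC0.
have mp0 : muni p != 0.
  by apply: contra_neq p0 => e; rewrite -[p]muniK e rmorph0.
have [y y0] : exists y, meval y (lead_coef (muni p)) != 0.
  by apply: IH; rewrite lead_coef_eq0.
set q := map_poly (meval y) (muni p).
have q0 : q != 0.
  by apply: contra_neq y0 => e; have := coef0 F (size (muni p)).-1; rewrite -e coef_map.
have [s s0] : exists s, ~~ root q s.
  exact/closed_nonrootP.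
pose x (i : 'I_n.+1) := if unlift ord_max i is Some j then y j else s.
have xm : x ord_max = s by rewrite /x unlift_none.
have xw : x \o @widen1 n =1 y.
  move=> j; rewrite /x /=; have -> : widen1 j = lift ord_max j.
    by apply: val_inj; rewrite /= /bump leqNgt ltn_ord.
  by rewrite liftK.
exists x; rewrite meval_muni xm; have -> : map_poly (meval (x \o @widen1 n)) (muni p) = q.
  by apply/polyP => i; rewrite !coef_map; apply: meval_eq.
exact: s0.
Qed.

End MPoly.

(** * Points of projective space and vanishing of forms *)

Section Projective.
Local Open Scope ring_scope.
Local Open Scope classical_set_scope.
Variable C : numClosedFieldType.
Implicit Types (f g h : poly4 C) (p : P3 C) (x y v : 'rV[C]_4).

Lemma line_dim v : (\dim <[v]>%VS == 1%N) = (v != 0).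
Proof. by rewrite dim_vline; case: (v != 0). Qed.

Lemma base_line : \dim <[delta_mx 0%R 0%R : 'rV[C]_4]>%VS == 1%N.
Proof.
rewrite line_dim; apply/eqP => /rowP/(_ 0); rewrite !mxE => /eqP.
by rewrite oner_eq0.
Qed.

Definition base_point : P3 C := 
  exist (fun V : {vspace 'rV[C]_4} => \dim V == 1%N) _ base_line.

(** For v = 0 the value is the arbitrary [base_point]. *)
Definition proj_point v : P3 C := insubd base_point <[v]>%VS.

Lemma val_point v : v != 0 -> val (proj_point v) = <[v]>%VS.
Proof. by move=> v0; rewrite /proj_point insubdK // unfold_in line_dim. Qed.

Lemma point_mem v : v != 0 -> v \in val (proj_point v).
Proof. by move=> v0; rewrite val_point // memv_line. Qed.

Lemma pointP p : exists2 v, v != 0 & p = proj_point v.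
Proof.
have v0 : vpick (val p) != 0.
  by rewrite vpick0 -dimv_eq0; move/eqP: (valP p) => ->.
exists (vpick (val p)) => //; apply: val_inj; rewrite val_point //; apply/eqP.
rewrite eq_sym eqEdim -memvE memv_pick /= dim_vline v0.
by move/eqP: (valP p) => ->.
Qed.

Lemma mem_point p v : v != 0 -> v \in val p -> p = proj_point v.
Proof.
have [u u0 ->] := pointP p; move=> v0; rewrite val_point // => /vlineP[k ek].
apply: val_inj; rewrite !val_point // ek.
have k0 : k != 0 by apply: contra_neq v0 => e; rewrite ek e scale0r.
apply/eqP; rewrite eqEsubv -!memvE; apply/andP; split; last exact/memvZ/memv_line.
by apply/vlineP; exists k^-1; rewrite scalerA mulVf // scale1r.
Qed.

Lemma eq_point u v : u != 0 -> v != 0 -> (proj_point u = proj_point v) <-> (exists k, u = k *: v).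
Proof.
move=> u0 v0; split=> [e|[k e]].
  by have := point_mem u0; rewrite e val_point // => /vlineP.
by symmetry; apply: mem_point => //; rewrite val_point // e memvZ // memv_line.
Qed.

Lemma evalvZ d f a x : homogeneous d f -> evalv f (a *: x) = a ^+ d * evalv f x.
Proof.
move=> /dhomogP hf; rewrite /evalv !mevalE mulr_sumr; apply: eq_big_seq => m mf.
rewrite mulrCA; congr (_ * _); have <- : mdeg m = d by exact: hf.
rewrite (eq_bigr (fun i => a ^+ m i * x 0 i ^+ m i)) ?big_split /=; last first.
  by move=> i _; rewrite mxE exprMn.
by rewrite mdegE expr_sum.
Qed.

Lemma vanishes_pointE d f v : homogeneous d f -> v != 0 ->
  vanishes_at f (proj_point v) <-> evalv f v = 0.
Proof.
move=> hf v0; split=> [|e x]; first by apply; apply: point_mem.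
by rewrite val_point // => /vlineP[k ->]; rewrite (evalvZ _ _ hf) e mulr0.
Qed.

Lemma homogeneousM d e f g :
  homogeneous d f -> homogeneous e g -> homogeneous (d + e) (f * g).
Proof. exact: dhomogM. Qed.

Lemma zeros_closed d f : homogeneous d f -> zariski_closed (zeros f).
Proof.
move=> hf; exists [set f]; split=> [_ ->|]; first by exists d.
by apply/seteqP; split=> p /= => [vf _ ->|]; [exact: vf|apply].
Qed.

End Projective.

(** * Projection from (0:0:0:1) and resultants *)

Section IrreducibleSurface.
Local Open Scope ring_scope.
Local Open Scope classical_set_scope.
Variable C : numClosedFieldType.

(** The vector over y in the projection from (0:0:0:1), with s the coordinate along the fibre. *)
Definition row4 (y : 'I_3 -> C) (s : C) : 'rV[C]_4 :=
  \row_i (if unlift ord_max i is Some j then y j else s).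

Lemma row4_max y s : row4 y s 0 ord_max = s.
Proof. by rewrite mxE unlift_none. Qed.

Lemma row4_widen y s j : row4 y s 0 (widen1 j) = y j.
Proof.
rewrite mxE; have -> : widen1 j = lift ord_max j.
  by apply: val_inj; rewrite /= /bump leqNgt ltn_ord.
by rewrite liftK.
Qed.

Lemma row4_eq0 y s : row4 y s = 0 -> forall j, y j = 0.
Proof. by move=> e j; rewrite -(row4_widen y s) e mxE. Qed.

Lemma evalv_row4 (f : poly4 C) y s :
  evalv f (row4 y s) = (map_poly (meval y) (muni f)).[s].
Proof.
rewrite /evalv meval_muni row4_max; congr (_.[_]).
by apply/polyP => i; rewrite !coef_map; apply: meval_eq => j; rewrite /= row4_widen.
Qed.

(** Since the leading coefficients survive at y, the Sylvester matrix keeps its shape and its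
    determinant commutes with evaluation. *)
Lemma resultant_specialize (A B : {poly mpoly 3 C}) y :
  meval y (lead_coef A) != 0 -> meval y (lead_coef B) != 0 ->
  (meval y (resultant A B) == 0) =
    (1 < size (gcdp (map_poly (meval y) A) (map_poly (meval y) B)))%N.
Proof.
move=> a0 b0; rewrite -resultant_eq0 /resultant /Sylvester_mx.
rewrite !size_map_poly_id0 // -det_map_mx /= map_col_mx.
by congr (\det (col_mx _ _) == 0); apply: map_lin1_mx => v;
   rewrite map_poly_rV rmorphM /= map_rVpoly.
Qed.

Lemma common_root (A B : {poly mpoly 3 C}) y :
  meval y (lead_coef A) != 0 -> meval y (lead_coef B) != 0 ->
  meval y (resultant A B) = 0 <->
  exists s, (map_poly (meval y) A).[s] = 0 /\ (map_poly (meval y) B).[s] = 0.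
Proof.
move=> a0 b0; have rE := resultant_specialize a0 b0.
set a := map_poly _ A in rE *; set b := map_poly _ B in rE *.
split=> [/eqP|[s [as0 bs0]]].
  rewrite rE => gt1; have /closed_rootP[s] : size (gcdp a b) != 1%N by rewrite gtn_eqF.
  by rewrite root_gcd => /andP[/rootP ? /rootP ?]; exists s.
apply/eqP; rewrite rE ltnNge; apply/negP => le1.
have g0 : gcdp a b != 0.
  rewrite gcdp_eq0 negb_and; apply/orP; left; apply: contra_neq a0 => ea.
  by have := coef0 C (size A).-1; rewrite -ea coef_map.
have : root (gcdp a b) s by rewrite root_gcd; apply/andP; split; apply/rootP.
by move=> /(root_size_gt1 g0); rewrite ltnNge le1.
Qed.

Section Pencil.
Variables (R : mpoly 3 C) (P Q : 'I_3 -> C).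

(* A polynomial vanishing at the origin of a plane has another zero there:
   otherwise each of its restrictions to the parallels of a fixed direction that
   avoid the origin is a nonvanishing, hence constant, polynomial. *)
Lemma plane_zero : meval (fun=> 0) R = 0 ->
  exists a b, ~ (a = 0 /\ b = 0) /\ meval (fun i => a * P i + b * Q i) R = 0.
Proof.
move=> R0; apply: contrapT => /forallNP noz.
have nz a b : ~ (a = 0 /\ b = 0) -> meval (fun i => a * P i + b * Q i) R != 0.
  by move=> ab; apply/eqP => e; apply: (noz a); exists b.
pose u b i : {poly C} := (P i)%:P * 'X + (b * Q i)%:P.
pose w i : {poly C} := (P i)%:P + (Q i)%:P * 'X.
pose z i : {poly C} := (Q i)%:P * 'X.
have hE (t : 'I_3 -> {poly C}) a :
    (mmap (@polyC C) t R).[a] = meval (fun i => (t i).[a]) R.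
  pose F : {rmorphism _ -> _} := horner_eval a \o mmap (@polyC C) t.
  apply: (@mpoly_morph_ext _ _ _ F (meval (fun i => (t i).[a]))) => [c|i] /=.
    by rewrite /F /= mmapC /horner_eval hornerC mevalC.
  by rewrite /F /= mmapX mmap1U /horner_eval mevalXU.
have uE b a : (mmap (@polyC C) (u b) R).[a] = meval (fun i => a * P i + b * Q i) R.
  by rewrite hE; apply: meval_eq => i; rewrite !hornerE mulrC.
have cst a b : b != 0 -> meval (fun i => a * P i + b * Q i) R = meval (fun i => b * Q i) R.
  move=> b0; set q := mmap (@polyC C) (u b) R.
  have sq : size q = 1%N.
    apply/eqP; apply: contraT => /closed_rootP[s /rootP]; rewrite uE => e.
    by have := nz s b; rewrite e eqxx => /(_ _)/negP; case=> // -[_ /eqP]; rewrite (negPf b0).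
  have [k ek] : exists k, q = k%:P by exists q`_0; apply: size1_polyC; rewrite sq.
  rewrite -uE -/q ek hornerC -[LHS](hornerC k 0) -ek uE.
  by apply: meval_eq => i; rewrite mul0r add0r.
(* The polynomials R(P + s Q) and R(s Q) in s agree for s != 0, hence also at s = 0, which gives
   R(P) = R(0) = 0. *)
pose d := mmap (@polyC C) w R - mmap (@polyC C) z R.
have d0 : d = 0.
  apply/eqP; apply: contraT => dn0.
  have /closed_nonrootP[s] : d * 'X != 0 by rewrite mulf_neq0 ?polyX_eq0.
  rewrite rootM rootX negb_or => /andP[ds s0]; case/negP: ds; apply/rootP.
  rewrite /d !hornerE !hE /=.
  rewrite [X in X - _](_ : _ = meval (fun i => 1 * P i + s * Q i) R); last first.
    by apply: meval_eq => i; rewrite /w !hornerE ?mul1r [s * _]mulrC.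
  rewrite cst // (_ : meval _ R = meval (fun i => (z i).[s]) R) ?subrr //.
  by apply: meval_eq => i; rewrite !hornerE mulrC.
have := congr1 (fun q : {poly C} => q.[0]) d0.
rewrite /d !hornerE !hE.
rewrite [X in _ - X](_ : _ = meval (fun=> 0) R); last first.
  by apply: meval_eq => i; rewrite /z !hornerE ?mulr0.
rewrite R0 subr0 => e.
have /eqP[] : meval (fun i => 1 * P i + 0 * Q i) R != 0.
  by apply: nz => -[/eqP]; rewrite oner_eq0.
apply: etrans e; apply: meval_eq => i.
by rewrite /w !hornerE ?mul1r ?mul0r ?mulr0.
Qed.

End Pencil.

(** For a nonzero y the condition is a nonzero polynomial equation in l, so finitely many y exclude
    finitely many l. The plane so chosen avoids the projections of the singular points. *)
Lemma separating_parameter (S : seq ('I_3 -> C)) : exists l : C, forall y, List.In y S ->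
  y 0 + l * y 1 + l ^+ 2 * y 2%:R = 0 -> forall i, y i = 0.
Proof.
pose q (y : 'I_3 -> C) : {poly C} := (y 0)%:P + (y 1)%:P * 'X + (y 2%:R)%:P * 'X^2.
have qE y l : (q y).[l] = y 0 + l * y 1 + l ^+ 2 * y 2%:R.
  by rewrite /q !(hornerD, hornerM, hornerC, hornerX, hornerXn) ![l * _]mulrC [l ^+ 2 * _]mulrC.
have q0 y : q y = 0 -> forall i, y i = 0.
  move=> e i; have c j : (q y)`_j = 0 by rewrite e coef0.
  have := c 0%N; have := c 1%N; have := c 2%N.
  rewrite /q !coefD !coefC !coefCM !coefX !coefXn /= !mulr0 !mulr1 !addr0 !add0r.
  move=> c2 c1 c0; case: i => -[|[|[|//]]] lt.
  - by rewrite -[RHS]c0; congr y; apply: val_inj.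
  - by rewrite -[RHS]c1; congr y; apply: val_inj.
  by rewrite -[RHS]c2; congr y; apply: val_inj.
(* For y = 0 the factor is replaced by 1 to keep the product nonzero. *)
pose r y := if q y == 0 then 1 else q y.
have : exists l, forall y, List.In y S -> ~~ root (r y) l.
  have pn0 : \prod_(y <- S) r y != 0.
    rewrite prodf_seq_neq0; apply/allP => y _ /=; rewrite /r.
    by case: ifP => [_|->//]; exact: oner_neq0.
  have /closed_nonrootP[l rl] := pn0; exists l.
  elim: S rl {pn0} => // y0 S IH; rewrite big_cons rootM negb_or => /andP[ry0 rS] y /=.
  by case=> [<-//|]; apply: IH.
move=> [l rl]; exists l => y yS; rewrite -qE => e; apply: q0.
have := rl y yS; rewrite /r; case: eqP => // _; by rewrite /root e eqxx.
Qed.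

End IrreducibleSurface.

Lemma resultant_common_zero (A B : comNzRingType) (F : {rmorphism {poly A} -> B})
  (p q : {poly A}) : (1 < size p)%N -> (1 < size q)%N -> F p = 0%R -> F q = 0%R ->
  F (polyC (resultant p q)) = 0%R.
Proof.
move=> sp sq Fp Fq; have [[u v] /= _ ->] := resultant_in_ideal sp sq.
by rewrite rmorphD !rmorphM Fp Fq !mulr0 addr0.
Qed.

Lemma of_muni_mul n (R : comNzRingType) (P Q : {poly mpoly n R}) (f : mpoly n.+1 R) :
  P = (Q * muni f)%R -> of_muni P = (of_muni Q * f)%R.
Proof. by move=> ->; rewrite rmorphM /= muniK. Qed.

(** * A surface with finitely many singular points is irreducible and reduced *)

Section IsolatedSingularities.
Local Open Scope ring_scope.
Local Open Scope classical_set_scope.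
Variable C : numClosedFieldType.
Variables (f : poly4 C) (d : nat).
Hypotheses (d0 : (0 < d)%N) (hf : homogeneous d f).

Let c : C := evalv f (row4 (fun=> 0) 1).
Hypothesis c0 : c != 0.

Lemma muni_coef_lt i : (d < i)%N -> (muni f)`_i = 0.
Proof.
move=> lt_di; rewrite muniE coef_sum big1_seq // => m /andP[_ mf].
have em : mdeg m = d by move/dhomogP: hf; apply.
 rewrite coefZ coefXn.
case: eqP => [ei|_]; last by rewrite mulr0.
have : (m ord_max <= mdeg m)%N by rewrite mdegE (bigD1 ord_max) //= leq_addr.
by rewrite em -ei leqNgt lt_di.
Qed.

(** Only the monomial x_4^d reaches degree d in the last variable, and its coefficient is the value
    c at (0:0:0:1). As c != 0, the projection from that point has fibres of constant degree. *)
Lemma muni_coef_top : (muni f)`_d = mpolyC 3 c.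
Proof.
rewrite muniE coef_sum /c /evalv mevalE raddf_sum; apply: eq_big_seq => m mf.
have em : mdeg m = d by move/dhomogP: hf; apply.
 rewrite coefZ coefXn.
have eqd : (d == m ord_max) = [forall j, m (widen1 j) == 0%N].
  rewrite -em mdegE big_ord_recr /= -[X in _ == X]add0n eqn_add2r sum_nat_eq0.
  by [].
rewrite eqd; have [/forallP m0|/forallPn[j mj]] := boolP [forall j, m (widen1 j) == 0%N].
  rewrite mulr1 big1 ?mulr1 => [|i _].
    rewrite (_ : Multinom _ = mnm0) ?mpolyX0 ?alg_mpolyC //.
    by apply/mnmP => j; rewrite !mnmE; apply/eqP/m0.
  elim/ord_widenP: i => [j|]; last by rewrite row4_max expr1n.
  by rewrite (eqP (m0 j)) expr0.
rewrite mulr0 (bigD1 (widen1 j)) //= row4_widen expr0n (negPf mj) mul0r mulr0.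
by rewrite mpolyC0.
Qed.

Lemma muni_size : size (muni f) = d.+1.
Proof.
apply/eqP; rewrite eqn_leq; apply/andP; split.
  by apply/leq_sizeP => i; apply: muni_coef_lt.
rewrite ltnNge; apply/negP => /leq_sizeP/(_ d (leqnn d)).
by rewrite muni_coef_top => /eqP; rewrite mpolyC_eq0 (negPf c0).
Qed.

Lemma muni_lead : lead_coef (muni f) = mpolyC 3 c.
Proof. by rewrite lead_coefE muni_size muni_coef_top. Qed.

Lemma evalv_axis s : evalv f (row4 (fun=> 0) s) = s ^+ d * c.
Proof.
rewrite /c -(evalvZ _ _ hf); congr evalv; apply/rowP; apply: ord_widenP => [j|].
  by rewrite [RHS]mxE !row4_widen mulr0.
by rewrite [RHS]mxE !row4_max mulr1.
Qed.

Lemma fiber_root y : exists s, evalv f (row4 y s) = 0.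
Proof.
have sz : size (map_poly (meval y) (muni f)) = d.+1.
  by rewrite size_map_poly_id0 ?muni_size // muni_lead mevalC.
have /closed_rootP[s /rootP e] : size (map_poly (meval y) (muni f)) != 1%N.
  by rewrite sz eqSS -lt0n.
by exists s; rewrite evalv_row4.
Qed.

Variable S : seq 'rV[C]_4.
Hypothesis singS : forall x, x != 0 -> evalv f x = 0 ->
  (forall i, evalv (mderiv i f) x = 0) -> exists2 y, List.In y S & exists k, x = k *: y.

Lemma factor_unit_lead (A B : {poly mpoly 3 C}) : muni f = A * B ->
  exists2 k, k != 0 & lead_coef A = mpolyC 3 k.
Proof.
move=> e; apply: mpoly_unit_const.
have : lead_coef A * lead_coef B \is a GRing.unit.
  by rewrite -lead_coefM -e muni_lead rmorph_unit // unitfE.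
by rewrite unitrM => /andP[].
Qed.

(** Suppose f = A B properly. The resultant of A and B in the last variable vanishes at 0, hence at
    a nonzero y in a plane missing the projections of all singular points. Over y lies a common zero
    of A and B, which is a singular point of f. Homogeneity of A and B is not established, which is
    why the second zero of the resultant comes from [plane_zero]. *)
Lemma muni_irreducible : irreducible_elt (muni f).
Proof.
have f0 : muni f != 0 by rewrite -size_poly_gt0 muni_size.
split=> // [|A B e]; first by rewrite poly_unitE muni_size eqSS eqn0Ngt d0.
have [ka ka0 la] := factor_unit_lead e.
have [kb kb0 lb] := factor_unit_lead (etrans e (mulrC A B)).
apply: contrapT => /not_orP[Au Bu].
have sz_gt1 (D : {poly mpoly 3 C}) k : k != 0 -> lead_coef D = mpolyC 3 k ->
    ~ D \is a GRing.unit -> (1 < size D)%N.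
  move=> k0 lD Du; rewrite ltnNge; apply/negP => sD; apply: Du.
  have D0 : D != 0 by rewrite -lead_coef_eq0 lD mpolyC_eq0.
  have sD1 : size D = 1%N.
    by apply/eqP; rewrite eqn_leq sD size_poly_gt0.
  rewrite poly_unitE sD1 eqxx /=; move: lD; rewrite lead_coefE sD1 /= => ->.
  by rewrite rmorph_unit // unitfE.
have sA := sz_gt1 _ _ ka0 la Au; have sB := sz_gt1 _ _ kb0 lb Bu.
have lA y : meval y (lead_coef A) != 0 by rewrite la mevalC.
have lB y : meval y (lead_coef B) != 0 by rewrite lb mevalC.
(* On the axis f equals c s^d, so 0 is the only root of a factor over y = 0. *)
have ev0 (D E : {poly mpoly 3 C}) k : k != 0 -> lead_coef D = mpolyC 3 k ->
    (1 < size D)%N -> muni f = D * E -> (map_poly (meval (fun=> 0)) D).[0] = 0.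
  move=> k0 lD sD eD.
  have /closed_rootP[s /rootP es] : size (map_poly (meval (fun=> 0 : C)) D) != 1%N.
    by rewrite size_map_poly_id0 ?lD ?mevalC // gtn_eqF.
  have := evalv_axis s; rewrite evalv_row4 eD rmorphM hornerM es mul0r.
  move=> /esym/eqP; rewrite mulf_eq0 (negPf c0) orbF expf_eq0 => /andP[_ /eqP s0].
  by move: es; rewrite s0.
have R0 : meval (fun=> 0) (resultant A B) = 0.
  apply/common_root => //; exists 0; split; first exact: (ev0 _ _ _ ka0 la sA e).
  exact: (ev0 _ _ _ kb0 lb sB (etrans e (mulrC A B))).
have [l lP] := separating_parameter
  (List.map (fun (y : 'rV[C]_4) j => y 0 (widen1 j)) S).
(* A basis of the plane y_0 + l y_1 + l^2 y_2 = 0. *)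
pose P (i : 'I_3) : C := nth 0 [:: - l; 1; 0] i.
pose Q (i : 'I_3) : C := nth 0 [:: - l ^+ 2; 0; 1] i.
have [a [b [ab0]]] := plane_zero P Q R0.
set y := fun i => _ => /common_root-/(_ (lA y) (lB y))[s [As Bs]].
have yl : y 0 + l * y 1 + l ^+ 2 * y 2%:R = 0.
  by rewrite /y /P /Q /=; ring.
pose x := row4 y s.
have x0 : x != 0.
  apply/eqP => /row4_eq0 y0; apply: ab0.
  have := y0 1; have := y0 2%:R; rewrite /y /P /Q /=.
  by rewrite !mulr0 !mulr1 addr0 add0r.
have fE : f = of_muni A * of_muni B by rewrite -rmorphM -e /= muniK.
have xA : evalv (of_muni A) x = 0 by rewrite evalv_row4 of_muniK.
have xB : evalv (of_muni B) x = 0 by rewrite evalv_row4 of_muniK.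
have evM g h : evalv (g * h) x = evalv g x * evalv h x by rewrite /evalv mevalM.
have [||z zS [k ek]] := singS x0.
- by rewrite fE evM xA mul0r.
- move=> i; rewrite fE mderivM /evalv mevalD -!/(evalv _ _) !evM xA xB.
  by rewrite mulr0 mul0r addr0.
have k0 : k != 0 by apply: contra_neq x0; rewrite ek => ->; rewrite scale0r.
have zy j : z 0 (widen1 j) = k^-1 * y j.
  have := row4_widen y s j; rewrite -/x ek mxE => <-.
  by rewrite mulrA mulVf // mul1r.
case/eqP: x0; rewrite ek; suff -> : z = 0 by rewrite scaler0.
have z0 : forall j, z 0 (widen1 j) = 0.
  apply: (lP (fun j => z 0 (widen1 j))).
    by apply: (List.in_map (fun (y : 'rV[C]_4) j => y 0 (widen1 j))).
  by rewrite !zy -[RHS](mulr0 k^-1) -yl; ring.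
exfalso; apply: ab0.
have y0 j : y j = 0.
  by have /eqP := z0 j; rewrite zy mulf_eq0 invr_eq0 (negPf k0) => /eqP.
have := y0 1; have := y0 2%:R; rewrite /y /P /Q /=.
by rewrite !mulr0 !mulr1 addr0 add0r.
Qed.

Lemma muni_prime : prime_elt (muni f).
Proof. exact/irreducible_poly_prime/muni_irreducible/factorial_mpoly. Qed.

(** The Nullstellensatz for f. If the resultant with h were nonzero, it would be nonzero at some y;
    but over y there is a zero of f, hence of h, which annihilates it. So f and h share a
    nonconstant factor over the fraction field, and f is prime. *)
Lemma vanishing_divides (h : poly4 C) :
  (forall x, x != 0 -> evalv f x = 0 -> evalv h x = 0) -> exists q, h = q * f.
Proof.
move=> hv; set H := muni h.
suff [q e] : divides (muni f) H.
  by exists (of_muni q); exact: etrans (esym (muniK h)) (of_muni_mul e).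
have row0 y s : mpolyX C (mnm1 (0 : 'I_3)) != 0 ->
    meval y (mpolyX C (mnm1 (0 : 'I_3))) != 0 -> row4 y s != 0.
  by move=> _; rewrite mevalXU; apply: contra_neq => /row4_eq0.
have X0 : mpolyX C (mnm1 (0 : 'I_3)) != 0.
  by rewrite -msize_poly_eq0 msizeX.
(* Multiplying D by the first variable forces y_0 != 0, so that the point over y is not the zero
   vector. *)
have generic (D : mpoly 3 C) : D != 0 -> exists y s,
    [/\ meval y D != 0, row4 y s != 0, evalv f (row4 y s) = 0
      & evalv h (row4 y s) = 0].
  move=> D0; have [y] := mpoly_nonzero_eval (mulf_neq0 D0 X0).
  rewrite mevalM mulf_eq0 negb_or => /andP[yD yX].
  have [s es] := fiber_root y; exists y, s; split=> //; first exact: row0.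
  by apply: hv => //; apply: row0.
have [sH|sH] := leqP (size H) 1.
  have [D eD] : exists D, H = D%:P by exists H`_0; apply: size1_polyC.
  have [->|D0] := eqVneq H 0; first by exists 0; rewrite mul0r.
  have [|y [s [yD _ _]]] := generic D; first by apply: contra_neq D0; rewrite eD => ->.
  by rewrite evalv_row4 -/H eD map_polyC hornerC /= => /eqP; rewrite (negPf yD).
have sf : (1 < size (muni f))%N by rewrite muni_size ltnS.
have [R0|Rn0] := eqVneq (resultant (muni f) H) 0; last first.
  have [y [s [yR _ fy hy]]] := generic _ Rn0.
  have [ev evE] : exists ev : {rmorphism {poly mpoly 3 C} -> C},
      forall q, ev q = (map_poly (meval y) q).[s].
    by exists (horner_eval s \o map_poly (meval y)).
  have evf : ev (muni f) = 0 by rewrite evE -fy evalv_row4.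
  have evH : ev H = 0 by rewrite evE -hy evalv_row4.
  have evR : ev (resultant (muni f) H)%:P = meval y (resultant (muni f) H).
    by rewrite evE map_polyC hornerC.
  case/eqP: yR; exact: etrans (esym evR) (resultant_common_zero sf sH evf evH).
move/eqP: R0; rewrite resultant_eq0; set g := gcdp _ _ => sg.
have [f0 fU fP] := muni_prime.
have /Pdiv.Idomain.dvdpP[[k q] /= k0 ef] : (g %| muni f)%R by exact: dvdp_gcdl.
have /Pdiv.Idomain.dvdpP[[k' q'] /= k0' eH] : (g %| H)%R by exact: dvdp_gcdr.
have q0 : q != 0.
  apply: contra_neq f0 => q0; move/eqP: ef.
  by rewrite q0 mul0r -mul_polyC mulf_eq0 polyC_eq0 (negPf k0) => /eqP.
have g0 : g != 0 by rewrite -size_poly_gt0 ltnW.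
(* Neither q nor the constant k' can be divisible by f, having smaller degree in the last
   variable. *)
have small (w : {poly mpoly 3 C}) : w != 0 -> (size w < size (muni f))%N ->
    ~ divides (muni f) w.
  move=> w0 lt [z ez]; have z0 : z != 0 by apply: contra_neq w0; rewrite ez => ->; rewrite mul0r.
  move: lt; rewrite ez size_mul //; move: z0; rewrite -size_poly_gt0.
  by case: (size z) => // n _; rewrite addSn /= ltnNge leq_addl.
have : divides (muni f) (q * g) by rewrite -ef -mul_polyC; exists k%:P.
move=> /fP[/small|fg].
  move=> /(_ q0); case.
  have : size (k *: muni f) = (size q + size g).-1 by rewrite ef size_mul.
  rewrite (size_scale _ k0) => ->; move: sg; case: (size g) => [|[|n]]; [by []|by []|].
  by move=> _; rewrite !addnS /= ltnS leq_addr.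
have : divides (muni f) (k'%:P * H) by rewrite mul_polyC eH; apply: divides_mull.
move=> /fP[/small small_k'|dH]; last exact: dH.
case: small_k'; first by rewrite polyC_eq0.
by rewrite size_polyC k0'.
Qed.

(** If neither closed set contains the surface, forms a and b vanish on them without vanishing on
    the surface. Then f divides a b by [vanishing_divides], but neither factor, against
    primality. *)
Lemma isolated_irreducible_surface : irreducible_surface f d.
Proof.
have [f0 fU fP] := muni_prime.
have fn0 : f != 0 by apply: contra_neq f0 => ->; rewrite rmorph0.
have nz (y : 'I_3 -> C) s : y 0 != 0 -> row4 y s != 0 by apply: contra_neq => /row4_eq0.
have vanish_divides e h : homogeneous e h -> zeros f `<=` zeros h ->
    exists q, h = q * f.
  move=> hh fh; apply: vanishing_divides => x x0 fx.
  by apply/(vanishes_pointE hh x0)/fh/(vanishes_pointE hf x0).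
split=> //; split; first exact: zeros_closed hf.
  have [s es] := fiber_root (fun=> 1).
  exists (proj_point (row4 (fun=> 1) s)); apply/(vanishes_pointE hf) => //.
  by apply: nz; exact: oner_neq0.
move=> A B [SA [hA eA]] [SB [hB eB]] fAB; apply: contrapT => /not_orP[].
have witness (X : set (P3 C)) T : X = [set p | forall g, T g -> vanishes_at g p] ->
    ~ zeros f `<=` X -> exists p g, [/\ zeros f p, T g & ~ vanishes_at g p].
  move=> -> /existsNP[p /not_implyP[fp /existsNP[g /not_implyP[Tg gp]]]].
  by exists p, g.
move=> /(witness _ _ eA)[p [a [fp SAa ap]]] /(witness _ _ eB)[q [b [fq SBb bq]]].
have [ea ha] := hA a SAa; have [eb hb] := hB b SBb.
have [|r er] := vanish_divides _ _ (homogeneousM ha hb).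
  move=> z fz; have [v v0 ez] := pointP z.
  rewrite /zeros /= ez; apply/(vanishes_pointE (homogeneousM ha hb) v0).
  rewrite /evalv mevalM; case: (fAB z fz); rewrite ?eA ?eB /= => vz.
    by have := vz a SAa; rewrite ez => /(vanishes_pointE ha v0); rewrite /evalv => ->; rewrite mul0r.
  by have := vz b SBb; rewrite ez => /(vanishes_pointE hb v0); rewrite /evalv => ->; rewrite mulr0.
have [|[t et]|[t et]] := fP (muni a) (muni b).
- by exists (muni r); exact: etrans (esym (muniM a b)) (etrans (congr1 _ er) (muniM r f)).
- apply: ap => x xp; have ea' : a = of_muni t * f.
    exact: etrans (esym (muniK a)) (of_muni_mul et).
  by rewrite ea' /evalv mevalM; have := fp x xp; rewrite /evalv => ->; rewrite mulr0.
apply: bq => x xq; have eb' : b = of_muni t * f.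
  exact: etrans (esym (muniK b)) (of_muni_mul et).
by rewrite eb' /evalv mevalM; have := fq x xq; rewrite /evalv => ->; rewrite mulr0.
Qed.

End IsolatedSingularities.

(** * Differentiability by estimates *)

Section Differentiability.
Local Open Scope ring_scope.
Local Open Scope classical_set_scope.
Variable C : numFieldType.

Lemma differentiable_epsilon (V W : normedModType C) (f : V -> W) a :
  differentiable f a -> forall e : C, 0 < e ->
  \forall h \near 0, `|f (h + a) - f a - 'd f a h| <= e * `|h|.
Proof.
move=> /diff_locallyP[_ /eqaddoP df] e e0.
by have := df _ e0; apply: filterS => h /=; rewrite opprD addrA.
Qed.

Lemma epsilon_differentiable (V W : normedModType C) (f : V -> W) a
  (L : {linear V -> W}) : continuous L ->
  (forall e : C, 0 < e -> \forall h \near 0, `|f (h + a) - f a - L h| <= e * `|h|) ->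
  differentiable f a.
Proof.
move=> cL fL.
have fE : f \o shift a = cst (f a) + L +o_ 0 id.
  apply/eqaddoP => e e0; apply: filterS (fL _ e0) => h /=.
  by rewrite opprD addrA.
have dE := diff_unique cL fE.
apply/diff_locallyP; split; first by rewrite dE.
by rewrite dE.
Qed.

Lemma differentiable_near_eq (V W : normedModType C) (f g : V -> W) a :
  (\forall x \near a, f x = g x) -> differentiable f a -> differentiable g a.
Proof.
move=> fg df; apply: (@epsilon_differentiable _ _ _ _ ('d f a)).
  exact: diff_continuous.
move=> e e0; rewrite -(nbhs_singleton fg).
move: fg; rewrite (near_shift 0 a) => fg.
have := differentiable_epsilon df e0; apply: filterS2 fg => h /=.
by rewrite subr0 => <-.
Qed.

(** Where N vanishes, the variation of K only enters multiplied by N, so continuity of K suffices.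
    This turns continuity of an implicit root into differentiability. *)
Lemma differentiable_mul_continuous (V : normedModType C) (N K : V -> C) a :
  differentiable N a -> N a = 0 -> {for a, continuous K} ->
  differentiable (fun x => N x * K x) a.
Proof.
move=> dN Na cK; apply: (@epsilon_differentiable _ _ _ _ (K a \*: 'd N a)).
  by move=> x; apply: cvgZr; apply: diff_continuous.
have [M M0 MP] := linear_lipschitz (diff_continuous dN).
move=> e e0; rewrite Na mul0r.
have B0 : 0 < `|K a| + 1 by rewrite ltr_pwDr.
have e1 : 0 < e / 2 / (`|K a| + 1) by rewrite !divr_gt0.
have e2 : 0 < e / 2 / M by rewrite !divr_gt0.
have cK' : \forall h \near 0, `|K (h + a) - K a| < e / 2 / M /\ `|K (h + a) - K a| < 1.
  have : \forall x \near a, `|K x - K a| < e / 2 / M /\ `|K x - K a| < 1.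
    by apply: filterI; [have /cvgrPdistC_lt := cK; apply | have /cvgrPdistC_lt := cK; apply].
  by rewrite (near_shift 0 a); apply: filterS => h /=; rewrite subr0.
apply: filterS2 (differentiable_epsilon dN e1) cK' => h /=.
rewrite Na subr0 => dNh [Kh1 Kh2].
have -> : N (h + a) * K (h + a) - 0 - K a *: 'd N a h =
    (N (h + a) - 'd N a h) * K (h + a) + 'd N a h * (K (h + a) - K a).
  by rewrite /GRing.scale /=; ring.
apply: le_trans (ler_normD _ _) _; rewrite !normrM.
have -> : e * `|h| = e / 2 / (`|K a| + 1) * `|h| * (`|K a| + 1) + M * `|h| * (e / 2 / M).
  by field; rewrite !gt_eqF.
apply: lerD; apply: ler_pM => //; last exact: ltW.
rewrite -[K (h + a)](subrK (K a)) (le_trans (ler_normD _ _)) // addrC lerD2l.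
exact: ltW.
Qed.

Lemma differentiable_row (V : normedModType C) n (f : V -> 'rV[C]_n) a :
  (forall j, differentiable (fun x => f x 0 j) a) -> differentiable f a.
Proof.
move=> df; have -> : f = \sum_j (fun x => f x 0 j *: (delta_mx 0 j : 'rV[C]_n)).
  apply/funext => x; rewrite [LHS]row_sum_delta fct_sumE.
  by apply: eq_bigr.
by apply: differentiable_sum => j; apply: differentiableZl.
Qed.

End Differentiability.

(** * Simple roots of a polynomial with varying coefficients *)

Section ImplicitRoot.
Local Open Scope ring_scope.
Local Open Scope classical_set_scope.
Variable C : numClosedFieldType.

Lemma deriv_prod_XsubC (s : seq C) (w : C) : (forall r, r \in s -> w != r) ->
  (\prod_(r <- s) ('X - r%:P))^`().[w] =
  (\prod_(r <- s) (w - r)) * \sum_(r <- s) (w - r)^-1.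
Proof.
elim: s => [|r s IH] ws; first by rewrite !big_nil derivC horner0 mulr0.
rewrite !big_cons derivM hornerD !hornerM IH; last first.
  by move=> t ts; apply: ws; rewrite inE ts orbT.
rewrite derivXsubC hornerXsubC hornerC mul1r horner_prod.
rewrite (eq_bigr (fun r => w - r)) => [|t _]; last by rewrite hornerXsubC.
have : w - r != 0 by rewrite subr_eq0 ws // mem_head.
by move=> wr; field.
Qed.

(* The logarithmic derivative of q at w is the sum of the inverses of the
   distances to the roots, so one root is not too far away. *)
Lemma root_near (q : {poly C}) n (w : C) : (size q <= n)%N -> q^`().[w] != 0 ->
  exists r, q.[r] = 0 /\ `|w - r| * `|q^`().[w]| <= n%:R * `|q.[w]|.
Proof.
move=> sq dq; apply: contrapT => /forallNP far.
have lt_far r : q.[r] = 0 -> n%:R * `|q.[w]| < `|w - r| * `|q^`().[w]|.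
  move=> qr; rewrite real_ltNge ?rpredM ?normr_real ?realn //.
  by apply/negP => le; apply: (far r).
have qw : q.[w] != 0.
  apply/eqP => qw; have := lt_far w qw.
  by rewrite qw normr0 mulr0 subrr normr0 mul0r ltxx.
have q0 : q != 0 by apply: contra_neq qw => ->; rewrite horner0.
have [s es] := closed_field_poly_normal q.
have lc0 : lead_coef q != 0 by rewrite lead_coef_eq0.
have rs r : r \in s -> q.[r] = 0.
  move=> r_s; apply/rootP; rewrite es rootZ // root_prod_XsubC //.
have ws r : r \in s -> w != r.
  by move=> /rs qr; apply: contra_neq qw => ->.
have sz : (size s < n)%N.
  by apply: leq_trans sq; rewrite es size_scale // size_prod_XsubC.
have n0 : 0 < n%:R :> C by rewrite ltr0n (leq_ltn_trans _ sz).
have qwE : q.[w] = lead_coef q * \prod_(r <- s) (w - r).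
  rewrite {1}es hornerZ horner_prod; congr (_ * _).
  by apply: eq_bigr => r _; rewrite hornerXsubC.
have dE : q^`().[w] = q.[w] * \sum_(r <- s) (w - r)^-1.
  by rewrite {1}es derivZ hornerZ deriv_prod_XsubC // mulrA -qwE.
have sumlt : `|\sum_(r <- s) (w - r)^-1| <=
    \sum_(r <- s) `|q^`().[w]| / (n%:R * `|q.[w]|).
  apply: le_trans (ler_norm_sum _ _ _) _; rewrite !big_seq; apply: ler_sum => r r_s.
  have wr : 0 < `|w - r| by rewrite normr_gt0 subr_eq0 ws.
  rewrite normfV -[leLHS]mul1r ler_pdivrMr //.
  rewrite mulrAC ler_pdivlMr ?mulr_gt0 ?normr_gt0 // mul1r.
  by rewrite [leRHS]mulrC; apply/ltW/lt_far/rs.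
have : `|q^`().[w]| <= (size s)%:R / n%:R * `|q^`().[w]|.
  rewrite {1}dE normrM; apply: le_trans (ler_wpM2l (normr_ge0 _) sumlt) _.
  rewrite big_const_seq count_predT iter_addr_0 -mulr_natl.
  have qw0 : 0 < `|q.[w]| by rewrite normr_gt0.
  by rewrite le_eqVlt; apply/orP; left; apply/eqP; field; rewrite !gt_eqF.
rewrite -{1}[`|_|]mul1r ler_pM2r ?normr_gt0 // ler_pdivlMr // mul1r ler_nat.
by rewrite leqNgt sz.
Qed.

(** The quotient (q(x) - q(y)) / (x - y) written out as a polynomial, so that it makes sense at x =
    y and depends continuously on the coefficients and on x and y. *)
Definition diff_quotient n (q : {poly C}) (x y : C) :=
  \sum_(i < n) q`_i * \sum_(j < i) x ^+ (i.-1 - j) * y ^+ j.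

Lemma diff_quotientE n (q : {poly C}) x y : (size q <= n)%N ->
  q.[x] - q.[y] = (x - y) * diff_quotient n q x y.
Proof.
move=> sq; rewrite !(horner_coef_wide _ sq) -sumrB mulr_sumr.
by apply: eq_bigr => i _; rewrite -mulrBr subrXX mulrCA.
Qed.

Lemma diff_quotient_diag n (q : {poly C}) x : (size q <= n)%N ->
  diff_quotient n q x x = q^`().[x].
Proof.
move=> sq; have -> : q = \sum_(i < n) q`_i *: 'X^i.
  rewrite -poly_def; apply/polyP => i; rewrite coef_poly; case: ltnP => // le_ni.
  by rewrite nth_default // (leq_trans sq).
rewrite (raddf_sum (@deriv C)) horner_sum /=; apply: eq_bigr => i _.
rewrite derivZ hornerZ derivXn hornerMn hornerXn; congr (_ * _).
  rewrite coef_sum (bigD1 i) //= coefZ coefXn eqxx mulr1 big1 ?addr0 // => j ji.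
  by rewrite coefZ coefXn eq_sym val_eqE (negPf ji) mulr0.
rewrite (eq_bigr (fun=> x ^+ i.-1)) ?sumr_const ?card_ord // => j _.
rewrite -exprD subnK // -ltnS prednK // (leq_ltn_trans _ (ltn_ord j)) //.
Qed.

Lemma cvg_sum_ord (T : Type) (F : set_system T) {FF : Filter F} n
  (f : 'I_n -> T -> C) (l : 'I_n -> C) :
  (forall i, f i @ F --> l i) -> (fun x => \sum_i f i x) @ F --> \sum_i l i.
Proof.
elim: n f l => [|n IH] f l fl.
  rewrite big_ord0 [X in X @ _](_ : _ = cst 0) ?funeqE => [|x]; first exact: cvg_cst.
  by rewrite big_ord0.
rewrite big_ord_recr [X in X @ _](_ : _ =
  (fun x => \sum_i f (widen_ord (leqnSn n) i) x) \+ f ord_max) ?funeqE => [|x].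
  by apply: cvgD => //; apply: IH.
by rewrite big_ord_recr.
Qed.

Lemma cvg_expr (T : Type) (F : set_system T) {FF : Filter F} (f : T -> C) (l : C) k :
  f @ F --> l -> (fun x => f x ^+ k) @ F --> l ^+ k.
Proof.
move=> fl; elim: k => [|k IH]; first exact: cvg_cst.
rewrite exprS [X in X @ _](_ : _ = f \* (fun x => f x ^+ k)) ?funeqE => [|x].
  exact: cvgM.
by rewrite exprS.
Qed.

Section Implicit.
Variables (V : normedModType C) (P : V -> {poly C}) (n : nat) (a : V) (w0 : C).
Hypotheses (sP : forall p, (size (P p) <= n)%N)
  (dP : forall i : 'I_n, \forall p \near a, differentiable (fun p => (P p)`_i) p)
  (P0 : (P a).[w0] = 0) (dP0 : (P a)^`().[w0] != 0).

Let coef_near : \forall p \near a, forall i : 'I_n, differentiable (fun p => (P p)`_i) p.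
Proof. exact: filter_forall. Qed.

Lemma cvg_diff_quotient (T : Type) (F : set_system T) {FF : Filter F}
  (p : T -> V) (x y : T -> C) (b : V) (x0 y0 : C) :
  (forall i : 'I_n, differentiable (fun p => (P p)`_i) b) ->
  p @ F --> b -> x @ F --> x0 -> y @ F --> y0 ->
  (fun t => diff_quotient n (P (p t)) (x t) (y t)) @ F --> diff_quotient n (P b) x0 y0.
Proof.
move=> db pb xx yy; apply: cvg_sum_ord => i; apply: cvgM.
  by apply: (@cvg_comp _ _ _ p (fun p => (P p)`_i)) pb _; apply: differentiable_continuous.
by apply: cvg_sum_ord => j; apply: cvgM; apply: cvg_expr.
Qed.

Lemma differentiable_horner b c : (forall i : 'I_n, differentiable (fun p => (P p)`_i) b) ->
  differentiable (fun p => (P p).[c]) b.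
Proof.
move=> db; have -> : (fun p => (P p).[c]) = \sum_(i < n) (fun p => c ^+ i *: (P p)`_i).
  apply/funext => p; rewrite (horner_coef_wide _ (sP p)) fct_sumE.
  by apply: eq_bigr => i _; rewrite mulrC.
by apply: differentiable_sum => i; apply: differentiableZ.
Qed.

(** Existence of a nearby root comes from [root_near]. Near the simple root the difference quotient
    is bounded away from 0, which gives uniqueness, and the formula w(p) = w(b) - N(p) / K(p), with
    N(p) the value at w(b) and K(p) the difference quotient, gives first continuity and then
    differentiability. *)
Theorem implicit_root : exists w : V -> C,
  [/\ w a = w0,
      \forall p \near a, differentiable w p /\ (P p).[w p] = 0 &
      exists2 e : C, 0 < e &
        \forall p \near a, forall x, `|x - w0| < e -> (P p).[x] = 0 -> x = w p].
Proof.
(* Half of the value of the difference quotient at (a, w0, w0) is a lower bound for it nearby. *)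
pose d := `|(P a)^`().[w0]| / 2.
have d0 : 0 < d by rewrite divr_gt0 // normr_gt0.
have [e e0 [U Ua HU]] : exists2 e : C, 0 < e & exists2 U, nbhs a U &
    forall p x y, U p -> `|x - w0| < e -> `|y - w0| < e ->
    d < `|diff_quotient n (P p) x y|.
  have : \forall z \near (a, (w0, w0)), d < `|diff_quotient n (P z.1) z.2.1 z.2.2|.
    have cK : (fun z : V * (C * C) => diff_quotient n (P z.1) z.2.1 z.2.2)
        @ (a, (w0, w0)) --> diff_quotient n (P a) w0 w0.
      apply: cvg_diff_quotient; first exact: nbhs_singleton coef_near.
      - exact: cvg_fst.
      - by apply: (@cvg_comp _ _ _ snd fst) cvg_snd _; apply: cvg_fst.
      by apply: (@cvg_comp _ _ _ snd snd) cvg_snd _; apply: cvg_snd.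
    apply: (@cvgr_norm_gt _ _ _ _ _ _ _ cK).
    rewrite diff_quotient_diag // /d gtr_pMr ?normr_gt0 //.
    by rewrite invf_lt1 // ltr1n.
  move=> [[U B] /= [Ua [[B1 B2] /= [HB1 HB2] HB]] HU].
  have [e1 /= e10 He1] := HB1; have [e2 /= e20 He2] := HB2.
  (* The order of C is partial, so the minimum needs comparability, which holds for real
     elements. *)
  have re : e1 >=< e2 by apply: real_comparable; rewrite ger0_real ?ltW.
  exists (Num.min e1 e2); first by rewrite comparable_lt_min // e10 e20.
  exists U => // p x y Up; rewrite !comparable_lt_min // => /andP[x1 _] /andP[_ y2].
  apply: (HU (p, (x, y))); split=> //=; apply: HB; split=> /=.
    by apply: He1; rewrite /ball_ /= distrC.
  by apply: He2; rewrite /ball_ /= distrC.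
have uniq_root p x y : U p -> `|x - w0| < e -> `|y - w0| < e ->
    (P p).[x] = 0 -> (P p).[y] = 0 -> x = y.
  move=> Up xe ye Px Py; apply/eqP; rewrite -subr_eq0.
  have := diff_quotientE x y (sP p); rewrite Px Py subrr => /esym/eqP.
  rewrite mulf_eq0 => /orP[//|/eqP q0].
  by have := HU p x y Up xe ye; rewrite q0 normr0 => /(lt_trans d0); rewrite ltxx.
have ex_root : \forall p \near a, exists x, `|x - w0| < e /\ (P p).[x] = 0.
  have cP : (fun p => (P p).[w0]) @ a --> 0.
    have := differentiable_continuous
      (differentiable_horner w0 (nbhs_singleton coef_near)).
    by rewrite /prop_for /continuous_at P0.
  have cN : (fun p => n%:R * (P p).[w0]) @ a --> (n%:R * 0 : C).
    by apply: cvgM => //; exact: cvg_cst.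
  have de0 : 0 < d * e by rewrite mulr_gt0.
  have Ne : \forall p \near a, `|n%:R * (P p).[w0]| < d * e.
    by move: cN; rewrite mulr0 => /cvgr0Pnorm_lt; apply.
  apply: filterS2 Ua Ne => p Up lt_p.
  have w0e : `|w0 - w0| < e by rewrite subrr normr0.
  have dp : d < `|(P p)^`().[w0]| by rewrite -(diff_quotient_diag _ (sP p)); apply: HU.
  have dp0 : (P p)^`().[w0] != 0 by rewrite -normr_gt0 (lt_trans d0).
  (* Since the derivative exceeds d and n |P(w0)| < d e, the root found lies within e of w0. *)
  have [r [Pr le_r]] := root_near (sP p) dp0.
  exists r; split=> //; rewrite distrC -(ltr_pM2l d0).
  apply: le_lt_trans lt_p; rewrite normrM normr_nat; apply: le_trans le_r.
  by rewrite mulrC ler_wpM2l // ltW.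
(* A choice of the root near w0; the default value w0 occurs only where there is none. *)
pose w p := xget w0 [set x | `|x - w0| < e /\ (P p).[x] = 0].
have wP : \forall p \near a, [/\ U p, `|w p - w0| < e & (P p).[w p] = 0].
  by apply: filterS2 Ua ex_root => p Up /(xgetPex w0)[].
have wa : w a = w0.
  have [Ua' we Pw] := nbhs_singleton wP.
  by apply: (uniq_root a) => //; rewrite subrr normr0.
exists w; split=> //; last first.
  exists e => //; apply: filterS wP => p [Up we Pw] x xe Px.
  exact: (uniq_root p).
apply: filterS2 (nbhs_interior wP) (nbhs_interior coef_near) => b wPb coefb.
have [Ub wbe Pwb] := nbhs_singleton (wPb : nbhs b _).
have db := nbhs_singleton (coefb : nbhs b _).
split=> //; pose N p := (P p).[w b]; pose K p := diff_quotient n (P p) (w p) (w b).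
have dN : differentiable N b by apply: differentiable_horner.
have Kd p : U p -> `|w p - w0| < e -> d < `|K p| by move=> Up wpe; apply: HU.
have wE : \forall p \near b, w p = w b + N p * - (K p)^-1.
  apply: filterS wPb => p [Up wpe Pwp].
  have K0 : K p != 0 by rewrite -normr_gt0 (lt_trans d0) // Kd.
  have := diff_quotientE (w p) (w b) (sP p); rewrite Pwp sub0r -/(N p) -/(K p) => eN.
  by apply: (mulIf K0); rewrite mulrDl -mulrA mulNr mulVf // mulrN1 eN; ring.
have cw : {for b, continuous w}.
  have cN : N @ b --> 0.
    by have := differentiable_continuous dN; rewrite /prop_for /continuous_at /N Pwb.
  apply/cvgrPdist_lt => t t0; have dt : 0 < d * t by rewrite mulr_gt0.
  have Nt : \forall p \near b, `|N p| < d * t by move/cvgr0Pnorm_lt: cN; apply.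
  near=> p.
  have [Up wpe Pwp] : [/\ U p, `|w p - w0| < e & (P p).[w p] = 0] by near: p.
  have -> : w p = w b + N p * - (K p)^-1 by near: p.
  have Kp := Kd p Up wpe.
  have K0 : 0 < `|K p| by apply: lt_trans Kp.
  rewrite opprD addrA subrr sub0r mulrN opprK normrM normfV ltr_pdivrMr //.
  apply: lt_trans (_ : d * t < _); first by near: p.
  by rewrite mulrC ltr_pM2l.
apply: (@differentiable_near_eq _ _ _ (cst (w b) + (fun p => N p * - (K p)^-1))).
  by apply: filterS wE => p ->.
apply: differentiableD => //; apply: differentiable_mul_continuous => //.
have cK : {for b, continuous K}.
  by apply: cvg_diff_quotient => //; exact: cvg_cst.
apply: cvgN; apply: cvgV => //.
by rewrite -normr_gt0 (lt_trans d0) // Kd.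
Unshelve. all: by end_near. Qed.

End Implicit.

End ImplicitRoot.

(** * Local biholomorphisms and coordinate changes *)

Section LocalIsomorphisms.
Local Open Scope ring_scope.
Local Open Scope classical_set_scope.
Variable C : numClosedFieldType.
Local Notation U := 'rV[C]_3.
Implicit Types (X Y Z : set U) (a b c x y : U) (phi psi : U -> U).

(** A local biholomorphism of the ambient space carrying one set to the other. The coordinate
    changes below are all of this kind; [loc_iso_germ] restricts them to the germs. *)
Definition loc_iso X a Y b := exists phi psi : U -> U,
  [/\ holomorphic_near phi a, holomorphic_near psi b, phi a = b & psi b = a] /\
  [/\ \forall x \near a, psi (phi x) = x, \forall y \near b, phi (psi y) = y &
      \forall x \near a, X x <-> Y (phi x)].

Lemma near_image phi a b (Q : set U) : holomorphic_near phi a -> phi a = b ->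
  (\forall y \near b, Q y) -> \forall x \near a, Q (phi x).
Proof.
move=> /nbhs_singleton/differentiable_continuous cphi <-.
exact: (cphi Q).
Qed.

Lemma holomorphic_comp phi psi a b : holomorphic_near phi a -> phi a = b ->
  holomorphic_near psi b -> holomorphic_near (psi \o phi) a.
Proof.
move=> hphi pab hpsi; apply: filterS2 hphi (near_image hphi pab hpsi) => x dx dpx.
exact: differentiable_comp.
Qed.

Lemma loc_iso_sym X a Y b : loc_iso X a Y b -> loc_iso Y b X a.
Proof.
move=> [phi [psi [[hphi hpsi pab pba] [K1 K2 XY]]]].
exists psi, phi; split=> //; split=> //.
by apply: filterS2 K2 (near_image hpsi pba XY) => y -> [].
Qed.

Lemma loc_iso_trans Y b X a Z c : loc_iso X a Y b -> loc_iso Y b Z c -> loc_iso X a Z c.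
Proof.
move=> [phi [psi [[hphi hpsi pab pba] [K1 K2 XY]]]].
move=> [phi' [psi' [[hphi' hpsi' pbc pcb] [K1' K2' YZ]]]].
exists (phi' \o phi), (psi \o psi'); split; split.
- exact: holomorphic_comp hphi'.
- exact: holomorphic_comp hpsi.
- by rewrite /= pab.
- by rewrite /= pcb.
- by apply: filterS2 K1 (near_image hphi pab K1') => x e1 /= ->.
- by apply: filterS2 K2' (near_image hpsi' pcb K2) => x e1 /= ->.
by apply: filterS2 XY (near_image hphi pab YZ) => x /= ->.
Qed.

Lemma loc_iso_germ X a Y b : loc_iso X a Y b -> germ_iso X a Y b.
Proof.
move=> [phi [psi [[hphi hpsi pab pba] [K1 K2 XY]]]].
exists phi, psi; split=> //.
  by apply: filterS2 K1 XY => x ? [XYx _] /XYx.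
apply: filterS2 K2 (near_image hpsi pba XY) => y e.
by rewrite e => -[_ YX] /YX.
Qed.

Lemma germ_iso_sym X a Y b : germ_iso X a Y b -> germ_iso Y b X a.
Proof. by move=> [phi [psi [h1 h2 h3 h4]]]; exists psi, phi; split. Qed.

Lemma germ_iso_trans Y b X a Z c : germ_iso X a Y b -> germ_iso Y b Z c -> germ_iso X a Z c.
Proof.
move=> [phi [psi [[hphi pab] [hpsi pba] K1 K2]]].
move=> [phi' [psi' [[hphi' pbc] [hpsi' pcb] K1' K2']]].
exists (phi' \o phi), (psi \o psi'); split.
- by split; [exact: holomorphic_comp hphi'|rewrite /= pab].
- by split; [exact: holomorphic_comp hpsi|rewrite /= pcb].
- apply: filterS2 K1 (near_image hphi pab K1') => x /= KX KY /KX[/KY[Zx e] ex].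
  by split=> //; rewrite e.
apply: filterS2 K2' (near_image hpsi' pcb K2) => x /= KX KY /KX[/KY[Zx e] ex].
by split=> //; rewrite e.
Qed.

Lemma differentiable_meval (B : mpoly 3 C) x :
  differentiable (fun y : U => meval (fun i => y 0 i) B) x.
Proof.
elim/mpoly_ring_ind: B => [k|i|p q dp dq|p q dp dq].
- by rewrite (_ : (fun _ => _) = cst k) //; apply/funext => y; rewrite mevalC.
- rewrite (_ : (fun _ => _) = (fun y : U => y 0 i)); first exact: differentiable_coord.
  by apply/funext => y; rewrite mevalXU.
- rewrite (_ : (fun _ => _) = (fun y : U => meval (fun i => y 0 i) p) +
    (fun y : U => meval (fun i => y 0 i) q)); first exact: differentiableD.
  by apply/funext => y; rewrite mevalD.
rewrite (_ : (fun _ => _) = (fun y : U => meval (fun i => y 0 i) p) *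
  (fun y : U => meval (fun i => y 0 i) q)); first exact: differentiableM.
by apply/funext => y; rewrite mevalM.
Qed.

Definition set_coord (j : 'I_3) (x : U) (t : C) : U :=
  \row_i (if i == j then t else x 0 i).

Lemma set_coord_same j x t : set_coord j x t 0 j = t.
Proof. by rewrite mxE eqxx. Qed.

Lemma set_coord_other j x t i : i != j -> set_coord j x t 0 i = x 0 i.
Proof. by move=> /negPf ij; rewrite mxE ij. Qed.

Lemma set_coordK j x t : set_coord j (set_coord j x t) (x 0 j) = x.
Proof. by apply/rowP => i; rewrite !mxE; case: eqP => [->|]. Qed.

Lemma set_coord_id j x : set_coord j x (x 0 j) = x.
Proof. by apply/rowP => i; rewrite !mxE; case: eqP => [->|]. Qed.

Lemma set_coord2 j x s t : set_coord j (set_coord j x s) t = set_coord j x t.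
Proof. by apply/rowP => i; rewrite !mxE; case: eqP. Qed.

Lemma holomorphic_set_coord j (f : U -> C) a :
  (\forall x \near a, differentiable f x) ->
  holomorphic_near (fun x => set_coord j x (f x)) a.
Proof.
apply: filterS => x df; apply: differentiable_row => i.
have [->|ij] := eqVneq i j.
  rewrite (_ : (fun _ => _) = f) //; apply/funext => y; exact: set_coord_same.
rewrite (_ : (fun _ => _) = (fun y : U => y 0 i)); first exact: differentiable_coord.
by apply/funext => y; rewrite set_coord_other.
Qed.

(* phi and psi are mutually inverse modifications of the coordinate j. *)
Lemma loc_iso_coord j (f g : U -> C) X a Y b :
  (\forall x \near a, differentiable f x) -> (\forall y \near b, differentiable g y) ->
  b = set_coord j a (f a) -> g b = a 0 j ->
  (\forall x \near a, g (set_coord j x (f x)) = x 0 j) ->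
  (\forall y \near b, f (set_coord j y (g y)) = y 0 j) ->
  (\forall x \near a, X x <-> Y (set_coord j x (f x))) -> loc_iso X a Y b.
Proof.
move=> df dg eb eg gf fg XY.
exists (fun x => set_coord j x (f x)), (fun y => set_coord j y (g y)); split; split=> //.
- exact: holomorphic_set_coord.
- exact: holomorphic_set_coord.
- by rewrite eg eb set_coordK.
- by apply: filterS gf => x ->; rewrite set_coordK.
by apply: filterS fg => x ->; rewrite set_coordK.
Qed.

Section Roots.
Variable e : nat.
Hypothesis e0 : (0 < e)%N.

Lemma implicit_nth_root (h : U -> C) a w0 :
  (\forall x \near a, differentiable h x) -> w0 ^+ e = h a -> h a != 0 ->
  exists w : U -> C,
  [/\ w a = w0, \forall x \near a, differentiable w x /\ w x ^+ e = h x &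
      exists2 d : C, 0 < d & \forall x \near a, forall t, `|t - w0| < d ->
        t ^+ e = h x -> t = w x].
Proof.
move=> dh ew ha; pose P x : {poly C} := 'X^e - (h x)%:P.
have PE x t : (P x).[t] = t ^+ e - h x by rewrite !(hornerD, hornerN, hornerC, hornerXn).
have sP x : (size (P x) <= e.+1)%N.
  by rewrite size_XnsubC.
have dP (i : 'I_e.+1) : \forall x \near a, differentiable (fun x => (P x)`_i) x.
  apply: filterS dh => x dx.
  rewrite (_ : (fun _ => _) = cst ('X^e : {poly C})`_i - (fun x => ((i : nat) == 0%N)%:R *: h x)).
    by apply: differentiableB => //; apply: differentiableZ.
  apply/funext => y; rewrite !fctE coefB coefC /cst; congr (_ - _).
  by case: eqP; rewrite ?scale1r ?scale0r.
have [||w [wa wP [d d0 dU]]] := @implicit_root C U P e.+1 a w0 sP dP.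
- by rewrite PE ew subrr.
- rewrite derivB derivC subr0 derivXn hornerMn hornerXn mulrn_eq0 negb_or -lt0n e0 /=.
  by rewrite expf_eq0 negb_and; apply/orP; right; apply: contra_neq ha => w00;
     rewrite -ew w00 expr0n gtn_eqF.
exists w; split=> //.
  by apply: filterS wP => x [dx]; rewrite PE => /subr0_eq.
exists d => //; apply: filterS dU => x dU t td et; apply: dU => //.
by rewrite PE et subrr.
Qed.

Lemma near_dist (w : U -> C) a w0 (d : C) : 0 < d -> w a = w0 -> differentiable w a ->
  \forall x \near a, `|w x - w0| < d.
Proof.
move=> d0 <- /differentiable_continuous cw.
by have /cvgrPdistC_lt := cw; apply.
Qed.

(** Where x_j is nonzero, x_j^e serves as a coordinate in its place; the inverse is the branch of
    the e-th root near a_j. *)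
Lemma loc_iso_power j X a Y : a 0 j != 0 ->
  (\forall x \near a, X x <-> Y (set_coord j x (x 0 j ^+ e))) ->
  loc_iso X a Y (set_coord j a (a 0 j ^+ e)).
Proof.
move=> aj XY; set b := set_coord j a _.
have dj x : differentiable (fun y : U => y 0 j) x by exact: differentiable_coord.
have bj : b 0 j = a 0 j ^+ e by rewrite set_coord_same.
have [|||w [wb wP [d d0 dU]]] := @implicit_nth_root (fun y => y 0 j) b (a 0 j).
- by apply: filterE => x.
- by rewrite bj.
- by rewrite bj expf_neq0.
have df : \forall x \near a, differentiable (fun x : U => x 0 j ^+ e) x.
  apply: filterE => x; elim: e => [|n IH]; first exact: differentiable_cst.
  rewrite (_ : (fun _ => _) = (fun y : U => y 0 j) * (fun y : U => y 0 j ^+ n)).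
    exact: differentiableM.
  by apply/funext => y; rewrite exprS.
apply: (@loc_iso_coord j (fun x => x 0 j ^+ e) w) => //.
- by apply: filterS wP => x [].
- have hp := holomorphic_set_coord j df.
  have dUa := near_image hp (erefl b) dU.
  apply: filterS2 dUa (near_dist d0 (erefl _) (dj a)) => x H1 H2.
  by symmetry; apply: H1 => //; rewrite set_coord_same.
by apply: filterS wP => y [_]; rewrite set_coord_same.
Qed.

Section Unit.
Variables (j : 'I_3) (B : mpoly 3 C).
Local Notation ev x := (meval (fun i => x 0 i) B).

(** Replaces the j-th variable by y_j T and the others by the coordinates of y, so that B becomes a
    polynomial in T whose coefficients depend on y. *)
Definition scaled_morph (y : U) : {rmorphism mpoly 3 C -> {poly C}} :=
  mmap (@polyC C) (fun i => if i == j then y 0 j *: 'X else (y 0 i)%:P).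

Lemma scaled_morphC y k : scaled_morph y (mpolyC 3 k) = k%:P.
Proof. exact: mmapC. Qed.

Lemma scaled_morphX y i : scaled_morph y (mpolyX C (mnm1 i)) =
  if i == j then y 0 j *: 'X else (y 0 i)%:P.
Proof. by rewrite /scaled_morph /= mmapX mmap1U. Qed.

Definition scaled_poly (y : U) : {poly C} := scaled_morph y B.

Lemma scaled_polyE y t : (scaled_poly y).[t] = ev (set_coord j y (y 0 j * t)).
Proof.
rewrite /scaled_poly; elim/mpoly_ring_ind: B => [k|i|p q ep eq|p q ep eq].
- by rewrite scaled_morphC hornerC mevalC.
- rewrite scaled_morphX mevalXU mxE; case: eqP => [_|_]; last by rewrite hornerC.
  by rewrite hornerZ hornerX.
- by rewrite rmorphD hornerD ep eq mevalD.
by rewrite rmorphM hornerM ep eq mevalM.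
Qed.

Lemma scaled_poly_bound : exists n,
  (forall y, (size (scaled_poly y) <= n)%N) /\
  forall i x, differentiable (fun y : U => (scaled_poly y)`_i) x.
Proof.
rewrite /scaled_poly; elim/mpoly_ring_ind: B => [k|i|p q [n [sn dn]] [m [sm dm]]|p q [n [sn dn]] [m [sm dm]]].
- exists 1%N; split=> [y|i x]; first by rewrite scaled_morphC size_polyC leq_b1.
  by rewrite (_ : (fun _ => _) = cst (k%:P)`_i) //; apply/funext => y; rewrite scaled_morphC.
- exists 2%N; split=> [y|k x].
    rewrite scaled_morphX; case: eqP => _.
      by rewrite (leq_trans (size_scale_leq _ _)) // size_polyX.
    by rewrite (leq_trans (size_polyC_leq1 _)).
  rewrite (_ : (fun _ => _) = (fun y : U =>
     (if i == j then (k == 1%N)%:R else (k == 0%N)%:R) *: y 0 i)).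
    by apply: differentiableZ; apply: differentiable_coord.
  apply/funext => y; rewrite scaled_morphX /GRing.scale /=; case: eqP => [->|_].
    by rewrite coefZ coefX mulrC.
  by rewrite coefC; case: (k == 0%N); rewrite ?mul1r ?mul0r.
- exists (maxn n m); split=> [y|i x].
    by rewrite rmorphD (leq_trans (size_polyD _ _)) // geq_max !leq_max sn sm orbT.
  rewrite (_ : (fun _ => _) = (fun y : U => (scaled_morph y p)`_i) + (fun y : U => (scaled_morph y q)`_i)); first exact: differentiableD.
  by apply/funext => y; rewrite rmorphD coefD.
exists (n + m)%N; split=> [y|i x].
  rewrite rmorphM; apply: leq_trans (size_polyMleq _ _) _.
  by apply: leq_trans (leq_pred _) _; apply: leq_add.
rewrite (_ : (fun _ => _) = \sum_(k < i.+1) ((fun y : U => (scaled_morph y p)`_k) * (fun y : U => (scaled_morph y q)`_(i - k)))).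
  by apply: differentiable_sum => k; apply: differentiableM.
by apply/funext => y; rewrite rmorphM coefM fct_sumE.
Qed.

(** A nonvanishing factor B of x_j^e is absorbed by the coordinate change x_j |-> x_j w with w^e =
    B. The inverse is y_j |-> y_j v, where v solves v^e B(y with y_j v in place j) = 1. This is
    polynomial in v, so both directions come from implicit roots and no general inverse function
    theorem enters. *)
Lemma loc_iso_unit a X Y : a 0 j = 0 -> ev a != 0 ->
  (forall x w, w ^+ e = ev x -> X x <-> Y (set_coord j x (x 0 j * w))) ->
  loc_iso X a Y a.
Proof.
move=> aj Ba XY; pose w0 := e.-root (ev a).
have w0e : w0 ^+ e = ev a by rewrite /w0 rootCK.
have w00 : w0 != 0 by apply: contra_neq Ba => w00; rewrite -w0e w00 expr0n gtn_eqF.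
have [|w [wa wP [d d0 dU]]] := @implicit_nth_root (fun x => ev x) a w0 _ w0e Ba.
  by apply: filterE => x; apply: differentiable_meval.
have [n [sn dn]] := scaled_poly_bound.
pose P y : {poly C} := 'X^e * scaled_poly y - 1.
have PE y t : (P y).[t] = t ^+ e * ev (set_coord j y (y 0 j * t)) - 1.
  by rewrite hornerD hornerN hornerM hornerXn scaled_polyE hornerC.
have sP y : (size (P y) <= (e + n).+1)%N.
  rewrite (leq_trans (size_polyD _ _)) // size_polyN size_poly1 geq_max /= andbT.
  rewrite (leq_trans (size_polyMleq _ _)) // size_polyXn addSn /=.
  by rewrite (leq_trans _ (leqnSn _)) // leq_add2l.
have dP (i : 'I_(e + n).+1) : \forall y \near a, differentiable (fun y => (P y)`_i) y.
  apply: filterE => y.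
  rewrite (_ : (fun _ => _) =
    (fun y => (if (i < e)%N then 0 else 1) *: (scaled_poly y)`_(i - e)) - cst (1 : {poly C})`_i).
    by apply: differentiableB => //; apply: differentiableZ.
  apply/funext => z; rewrite !fctE /P coefB coefXnM /cst; congr (_ - _).
  by rewrite /GRing.scale /=; case: ifP; rewrite ?mul0r ?mul1r.
have a0 t : set_coord j a (a 0 j * t) = a.
  by rewrite aj mul0r -[X in set_coord j a X]aj set_coord_id.
have [||v [va vP [d' d0' dU']]] := @implicit_root C U P _ a w0^-1 sP dP.
- by rewrite PE a0 exprVn w0e mulVf // subrr.
(* As a_j = 0, [scaled_poly a] is constant, and only the derivative of 'X^e contributes at the root
   w0^-1. *)
- rewrite derivB derivM -polyC1 derivC subr0 hornerD !hornerM derivXn hornerMn !hornerXn.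
  rewrite scaled_polyE a0 [X in _ + _ * X](_ : _ = 0) ?mulr0 ?addr0; last first.
    have -> : scaled_poly a = (ev a)%:P; last by rewrite derivC hornerC.
    rewrite /scaled_poly; elim/mpoly_ring_ind: B => [k|i|p q ep eq|p q ep eq].
    + by rewrite scaled_morphC mevalC.
    + rewrite scaled_morphX mevalXU; case: eqP => [->|//]; by rewrite aj scale0r polyC0.
    + by rewrite rmorphD ep eq mevalD polyCD.
    by rewrite rmorphM ep eq mevalM polyCM.
  by rewrite mulf_neq0 // mulrn_eq0 negb_or -lt0n e0 expf_neq0 // invr_eq0.
have dwx : \forall x \near a, differentiable (fun x : U => x 0 j * w x) x.
  apply: filterS wP => x [dw _].
  by apply: (@differentiableM _ _ (fun x : U => x 0 j) w) => //; apply: differentiable_coord.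
have dvx : \forall x \near a, differentiable (fun x : U => x 0 j * v x) x.
  apply: filterS vP => x [dv _].
  by apply: (@differentiableM _ _ (fun x : U => x 0 j) v) => //; apply: differentiable_coord.
have fa : set_coord j a (a 0 j * w a) = a by rewrite a0.
have ga : set_coord j a (a 0 j * v a) = a by rewrite a0.
have [dwa _] := nbhs_singleton wP; have [dva _] := nbhs_singleton vP.
have w_neq0 : \forall x \near a, w x != 0.
  have cw : w @ a --> w0.
    by have := differentiable_continuous dwa; rewrite /prop_for /continuous_at wa.
  exact: (@cvgr_neq0 _ _ _ _ _ _ _ cw).
have v_neq0 : \forall x \near a, v x != 0.
  have cv : v @ a --> w0^-1.
    by have := differentiable_continuous dva; rewrite /prop_for /continuous_at va.
  by apply: (@cvgr_neq0 _ _ _ _ _ _ _ cv); rewrite invr_eq0.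
have dwV : differentiable (fun x => (w x)^-1) a by apply: differentiableV; rewrite ?wa.
have dvV : differentiable (fun x => (v x)^-1) a.
  by apply: differentiableV => //; rewrite va invr_eq0.
have near_w : \forall x \near a, `|(w x)^-1 - w0^-1| < d'.
  by apply: near_dist => //; rewrite wa.
have near_v : \forall x \near a, `|(v x)^-1 - w0| < d.
  by apply: near_dist => //; rewrite va invrK.
apply: (@loc_iso_coord j (fun x => x 0 j * w x) (fun x => x 0 j * v x)) => //.
- by rewrite aj mul0r.
- have hf := near_image (holomorphic_set_coord j dwx) fa dU'.
  apply: filterS2 (filterI w_neq0 near_w) (filterI wP hf) => x [wx0 nx] [[_ wx] H].
  have vx : (w x)^-1 = v (set_coord j x (x 0 j * w x)).
    apply: H => //; rewrite PE set_coord_same set_coord2 mulfK // set_coord_id.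
    by rewrite exprVn wx mulVf ?subrr // -wx expf_neq0.
  by rewrite -vx set_coord_same mulfK.
- have hg := near_image (holomorphic_set_coord j dvx) ga dU.
  apply: filterS2 (filterI v_neq0 near_v) (filterI vP hg) => x [vx0 nx] [[_ vx] H].
  have wx : (v x)^-1 = w (set_coord j x (x 0 j * v x)).
    apply: H => //; move/eqP: vx; rewrite PE subr_eq0 => /eqP vx.
    by apply: (mulfI (expf_neq0 e vx0)); rewrite vx exprVn mulfV // expf_neq0.
  by rewrite -wx set_coord_same mulfK.
by apply: filterS wP => x [_ wx]; apply: XY.
Qed.

End Unit.

End Roots.

End LocalIsomorphisms.

(** * Germs in affine charts and projective transformations *)

Section ProjectiveGerms.
Local Open Scope ring_scope.
Local Open Scope classical_set_scope.
Variable C : numClosedFieldType.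
Local Notation U := 'rV[C]_3.

Lemma holomorphic_fraction (num : 'I_3 -> mpoly 3 C) (den : mpoly 3 C) (a : U) :
  meval (fun i => a 0 i) den != 0 ->
  holomorphic_near (fun x : U => \row_k (meval (fun i => x 0 i) (num k) /
     meval (fun i => x 0 i) den)) a.
Proof.
move=> da; pose d (x : U) := meval (fun i => x 0 i) den.
have dd x : differentiable d x by exact: differentiable_meval.
have : \forall x \near a, d x != 0.
  exact: (@cvgr_neq0 _ _ _ _ _ _ _ (differentiable_continuous (dd a))).
apply: filterS => x dx; apply: differentiable_row => j.
rewrite (_ : (fun _ => _) = (fun x : U => meval (fun i => x 0 i) (num j)) *
  (fun x => (d x)^-1)); last by apply/funext => y; rewrite mxE.
by apply: differentiableM; [exact: differentiable_meval | exact: differentiableV].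
Qed.

Definition chart_form (i : 'I_4) (M : 'M[C]_4) (l : 'I_4) : mpoly 3 C :=
  \sum_m M m l *: (if unlift i m is Some k then mpolyX C (mnm1 k) else 1).

Lemma chart_formE i M l (x : U) :
  meval (fun i => x 0 i) (chart_form i M l) = (chart i x *m M) 0 l.
Proof.
rewrite /chart_form raddf_sum mxE; apply: eq_bigr => m _ /=.
rewrite mevalZ mxE mulrC; congr (_ * _); case: unliftP => [k _|_].
  by rewrite mevalXU.
by rewrite meval1.
Qed.

Lemma chart_self i (x : U) : chart i x 0 i = 1.
Proof. by rewrite mxE unlift_none. Qed.

Lemma chart_neq0 i (x : U) : chart i x != 0.
Proof. by apply/eqP => /rowP/(_ i)/eqP; rewrite chart_self mxE oner_eq0. Qed.

Definition dehomog (j : 'I_4) (v : 'rV[C]_4) : U := \row_k (v 0 (lift j k) / v 0 j).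

Lemma chart_dehomog j (v : 'rV[C]_4) : v 0 j != 0 -> chart j (dehomog j v) = (v 0 j)^-1 *: v.
Proof.
move=> vj; apply/rowP => l; rewrite !mxE; case: unliftP => [k ->|->].
  by rewrite mxE mulrC.
by rewrite mulVf.
Qed.

Lemma dehomog_chart j (x : U) k : k != 0 -> dehomog j (k *: chart j x) = x.
Proof.
move=> k0; apply/rowP => l; rewrite !(mxE, liftK, unlift_none).
by rewrite mulr1 mulrC mulKf.
Qed.

Lemma holomorphic_dehomog i j (M : 'M[C]_4) (a : U) : (chart i a *m M) 0 j != 0 ->
  holomorphic_near (fun x => dehomog j (chart i x *m M)) a.
Proof.
rewrite -chart_formE => h.
rewrite (_ : (fun _ => _) = (fun x : U =>
  \row_k (meval (fun i => x 0 i) (chart_form i M (lift j k)) /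
     meval (fun i => x 0 i) (chart_form i M j)))); first exact: holomorphic_fraction.
by apply/funext => x; apply/rowP => k; rewrite !mxE !chart_formE !mxE.
Qed.

(** In charts an invertible matrix acts by linear fractional maps, regular near a because the j-th
    coordinate of the image is nonzero there. The two charts may differ, so M = 1 gives the change
    of chart. *)
Lemma loc_iso_projective (Z Z' : set 'rV[C]_4) (M N : 'M[C]_4) i j (a b : U) k :
  M *m N = 1%:M -> N *m M = 1%:M ->
  (forall c x, c != 0 -> Z' (c *: x) <-> Z' x) ->
  (forall x, Z x <-> Z' (x *m M)) -> k != 0 -> chart i a *m M = k *: chart j b ->
  loc_iso [set y | Z (chart i y)] a [set y | Z' (chart j y)] b.
Proof.
move=> MN NM cone ZZ k0 e.
have e' : chart j b *m N = k^-1 *: chart i a.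
  by rewrite -[chart i a]mulmx1 -MN mulmxA e -scalemxAl scalerA mulVf // scale1r.
have aj : (chart i a *m M) 0 j != 0 by rewrite e mxE chart_self mulr1.
have bi : (chart j b *m N) 0 i != 0 by rewrite e' mxE chart_self mulr1 invr_eq0.
have near_neq0 i' j' (M' : 'M[C]_4) (a' : U) : (chart i' a' *m M') 0 j' != 0 ->
    \forall x \near a', (chart i' x *m M') 0 j' != 0.
  move=> h; pose d (x : U) := meval (fun i => x 0 i) (chart_form i' M' j').
  have dd : differentiable d a' by exact: differentiable_meval.
  have d0 : d a' != 0 by rewrite /d chart_formE.
  have near_d : \forall x \near a', d x != 0.
    exact: (@cvgr_neq0 _ _ _ _ _ _ _ (differentiable_continuous dd) d0).
  by apply: filterS near_d => x; rewrite /d chart_formE.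
have K i' j' (M' N' : 'M[C]_4) (x : U) : M' *m N' = 1%:M -> (chart i' x *m M') 0 j' != 0 ->
    dehomog i' (chart j' (dehomog j' (chart i' x *m M')) *m N') = x.
  move=> MN' h; rewrite chart_dehomog // -scalemxAl -mulmxA MN' mulmx1.
  by rewrite dehomog_chart // invr_eq0.
exists (fun x => dehomog j (chart i x *m M)), (fun y => dehomog i (chart j y *m N)).
split; split.
- exact: holomorphic_dehomog.
- exact: holomorphic_dehomog.
- by rewrite e dehomog_chart.
- by rewrite e' dehomog_chart // invr_eq0.
- by apply: filterS (near_neq0 _ _ _ _ aj) => x xj; exact: (K _ _ _ _ _ MN xj).
- by apply: filterS (near_neq0 _ _ _ _ bi) => x xj; exact: (K _ _ _ _ _ NM xj).
apply: filterS (near_neq0 _ _ _ _ aj) => x xj /=.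
by rewrite chart_dehomog // cone ?invr_eq0.
Qed.

Lemma loc_iso_linear (X Y : set U) (M N : 'M[C]_3) : M *m N = 1%:M -> N *m M = 1%:M ->
  (forall x, X x <-> Y (x *m M)) -> loc_iso X 0 Y 0.
Proof.
move=> MN NM XY.
have hol (A : 'M[C]_3) : holomorphic_near (fun x : U => x *m A) 0.
  rewrite (_ : (fun _ => _) = (fun x : U => \row_k
    (meval (fun i => x 0 i) (\sum_i A i k *: mpolyX C (mnm1 i)) / meval (fun i => x 0 i) 1))).
    by apply: holomorphic_fraction; rewrite meval1 oner_neq0.
  apply/funext => x; apply/rowP => k; rewrite !mxE meval1 divr1 raddf_sum.
  by apply: eq_bigr => i _ /=; rewrite mevalZ mevalXU mulrC.
exists (fun x => x *m M), (fun x => x *m N); split; split; rewrite ?mul0mx //.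
- by apply: filterE => x; rewrite -mulmxA MN mulmx1.
- by apply: filterE => x; rewrite -mulmxA NM mulmx1.
by apply: filterE.
Qed.

Lemma chart_preimage_zeros d (f : poly4 C) i : homogeneous d f ->
  chart_preimage i (zeros f) = [set y | evalv f (chart i y) = 0].
Proof.
move=> hf; apply/seteqP; split=> y /=; first by move=> [p [fp yp]]; exact: fp.
move=> fy; exists (proj_point (chart i y)); split; last exact/point_mem/chart_neq0.
by apply/(vanishes_pointE hf) => //; apply: chart_neq0.
Qed.

Lemma has_germ_loc_iso d (f : poly4 C) (v : 'rV[C]_4) i (a : U) (Y : set U) k :
  homogeneous d f -> k != 0 -> v = k *: chart i a ->
  loc_iso [set y | evalv f (chart i y) = 0] a Y 0 -> has_germ (zeros f) (proj_point v) Y.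
Proof.
move=> hf k0 ev ia; exists i, a; split; last first.
  by rewrite (chart_preimage_zeros _ hf); apply: loc_iso_germ.
have v0 : v != 0 by rewrite ev scaler_eq0 negb_or k0 chart_neq0.
by rewrite val_point // ev; apply/vlineP; exists k^-1; rewrite scalerA mulVf // scale1r.
Qed.

(** The two charts are compared by [loc_iso_projective] with the identity matrix. Hence the type of
    a point is well defined as soon as the model germs are not isomorphic. *)
Lemma has_germ_unique d (f : poly4 C) p (Y Y' : set U) : homogeneous d f ->
  has_germ (zeros f) p Y -> has_germ (zeros f) p Y' -> germ_iso Y 0 Y' 0.
Proof.
move=> hf [i [a [ap]]]; rewrite (chart_preimage_zeros _ hf) => ia.
move=> [j [b [bp]]]; rewrite (chart_preimage_zeros _ hf) => jb.
apply: germ_iso_trans (germ_iso_sym ia) _; apply: germ_iso_trans jb.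
have [k ek] : exists k, chart i a = k *: chart j b.
  move: ap; rewrite (mem_point (chart_neq0 j b) bp) val_point ?chart_neq0 //.
  by move=> /vlineP.
have k0 : k != 0.
  by apply: contra_neq (chart_neq0 i a) => k0; rewrite ek k0 scale0r.
apply: loc_iso_germ.
apply: (@loc_iso_projective [set x | evalv f x = 0] [set x | evalv f x = 0]
   1%:M 1%:M i j a b k); rewrite ?mulmx1 //.
  move=> c x c0 /=; rewrite (evalvZ _ _ hf).
  split=> [/eqP|->]; last by rewrite mulr0.
  by rewrite mulf_eq0 expf_eq0 (negPf c0) andbF => /eqP.
by move=> x; rewrite mulmx1.
Qed.

End ProjectiveGerms.

(** * The germs A_1, A_2 and D_4 are not isomorphic *)

Section DistinctTypes.
Local Open Scope ring_scope.
Local Open Scope classical_set_scope.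
Variable C : numClosedFieldType.
Local Notation U := 'rV[C]_3.
Implicit Types (X Y : set U) (v : U) (c : C -> U).

(** The limits of c(t) / t for arbitrary functions c into X; a differentiable map carries them along
    by its differential. *)
Definition tangent X v := exists c : C -> U,
  (t^-1 *: c t @[t --> 0^'] --> v) /\ \forall t \near 0^', X (c t).

Lemma cvg_near_eq (T : Type) (W : normedModType C) (F : set_system T) {FF : Filter F}
  (f g : T -> W) (l : W) : (\forall t \near F, f t = g t) -> f @ F --> l -> g @ F --> l.
Proof.
move=> fg fl A /fl; rewrite /nbhs /= => FA; apply: filterS2 fg FA => t e.
by rewrite /preimage /= e.
Qed.

Lemma cvg_id_dnbhs0 : (fun t : C => t) @ 0^' --> (0 : C).
Proof. by move=> A; exact: nbhs_dnbhs. Qed.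

Lemma cvg_to0 c v : (t^-1 *: c t @[t --> 0^'] --> v) -> c t @[t --> 0^'] --> (0 : U).
Proof.
move=> cv; have h : (t *: (t^-1 *: c t)) @[t --> 0^'] --> (0 : C) *: v.
  by apply: (cvgZ cvg_id_dnbhs0).
rewrite scale0r in h; apply: cvg_near_eq h.
near=> t; rewrite scalerA mulfV ?scale1r //.
by near: t; exact: nbhs_dnbhs_neq.
Unshelve. all: by end_near. Qed.

Lemma cvg_differential (f : U -> U) c v : differentiable f 0 -> f 0 = 0 ->
  (t^-1 *: c t @[t --> 0^'] --> v) -> t^-1 *: f (c t) @[t --> 0^'] --> 'd f 0 v.
Proof.
move=> df f0 cv; have c0 := cvg_to0 cv.
have Lv : 'd f 0 (t^-1 *: c t) @[t --> 0^'] --> 'd f 0 v.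
  by apply: (cvg_comp _ _ cv); exact: diff_continuous.
have small : (t^-1 *: (f (c t) - 'd f 0 (c t))) @[t --> 0^'] --> (0 : U).
  apply/cvgr0Pnorm_lt => e e0.
  have B0 : 0 < `|v| + 1 by rewrite ltr_pwDr.
  have e1 : 0 < e / 2 / (`|v| + 1) by rewrite !divr_gt0.
  have bnd : \forall t \near 0^', `|t^-1 *: c t| < `|v| + 1.
    by apply: (@cvgr_norm_lt _ _ _ _ _ _ _ cv); rewrite ltrDl.
  have dfe : \forall t \near 0^', `|f (c t + 0) - f 0 - 'd f 0 (c t)| <=
      e / 2 / (`|v| + 1) * `|c t|.
    exact: (c0 _ (differentiable_epsilon df e1)).
  apply: filterS2 bnd dfe => t bt; rewrite addr0 f0 subr0 => ft.
  rewrite normrZ; apply: (@le_lt_trans _ _ (e / 2)); last first.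
    by rewrite ltr_pdivrMr // ltr_pMr // ltr1n.
  apply: le_trans (ler_wpM2l (normr_ge0 _) ft) _.
  rewrite mulrCA -normrZ mulrAC ler_pdivrMr //.
  by rewrite ler_wpM2l ?divr_ge0 ?ltW.
have h : (t^-1 *: (f (c t) - 'd f 0 (c t)) + 'd f 0 (t^-1 *: c t)) @[t --> 0^'] -->
    (0 : U) + 'd f 0 v by exact: (cvgD small Lv).
rewrite add0r in h; apply: cvg_near_eq h.
by apply: filterE => t /=; rewrite linearZ /= -scalerDr subrK.
Qed.

Lemma cvg_coordinate c v (j : 'I_3) : (t^-1 *: c t @[t --> 0^'] --> v) ->
  t^-1 * c t 0 j @[t --> 0^'] --> v 0 j.
Proof.
move=> cv; apply: (cvg_near_eq _ (cvg_comp _ _ cv (@coord_continuous C 1 3 0 j v))).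
apply: filterE => t /=.
by rewrite mxE.
Qed.

(** A and B are the differentials of the two maps. These are mutually inverse only on the sets, so A
    followed by B is known to be the identity only on tangent vectors. *)
Lemma germ_iso_tangent X Y : germ_iso X 0 Y 0 -> exists A B : 'M[C]_3,
  forall v, tangent X v -> tangent Y (v *m A) /\ v *m A *m B = v.
Proof.
move=> [phi [psi [[hphi p0] [hpsi q0] KX KY]]].
have dphi := nbhs_singleton hphi; have dpsi := nbhs_singleton hpsi.
exists (lin1_mx ('d phi 0)), (lin1_mx ('d psi 0)) => v [c [cv Xc]].
rewrite !mul_rV_lin1 /=.
have c0 := cvg_to0 cv; have pv := cvg_differential dphi p0 cv.
have qv := cvg_differential dpsi q0 pv.
have KXc : \forall t \near 0^', X (c t) -> Y (phi (c t)) /\ psi (phi (c t)) = c t.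
  exact: (c0 _ KX).
split.
  by exists (phi \o c); split=> //; apply: filterS2 Xc KXc => t Xt /(_ Xt)[].
apply: (norm_cvg_unique qv); apply: cvg_near_eq cv.
by apply: filterS2 Xc KXc => t Xt /(_ Xt)[_ /= ->].
Qed.

(** After division by t^2 only the quadratic part x^2 of the equation survives in the limit. *)
Lemma D4_tangent v : tangent (D4_germ C) v -> v 0 0 = 0.
Proof.
move=> [c [cv Xc]]; have cj j := @cvg_coordinate _ _ j cv.
have c2 : c t 0 2%:R @[t --> 0^'] --> (0 : C).
  have := cvg_comp _ _ (cvg_to0 cv) (@coord_continuous C 1 3 0 2%:R 0).
  by rewrite mxE.
have h : ((t^-1 * c t 0 0) ^+ 2 + ((t^-1 * c t 0 1) ^+ 2 + (t^-1 * c t 0 2%:R) ^+ 2) * c t 0 2%:R)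
    @[t --> 0^'] --> v 0 0 ^+ 2 + (v 0 1 ^+ 2 + v 0 2%:R ^+ 2) * 0.
  apply: cvgD; first exact: cvg_expr.
  by apply: cvgM => //; apply: cvgD; apply: cvg_expr.
rewrite mulr0 addr0 in h; have : v 0 0 ^+ 2 = 0.
  apply: (norm_cvg_unique h); apply: (cvg_near_eq _ (cvg_cst (0 : C))).
  apply: filterS Xc => t; rewrite /D4_germ /= /cst => e.
  apply/esym; rewrite -[RHS](mulr0 (t^-1 ^+ 2)) -e; ring.
by move/eqP; rewrite expf_eq0 /= => /eqP.
Qed.

Lemma A1_tangent v : tangent (A_germ C 1) v ->
  v 0 0 ^+ 2 + v 0 1 ^+ 2 + v 0 2%:R ^+ 2 = 0.
Proof.
move=> [c [cv Xc]]; have cj j := @cvg_coordinate _ _ j cv.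
have h : ((t^-1 * c t 0 0) ^+ 2 + (t^-1 * c t 0 1) ^+ 2 + (t^-1 * c t 0 2%:R) ^+ 2)
    @[t --> 0^'] --> v 0 0 ^+ 2 + v 0 1 ^+ 2 + v 0 2%:R ^+ 2.
  by apply: cvgD; [apply: cvgD|]; apply: cvg_expr.
apply: (norm_cvg_unique h); apply: (cvg_near_eq _ (cvg_cst (0 : C))).
apply: filterS Xc => t; rewrite /A_germ /= /cst => e.
apply/esym; rewrite -[RHS](mulr0 (t^-1 ^+ 2)) -e; ring.
Qed.

Definition row3 (x y z : C) : U := \row_i nth 0 [:: x; y; z] i.

Lemma row3E x y z :
  (row3 x y z 0 0 = x) * (row3 x y z 0 1 = y) * (row3 x y z 0 2%:R = z).
Proof. by rewrite !mxE. Qed.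

Lemma row3P (v : U) : v = row3 (v 0 0) (v 0 1) (v 0 2%:R).
Proof.
apply/rowP => i; rewrite mxE; case: i => -[|[|[|//]]] lt /=;
  by congr (v 0 _); apply: val_inj.
Qed.

Lemma tangent_polynomial_curve X (u w : U) :
  (forall t, X (t *: u + t ^+ 2 *: w)) -> tangent X u.
Proof.
move=> Xc; exists (fun t => t *: u + t ^+ 2 *: w); split; last exact: filterE.
have h : (u + t *: w) @[t --> 0^'] --> u + (0 : C) *: w.
  apply: cvgD; first exact: cvg_cst.
  by apply: (cvgZ cvg_id_dnbhs0); exact: cvg_cst.
rewrite scale0r addr0 in h; apply: cvg_near_eq h.
near=> t; rewrite scalerDr !scalerA expr2 mulrA mulVf ?mul1r ?scale1r //.
by near: t; exact: nbhs_dnbhs_neq.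
Unshelve. all: by end_near. Qed.

Lemma A1_cone_tangent v : v 0 0 ^+ 2 + v 0 1 ^+ 2 + v 0 2%:R ^+ 2 = 0 ->
  tangent (A_germ C 1) v.
Proof.
move=> e; apply: (@tangent_polynomial_curve _ v 0) => t.
rewrite scaler0 addr0 /A_germ /= !mxE -[RHS](mulr0 (t ^+ 2)) -e; ring.
Qed.

(* The curve is obtained by factoring x^2 + y^2 = (x + iy)(x - iy) = - z^3. *)
Lemma A2_plane_tangent (s b z : C) : s ^+ 2 = -1 -> b != 0 ->
  tangent (A_germ C 2) (row3 (s * b) b z).
Proof.
move=> s2 b0; pose k := - z ^+ 3 / (4%:R * s * b).
apply: (@tangent_polynomial_curve _ _ (row3 k (- (k / s)) 0)) => t.
have s0 : s != 0.
  by apply/eqP => e; move/eqP: s2; rewrite e expr0n eq_sym oppr_eq0 oner_eq0.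
have sV : s^-1 = - s by apply: (mulfI s0); rewrite mulfV // mulrN -expr2 s2 opprK.
have k4 : 4%:R * s * b * k = - z ^+ 3.
  by rewrite /k mulrC divfK // !mulf_neq0 // pnatr_eq0.
rewrite /A_germ /= !mxE /= sV.
transitivity (t ^+ 2 * (s ^+ 2 + 1) * (b ^+ 2 + t ^+ 2 * k ^+ 2) +
  t ^+ 3 * (2%:R * s * b * k + 2%:R * s * b * k + z ^+ 3)); first ring.
rewrite s2 addNr mulr0 mul0r add0r (_ : 2%:R * s * b * k + _ = 4%:R * s * b * k); last by ring.
by rewrite k4 addNr mulr0.
Qed.

Lemma ord3P (P : 'I_3 -> Prop) : P 0 -> P 1 -> P 2%:R -> forall i, P i.
Proof.
move=> P0 P1 P2 [[|[|[|//]]] lt].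
- by rewrite (_ : Ordinal lt = 0) //; apply: val_inj.
- by rewrite (_ : Ordinal lt = 1) //; apply: val_inj.
by rewrite (_ : Ordinal lt = 2%:R) //; apply: val_inj.
Qed.

(** Spanning in dual form: no nonzero linear form kills every tangent vector. *)
Definition tangent_spanning X := forall w : 'cV[C]_3,
  (forall v, tangent X v -> v *m w = 0) -> w = 0.

Lemma row3_mul x y z (w : 'cV[C]_3) :
  (row3 x y z *m w) 0 0 = x * w 0 0 + y * w 1 0 + z * w 2%:R 0.
Proof.
rewrite mxE !big_ord_recr big_ord0 /= !mxE /= add0r.
by congr (_ * w _ 0 + _ * w _ 0 + _ * w _ 0); apply: val_inj.
Qed.

Lemma tangent_spanning_inv X (A B : 'M[C]_3) : tangent_spanning X ->
  (forall v, tangent X v -> v *m A *m B = v) -> A *m B = 1%:M.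
Proof.
move=> sX AB; apply/eqP; rewrite -subr_eq0; apply/eqP/matrixP => i j.
have := sX (col j (A *m B - 1%:M)) _; move=> /(_ _)/matrixP/(_ i 0).
rewrite !mxE; apply=> v tv.
by rewrite colE mulmxA mulmxBr mulmxA AB // mulmx1 subrr mul0mx.
Qed.

(** Spanning makes the differential invertible. But all its values on tangent vectors lie in the
    plane x = 0 of [D4_tangent], so its first column is zero. *)
Lemma spanning_not_D4 X : tangent_spanning X -> ~ germ_iso X 0 (D4_germ C) 0.
Proof.
move=> sX /germ_iso_tangent[A [B AB]].
have AB1 : A *m B = 1%:M by apply: (tangent_spanning_inv sX) => v /AB[].
have A0 : col 0 A = 0.
  apply: sX => v /AB[/D4_tangent e _]; rewrite colE mulmxA -colE.
  by apply/matrixP => i j; rewrite !ord1 mxE e mxE.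
have /matrixP/(_ 0 0) := mulmx1C AB1.
rewrite !mxE big1 => [/eqP|i _]; first by rewrite eq_sym oner_eq0.
by move/matrixP/(_ i 0): A0; rewrite !mxE => ->; rewrite mulr0.
Qed.

Lemma cV3_eq0 (w : 'cV[C]_3) : w 0 0 = 0 -> w 1 0 = 0 -> w 2%:R 0 = 0 -> w = 0.
Proof.
move=> w0 w1 w2; apply/matrixP => i j; rewrite ord1 mxE.
by case: i => -[|[|[|//]]] lt; [rewrite -[RHS]w0|rewrite -[RHS]w1|rewrite -[RHS]w2];
   congr (w _ 0); apply: val_inj.
Qed.

Let s2 : 'i ^+ 2 = -1 :> C := sqrCi C.

Lemma double_eq0 (x : C) : x + x = 0 -> x = 0.
Proof. by move/eqP; rewrite -mulr2n mulrn_eq0 => /eqP. Qed.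

Lemma imag_mul_eq0 (x : C) : 'i * x = 0 -> x = 0.
Proof. by move/eqP; rewrite mulf_eq0 (negPf (neq0Ci C)) => /eqP. Qed.

Lemma A1_spanning : tangent_spanning (A_germ C 1).
Proof.
move=> w tw; have t x y z : x ^+ 2 + y ^+ 2 + z ^+ 2 = 0 ->
    x * w 0 0 + y * w 1 0 + z * w 2%:R 0 = 0.
  move=> e; rewrite -row3_mul tw ?mxE //; apply: A1_cone_tangent.
  by rewrite !row3E.
(* The isotropic vectors (1, i, 0), (1, -i, 0), (0, 1, i) form a basis. *)
have := t 1 'i 0; have := t 1 (- 'i) 0; have := t 0 1 'i.
rewrite !(expr1n, expr0n, sqrrN, s2, subrr, addr0, add0r, mul0r, mul1r) /=.
move=> /(_ erefl) e3 /(_ erefl) e2 /(_ erefl) e1.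
have w0 : w 0 0 = 0 by apply: double_eq0; apply: etrans (etrans (congr2 +%R e1 e2) (addr0 0)); ring.
move: e1; rewrite w0 add0r => /imag_mul_eq0 w1.
by move: e3; rewrite w1 add0r => /imag_mul_eq0 w2; apply: cV3_eq0.
Qed.

Lemma A2_spanning : tangent_spanning (A_germ C 2).
Proof.
move=> w tw; have t s b z : s ^+ 2 = -1 -> b != 0 ->
    s * b * w 0 0 + b * w 1 0 + z * w 2%:R 0 = 0.
  by move=> h h'; rewrite -row3_mul tw ?mxE //; apply: A2_plane_tangent.
have n0 := oner_neq0 C; have ns : (- 'i) ^+ 2 = -1 :> C by rewrite sqrrN.
(* The vectors (i, 1, 0), (-i, 1, 0), (i, 1, 1) form a basis. *)
have e1 := t _ _ 0 s2 n0; have e2 := t _ _ 0 ns n0; have e3 := t _ _ 1 s2 n0.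
have w1 : w 1 0 = 0.
  by apply: double_eq0; apply: etrans (etrans (congr2 +%R e1 e2) (addr0 0)); ring.
have w2 : w 2%:R 0 = 0 by apply: etrans (etrans (congr2 (fun x y => x - y) e3 e1) (subr0 0)); ring.
apply: cV3_eq0 => //; apply: imag_mul_eq0.
by rewrite w1 in e1; apply: etrans e1; ring.
Qed.

Lemma A1_not_D4 : ~ germ_iso (A_germ C 1) 0 (D4_germ C) 0.
Proof. exact/spanning_not_D4/A1_spanning. Qed.

Lemma A2_not_D4 : ~ germ_iso (A_germ C 2) 0 (D4_germ C) 0.
Proof. exact/spanning_not_D4/A2_spanning. Qed.

(* A nondegenerate quadratic form in three variables has no isotropic plane:
   the cross product n of two isotropic orthogonal vectors satisfies
   n x u = n x v = 0. *)
Lemma isotropic_plane (u v : U) :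
  u 0 0 ^+ 2 + u 0 1 ^+ 2 + u 0 2%:R ^+ 2 = 0 ->
  v 0 0 ^+ 2 + v 0 1 ^+ 2 + v 0 2%:R ^+ 2 = 0 ->
  u 0 0 * v 0 0 + u 0 1 * v 0 1 + u 0 2%:R * v 0 2%:R = 0 ->
  [/\ u 0 0 * v 0 1 = u 0 1 * v 0 0, u 0 0 * v 0 2%:R = u 0 2%:R * v 0 0 &
      u 0 1 * v 0 2%:R = u 0 2%:R * v 0 1].
Proof.
set a := u 0 0; set b := u 0 1; set c := u 0 2%:R.
set x := v 0 0; set y := v 0 1; set z := v 0 2%:R => uu vv uv.
have sq0 (t : C) : t ^+ 2 = 0 -> t = 0 by move/eqP; rewrite expf_eq0 => /eqP.
split; apply: subr0_eq; apply: (sq0).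
- transitivity ((a ^+ 2 + b ^+ 2 + c ^+ 2) * (x ^+ 2 + y ^+ 2) -
    (a * x + b * y + c * z) * (a * x + b * y - c * z)
    - c ^+ 2 * (x ^+ 2 + y ^+ 2 + z ^+ 2)); first ring.
  by rewrite uu vv uv !(mul0r, mulr0) !subr0.
- transitivity ((a ^+ 2 + b ^+ 2 + c ^+ 2) * (x ^+ 2 + z ^+ 2) -
    (a * x + b * y + c * z) * (a * x - b * y + c * z)
    - b ^+ 2 * (x ^+ 2 + y ^+ 2 + z ^+ 2)); first ring.
  by rewrite uu vv uv !(mul0r, mulr0) !subr0.
transitivity ((a ^+ 2 + b ^+ 2 + c ^+ 2) * (y ^+ 2 + z ^+ 2) -
    (a * x + b * y + c * z) * (- a * x + b * y + c * z)
    - a ^+ 2 * (x ^+ 2 + y ^+ 2 + z ^+ 2)); first ring.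
by rewrite uu vv uv !(mul0r, mulr0) !subr0.
Qed.

(** All (i, 1, z) are tangent to A_2. Their images under the invertible differential would be
    isotropic for x^2 + y^2 + z^2, and so would the whole plane they span, which a nondegenerate
    ternary form does not allow. *)
Lemma A2_not_A1 : ~ germ_iso (A_germ C 2) 0 (A_germ C 1) 0.
Proof.
move=> /germ_iso_tangent[A [B AB]].
have AB1 : A *m B = 1%:M by apply: (tangent_spanning_inv A2_spanning) => v /AB[].
have n0 := oner_neq0 C.
pose u := row3 'i 1 0 *m A; pose w := row3 0 0 1 *m A.
have q z : (u + z *: w) 0 0 ^+ 2 + (u + z *: w) 0 1 ^+ 2 + (u + z *: w) 0 2%:R ^+ 2 = 0.
  apply: A1_tangent; rewrite scalemxAl -mulmxDl.
  rewrite (_ : _ + _ = row3 ('i * 1) 1 z); first by case: (AB _ (A2_plane_tangent z s2 n0)).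
  by apply/rowP => -[[|[|[|//]]] lt]; rewrite !mxE /= !(mulr0, mulr1, addr0, add0r).
have uB : u *m B = row3 'i 1 0 by rewrite /u -mulmxA AB1 mulmx1.
have wB : w *m B = row3 0 0 1 by rewrite /w -mulmxA AB1 mulmx1.
clearbody u w.
(* Polarization from the values z = 0, 1, -1. *)
have : [/\ u 0 0 ^+ 2 + u 0 1 ^+ 2 + u 0 2%:R ^+ 2 = 0,
   w 0 0 ^+ 2 + w 0 1 ^+ 2 + w 0 2%:R ^+ 2 = 0 &
   u 0 0 * w 0 0 + u 0 1 * w 0 1 + u 0 2%:R * w 0 2%:R = 0].
  have E z : (u 0 0 + z * w 0 0) ^+ 2 + (u 0 1 + z * w 0 1) ^+ 2 +
      (u 0 2%:R + z * w 0 2%:R) ^+ 2 = 0.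
    by have := q z; rewrite ![(u + z *: w) _ _]mxE ![(z *: w) _ _]mxE.
  have E0 := E 0; have E1 := E 1; have Em := E (-1).
  have Q0 : u 0 0 ^+ 2 + u 0 1 ^+ 2 + u 0 2%:R ^+ 2 = 0 by apply: etrans E0; ring.
  split=> //; apply: double_eq0.
    transitivity ((u 0 0 + 1 * w 0 0) ^+ 2 + (u 0 1 + 1 * w 0 1) ^+ 2 +
      (u 0 2%:R + 1 * w 0 2%:R) ^+ 2 + ((u 0 0 + -1 * w 0 0) ^+ 2 + (u 0 1 + -1 * w 0 1) ^+ 2 +
      (u 0 2%:R + -1 * w 0 2%:R) ^+ 2) - (u 0 0 ^+ 2 + u 0 1 ^+ 2 + u 0 2%:R ^+ 2) *+ 2).
      ring.
    by rewrite E1 Em Q0 addr0 mul0rn subr0.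
  apply: double_eq0; apply: etrans (etrans (congr2 (fun x y => x - y) E1 Em) (subr0 0)).
  ring.
move=> [uu ww uw]; have [c1 c2 c3] := isotropic_plane uu ww uw.
have dep : forall j l, u 0 j * w 0 l = u 0 l * w 0 j.
  by apply: ord3P; apply: ord3P; rewrite ?c1 ?c2 ?c3.
have w0 l : w 0 l = 0.
  have : (w 0 l *: u - u 0 l *: w) *m B = w 0 l *: row3 'i 1 0 - u 0 l *: row3 0 0 1.
    by rewrite mulmxBl -!scalemxAl uB wB.
  rewrite (_ : _ - _ = 0) ?mul0mx; last first.
    by apply/rowP => j; rewrite !mxE mulrC dep subrr.
  by move=> /rowP/(_ 1); rewrite !mxE /= mulr1 mulr0 subr0.
move: wB; rewrite (_ : w = 0) ?mul0mx; last by apply/rowP => l; rewrite w0 mxE.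
by move=> /rowP/(_ 2%:R)/eqP; rewrite !mxE /= eq_sym oner_eq0.
Qed.

End DistinctTypes.

(** * Deciding polynomial identities with integer coefficients by computation *)

Section PolynomialReflection.
Local Open Scope ring_scope.

(** Binary integers keep the coefficients computable, while [zr] interprets them in any ring. *)
Definition zr (A : pzRingType) (z : Z) : A := (int_of_Z z)%:~R.

Lemma zrD (A : pzRingType) x y : zr A (Z.add x y) = zr A x + zr A y.
Proof. by rewrite /zr (rmorphD int_of_Z x y) rmorphD. Qed.

Lemma zrM (A : pzRingType) x y : zr A (Z.mul x y) = zr A x * zr A y.
Proof. by rewrite /zr (rmorphM int_of_Z x y) rmorphM. Qed.

Lemma zr0 (A : pzRingType) : zr A Z0 = 0. Proof. by []. Qed.
Lemma zr1 (A : pzRingType) : zr A (Zpos xH) = 1. Proof. by []. Qed.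

Lemma zrN (A : pzRingType) x : zr A (Z.opp x) = - zr A x.
Proof. by rewrite /zr (rmorphN int_of_Z x) rmorphN. Qed.

Lemma zr_nat (A : pzRingType) n : zr A (Z.of_nat n) = n%:R.
Proof.
elim: n => [|n IH] //.
by rewrite Nat2Z.inj_succ -Z.add_1_r zrD IH zr1 -natr1.
Qed.

Lemma zr_neq0 (F : numDomainType) z : Z.eqb z 0 = false -> zr F z != 0.
Proof.
move=> h; rewrite /zr intr_eq0; apply/eqP => /(congr1 Z_of_int).
by rewrite int_of_ZK /= => e; move: h; rewrite e.
Qed.

Lemma rmorph_zr (A B : pzRingType) (f : {rmorphism A -> B}) z : f (zr A z) = zr B z.
Proof. by rewrite /zr rmorph_int. Qed.

(* Dense recursive polynomials in n variables, the last variable outermost. *)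
Fixpoint nested n : Type := if n is n'.+1 then seq (nested n') else Z.

Fixpoint nadd n : nested n -> nested n -> nested n :=
  match n return nested n -> nested n -> nested n with
  | 0 => Z.add
  | n'.+1 => fix addl (p q : seq (nested n')) := match p, q with
             | [::], _ => q
             | _, [::] => p
             | a :: p', b :: q' => @nadd n' a b :: addl p' q'
             end
  end.

Fixpoint nzero n : nested n := if n is n'.+1 then [::] else Z0.

Fixpoint nmul n : nested n -> nested n -> nested n :=
  match n return nested n -> nested n -> nested n with
  | 0 => Z.mul
  | n'.+1 => fix mull (p q : seq (nested n')) := if p is a :: p'
      then @nadd n'.+1 (map (@nmul n' a) q) (nzero n' :: mull p' q) else [::]
  end.

Fixpoint nconst n (z : Z) : nested n := if n is n'.+1 then [:: nconst n' z] else z.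

Fixpoint nvar n i : nested n :=
  if n is n'.+1 then if i == n' then [:: nzero n'; nconst n' 1] else [:: nvar n' i]
  else Z0.

Fixpoint niszero n : nested n -> bool :=
  match n return nested n -> bool with
  | 0 => fun z => Z.eqb z 0
  | n'.+1 => all (@niszero n')
  end.

(** On this syntax differentiation and substitution are programs, and one computation proves an
    identity in every commutative ring. *)
Inductive pexpr := PC of Z | PV of nat | PA of pexpr & pexpr | PM of pexpr & pexpr
  | PP of pexpr & nat.

Fixpoint npow n (p : nested n) k := if k is k'.+1 then nmul p (npow p k') else nconst n 1.

Fixpoint norm n (e : pexpr) : nested n := match e with
  | PC z => nconst n z
  | PV i => nvar n i
  | PA e1 e2 => nadd (norm n e1) (norm n e2)
  | PM e1 e2 => nmul (norm n e1) (norm n e2)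
  | PP e k => npow (norm n e) k
  end.

Fixpoint zeval (env : nat -> Z) (e : pexpr) : Z := match e with
  | PC z => z
  | PV i => env i
  | PA e1 e2 => Z.add (zeval env e1) (zeval env e2)
  | PM e1 e2 => Z.mul (zeval env e1) (zeval env e2)
  | PP e k => iter k (Z.mul (zeval env e)) Z.one
  end.

Fixpoint pderiv i (e : pexpr) : pexpr := match e with
  | PC z => PC 0
  | PV j => PC (if i == j then 1 else 0)
  | PA e1 e2 => PA (pderiv i e1) (pderiv i e2)
  | PM e1 e2 => PA (PM (pderiv i e1) e2) (PM e1 (pderiv i e2))
  | PP e k => PM (PM (PC (Z.of_nat k)) (PP e k.-1)) (pderiv i e)
  end.

Fixpoint psubst (s : nat -> pexpr) (e : pexpr) : pexpr := match e with
  | PC z => PC z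
  | PV j => s j
  | PA e1 e2 => PA (psubst s e1) (psubst s e2)
  | PM e1 e2 => PM (psubst s e1) (psubst s e2)
  | PP e k => PP (psubst s e) k
  end.

Definition psub e1 e2 := PA e1 (PM (PC (-1)) e2).

Section Eval.
Variables (A : comPzRingType).

Fixpoint peval (env : nat -> A) (e : pexpr) : A := match e with
  | PC z => zr A z
  | PV i => env i
  | PA e1 e2 => peval env e1 + peval env e2
  | PM e1 e2 => peval env e1 * peval env e2
  | PP e k => peval env e ^+ k
  end.

Fixpoint neval n (env : nat -> A) : nested n -> A :=
  match n return nested n -> A with
  | 0 => zr A
  | n'.+1 => foldr (fun a acc => neval env (a : nested n') + env n' * acc) 0
  end.

Lemma neval_zero n env : neval env (nzero n) = 0. Proof. by case: n. Qed.

Lemma neval_add n env (p q : nested n) : neval env (nadd p q) = neval env p + neval env q.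
Proof.
elim: n p q => [|n IH] /=; first exact: zrD.
elim=> [|a p IHp] [|b q] /=; rewrite ?add0r ?addr0 //.
by rewrite IH IHp mulrDr addrACA.
Qed.

Lemma neval_const n env z : neval env (nconst n z) = zr A z.
Proof. by elim: n => //= n ->; rewrite mulr0 addr0. Qed.

Lemma neval_mul n env (p q : nested n) : neval env (nmul p q) = neval env p * neval env q.
Proof.
elim: n p q => [|n IH]; first exact: zrM.
elim=> [|a p IHp] q; first by rewrite mul0r.
have -> : @nmul n.+1 (a :: p) q =
    @nadd n.+1 (map (@nmul n a) q) (nzero n :: @nmul n.+1 p q) by [].
have cons0 : neval env (nzero n :: @nmul n.+1 p q : nested n.+1) =
    env n * @neval n.+1 env (@nmul n.+1 p q) by rewrite /= neval_zero add0r.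
rewrite neval_add cons0 IHp /=.
rewrite mulrDl -mulrA; congr (_ + _).
by elim: q {IHp cons0} => [|b q IHq] /=; rewrite ?mulr0 // IH IHq mulrDr mulrCA.
Qed.

Lemma neval_pow n env (p : nested n) k : neval env (npow p k) = neval env p ^+ k.
Proof.
elim: k => [|k IH] /=; first by rewrite neval_const.
by rewrite neval_mul IH exprS.
Qed.

Lemma neval_var n env i : (i < n)%N -> neval env (nvar n i) = env i.
Proof.
elim: n => // n IH; rewrite ltnS leq_eqVlt /=; case: eqP => [-> _|_ /= lt].
  by rewrite /= neval_zero neval_const mulr0 addr0 mulr1 add0r.
by rewrite /= IH // mulr0 addr0.
Qed.

Lemma neval_iszero n env (p : nested n) : niszero p -> neval env p = 0.
Proof.
elim: n p => [|n IH] /=; first by move=> z /Z.eqb_eq ->.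
by elim=> //= a p IHp /andP[/IH-> /IHp->]; rewrite mulr0 addr0.
Qed.

Fixpoint pvars n (e : pexpr) : bool := match e with
  | PC z => true
  | PV j => (j < n)%N
  | PA e1 e2 => pvars n e1 && pvars n e2
  | PM e1 e2 => pvars n e1 && pvars n e2
  | PP e k => pvars n e
  end.

Lemma neval_norm n env e : pvars n e -> neval env (norm n e) = peval env e.
Proof.
elim: e => [z|i|e1 I1 e2 I2|e1 I1 e2 I2|e I k] /=.
- by rewrite neval_const.
- exact: neval_var.
- by move=> /andP[/I1 <- /I2 <-]; rewrite neval_add.
- by move=> /andP[/I1 <- /I2 <-]; rewrite neval_mul.
by move=> /I <-; rewrite neval_pow.
Qed.

(** The test [pvars n] is part of the check because [nvar n i] is zero for i >= n. *)
Definition peq n e1 e2 := pvars n (psub e1 e2) && niszero (norm n (psub e1 e2)).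

Lemma peqP n env e1 e2 : peq n e1 e2 -> peval env e1 = peval env e2.
Proof.
move=> /andP[pv /(neval_iszero env)]; rewrite neval_norm //= (zrN _ (Zpos xH)) zr1 mulN1r.
exact: subr0_eq.
Qed.

Lemma peval_zeval (f : nat -> Z) e : peval (fun i => zr A (f i)) e = zr A (zeval f e).
Proof.
elim: e => //= [e1 -> e2 ->|e1 -> e2 ->|e -> k]; rewrite ?zrD ?zrM //.
by elim: k => [|k IH] //=; rewrite zrM exprS IH.
Qed.

Lemma peval_subst env s e : peval env (psubst s e) = peval (fun i => peval env (s i)) e.
Proof. by elim: e => //= [e1 -> e2 ->|e1 -> e2 ->|e -> k]. Qed.

Lemma eq_peval env env' e : env =1 env' -> peval env e = peval env' e.
Proof. by move=> h; elim: e => //= [e1 -> e2 ->|e1 -> e2 ->|e -> k]. Qed.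

End Eval.

Lemma rmorph_peval (A B : comPzRingType) (f : {rmorphism A -> B}) env e :
  f (peval env e) = peval (f \o env) e.
Proof.
elim: e => /= [z|i|e1 <- e2 <-|e1 <- e2 <-|e <- k]; rewrite ?rmorphD ?rmorphM ?rmorphXn //.
exact: rmorph_zr.
Qed.

Definition Xvar n (R : comNzRingType) (i : nat) : mpoly n.+1 R := mpolyX R (mnm1 (inord i)).

Definition peM n (R : comNzRingType) (e : pexpr) : mpoly n.+1 R := peval (@Xvar n R) e.

Lemma meval_peM n (R : comNzRingType) (x : 'I_n.+1 -> R) e :
  meval x (peM n R e) = peval (fun i => x (inord i)) e.
Proof.
rewrite /peM (rmorph_peval (meval x)); apply: eq_peval => i /=.
by rewrite /Xvar mevalXU.
Qed.

Local Arguments Z.of_nat : simpl never.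

Lemma mderiv_peM n (R : comNzRingType) (i : nat) e : pvars n.+1 e -> (i <= n)%N ->
  mderiv (inord i) (peM n R e) = peM n R (pderiv i e).
Proof.
move=> pv lt_in; rewrite /peM; elim: e pv => /= [z|j|e1 I1 e2 I2|e1 I1 e2 I2|e I k].
- move=> _; rewrite (_ : zr _ z = mpolyC n.+1 (zr R z)) ?mderivC //.
  by rewrite (rmorph_zr (@mpolyC n.+1 R)).
- move=> lt_j; rewrite /Xvar mderivX mnm1E -val_eqE /= !inordK //.
  rewrite eq_sym; case: eqP => [->|_]; rewrite ?scale0r //.
  by rewrite scale1r zr1 -mpolyX0; congr (mpolyX _ _); apply/mnmP => k; rewrite !mnmE subnn.
- by move=> /andP[/I1 e1E /I2 e2E]; rewrite mderivD e1E e2E.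
- by move=> /andP[/I1 e1E /I2 e2E]; rewrite mderivM e1E e2E.
move=> /I eE; elim: k => [|k IH] /=.
  by rewrite expr0 zr_nat !mul0r -mpolyC1 mderivC.
rewrite exprS mderivM eE IH !zr_nat; case: k {IH} => [|k] /=.
  by rewrite !expr0 mulr0n !mul0r mulr0 addr0 !mulr1 mul1r.
by rewrite exprS -[k.+2%:R]natr1; ring.
Qed.

End PolynomialReflection.

(** * The orbits of monomials under W_1 and the octic as an expression *)

Section Octic.
Local Open Scope ring_scope.
Local Open Scope classical_set_scope.
Variable C : numClosedFieldType.
Local Notation X i := (@Xvar 3 C i).

(** Generators of W_1 map signed monomials to signed monomials, so orbits are computed on a sign,
    [true] for minus, together with four exponents. *)
Definition signed_exponents := (bool * (nat * nat * nat * nat))%type.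
Implicit Type t : signed_exponents.

Definition act1 t : signed_exponents :=
  let: (s, (a, b, c, d)) := t in (s (+) odd d, (b, a, c, d)).
Definition act2 t : signed_exponents :=
  let: (s, (a, b, c, d)) := t in (s (+) odd d, (a, c, b, d)).
Definition act3 t : signed_exponents :=
  let: (s, (a, b, c, d)) := t in (s (+) odd a, (a, b, d, c)).

Definition signed_monomial (A : comNzRingType) (x y z w : A) t : A :=
  let: (s, (a, b, c, d)) := t in (-1) ^+ s * (x ^+ a * y ^+ b * z ^+ c * w ^+ d).

Section SignedMonomial.
Variables (A : comNzRingType) (x y z w : A).

Lemma signed_monomial_act1 t :
  signed_monomial y x z (- w) t = signed_monomial x y z w (act1 t).
Proof.
case: t => s [[[a b] c] d] /=.
by rewrite [(- w) ^+ d]exprNn signr_addb signr_odd; ring.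
Qed.

Lemma signed_monomial_act2 t :
  signed_monomial x z y (- w) t = signed_monomial x y z w (act2 t).
Proof.
case: t => s [[[a b] c] d] /=.
by rewrite [(- w) ^+ d]exprNn signr_addb signr_odd; ring.
Qed.

Lemma signed_monomial_act3 t :
  signed_monomial (- x) y w z t = signed_monomial x y z w (act3 t).
Proof.
case: t => s [[[a b] c] d] /=.
by rewrite [(- x) ^+ a]exprNn signr_addb signr_odd; ring.
Qed.

End SignedMonomial.

Lemma rmorph_signed_monomial (A B : comNzRingType) (f : {rmorphism A -> B}) x y z w t :
  f (signed_monomial x y z w t) = signed_monomial (f x) (f y) (f z) (f w) t.
Proof.
by case: t => s [[[a b] c] d] /=; rewrite !rmorphM rmorph_sign !rmorphXn.
Qed.

Definition smono t : poly4 C := signed_monomial (X 0) (X 1) (X 2) (X 3) t.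

Lemma inord4 (i : 'I_4) : inord (i : nat) = i. Proof. exact: inord_val. Qed.

Lemma sum4 (V : zmodType) (F : 'I_4 -> V) :
  \sum_(j < 4) F j = F (inord 0) + F (inord 1) + F (inord 2) + F (inord 3).
Proof.
rewrite !big_ord_recr big_ord0 /= add0r.
by congr (F _ + F _ + F _ + F _); apply: val_inj; rewrite /= inordK.
Qed.

Lemma prod4 (V : comNzRingType) (F : 'I_4 -> V) :
  \prod_(j < 4) F j = F (inord 0) * F (inord 1) * F (inord 2) * F (inord 3).
Proof.
rewrite !big_ord_recr big_ord0 /= mul1r.
by congr (F _ * F _ * F _ * F _); apply: val_inj; rewrite /= inordK.
Qed.

Lemma monomialE a b c d : monomial C a b c d = smono (false, (a, b, c, d)).
Proof.
rewrite /monomial /smono /signed_monomial expr0 mul1r mpolyXE_id prod4 !multinomE !(tnth_nth 0%N) /=.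
by rewrite !inordK.
Qed.

Lemma mx_substM A (f g : poly4 C) : mx_subst A (f * g) = mx_subst A f * mx_subst A g.
Proof. exact: rmorphM. Qed.

Lemma mx_subst_var A (i : nat) : (i < 4)%N ->
  mx_subst A (X i) = \sum_(j < 4) A (inord i) j *: X j.
Proof.
move=> lt_i; rewrite /mx_subst /Xvar comp_mpolyXU -tnth_nth tnth_mktuple.
by apply: eq_bigr => j _; rewrite inord4.
Qed.

Lemma mx_subst_perm r (i j : nat) e : (i < 4)%N -> (j < 4)%N ->
  nth [::] r i = mkseq (fun k => if k == j then e else 0) 4 ->
  mx_subst (mat4 r) (X i) = e *: X j.
Proof.
move=> lt_i lt_j ri; rewrite mx_subst_var // (bigD1 (inord j)) //= inordK //.
rewrite mxE !inordK // ri nth_mkseq // eqxx big1 ?addr0 // => k kj.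
rewrite mxE (inordK lt_i) ri nth_mkseq //; case: eqP => [ki|_]; last exact: scale0r.
by case/eqP: kj; rewrite -ki inord4.
Qed.

Lemma mx_subst_smono A t : mx_subst A (smono t) =
  signed_monomial (mx_subst A (X 0)) (mx_subst A (X 1)) (mx_subst A (X 2)) (mx_subst A (X 3)) t.
Proof. exact: rmorph_signed_monomial. Qed.

Lemma mx_subst_act1 t : mx_subst (s1 C) (smono t) = smono (act1 t).
Proof.
rewrite mx_subst_smono.
rewrite (_ : mx_subst (s1 C) (X 0) = 1 *: X 1); last exact: mx_subst_perm.
rewrite scale1r.
rewrite (_ : mx_subst (s1 C) (X 1) = 1 *: X 0); last exact: mx_subst_perm.
rewrite scale1r.
rewrite (_ : mx_subst (s1 C) (X 2) = 1 *: X 2); last exact: mx_subst_perm.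
rewrite scale1r.
rewrite (_ : mx_subst (s1 C) (X 3) = -1 *: X 3); last exact: mx_subst_perm.
rewrite scaleN1r.
exact: signed_monomial_act1.
Qed.

Lemma mx_subst_act2 t : mx_subst (s2 C) (smono t) = smono (act2 t).
Proof.
rewrite mx_subst_smono.
rewrite (_ : mx_subst (s2 C) (X 0) = 1 *: X 0); last exact: mx_subst_perm.
rewrite scale1r.
rewrite (_ : mx_subst (s2 C) (X 1) = 1 *: X 2); last exact: mx_subst_perm.
rewrite scale1r.
rewrite (_ : mx_subst (s2 C) (X 2) = 1 *: X 1); last exact: mx_subst_perm.
rewrite scale1r.
rewrite (_ : mx_subst (s2 C) (X 3) = -1 *: X 3); last exact: mx_subst_perm.
rewrite scaleN1r.
exact: signed_monomial_act2.
Qed.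

Lemma mx_subst_act3 t : mx_subst (s3 C) (smono t) = smono (act3 t).
Proof.
rewrite mx_subst_smono.
rewrite (_ : mx_subst (s3 C) (X 0) = -1 *: X 0); last exact: mx_subst_perm.
rewrite scaleN1r.
rewrite (_ : mx_subst (s3 C) (X 1) = 1 *: X 1); last exact: mx_subst_perm.
rewrite scale1r.
rewrite (_ : mx_subst (s3 C) (X 2) = 1 *: X 3); last exact: mx_subst_perm.
rewrite scale1r.
rewrite (_ : mx_subst (s3 C) (X 3) = 1 *: X 2); last exact: mx_subst_perm.
rewrite scale1r.
exact: signed_monomial_act3.
Qed.

Lemma mx_subst_comp A B (f : poly4 C) : mx_subst B (mx_subst A f) = mx_subst (A *m B) f.
Proof.
elim/mpoly_ring_ind: f => [c|i|p q ep eq|p q ep eq].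
- by rewrite /mx_subst !comp_mpolyC.
- rewrite -(inord4 i) -!/(X _) !mx_subst_var ?ltn_ord //.
  rewrite /mx_subst raddf_sum /= (eq_bigr (fun j => A (inord i) j *: \sum_(k < 4) B j k *: X k)).
    rewrite (eq_bigr (fun j => \sum_k (A (inord i) j * B j k) *: X k)) => [|j _].
      rewrite exchange_big /=; apply: eq_bigr => k _.
      by rewrite mxE scaler_suml.
    by rewrite scaler_sumr; apply: eq_bigr => k _; rewrite scalerA.
  move=> j _; rewrite comp_mpolyZ; congr (_ *: _).
  by have := mx_subst_var B (ltn_ord j); rewrite inord4.
- by rewrite /mx_subst !raddfD /= -!/(mx_subst _ _) ep eq.
by rewrite !mx_substM ep eq.
Qed.

Lemma mx_subst1 (f : poly4 C) : mx_subst 1%:M f = f.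
Proof.
rewrite /mx_subst -[RHS]comp_mpoly_id; congr comp_mpoly.
apply: eq_from_tnth => i; rewrite !tnth_mktuple (bigD1 i) //= mxE eqxx scale1r.
rewrite big1 ?addr0 // => j ji; by rewrite mxE eq_sym (negPf ji) scale0r.
Qed.

Lemma signed_permutation_involution (A : 'M[C]_4) : (forall i : 'I_4, mx_subst A (mx_subst A (X i)) = X i) ->
  A *m A = 1%:M.
Proof.
move=> AA; apply/matrixP => i j.
have e : \sum_(k < 4) (A *m A) i k *: X k = X i.
  by rewrite -(AA i) mx_subst_comp mx_subst_var ?ltn_ord // inord4.
have := congr1 (mcoeff (mnm1 j)) e; rewrite raddf_sum (bigD1 j) //= mcoeffZ.
rewrite /Xvar !mcoeffXU inord4 eqxx mulr1 big1 ?addr0 => [->|k kj].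
  by rewrite mxE inord4 eq_sym.
by rewrite mcoeffZ mcoeffXU inord4 (negPf kj) mulr0.
Qed.

Lemma Xvar_smono (k : 'I_4) : X k = smono (false, ((k == 0 :> nat) : nat, (k == 1 :> nat) : nat,
    (k == 2 :> nat) : nat, (k == 3 :> nat) : nat))%N.
Proof.
by case: k => -[|[|[|[|//]]]] ? /=; rewrite /smono /= ?expr0 ?expr1 ?mul1r ?mulr1.
Qed.

Lemma s1_involution : s1 C *m s1 C = 1%:M.
Proof.
apply: signed_permutation_involution => i; rewrite Xvar_smono !mx_subst_act1 /=.
by rewrite addbb.
Qed.

Lemma s2_involution : s2 C *m s2 C = 1%:M.
Proof.
apply: signed_permutation_involution => i; rewrite Xvar_smono !mx_subst_act2 /=.
by rewrite addbb.
Qed.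

Lemma s3_involution : s3 C *m s3 C = 1%:M.
Proof.
apply: signed_permutation_involution => i; rewrite Xvar_smono !mx_subst_act3 /=.
by rewrite addbb.
Qed.

Lemma W1_unit (A : 'M[C]_4) : W1 A -> A \in unitmx.
Proof.
elim=> [||||B D _ uB _ uD|B _ uB].
- by have [] := mulmx1_unit s1_involution.
- by have [] := mulmx1_unit s2_involution.
- by have [] := mulmx1_unit s3_involution.
- exact: unitmx1.
- by rewrite unitmx_mul uB.
by rewrite unitmx_inv.
Qed.

Definition orbit_step (L : seq signed_exponents) :=
  undup (L ++ map act1 L ++ map act2 L ++ map act3 L).

(** That eight rounds close the orbit is not assumed but verified by [orbit_ok]. *)
Definition orbit e := iter 8 orbit_step [:: (false, e) : signed_exponents].

Arguments orbit : simpl never.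

(** The second condition says that no monomial occurs with both signs; it makes distinct list
    entries distinct polynomials. *)
Definition orbit_ok (L : seq signed_exponents) :=
  all (fun t => [&& act1 t \in L, act2 t \in L & act3 t \in L]) L && uniq (map snd L).

Lemma orbit_sub a b c d t : t \in orbit (a, b, c, d) -> @Omega_minus C a b c d (smono t).
Proof.
have gen A : W1 A -> forall f, @Omega_minus C a b c d f -> @Omega_minus C a b c d (mx_subst A f).
  by move=> wA f [B wB <-]; exists (B *m A); [exact: W1_mul|rewrite -mx_subst_comp].
have base : forall t, t \in [:: (false, (a, b, c, d)) : signed_exponents] ->
    @Omega_minus C a b c d (smono t).
  move=> u; rewrite inE => /eqP ->; exists 1%:M; first exact: W1_one.
  by rewrite mx_subst1 monomialE.
rewrite /orbit; elim: 8%N t => [|n IH] t; [exact: base|rewrite iterS].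
rewrite /orbit_step mem_undup !mem_cat => /or4P[/IH//|/mapP[u /IH h ->]|/mapP[u /IH h ->]|/mapP[u /IH h ->]].
- by rewrite -mx_subst_act1; apply: gen => //; exact: W1_s1.
- by rewrite -mx_subst_act2; apply: gen => //; exact: W1_s2.
by rewrite -mx_subst_act3; apply: gen => //; exact: W1_s3.
Qed.

Lemma orbit_start e : (false, e) \in orbit e.
Proof. by rewrite /orbit; elim: 8%N => [|n IH]; rewrite ?inE // iterS /orbit_step mem_undup mem_cat IH. Qed.

(** Stability of the list is stated as an equivalence for each B, since this form passes to products
    and inverses. For the generators the converse holds because they are involutions. *)
Lemma Omega_minus_closed a b c d L : (false, (a, b, c, d)) \in L ->
  (forall t, t \in L -> @Omega_minus C a b c d (smono t)) ->
  (forall t, t \in L -> [&& act1 t \in L, act2 t \in L & act3 t \in L]) ->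
  forall f, @Omega_minus C a b c d f <-> f \in map smono L.
Proof.
move=> startL subL clL f; split=> [[A wA <-]|/mapP[t tL ->]]; last exact: subL.
pose P h := exists2 t, t \in L & h = smono t.
suff stable : forall B, W1 B -> forall h, P h <-> P (mx_subst B h).
  have /(stable A wA)[t tL ->] : P (monomial C a b c d).
    by exists (false, (a, b, c, d)); [exact: startL|exact: monomialE].
  exact: map_f.
have invol B (act : signed_exponents -> signed_exponents) : B *m B = 1%:M ->
    (forall t, mx_subst B (smono t) = smono (act t)) ->
    (forall t, t \in L -> act t \in L) ->
    forall h, P h <-> P (mx_subst B h).
  move=> BB Bact clact h; split=> [[t tL ->]|[t tL e]].
    by exists (act t); [exact: clact|exact: Bact].
  exists (act t); first exact: clact.
  by rewrite -Bact -e mx_subst_comp BB mx_subst1.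
move=> B; elim=> [||||B1 B2 _ I1 _ I2|B1 wB1 I1] h.
- by apply: (invol _ act1 s1_involution mx_subst_act1) => t /clL/and3P[].
- by apply: (invol _ act2 s2_involution mx_subst_act2) => t /clL/and3P[].
- by apply: (invol _ act3 s3_involution mx_subst_act3) => t /clL/and3P[].
- by rewrite mx_subst1.
- by rewrite -mx_subst_comp -I2 -I1.
by rewrite (I1 (mx_subst (invmx B1) h)) mx_subst_comp mulVmx ?mx_subst1 // W1_unit.
Qed.

Lemma smono_inj (L : seq signed_exponents) : uniq (map snd L) -> {in L &, injective smono}.
Proof.
move=> uL t u tL uL' e.
have exE (v : signed_exponents) m : mcoeff m (smono v) != 0 ->
    m = Multinom [tuple of [:: v.2.1.1.1; v.2.1.1.2; v.2.1.2; v.2.2]].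
  case: v => s [[[a b] c] d].
  have -> : smono (s, (a, b, c, d)) = (-1) ^+ s *: monomial C a b c d.
    rewrite monomialE /= mul1r -mul_mpolyC; congr (_ * _).
    by rewrite rmorph_sign.
  rewrite mcoeffZ mcoeffX; have [<- //|_] := eqVneq (Multinom [tuple of [:: a; b; c; d]]) m.
  by rewrite mulr0 eqxx.
have nz (v : signed_exponents) : exists m, mcoeff m (smono v) != 0.
  case: v => s [[[a b] c] d]; exists (Multinom [tuple of [:: a; b; c; d]]).
  have -> : smono (s, (a, b, c, d)) = (-1) ^+ s *: monomial C a b c d.
    rewrite monomialE /= mul1r -mul_mpolyC; congr (_ * _).
    by rewrite rmorph_sign.
  by rewrite mcoeffZ mcoeffX eqxx mulr1 signr_eq0.
have [m mt] := nz t; have mu := mt; rewrite e in mu.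
have := etrans (esym (exE _ _ mt)) (exE _ _ mu).
move=> /(congr1 (fun m : multinom 4 => tval (multinom_val m))) /= [e1 e2 e3 e4].
apply: (can_inj (g := fun x => x) (fun _ => erefl _)).
have tu : t.2 = u.2.
  by case: t u {tL uL' e mt mu} e1 e2 e3 e4 => [? [[[? ?] ?] ?]] [? [[[? ?] ?] ?]] /= -> -> -> ->.
move: tu; have := uL => /(nth_uniq t.2).
have it := tL; have iu := uL'; rewrite -index_mem in it; rewrite -index_mem in iu.
move=> /(_ (index t L) (index u L)); rewrite size_map => /(_ it iu).
rewrite !(nth_map t) // !nth_index // => h /eqP; rewrite h => /eqP eI.
by rewrite -(nth_index t tL) -(nth_index t uL') eI.
Qed.

Lemma m_minusE a b c d : orbit_ok (orbit (a, b, c, d)) ->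
  m_minus C a b c d = \sum_(t <- orbit (a, b, c, d)) smono t.
Proof.
rewrite /orbit_ok => /andP[/allP cl u]; have := Omega_minus_closed (orbit_start _) (@orbit_sub a b c d) cl.
move: (orbit _) u {cl} => L u OL; rewrite /m_minus.
rewrite (_ : Omega_minus _ _ _ _ = [set` map smono L]); last by apply/seteqP; split=> f /OL.
rewrite -fsbig_seq ?big_map // map_inj_in_uniq; last exact: smono_inj.
exact: map_uniq u.
Qed.

Definition term_expr (z : Z) t : pexpr :=
  let: (s, (a, b, c, d)) := t in
  PM (PC (if s then Z.opp z else z))
     (PM (PM (PM (PP (PV 0) a) (PP (PV 1) b)) (PP (PV 2) c)) (PP (PV 3) d)).

Definition octic_data : seq (Z * (nat * nat * nat * nat)) :=
  [:: (Z.opp (-1), (8, 0, 0, 0)); (Z.opp 6, (6, 2, 0, 0)); (Z.opp 60, (6, 1, 1, 0));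
      (Z.opp (-2240), (5, 2, 1, 0)); (Z.opp 14, (4, 4, 0, 0)); (Z.opp (-10180), (4, 3, 1, 0));
      (Z.opp (-40412), (4, 2, 2, 0)); (Z.opp 23440, (4, 2, 1, 1));
      (Z.opp (-111980), (3, 3, 2, 0)); (Z.opp (-154704), (2, 2, 2, 2))]%N.

Definition octic_terms : seq (Z * signed_exponents) :=
  flatten [seq [seq (p.1, t) | t <- orbit p.2] | p <- octic_data].

Definition octic_expr : pexpr :=
  foldr (fun zt e => PA (term_expr zt.1 zt.2) e) (PC 0) octic_terms.

Lemma peval_term_expr (A : comNzRingType) (env : nat -> A) z t : peval env (term_expr z t) =
  zr A z * signed_monomial (env 0) (env 1) (env 2) (env 3) t.
Proof.
case: t => s [[[a b] c] d] /=; case: s; last by rewrite expr0 mul1r.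
by rewrite zrN expr1 mulN1r mulrN mulNr.
Qed.

Lemma term_exprE z t : peM 3 C (term_expr z t) = zr (mpoly 4 C) z * smono t.
Proof. exact: peval_term_expr. Qed.

Lemma octic_orbits_ok : all (fun p => orbit_ok (orbit p.2)) octic_data.
Proof. by vm_compute. Qed.

Lemma peM_octic_expr : peM 3 C octic_expr =
  \sum_(p <- octic_data) zr (mpoly 4 C) p.1 *
    m_minus C p.2.1.1.1 p.2.1.1.2 p.2.1.2 p.2.2.
Proof.
rewrite /octic_expr; transitivity (\sum_(zt <- octic_terms) peM 3 C (term_expr zt.1 zt.2)).
  by elim: octic_terms => [|zt l IH]; [rewrite big_nil|rewrite big_cons -IH].
rewrite /octic_terms big_flatten big_map !big_seq; apply: eq_bigr => -[z [[[a b] c] d]] pin.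
rewrite big_map m_minusE; last exact: (allP octic_orbits_ok _ pin).
by rewrite mulr_sumr; apply: eq_bigr => t _; rewrite term_exprE.
Qed.

Lemma sum_list10 (V : nmodType) I (F : I -> V) x0 x1 x2 x3 x4 x5 x6 x7 x8 x9 y0 y1 y2 y3 y4 y5 y6 y7 y8 y9 :
  F x0 = y0 -> F x1 = y1 -> F x2 = y2 -> F x3 = y3 -> F x4 = y4 -> F x5 = y5 -> F x6 = y6 -> F x7 = y7 -> F x8 = y8 -> F x9 = y9 ->
  y0 + y1 + y2 + y3 + y4 + y5 + y6 + y7 + y8 + y9 = \sum_(x <- [:: x0; x1; x2; x3; x4; x5; x6; x7; x8; x9]) F x.
Proof. by do 10![move=> <-]; rewrite !big_cons big_nil addr0 !addrA. Qed.

(* Large numerals are Nat.of_num_uint terms, whose unary value must not be computed. *)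
Fixpoint zdec (d : Decimal.uint) (z : Z) : Z := match d with
  | Decimal.Nil => z
  | Decimal.D0 d => zdec d (Z.add 0 (Z.mul 10 z))
  | Decimal.D1 d => zdec d (Z.add 1 (Z.mul 10 z))
  | Decimal.D2 d => zdec d (Z.add 2 (Z.mul 10 z))
  | Decimal.D3 d => zdec d (Z.add 3 (Z.mul 10 z))
  | Decimal.D4 d => zdec d (Z.add 4 (Z.mul 10 z))
  | Decimal.D5 d => zdec d (Z.add 5 (Z.mul 10 z))
  | Decimal.D6 d => zdec d (Z.add 6 (Z.mul 10 z))
  | Decimal.D7 d => zdec d (Z.add 7 (Z.mul 10 z))
  | Decimal.D8 d => zdec d (Z.add 8 (Z.mul 10 z))
  | Decimal.D9 d => zdec d (Z.add 9 (Z.mul 10 z))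
  end.

Lemma natr_decimal (A : pzRingType) d :
  (Init.Nat.of_num_uint (Number.UIntDecimal d))%:R = zr A (zdec d 0).
Proof.
have acc : forall d n, Z.of_nat (Nat.of_uint_acc d n) = zdec d (Z.of_nat n).
  elim=> [n|d' IH n|d' IH n|d' IH n|d' IH n|d' IH n|d' IH n|d' IH n|d' IH n|d' IH n|d' IH n] //;
    (apply: etrans (IH _) _; congr zdec; rewrite Nat.tail_mul_spec; clear; lia).
by rewrite -zr_nat /= /Nat.of_uint acc.
Qed.

Lemma octicE : octic C = peM 3 C octic_expr.
Proof.
have natE (f : poly4 C) n : zr (mpoly 4 C) (Z.of_nat n) * f = n%:R *: f.
  by rewrite zr_nat -mul_mpolyC rmorph_nat.
have scaleE (f : poly4 C) d z : zdec d 0 = z -> zr (mpoly 4 C) z * f =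
    (Init.Nat.of_num_uint (Number.UIntDecimal d))%:R *: f.
  by move=> <-; rewrite -natr_decimal -mul_mpolyC rmorph_nat.
have opp (f h : poly4 C) z : zr (mpoly 4 C) z * f = h -> zr (mpoly 4 C) (Z.opp z) * f = - h.
  by move=> <-; rewrite zrN mulNr.
rewrite peM_octic_expr; apply: sum_list10.
- exact: mul1r.
- exact: opp (natE _ 6).
- exact: opp (natE _ 60).
- exact: natE 2240.
- exact: opp (natE _ 14).
- exact: scaleE.
- exact: scaleE.
- apply: opp; exact: scaleE.
- exact: scaleE.
- exact: scaleE.
Qed.
End Octic.

(** * Values and derivatives of g[k] *)

Section OcticPowers.
Local Open Scope ring_scope.
Local Open Scope classical_set_scope.

Lemma eq_peval_vars (A : comPzRingType) n (env env' : nat -> A) e : pvars n e ->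
  (forall i, (i < n)%N -> env i = env' i) -> peval env e = peval env' e.
Proof.
move=> pv h; elim: e pv => /= [z|i|e1 I1 e2 I2|e1 I1 e2 I2|e I k].
- by [].
- exact: h.
- by move=> /andP[/I1 -> /I2 ->].
- by move=> /andP[/I1 -> /I2 ->].
by move=> /I ->.
Qed.

Local Arguments Z.of_nat : simpl never.
#[local] Opaque octic_expr.

Lemma peval_pderiv_subst (A : comNzRingType) n (env : nat -> A) s e j : pvars n e ->
  peval env (pderiv j (psubst s e)) =
  \sum_(k < n) peval (fun i => peval env (s i)) (pderiv k e) * peval env (pderiv j (s k)).
Proof.
elim: e => /= [z|i|e1 I1 e2 I2|e1 I1 e2 I2|e I k].
- by move=> _; rewrite big1 // => k _; rewrite mul0r.
- move=> lt_i; rewrite (bigD1 (Ordinal lt_i)) //= eqxx mul1r big1 ?addr0 // => k ki.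
  by case: eqP => [e|_]; [case/eqP: ki; apply: val_inj|rewrite mul0r].
- move=> /andP[/I1 -> /I2 ->]; rewrite -big_split; apply: eq_bigr => k _.
  by rewrite /= mulrDl.
- move=> /andP[/I1 -> /I2 ->]; rewrite mulr_suml mulr_sumr -big_split !peval_subst.
  by apply: eq_bigr => k _ /=; ring.
move=> /I ->; rewrite mulr_sumr peval_subst; apply: eq_bigr => i _.
by rewrite /=; ring.
Qed.

Fixpoint pdeg (e : pexpr) : nat := match e with
  | PC z => 0
  | PV i => 1
  | PA e1 e2 => maxn (pdeg e1) (pdeg e2)
  | PM e1 e2 => pdeg e1 + pdeg e2
  | PP e k => pdeg e * k
  end%N.

Fixpoint phomog d (e : pexpr) : bool := match e with
  | PC z => Z.eqb z 0 || (d == 0)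
  | PV i => d == 1
  | PA e1 e2 => phomog d e1 && phomog d e2
  | PM e1 e2 => [&& d == pdeg e1 + pdeg e2, phomog (pdeg e1) e1 & phomog (pdeg e2) e2]
  | PP e k => (d == pdeg e * k) && phomog (pdeg e) e
  end%N.

Variable C : numClosedFieldType.

Lemma homogeneous_peM d e : phomog d e -> homogeneous d (peM 3 C e).
Proof.
elim: e d => /= [z|i|e1 I1 e2 I2|e1 I1 e2 I2|e I k] d.
- have zE : peM 3 C (PC z) = zr C z *: 1.
    by rewrite -mul_mpolyC mulr1 (rmorph_zr (@mpolyC 4 C)).
  rewrite zE => /orP[/Z.eqb_eq ->|/eqP ->]; last by apply: dhomogZ; apply: dhomog1.
  by rewrite scale0r; apply: dhomog0.
- by move=> /eqP ->; rewrite /homogeneous dhomogX /= mdeg1.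
- by move=> /andP[/I1 h1 /I2 h2]; apply: rpredD.
- by move=> /and3P[/eqP -> /I1 h1 /I2 h2]; apply: homogeneousM.
move=> /andP[/eqP -> /I h]; exact: dhomogMn.
Qed.

Definition coords (x : 'rV[C]_4) (i : nat) : C := x 0 (inord i).

Lemma evalv_peM x e : evalv (peM 3 C e) x = peval (coords x) e.
Proof. exact: meval_peM. Qed.

Lemma evalv_mderiv_peM x e (i : 'I_4) : pvars 4 e ->
  evalv (mderiv i (peM 3 C e)) x = peval (coords x) (pderiv i e).
Proof.
move=> pv; rewrite -{1}(inord_val i) mderiv_peM ?evalv_peM //.
by rewrite -ltnS ltn_ord.
Qed.

Definition pow_expr k e := psubst (fun i => PP (PV i) k) e.

Lemma subst_powE k : subst_pow k (octic C) = peM 3 C (pow_expr k octic_expr).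
Proof.
rewrite /subst_pow octicE /pow_expr /peM peval_subst (rmorph_peval (comp_mpoly _)).
apply: eq_peval => i /=; rewrite /Xvar comp_mpolyXU -tnth_nth tnth_mktuple.
by [].
Qed.

Lemma octic_vars : pvars 4 octic_expr. Proof. by vm_compute. Qed.

Lemma pow_expr_vars k : pvars 4 (pow_expr k octic_expr).
Proof.
rewrite /pow_expr; move: octic_vars; elim: octic_expr => //= e1 I1 e2 I2.
  by move=> /andP[/I1 -> /I2].
by move=> /andP[/I1 -> /I2].
Qed.

Lemma phomog_pow (k d : nat) e : phomog d e -> phomog (d * k)%N (pow_expr k e).
Proof.
(* [phomog] compares degrees with [pdeg], which the substitution multiplies by k. *)
have degE e' : pdeg (psubst (fun i => PP (PV i) k) e') = (pdeg e' * k)%N.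
  elim: e' => /= [z|i|e1 -> e2 ->|e1 -> e2 ->|e1 -> n]; rewrite ?mul0n ?mulnDl //.
    by rewrite maxnMl.
  by rewrite mulnAC.
elim: e d => /= [z|i|e1 I1 e2 I2|e1 I1 e2 I2|e1 I n] d.
- by move=> /orP[-> //|/eqP ->]; rewrite mul0n eqxx orbT.
- by move=> /eqP ->; rewrite mul1n eqxx.
- by move=> /andP[/I1 -> /I2 ->].
- by move=> /and3P[/eqP -> /I1 h1 /I2 h2]; rewrite !degE mulnDl eqxx h1.
by move=> /andP[/eqP -> /I h]; rewrite degE mulnAC eqxx.
Qed.

Lemma octic_homog : phomog 8 octic_expr. Proof. by vm_compute. Qed.

Lemma homogeneous_octic_pow (k : nat) : homogeneous (8 * k)%N (subst_pow k (octic C)).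
Proof. by rewrite subst_powE; apply: homogeneous_peM; apply: phomog_pow octic_homog. Qed.

Lemma subst_pow1 : subst_pow 1 (octic C) = octic C.
Proof.
rewrite subst_powE octicE /peM peval_subst; apply: eq_peval => i /=.
exact: expr1.
Qed.

Definition coords_pow k (x : 'rV[C]_4) (i : nat) : C := coords x i ^+ k.

Definition octic_at (X : nat -> C) : C := peval X octic_expr.
Definition octic_deriv (j : nat) (X : nat -> C) : C := peval X (pderiv j octic_expr).

Lemma evalv_octic_pow k x : evalv (subst_pow k (octic C)) x = octic_at (coords_pow k x).
Proof. by rewrite subst_powE evalv_peM; exact: (peval_subst _ _ octic_expr). Qed.

Lemma evalv_mderiv_pow k x (j : 'I_4) e : pvars 4 e -> pvars 4 (pow_expr k e) ->
  evalv (mderiv j (peM 3 C (pow_expr k e))) x =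
  k%:R * coords x j ^+ k.-1 * peval (coords_pow k x) (pderiv j e).
Proof.
move=> pv pvk; rewrite evalv_mderiv_peM // (peval_pderiv_subst _ _ _ pv).
rewrite (bigD1 j) //= big1 ?addr0 => [|i ij].
  by rewrite eqxx zr1 mulr1 zr_nat mulrC; congr (_ * _); apply: eq_peval.
by rewrite -val_eqE eq_sym in ij; rewrite (negPf ij) zr0 !mulr0.
Qed.

Lemma evalv_mderiv_octic_pow k x (j : 'I_4) :
  evalv (mderiv j (subst_pow k (octic C))) x =
  k%:R * coords x j ^+ k.-1 * octic_deriv j (coords_pow k x).
Proof.
rewrite subst_powE; exact: (evalv_mderiv_pow _ _ octic_vars (pow_expr_vars k)).
Qed.

(** The coefficient of x_4^8 in g is 1, so the centre of projection (0:0:0:1) lies on none of the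
    surfaces. *)
Lemma octic_pow_e4 k : (0 < k)%N ->
  evalv (subst_pow k (octic C)) (row4 (fun=> 0) 1) = 1.
Proof.
move=> k0; rewrite evalv_octic_pow /octic_at.
have valE i : (i < 4)%N -> coords_pow k (row4 (fun=> 0) 1) i =
    zr C (if i == 3 then Zpos xH else Z0).
  move=> lt_i; rewrite /coords_pow /coords.
  have [->|i3] := eqVneq i 3.
    by rewrite (_ : inord 3 = ord_max) ?row4_max ?expr1n //; apply: val_inj; rewrite /= inordK.
  have lt3 : (i < 3)%N by rewrite ltn_neqAle i3.
  rewrite (_ : inord i = widen1 (Ordinal lt3)); last by apply: val_inj; rewrite /= inordK.
  by rewrite row4_widen expr0n gtn_eqF.
rewrite (eq_peval_vars octic_vars valE) peval_zeval.
by rewrite (_ : zeval _ _ = Zpos xH) //; vm_compute.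
Qed.

End OcticPowers.

(** * The octic in terms of reflection group invariants; Jacobian criteria *)

Section OcticInvariants.
Local Open Scope ring_scope.
Local Open Scope classical_set_scope.

Definition plist (l : seq (Z * (nat * nat * nat * nat))) : pexpr :=
  foldr (fun zt e => PA (term_expr zt.1 (false, zt.2)) e) (PC 0) l.

Definition mono (z : Z) (a b c d : nat) := (z, (a, b, c, d)).

Local Notation x0 := (PV 0).
Local Notation x1 := (PV 1).
Local Notation x2 := (PV 2).
Local Notation x3 := (PV 3).

(** At a^3, b^3, c^3 this cubic is the product of the nine linear forms a + y b + z c with y^3 = z^3
    = 1, that is, of nine mirrors. *)
Definition ptri e1 e2 e3 :=
  psub (PP (PA (PA e1 e2) e3) 3) (PM (PC 27) (PM (PM e1 e2) e3)).

Definition psum3 := PA (PA x0 x1) x2.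

(** Evaluated at the cubes of three coordinates, [inv2], [inv3] and [inv4] are Maschke's invariants
    of degrees 6, 9 and 12 of the Hessian reflection group of order 648, G_25 in the Shephard-Todd
    list. *)
Definition inv2 := psub (PP psum3 2)
  (PM (PC 12) (PA (PA (PM x0 x1) (PM x1 x2)) (PM x0 x2))).
Definition inv3 := PM (PM (psub x0 x1) (psub x1 x2)) (psub x2 x0).
Definition inv4 := PM psum3 (PA (PP psum3 3) (PM (PC 216) (PM (PM x0 x1) x2))).
Definition basic_inv i := nth x3 [:: inv2; inv3; inv4; x3] i.

(** In this and the following lists the variables are [inv2], [inv3], [inv4] and the last
    coordinate, of weights 2, 3, 4, 1. The weights 4, 6, 8, 10 become the degrees 12, 18, 24, 30 of
    G_32 after cubing; their common purpose is the identity [jacobian4]. *)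
Definition G4_data : seq (Z * (nat * nat * nat * nat)) :=
  [:: mono 1 2 0 0 0; mono 132 1 0 0 2; mono (-1320) 0 1 0 1; mono 5 0 0 1 0;
      mono 6 0 0 0 4].

Definition G6_data : seq (Z * (nat * nat * nat * nat)) :=
  [:: mono 1 3 0 0 0; mono 323 2 0 0 2; mono (-680) 1 1 0 1; mono (-5) 1 0 1 0;
      mono 68 1 0 0 4; mono (-400) 0 2 0 0; mono (-7480) 0 1 0 3;
      mono (-255) 0 0 1 2; mono (-4) 0 0 0 6].

Definition G8_data : seq (Z * (nat * nat * nat * nat)) :=
  [:: mono (-67) 4 0 0 0; mono 27312 3 0 0 2; mono (-24720) 2 1 0 1;
      mono 230 2 0 1 0; mono 121488 2 0 0 4; mono 28800 1 2 0 0;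
      mono (-2931840) 1 1 0 3; mono (-29040) 1 0 1 2; mono (-1728) 1 0 0 6;
      mono 2404800 0 2 0 2; mono 42000 0 1 1 1; mono (-645120) 0 1 0 5;
      mono 125 0 0 2 0; mono (-125520) 0 0 1 4; mono 288 0 0 0 8].

Definition G10_data : seq (Z * (nat * nat * nat * nat)) :=
  [:: mono 235 4 0 0 2; mono 1904 3 1 0 1; mono (-1) 3 0 1 0; mono (-20723) 3 0 0 4;
      mono (-32) 2 2 0 0; mono 262384 2 1 0 3; mono (-1867) 2 0 1 2;
      mono (-4439) 2 0 0 6; mono (-622176) 1 2 0 2; mono (-3464) 1 1 1 1;
      mono 553656 1 1 0 5; mono 13 1 0 2 0; mono 11339 1 0 1 4; mono 156 1 0 0 8;
      mono (-658560) 0 3 0 1; mono 1040 0 2 1 0; mono (-5123664) 0 2 0 4;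
      mono (-193384) 0 1 1 3; mono 34776 0 1 0 7; mono 1788 0 0 2 2;
      mono (-4945) 0 0 1 6; mono 12 0 0 0 10].

(** The product of the three cubics other than the one on the first three coordinates, written in
    the invariants. *)
Definition Q_data : seq (Z * (nat * nat * nat * nat)) :=
  [:: mono 3 4 0 0 1; mono (-32) 3 0 0 3; mono 192 2 1 0 2; mono (-6) 2 0 1 1;
      mono 672 2 0 0 5; mono (-960) 1 2 0 1; mono 5376 1 1 0 4; mono 288 1 0 1 3;
      mono 768 1 0 0 7; mono 256 0 3 0 0; mono 40704 0 2 0 3; mono 576 0 1 1 2;
      mono 21504 0 1 0 6; mono 3 0 0 2 1; mono (-1440) 0 0 1 5; mono (-256) 0 0 0 9].

Lemma octic_inv : peq 4 (PM (PC 288) octic_expr) (psubst basic_inv (plist G8_data)).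
Proof. by vm_compute. Qed.

Definition popp e := PM (PC (-1)) e.

Lemma Q_inv : peq 4 (psubst basic_inv (plist Q_data))
  (PM (PC 256) (PM (PM (ptri (popp x0) x1 x3) (ptri (popp x0) x2 (popp x3)))
     (ptri (popp x1) x2 x3))).
Proof. by vm_compute. Qed.

Definition pdet3 (r s t : nat -> pexpr) i j k :=
  PA (PA (PM (r i) (psub (PM (s j) (t k)) (PM (s k) (t j))))
         (PM (r j) (psub (PM (s k) (t i)) (PM (s i) (t k)))))
     (PM (r k) (psub (PM (s i) (t j)) (PM (s j) (t i)))).

Definition pgrad e i := pderiv i e.

Definition pdet4 (p : pexpr) r s t :=
  psub (PA (PM (pderiv 0 p) (pdet3 r s t 1 2 3)) (PM (pderiv 2 p) (pdet3 r s t 0 1 3)))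
       (PA (PM (pderiv 1 p) (pdet3 r s t 0 2 3)) (PM (pderiv 3 p) (pdet3 r s t 0 1 2))).

(** The Jacobian of basic invariants of a reflection group is a product of mirror equations, each to
    the order of the reflections minus one. Here this exponent is 2, whence the square; the
    remaining mirrors belong to [jacobian3] and to the cubing of coordinates. *)
Lemma jacobian4 : peq 4
  (pdet4 (plist G8_data) (pgrad (plist G4_data)) (pgrad (plist G6_data)) (pgrad (plist G10_data)))
  (PM (PC (-675000000)) (PP (plist Q_data) 2)).
Proof. by vm_compute. Qed.

Lemma jacobian3 : peq 3 (pdet3 (pgrad inv2) (pgrad inv3) (pgrad inv4) 0 1 2)
  (PM (PC (-96)) (PP (ptri x0 x1 x2) 2)).
Proof. by vm_compute. Qed.

#[local] Opaque octic_expr.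
Variable C : numClosedFieldType.

Lemma pvars_pderiv n j e : pvars n e -> pvars n (pderiv j e).
Proof.
elim: e => //= [e1 I1 e2 I2|e1 I1 e2 I2|e I k].
- by move=> /andP[/I1 -> /I2].
- by move=> /andP[h1 h2]; rewrite I1 ?I2 ?h1 ?h2.
by move=> h; rewrite h I.
Qed.

(** Values at one point cannot be differentiated, so the identity is read in the polynomial ring,
    differentiated there, and evaluated afterwards. *)
Lemma peq_pderiv n (X : nat -> C) j e1 e2 : peq n.+1 e1 e2 -> (j <= n)%N ->
  peval X (pderiv j e1) = peval X (pderiv j e2).
Proof.
move=> e12 le_jn; have := congr1 (mderiv (inord j)) (peqP (@Xvar n C) e12).
have /andP[/andP[pv1 /= pv2] _] := e12.
rewrite -!/(peM n C _) !mderiv_peM // => /(congr1 (meval (fun i : 'I_n.+1 => X i))).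
have valE e : pvars n.+1 e -> meval (fun i : 'I_n.+1 => X i) (peM n C e) = peval X e.
  move=> pv; rewrite meval_peM; apply: (eq_peval_vars pv) => i lt_i.
  by rewrite inordK.
by rewrite !valE ?pvars_pderiv.
Qed.
Implicit Type X : nat -> C.

Definition tri (a b c : C) := (a + b + c) ^+ 3 - 27%:R * (a * b * c).

Lemma peval_psub X e1 e2 : peval X (psub e1 e2) = peval X e1 - peval X e2.
Proof. by rewrite /psub /= (zrN _ 1) zr1 mulN1r. Qed.

Lemma peval_pdet3 X r s t i j k (p := peval X) : p (pdet3 r s t i j k) =
  p (r i) * (p (s j) * p (t k) - p (s k) * p (t j)) +
  p (r j) * (p (s k) * p (t i) - p (s i) * p (t k)) +
  p (r k) * (p (s i) * p (t j) - p (s j) * p (t i)).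
Proof.
have h a b c d : peval X (psub (PM a b) (PM c d)) =
  peval X a * peval X b - peval X c * peval X d by exact: peval_psub.
by rewrite /p -!h.
Qed.

Lemma peval_ptri X e1 e2 e3 : peval X (ptri e1 e2 e3) = tri (peval X e1) (peval X e2) (peval X e3).
Proof.
by rewrite /ptri peval_psub.
Qed.

Lemma cramer3 (m : nat -> nat -> C) (u : nat -> C) :
  m 0 0 * (m 1 1 * m 2 2 - m 1 2 * m 2 1) + m 0 1 * (m 1 2 * m 2 0 - m 1 0 * m 2 2)
    + m 0 2 * (m 1 0 * m 2 1 - m 1 1 * m 2 0) != 0 ->
  (forall j, (j < 3)%N -> u 0 * m 0 j + u 1 * m 1 j + u 2 * m 2 j = 0) ->
  [/\ u 0 = 0, u 1 = 0 & u 2 = 0].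
Proof.
set d := (X in X != 0) => d0 h.
have h0 := h 0%N isT; have h1 := h 1%N isT; have h2 := h 2%N isT.
have cancel_d a : d * a = 0 -> a = 0 by move/eqP; rewrite mulf_eq0 (negPf d0) => /eqP.
split; apply: cancel_d; rewrite /d.
- transitivity ((m 1 1 * m 2 2 - m 1 2 * m 2 1) * (u 0 * m 0 0 + u 1 * m 1 0 + u 2 * m 2 0)
   + (m 1 2 * m 2 0 - m 1 0 * m 2 2) * (u 0 * m 0 1 + u 1 * m 1 1 + u 2 * m 2 1)
   + (m 1 0 * m 2 1 - m 1 1 * m 2 0) * (u 0 * m 0 2 + u 1 * m 1 2 + u 2 * m 2 2)); first by ring.
  by rewrite h0 h1 h2 !mulr0 !addr0.
- transitivity ((m 0 2 * m 2 1 - m 0 1 * m 2 2) * (u 0 * m 0 0 + u 1 * m 1 0 + u 2 * m 2 0)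
   + (m 0 0 * m 2 2 - m 0 2 * m 2 0) * (u 0 * m 0 1 + u 1 * m 1 1 + u 2 * m 2 1)
   + (m 0 1 * m 2 0 - m 0 0 * m 2 1) * (u 0 * m 0 2 + u 1 * m 1 2 + u 2 * m 2 2)); first by ring.
  by rewrite h0 h1 h2 !mulr0 !addr0.
transitivity ((m 0 1 * m 1 2 - m 0 2 * m 1 1) * (u 0 * m 0 0 + u 1 * m 1 0 + u 2 * m 2 0)
   + (m 0 2 * m 1 0 - m 0 0 * m 1 2) * (u 0 * m 0 1 + u 1 * m 1 1 + u 2 * m 2 1)
   + (m 0 0 * m 1 1 - m 0 1 * m 1 0) * (u 0 * m 0 2 + u 1 * m 1 2 + u 2 * m 2 2)); first by ring.
by rewrite h0 h1 h2 !mulr0 !addr0.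
Qed.

Definition inv_at X (i : nat) : C := peval X (basic_inv i).

Lemma octic_deriv_inv X j : (j < 4)%N -> zr C 288 * octic_deriv j X =
  \sum_(k < 4) peval (inv_at X) (pderiv k (plist G8_data)) * peval X (pderiv j (basic_inv k)).
Proof.
move=> lt_j; rewrite -peval_pderiv_subst; last by vm_compute.
have := peq_pderiv X octic_inv (lt_j : (j <= 3)%N).
by move=> <-; rewrite [peval _ (pderiv j (PM _ _))]/= mul0r add0r.
Qed.

(* The Jacobian of (p2, p3, p4) is -96 T^2, so away from T = 0 a critical point of the octic
   is a critical point of its expression in the invariants. *)
Lemma critical_inv X : tri (X 0) (X 1) (X 2) != 0 ->
  (forall j, (j < 3)%N -> octic_deriv j X = 0) ->
  forall k, (k < 3)%N -> peval (inv_at X) (pderiv k (plist G8_data)) = 0.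
Proof.
move=> T0 h; pose m k j := peval X (pderiv j (basic_inv k)).
have := @cramer3 m (fun k => peval (inv_at X) (pderiv k (plist G8_data))).
case=> [|j lt_j|e0 e1 e2].
- have e := peqP X jacobian3; rewrite peval_pdet3 in e.
  rewrite [X in X != 0]e.
  have -> : peval X (PM (PC (-96)) (PP (ptri x0 x1 x2) 2)) =
    zr C (-96) * peval X (ptri x0 x1 x2) ^+ 2 by [].
  rewrite peval_ptri.
  by rewrite mulf_neq0 ?expf_neq0 //; exact: zr_neq0.
- have := octic_deriv_inv X (ltnW lt_j); rewrite h // mulr0 sum4 !inordK //.
  have -> : peval X (pderiv j (basic_inv 3)) = 0 by case: j lt_j => [|[|[|]]].
  by rewrite mulr0 addr0 => /esym.
by case=> [|[|[|//]]].
Qed.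

Lemma octic_deriv3_inv X :
  zr C 288 * octic_deriv 3 X = peval (inv_at X) (pderiv 3 (plist G8_data)).
Proof.
rewrite octic_deriv_inv // sum4 !inordK //.
have -> : peval X (pderiv 3 (basic_inv 3)) = 1 by [].
have d0 k : (k < 3)%N -> peval X (pderiv 3 (basic_inv k)) = 0.
  move=> lt_k; rewrite (@peqP C 4 X _ (PC 0)) //.
  by case: k lt_k => [|[|[|//]]] _; vm_compute.
by rewrite !d0 // !mulr0 !add0r mulr1.
Qed.

(** Off the first cubic all four derivatives of the expression in the invariants vanish. Expanding
    [jacobian4] along them gives Q = 0, and Q is the product of the other three cubics. *)
Lemma critical_tri X : (forall j, (j < 4)%N -> octic_deriv j X = 0) ->
  [\/ tri (X 0) (X 1) (X 2) = 0, tri (- X 0) (X 1) (X 3) = 0,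
      tri (- X 0) (X 2) (- X 3) = 0 | tri (- X 1) (X 2) (X 3) = 0].
Proof.
move=> h; have [e|T0] := eqVneq (tri (X 0) (X 1) (X 2)) 0; first by constructor 1.
have h3 j : (j < 3)%N -> octic_deriv j X = 0 by move=> lt_j; apply: h; exact: ltnW.
have crit := critical_inv T0 h3.
have crit3 : peval (inv_at X) (pderiv 3 (plist G8_data)) = 0.
  by rewrite -octic_deriv3_inv h // mulr0.
have dE p r s t : (forall k, (k < 4)%N -> peval (inv_at X) (pderiv k p) = 0) ->
    peval (inv_at X) (pdet4 p r s t) = 0.
  move=> p0; rewrite /pdet4 peval_psub; move: (pdet3 r s t) => D /=.
  by rewrite !p0 // !mul0r !addr0 subr0.
have Q0 : peval (inv_at X) (plist Q_data) = 0.
  have := peqP (inv_at X) jacobian4; rewrite dE => [/esym/eqP|[|[|[|[|//]]]] _] //; last first.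
  - exact: crit.
  - exact: crit.
  - exact: crit.
  move: (plist Q_data) => q; rewrite [peval _ _]/= mulf_eq0 expf_eq0 /=.
  by rewrite (negPf (@zr_neq0 C (-675000000) erefl)) => /eqP.
have prodE z a b c : peval X (PM (PC z) (PM (PM a b) c)) =
  zr C z * (peval X a * peval X b * peval X c) by [].
have oppE e : peval X (popp e) = - peval X e by rewrite /= (zrN _ 1) mulN1r.
have := peqP X Q_inv; rewrite peval_subst -/(inv_at X) Q0 prodE !peval_ptri !oppE /=.
move/esym/eqP; rewrite !mulf_eq0 (negPf (@zr_neq0 C 256 erefl)) /=.
by case/orP => [/orP[]|] /eqP ->; [constructor 2|constructor 3|constructor 4].
Qed.

End OcticInvariants.

(** * Invariance of g[3] under signed permutations and a reflection of order three *)

Section Reflections.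
Local Open Scope ring_scope.
Local Open Scope classical_set_scope.

(** Expansions of the invariants at the cubes of u + d, u + e, u - d - e, in the variables u^3, d,
    e. *)
Definition inv2_data : seq (Z * (nat * nat * nat * nat)) :=
  [:: mono (-27) 2 0 0 0; mono (-270) 1 2 1 0; mono (-270) 1 1 2 0; mono 12 0 6 0 0;
      mono 36 0 5 1 0; mono 45 0 4 2 0; mono 30 0 3 3 0; mono 45 0 2 4 0;
      mono 36 0 1 5 0; mono 12 0 0 6 0].

Definition inv3_data : seq (Z * (nat * nat * nat * nat)) :=
  [:: mono (-54) 2 3 0 0; mono (-81) 2 2 1 0; mono 81 2 1 2 0; mono 54 2 0 3 0;
      mono (-54) 1 5 1 0; mono (-135) 1 4 2 0; mono 135 1 2 4 0; mono 54 1 1 5 0;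
      mono (-2) 0 9 0 0; mono (-9) 0 8 1 0; mono (-18) 0 7 2 0; mono (-21) 0 6 3 0;
      mono (-9) 0 5 4 0; mono 9 0 4 5 0; mono 21 0 3 6 0; mono 18 0 2 7 0;
      mono 9 0 1 8 0; mono 2 0 0 9 0].

Definition inv4_data : seq (Z * (nat * nat * nat * nat)) :=
  [:: mono 729 4 0 0 0; mono (-2916) 3 2 1 0; mono (-2916) 3 1 2 0;
      mono 5832 2 6 0 0; mono 17496 2 5 1 0; mono 39366 2 4 2 0; mono 49572 2 3 3 0;
      mono 39366 2 2 4 0; mono 17496 2 1 5 0; mono 5832 2 0 6 0;
      mono (-5832) 1 8 1 0; mono (-23328) 1 7 2 0; mono (-55404) 1 6 3 0;
      mono (-84564) 1 5 4 0; mono (-84564) 1 4 5 0; mono (-55404) 1 3 6 0;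
      mono (-23328) 1 2 7 0; mono (-5832) 1 1 8 0; mono 729 0 8 4 0;
      mono 2916 0 7 5 0; mono 4374 0 6 6 0; mono 2916 0 5 7 0; mono 729 0 4 8 0].

(* The reflection multiplies the mean u of three coordinates by w and fixes their
   deviations from the mean; the invariants of the cubes involve u only through u^3. *)
Definition mean_cubes i := nth (PV 3)
  [:: PP (PA (PV 0) (PV 1)) 3; PP (PA (PV 0) (PV 2)) 3;
      PP (psub (PV 0) (PA (PV 1) (PV 2))) 3] i.

Definition mean_cube i := nth (PV 3) [:: PP (PV 0) 3; PV 1; PV 2] i.

Definition inv_data := [:: inv2_data; inv3_data; inv4_data].

Lemma inv_mean_cubes : all (fun i =>
  peq 4 (psubst mean_cubes (basic_inv i)) (psubst mean_cube (plist (nth [::] inv_data i)))) (iota 0 3).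
Proof. by vm_compute. Qed.

Definition sign_data : seq (nat -> pexpr) :=
  [:: nth (PV 3) [:: PV 1; PV 0; PV 2; popp (PV 3)];
      nth (PV 3) [:: PV 0; PV 2; PV 1; popp (PV 3)];
      nth (PV 3) [:: popp (PV 0); PV 1; PV 3; PV 2]].

Lemma octic_signs i : (i < 3)%N -> peq 4 (psubst (nth PV sign_data i) octic_expr) octic_expr.
Proof. by case: i => [|[|[|//]]] _; vm_compute. Qed.

#[local] Opaque octic_expr.

Variable C : numClosedFieldType.

Definition quad (a b c d : C) : nat -> C := nth d [:: a; b; c].

Lemma octic_sign i (X Y : nat -> C) : (i < 3)%N ->
  (forall k, (k < 4)%N -> Y k = peval X (nth PV sign_data i k)) -> octic_at Y = octic_at X.
Proof.
move=> /octic_signs/(peqP X) + YX; rewrite peval_subst => e.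
by rewrite /octic_at -[RHS]e; apply: (eq_peval_vars octic_vars).
Qed.

Lemma octic_sign1 a b c d : octic_at (quad b a c (- d)) = octic_at (quad a b c d).
Proof.
apply: (@octic_sign 0) => //.
by case=> [|[|[|[|//]]]] _ //=; rewrite (zrN _ 1) mulN1r.
Qed.

Lemma octic_sign2 a b c d : octic_at (quad a c b (- d)) = octic_at (quad a b c d).
Proof.
apply: (@octic_sign 1) => //.
by case=> [|[|[|[|//]]]] _ //=; rewrite (zrN _ 1) mulN1r.
Qed.

Lemma octic_sign3 a b c d : octic_at (quad (- a) b d c) = octic_at (quad a b c d).
Proof.
apply: (@octic_sign 2) => //.
by case=> [|[|[|[|//]]]] _ //=; rewrite (zrN _ 1) mulN1r.
Qed.

Lemma octic_atE (X : nat -> C) : zr C 288 * octic_at X = peval (inv_at X) (plist G8_data).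
Proof.
have := peqP X octic_inv; rewrite peval_subst -/(inv_at X) => <-.
by [].
Qed.

Lemma eq_octic_at (X Y : nat -> C) : (forall i, (i < 4)%N -> X i = Y i) ->
  octic_at X = octic_at Y.
Proof. exact: (eq_peval_vars octic_vars). Qed.

Lemma inv_mean (w u d e t : C) i : w ^+ 3 = 1 -> (i < 4)%N ->
  inv_at (quad ((w * u + d) ^+ 3) ((w * u + e) ^+ 3) ((w * u - (d + e)) ^+ 3) t) i =
  inv_at (quad ((u + d) ^+ 3) ((u + e) ^+ 3) ((u - (d + e)) ^+ 3) t) i.
Proof.
move=> w3 lt_i4.
have cubesE v j : (j < 4)%N -> peval (quad v d e t) (mean_cubes j) =
    quad ((v + d) ^+ 3) ((v + e) ^+ 3) ((v - (d + e)) ^+ 3) t j.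
  by case: j => [|[|[|[|//]]]] _ //; rewrite /= (zrN _ 1) mulN1r.
have invE v j : (j < 3)%N -> inv_at (quad ((v + d) ^+ 3) ((v + e) ^+ 3) ((v - (d + e)) ^+ 3) t) j =
    peval (quad (v ^+ 3) d e t) (plist (nth [::] inv_data j)).
  move=> lt_j; have := peqP (quad v d e t) (allP inv_mean_cubes j _).
  rewrite !peval_subst mem_iota => /(_ lt_j) h.
  transitivity (peval (fun j => peval (quad v d e t) (mean_cubes j)) (basic_inv j)).
    apply: (@eq_peval_vars _ 4) => [|k lt_k]; last by rewrite cubesE.
    by case: j lt_j {h} => [|[|[|]]].
  rewrite [LHS]h; apply: (@eq_peval_vars _ 4) => [|[|[|[|[|//]]]]] //.
  by case: j lt_j {h} => [|[|[|]]].
by case: i lt_i4 => [|[|[|[|//]]]] _ //; rewrite !invE // exprMn w3 mul1r.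
Qed.

Lemma octic_inv_eq (X Y : nat -> C) : (forall i, (i < 4)%N -> inv_at X i = inv_at Y i) ->
  octic_at X = octic_at Y.
Proof.
move=> XY; apply: (mulfI (@zr_neq0 C 288 erefl)); rewrite !octic_atE.
exact: (@eq_peval_vars _ 4).
Qed.

Lemma octic_mean (w u d e t : C) : w ^+ 3 = 1 ->
  octic_at (quad ((w * u + d) ^+ 3) ((w * u + e) ^+ 3) ((w * u - (d + e)) ^+ 3) t) =
  octic_at (quad ((u + d) ^+ 3) ((u + e) ^+ 3) ((u - (d + e)) ^+ 3) t).
Proof. by move=> w3; apply: octic_inv_eq => i; exact: inv_mean. Qed.

End Reflections.

(** * The symmetries of g[3] as matrices *)

Section SymmetryGroup.
Local Open Scope ring_scope.
Local Open Scope classical_set_scope.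
#[local] Opaque octic_expr.
Variable C : numClosedFieldType.
Implicit Type x : 'rV[C]_4.

Definition vec4 (a b c d : C) : 'rV[C]_4 := \row_i quad a b c d i.

Lemma coords_vec4 a b c d i : (i < 4)%N -> coords (vec4 a b c d) i = quad a b c d i.
Proof. by move=> lt_i; rewrite /coords mxE inordK. Qed.

Lemma vec4_eta x : x = vec4 (coords x 0) (coords x 1) (coords x 2) (coords x 3).
Proof.
apply/rowP => i; rewrite mxE /coords -{1}(inord_val i).
by case: i => -[|[|[|[|//]]]] /=.
Qed.

Lemma vec4P x : exists a b c d, x = vec4 a b c d.
Proof. by do 4!eexists; exact: vec4_eta. Qed.

Lemma coords_inj x y : (forall i, (i < 4)%N -> coords x i = coords y i) -> x = y.
Proof. by move=> h; rewrite (vec4_eta x) (vec4_eta y) !h. Qed.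

Lemma vec4_eq a b c d a' b' c' d' : vec4 a b c d = vec4 a' b' c' d' ->
  [/\ a = a', b = b', c = c' & d = d'].
Proof.
move=> e; have h i (lt_i : (i < 4)%N) : quad a b c d i = quad a' b' c' d' i.
  by rewrite -!coords_vec4 // e.
by split; [exact: (h 0%N)|exact: (h 1%N)|exact: (h 2%N)|exact: (h 3%N)].
Qed.

Lemma scale_vec4 k a b c d : k *: vec4 a b c d = vec4 (k * a) (k * b) (k * c) (k * d).
Proof.
apply/rowP => i; rewrite !mxE; case: i => -[|[|[|[|//]]]] //.
Qed.

Lemma vec4_eq0 a b c d : (vec4 a b c d == 0) = [&& a == 0, b == 0, c == 0 & d == 0].
Proof.
have -> : 0 = vec4 0 0 0 0 by rewrite -[vec4 _ _ _ _](scale1r) -[LHS](scale0r (vec4 0 0 0 0)) !scale_vec4 !mulr0.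
apply/eqP/and4P => [/vec4_eq[-> -> -> ->]|[/eqP-> /eqP-> /eqP-> /eqP->]] //.
Qed.

Lemma mul_vec4_mat4 a b c d r0 r1 r2 r3 : vec4 a b c d *m mat4 [:: r0; r1; r2; r3] =
  let m j := a * nth 0 r0 j + b * nth 0 r1 j + c * nth 0 r2 j + d * nth 0 r3 j in
  vec4 (m 0) (m 1) (m 2) (m 3).
Proof.
apply: coords_inj => j lt_j; rewrite coords_vec4 // /coords !mxE sum4 !mxE !inordK //.
by case: j lt_j => [|[|[|[|//]]]].
Qed.

Definition diag4 (a b c d : C) : 'M[C]_4 :=
  mat4 [:: [:: a; 0; 0; 0]; [:: 0; b; 0; 0]; [:: 0; 0; c; 0]; [:: 0; 0; 0; d]].

Let simp := (mulr0, mulr1, mulrN1, add0r, addr0).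

Lemma mul_diag4 a b c d a' b' c' d' :
  vec4 a b c d *m diag4 a' b' c' d' = vec4 (a * a') (b * b') (c * c') (d * d').
Proof. by rewrite mul_vec4_mat4 /= !simp. Qed.

Lemma mul_s1 a b c d : vec4 a b c d *m s1 C = vec4 b a c (- d).
Proof. by rewrite mul_vec4_mat4 /= !simp. Qed.

Lemma mul_s2 a b c d : vec4 a b c d *m s2 C = vec4 a c b (- d).
Proof. by rewrite mul_vec4_mat4 /= !simp. Qed.

Lemma mul_s3 a b c d : vec4 a b c d *m s3 C = vec4 (- a) b d c.
Proof. by rewrite mul_vec4_mat4 /= !simp. Qed.

Lemma eq_mulmx_vec4 (A B : 'M[C]_4) :
  (forall a b c d, vec4 a b c d *m A = vec4 a b c d *m B) -> A = B.
Proof.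
move=> h; apply/row_matrixP => i; rewrite !rowE.
by have [a [b [c [d ->]]]] := vec4P (delta_mx 0 i).
Qed.

Variable w : C.
Hypothesis w_root : w ^+ 2 + w + 1 = 0.

Lemma w_cube : w ^+ 3 = 1.
Proof.
have : (w - 1) * (w ^+ 2 + w + 1) = 0 by rewrite w_root mulr0.
by rewrite (_ : _ * _ = w ^+ 3 - 1); [move/subr0_eq|ring].
Qed.

Lemma natr3_neq0 : 3%:R != 0 :> C. Proof. by rewrite pnatr_eq0. Qed.

(** The identity plus w - 1 times the projection onto (1, 1, 1, 0): it multiplies that vector by w
    and fixes the mirror a + b + c = 0. *)
Definition refl : 'M[C]_4 := let v := (w - 1) / 3%:R in
  mat4 [:: [:: 1 + v; v; v; 0]; [:: v; 1 + v; v; 0]; [:: v; v; 1 + v; 0]; [:: 0; 0; 0; 1]].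

(* Coordinates are given by the mean u of the first three and their deviations from it. *)
Lemma mul_refl u d e t : vec4 (u + d) (u + e) (u - (d + e)) t *m refl =
  vec4 (w * u + d) (w * u + e) (w * u - (d + e)) t.
Proof.
rewrite mul_vec4_mat4 /=; set v := _ / _.
have -> : w = 1 + 3%:R * v by rewrite /v mulrC divfK ?natr3_neq0 // addrC subrK.
by rewrite !simp; congr vec4; ring.
Qed.

Lemma mean_vec4 a b c t : exists u d e, vec4 a b c t = vec4 (u + d) (u + e) (u - (d + e)) t.
Proof.
pose u := (a + b + c) / 3%:R; exists u, (a - u), (b - u).
have e : 3%:R * u = a + b + c by rewrite mulrC divfK ?natr3_neq0.
congr vec4; try ring.
have -> : c = 3%:R * u - a - b by rewrite e; ring.
by ring.
Qed.

(** Inverses follow in [symmetry_inv] from the finite order of the generators. *)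
Inductive symmetry : 'M[C]_4 -> Prop :=
| symmetry_refl : symmetry refl
| symmetry_diag a b c d : a ^+ 3 = 1 -> b ^+ 3 = 1 -> c ^+ 3 = 1 -> d ^+ 3 = 1 ->
    symmetry (diag4 a b c d)
| symmetry_s1 : symmetry (s1 C)
| symmetry_s2 : symmetry (s2 C)
| symmetry_s3 : symmetry (s3 C)
| symmetry_mul A B : symmetry A -> symmetry B -> symmetry (A *m B).

Lemma diag4_1 : diag4 1 1 1 1 = 1%:M.
Proof. by apply: eq_mulmx_vec4 => a b c d; rewrite mulmx1 mul_diag4 !mulr1. Qed.

Lemma symmetry_one : symmetry 1%:M.
Proof. by rewrite -diag4_1; apply: symmetry_diag; rewrite expr1n. Qed.

Lemma mul_diag4_diag4 a b c d a' b' c' d' :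
  diag4 a b c d *m diag4 a' b' c' d' = diag4 (a * a') (b * b') (c * c') (d * d').
Proof.
by apply: eq_mulmx_vec4 => x y z t; rewrite mulmxA !mul_diag4 !mulrA.
Qed.

Lemma refl_cube : refl *m refl *m refl = 1%:M.
Proof.
apply: eq_mulmx_vec4 => a b c t; have [u [d [e ->]]] := mean_vec4 a b c t.
by rewrite mulmx1 !mulmxA !mul_refl; congr vec4; rewrite !mulrA -expr2 -exprSr w_cube mul1r.
Qed.

Lemma symmetry_inv A : symmetry A -> exists B, [/\ symmetry B, A *m B = 1%:M & B *m A = 1%:M].
Proof.
elim=> [|a b c d ha hb hc hd||||A1 A2 _ [B1 [sB1 AB1 BA1]] _ [B2 [sB2 AB2 BA2]]].
- exists (refl *m refl); rewrite mulmxA refl_cube; split=> //.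
  by apply: symmetry_mul; exact: symmetry_refl.
- exists (diag4 (a ^+ 2) (b ^+ 2) (c ^+ 2) (d ^+ 2)).
  rewrite !mul_diag4_diag4 -!exprS -!exprSr ha hb hc hd diag4_1; split=> //.
  by apply: symmetry_diag; rewrite exprAC ?ha ?hb ?hc ?hd expr1n.
- by exists (s1 C); rewrite s1_involution; split=> //; exact: symmetry_s1.
- by exists (s2 C); rewrite s2_involution; split=> //; exact: symmetry_s2.
- by exists (s3 C); rewrite s3_involution; split=> //; exact: symmetry_s3.
exists (B2 *m B1); split; first exact: symmetry_mul.
  by rewrite mulmxA -(mulmxA A1) AB2 mulmx1.
by rewrite mulmxA -(mulmxA B2) BA1 mulmx1.
Qed.

Definition F24 : poly4 C := subst_pow 3 (octic C).

Lemma evalv_octic_vec4 k a b c d :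
  evalv (subst_pow k (octic C)) (vec4 a b c d) = octic_at (quad (a ^+ k) (b ^+ k) (c ^+ k) (d ^+ k)).
Proof.
rewrite evalv_octic_pow; apply: eq_octic_at => i lt_i; rewrite /coords_pow coords_vec4 //.
by case: i lt_i => [|[|[|[|//]]]].
Qed.

Lemma symmetry_F24 A x : symmetry A -> evalv F24 (x *m A) = evalv F24 x.
Proof.
move=> sA; elim: sA x => [|a b c d ha hb hc hd||||A1 A2 _ I1 _ I2] x; last first.
- by rewrite mulmxA I2.
- have [x0 [x1 [x2 [x3 ->]]]] := vec4P x; rewrite mul_s3 !evalv_octic_vec4.
  by rewrite exprNn -signr_odd mulN1r octic_sign3.
- have [x0 [x1 [x2 [x3 ->]]]] := vec4P x; rewrite mul_s2 !evalv_octic_vec4.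
  by rewrite exprNn -signr_odd mulN1r octic_sign2.
- have [x0 [x1 [x2 [x3 ->]]]] := vec4P x; rewrite mul_s1 !evalv_octic_vec4.
  by rewrite exprNn -signr_odd mulN1r octic_sign1.
- have [x0 [x1 [x2 [x3 ->]]]] := vec4P x; rewrite mul_diag4 !evalv_octic_vec4.
  by rewrite !exprMn ha hb hc hd !mulr1.
have [a [b [c [t ->]]]] := vec4P x; have [u [d [e ->]]] := mean_vec4 a b c t.
by rewrite mul_refl !evalv_octic_vec4 octic_mean // w_cube.
Qed.

Definition singular_vec (f : poly4 C) x :=
  [/\ x != 0, evalv f x = 0 & forall i, evalv (mderiv i f) x = 0].

Lemma evalv_mx_subst (A : 'M[C]_4) f x : evalv (mx_subst A f) x = evalv f (x *m A^T).
Proof.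
rewrite /evalv /mx_subst comp_mpoly_meval; apply: meval_eq => i.
rewrite tnth_mktuple raddf_sum mxE; apply: eq_bigr => j _ /=.
by rewrite mevalZ mevalXU mulrC mxE.
Qed.

Lemma mderiv_mx_subst (A : 'M[C]_4) f x i : evalv (mderiv i (mx_subst A f)) x =
  \sum_j A j i * evalv (mderiv j f) (x *m A^T).
Proof.
elim/mpoly_ring_ind: f => [c|k|p q ep eq|p q ep eq].
- rewrite /mx_subst comp_mpolyC mderivC /evalv meval0 big1 // => j _.
  by rewrite mderivC meval0 mulr0.
- have dX (l m : 'I_4) : mderiv l (mpolyX C (mnm1 m)) = mpolyC 4 (m == l)%:R.
    rewrite mderivX mnm1E; have [<-|_] := eqVneq m l; last by rewrite scale0r mpolyC0.
    rewrite scale1r mpolyC1 -mpolyX0; congr (mpolyX _ _); apply/mnmP => j.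
    by rewrite !mnmE subnn.
  rewrite (bigD1 k) //= dX eqxx /evalv mevalC mulr1 big1 ?addr0 => [|j jk]; last first.
    by rewrite dX eq_sym (negPf jk) mevalC mulr0.
  rewrite /mx_subst comp_mpolyXU -tnth_nth tnth_mktuple (raddf_sum (mderiv i)) /= (bigD1 i) //=.
  rewrite mderivZ dX eqxx big1 ?addr0 => [|j ji].
    by rewrite mevalZ mevalC mulr1.
  by rewrite mderivZ dX (negPf ji) mpolyC0 scaler0.
- have evD g h y : evalv (g + h) y = evalv g y + evalv h y by exact: mevalD.
  have -> : mx_subst A (p + q) = mx_subst A p + mx_subst A q by exact: rmorphD.
  rewrite mderivD evD ep eq -big_split; apply: eq_bigr => j _.
  by rewrite mderivD evD mulrDr.
rewrite mx_substM mderivM /evalv mevalD !mevalM -!/(evalv _ _) ep eq !evalv_mx_subst.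
rewrite mulr_suml mulr_sumr -big_split; apply: eq_bigr => j _ /=.
by rewrite mderivM /evalv mevalD !mevalM -!/(evalv _ _); ring.
Qed.

(** By the chain rule the gradient at x is M times the gradient at x M, and M is invertible. *)
Lemma singular_mulmx (f : poly4 C) (M : 'M[C]_4) x : M \in unitmx ->
  (forall y, evalv f (y *m M) = evalv f y) -> singular_vec f x -> singular_vec f (x *m M).
Proof.
move=> uM fM [x0 fx dfx]; split; last 2 first.
- by rewrite fM.
(* Invariance of values becomes an identity of polynomials, which can be differentiated. *)
- have fE : mx_subst M^T f = f.
    apply/eqP; rewrite -subr_eq0; apply/negP => /negP /mpoly_nonzero_eval[y].
    rewrite mevalB subr_eq0 => /eqP; apply.
    have yE h : evalv h (\row_i y i) = meval y h by apply: meval_eq => i; rewrite mxE.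
    by have := evalv_mx_subst M^T f (\row_i y i); rewrite trmxK fM !yE.
  move=> j; pose g := \col_j evalv (mderiv j f) (x *m M).
  have Mg : M *m g = 0.
    apply/colP => i; rewrite !mxE -[RHS](dfx i) -{1}fE mderiv_mx_subst trmxK.
    by apply: eq_bigr => k _; rewrite !mxE.
  have : g = 0 by rewrite -[g](mulKmx uM) Mg mulmx0.
  by move=> /colP/(_ j); rewrite !mxE.
by apply: contra_neq x0 => e; rewrite -(mulmxK uM x) e mul0mx.
Qed.

Lemma symmetry_unit A : symmetry A -> A \in unitmx.
Proof. by move=> /symmetry_inv[B [_ /mulmx1_unit[]]]. Qed.

Lemma symmetry_singular A x : symmetry A -> singular_vec F24 x -> singular_vec F24 (x *m A).
Proof.
move=> sA; apply: singular_mulmx; first exact: symmetry_unit.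
by move=> y; exact: symmetry_F24.
Qed.

End SymmetryGroup.

(** * Moving a singular point of g[3] into a coordinate plane *)

Section Classification.
Local Open Scope ring_scope.
#[local] Opaque octic_expr.
Variable C : numClosedFieldType.
Variable w : C.
Hypothesis w_root : w ^+ 2 + w + 1 = 0.
Local Notation F24 := (F24 C).
Local Notation symmetry := (symmetry w).
Implicit Type x : 'rV[C]_4.

Let w3 := w_cube w_root.

Lemma cube_root_unity (a b : C) : a ^+ 3 = b ^+ 3 -> exists2 z, z ^+ 3 = 1 & a = z * b.
Proof.
move=> e; have [b0|b0] := eqVneq b 0.
  exists 1; rewrite ?expr1n // b0 mulr0; apply/eqP.
  by rewrite b0 expr0n in e; move/eqP: e; rewrite expf_eq0.
by exists (a / b); rewrite ?divfK // expr_div_n e divff // expf_neq0.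
Qed.

(** The hypothesis says (a^3 + b^3 + c^3)^3 = (3 a b c)^3. Replacing c by z c for a cube root of
    unity z turns this into a^3 + b^3 + c^3 = 3 a b c, whose difference splits into three linear
    forms. *)
Lemma tri_factor (a b c : C) : tri (a ^+ 3) (b ^+ 3) (c ^+ 3) = 0 ->
  exists y z, [/\ y ^+ 3 = 1, z ^+ 3 = 1 & a + y * b + z * c = 0].
Proof.
move=> /subr0_eq e.
have /cube_root_unity[z z3 e'] : (a ^+ 3 + b ^+ 3 + c ^+ 3) ^+ 3 = (3%:R * (a * b * c)) ^+ 3.
  by rewrite e; ring.
have fac d : (a + b + d) * ((a + w * b + w ^+ 2 * d) * (a + w ^+ 2 * b + w * d)) =
    a ^+ 3 + b ^+ 3 + d ^+ 3 - 3%:R * (a * b * d).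
  transitivity ((a + b + d) * (a ^+ 2 + b ^+ 2 + d ^+ 2 - a * b - a * d - b * d +
    (w ^+ 2 + w + 1) * ((w - 1) * (b ^+ 2 + d ^+ 2) + a * b + a * d + (w ^+ 2 - w + 1) * (b * d)))).
    by ring.
  by rewrite w_root mul0r addr0; ring.
have /eqP : a ^+ 3 + b ^+ 3 + (z * c) ^+ 3 - 3%:R * (a * b * (z * c)) = 0.
  by rewrite exprMn z3 mul1r e'; ring.
have ww : (w ^+ 2) ^+ 3 = 1 by rewrite exprAC w3 expr1n.
rewrite -fac !mulf_eq0 => /orP[/eqP h|/orP[]/eqP h].
- by exists 1, z; rewrite expr1n mul1r.
- exists w, (w ^+ 2 * z); split; [exact: w3|by rewrite exprMn ww z3 mul1r|by rewrite -mulrA].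
exists (w ^+ 2), (w * z); split; [exact: ww|by rewrite exprMn w3 z3 mul1r|by rewrite -mulrA].
Qed.

(* The product of two braided reflections carries the mirror a + b + c = 0 to the
   coordinate plane where the third coordinate vanishes. *)
Definition plane_inv (v : 'rV[C]_4) t :=
  inv_at (quad (coords v 0 ^+ 3) (coords v 1 ^+ 3) (coords v 2 ^+ 3) t).

Lemma tri_move (a b c : C) : tri (a ^+ 3) (b ^+ 3) (c ^+ 3) = 0 -> exists A,
  [/\ symmetry A, (forall v t i, (i < 4)%N -> plane_inv (v *m A) t i = plane_inv v t i),
     (forall v, coords (v *m A) 3 = coords v 3) &
     exists a' b', forall d, vec4 a b c d *m A = vec4 a' b' 0 d].
Proof.
move=> /tri_factor[y [z [y3 z3 e]]].
have zw3 : (z * w) ^+ 3 = 1 by rewrite exprMn z3 w3 mulr1.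
(* With a + y b + z c = 0 the third coordinate after this twist and the reflection is z c (w^2 + w +
   1) / 3 = 0. *)
exists (diag4 1 y (z * w) 1 *m refl w); split.
- apply: symmetry_mul; last exact: symmetry_refl.
  by apply: symmetry_diag; rewrite ?expr1n.
- move=> v t i lt_i; have [x0 [x1 [x2 [x3 ->]]]] := vec4P v.
  rewrite mulmxA mul_diag4 /plane_inv.
  have [u [d [f E]]] := mean_vec4 (x0 * 1) (x1 * y) (x2 * (z * w)) (x3 * 1).
  rewrite E mul_refl !coords_vec4 // /quad /= -/(quad _ _ _ _) inv_mean //.
  have [<- <- <- _] := vec4_eq E.
  by rewrite !exprMn y3 z3 w3 !mulr1 expr1n mulr1.
- move=> v; have [x0 [x1 [x2 [x3 ->]]]] := vec4P v.
  rewrite mulmxA mul_diag4; have [u [d [f E]]] := mean_vec4 (x0 * 1) (x1 * y) (x2 * (z * w)) (x3 * 1).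
  by rewrite E mul_refl !coords_vec4 // /quad /= mulr1.
pose v := (w - 1) / 3%:R; pose s := a + b * y + c * (z * w).
exists (a + v * s), (b * y + v * s) => d.
rewrite mulmxA mul_diag4 mul_vec4_mat4 /= -/v.
have wE : w = 1 + 3%:R * v by rewrite /v mulrC divfK ?natr3_neq0 // addrC subrK.
congr vec4; [by rewrite /s; ring|by rewrite /s; ring| |by ring].
have v0 : 1 + 3%:R * v + 3%:R * v ^+ 2 = 0.
  apply: (mulfI (natr3_neq0 C)); rewrite mulr0 -w_root wE; ring.
have -> : c * (z * w) = w * (z * c) by ring.
have -> : z * c = - a - b * y by apply/eqP; rewrite -subr_eq0 -e; apply/eqP; ring.
rewrite wE !mulr1 mulr0 addr0.
by transitivity ((- a - b * y) * (1 + 3%:R * v + 3%:R * v ^+ 2)); [ring|rewrite v0 mulr0].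
Qed.

Lemma singular_octic_deriv k (a b c d : C) j :
  singular_vec (subst_pow k (octic C)) (vec4 a b c d) -> (0 < k)%N -> (j < 4)%N ->
  quad a b c d j != 0 \/ k = 1%N ->
  octic_deriv j (quad (a ^+ k) (b ^+ k) (c ^+ k) (d ^+ k)) = 0.
Proof.
move=> [_ _ /(_ (inord j))] + k0 lt_j nz.
rewrite evalv_mderiv_octic_pow inordK // coords_vec4 //.
have -> : octic_deriv j (coords_pow k (vec4 a b c d)) =
    octic_deriv j (quad (a ^+ k) (b ^+ k) (c ^+ k) (d ^+ k)).
  apply: (@eq_peval_vars _ 4) => [|i lt_i]; first by apply: pvars_pderiv; exact: octic_vars.
  by rewrite /coords_pow coords_vec4 //; case: i lt_i => [|[|[|[|//]]]].
move: (octic_deriv _ _) => D /eqP; rewrite !mulf_eq0 pnatr_eq0 (gtn_eqF k0) /=.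
have -> : (quad a b c d j ^+ k.-1 == 0) = false.
  by case: nz => [nz|->]; rewrite ?expr0 ?oner_eq0 // expf_eq0 (negPf nz) andbF.
by move=> /eqP.
Qed.

(** A coordinate that already vanishes is permuted to the last place. Otherwise one of the four
    cubics vanishes; a signed permutation brings it to the first three coordinates, [tri_move]
    clears the third one, and [s3] exchanges it with the fourth. *)
Lemma move_fourth_zero x : singular_vec F24 x ->
  exists A, symmetry A /\ exists a b c, x *m A = vec4 a b c 0.
Proof.
have [a [b [c [d ->]]]] := vec4P x => sx.
have step B : symmetry B ->
    (exists A, symmetry A /\ exists a' b' c', vec4 a b c d *m B *m A = vec4 a' b' c' 0) ->
    exists A, symmetry A /\ exists a' b' c', vec4 a b c d *m A = vec4 a' b' c' 0.
  by move=> sB [A' [sA' e]]; exists (B *m A'); rewrite mulmxA; split=> //; exact: symmetry_mul.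
have c0 a' b' d' : exists A, symmetry A /\ exists a'' b'' c'',
    vec4 a' b' 0 d' *m A = vec4 a'' b'' c'' 0.
  by exists (s3 C); split; [exact: symmetry_s3|rewrite mul_s3; do 3!eexists].
have trimove a' b' c' d' : tri (a' ^+ 3) (b' ^+ 3) (c' ^+ 3) = 0 ->
    exists A, symmetry A /\ exists a'' b'' c'', vec4 a' b' c' d' *m A = vec4 a'' b'' c'' 0.
  move=> /tri_move[A [sA _ _ [a'' [b'' /(_ d') e]]]]; have [B [sB e']] := c0 a'' b'' d'.
  by exists (A *m B); rewrite mulmxA e; split=> //; exact: symmetry_mul.
have ss1 := symmetry_s1 w; have ss2 := symmetry_s2 w; have ss3 := symmetry_s3 w.
have [d0|dn0] := eqVneq d 0.
  by exists 1%:M; split; [exact: symmetry_one|rewrite mulmx1 d0; do 3!eexists].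
have [->|cn0] := eqVneq c 0; first exact: c0.
have [b0|bn0] := eqVneq b 0.
  by apply: (step (s2 C)) => //; rewrite mul_s2 b0; exact: c0.
have [a0|an0] := eqVneq a 0.
  apply: (step (s1 C *m s2 C)); first exact: symmetry_mul.
  by rewrite mulmxA mul_s1 mul_s2 a0; exact: c0.
have h j : (j < 4)%N -> octic_deriv j (quad (a ^+ 3) (b ^+ 3) (c ^+ 3) (d ^+ 3)) = 0.
  move=> lt_j; apply: (singular_octic_deriv sx) => //; left.
  by case: j lt_j => [|[|[|[|]]]].
have cubeN y : (- y) ^+ 3 = - y ^+ 3 :> C by rewrite exprNn -signr_odd mulN1r.
have [/= e|e|e|e] := critical_tri h.
- exact: trimove.
- by apply: (step (s3 C)) => //; rewrite mul_s3; apply: trimove; rewrite cubeN.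
- apply: (step (s2 C *m s3 C)); first exact: symmetry_mul.
  by rewrite mulmxA mul_s2 mul_s3; apply: trimove; rewrite !cubeN.
apply: (step (s1 C *m s2 C *m s3 C)); first by do 2!apply: symmetry_mul => //.
by rewrite !mulmxA mul_s1 mul_s2 mul_s3 opprK; apply: trimove; rewrite cubeN.
Qed.

Lemma inv_euler k : (k < 3)%N -> peq 3
  (PA (PA (PM (PV 0) (pderiv 0 (basic_inv k))) (PM (PV 1) (pderiv 1 (basic_inv k))))
      (PM (PV 2) (pderiv 2 (basic_inv k))))
  (PM (PC (Z.of_nat k.+2)) (basic_inv k)).
Proof. by case: k => [|[|[|//]]] _; vm_compute. Qed.

Definition plane_subst := nth (PC 0) [:: PV 0; PV 1; PV 2].

(** For t = 0 the expression of 288 g is -67 p^4 + 230 p^2 r + 28800 p q^2 + 125 r^2; these are its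
    derivatives in p, q, r. *)
Definition plane_grad : seq pexpr :=
  [:: plist [:: mono 28800 0 2 0 0; mono 460 1 0 1 0; mono (-268) 3 0 0 0];
      plist [:: mono 57600 1 1 0 0];
      plist [:: mono 250 0 0 1 0; mono 230 2 0 0 0]].

Lemma plane_gradE k : (k < 3)%N ->
  peq 4 (psubst plane_subst (pderiv k (plist G8_data))) (nth (PC 0) plane_grad k).
Proof. by case: k => [|[|[|//]]] _; vm_compute. Qed.

(** If p != 0 then q = 0, and eliminating r between the outer equations leaves p^3 with the
    coefficient 172800 = 460 * 230 + 250 * 268. *)
Lemma plane_invariants_zero (p q r : C) :
  zr C 28800 * q ^+ 2 + (zr C 460 * (p * r) + zr C (-268) * p ^+ 3) = 0 ->
  zr C 57600 * (p * q) = 0 -> zr C 250 * r + zr C 230 * p ^+ 2 = 0 ->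
  [/\ p = 0, q = 0 & r = 0].
Proof.
move=> e1 e2 e3.
have p0 : p = 0.
  apply/eqP/negPn/negP => p0.
  have q0 : q = 0.
    by move/eqP: e2; rewrite !mulf_eq0 (negPf p0) (negPf (@zr_neq0 C 57600 erefl)) /= => /eqP.
  have numE : zr C 460 * zr C 230 - zr C 250 * zr C (-268) = zr C 172800.
    by rewrite -!zrM -zrN -zrD.
  have /eqP : zr C 172800 * p ^+ 3 = 0.
    transitivity (zr C 460 * (p * (zr C 250 * r + zr C 230 * p ^+ 2)) - zr C 250 *
      (zr C 28800 * q ^+ 2 + (zr C 460 * (p * r) + zr C (-268) * p ^+ 3))); last first.
      by rewrite e1 e3 !mulr0 subr0.
    by rewrite -numE q0; ring.
  by rewrite mulf_eq0 expf_eq0 /= (negPf p0) (negPf (@zr_neq0 C 172800 erefl)) /=.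
have r0 : r = 0.
  move/eqP: e3; rewrite p0 expr0n mulr0 addr0 mulf_eq0.
  by rewrite (negPf (@zr_neq0 C 250 erefl)) /= => /eqP.
have q0 : q = 0.
  move/eqP: e1; rewrite p0 mul0r expr0n !mulr0 !addr0 mulf_eq0 expf_eq0 /=.
  by rewrite (negPf (@zr_neq0 C 28800 erefl)) /= => /eqP.
by [].
Qed.

Lemma peval_plane_grad (Y : nat -> C) (e := fun k => peval Y (nth (PC 0) plane_grad k)) :
  [/\ e 0 = zr C 28800 * Y 1 ^+ 2 + (zr C 460 * (Y 0 * Y 2) + zr C (-268) * Y 0 ^+ 3),
      e 1 = zr C 57600 * (Y 0 * Y 1) & e 2 = zr C 250 * Y 2 + zr C 230 * Y 0 ^+ 2].
Proof. by rewrite /e /= !expr0 !expr1 !mulr1 !mul1r !addr0; split. Qed.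

(** Off the cubic, criticality in the plane X_3 = 0 makes the three invariants vanish. Euler's
    relations then put (X_0, X_1, X_2) in the kernel of their Jacobian matrix, which is invertible
    off the cubic. *)
Lemma plane_critical_tri (X : nat -> C) : X 3 = 0 -> X 0 != 0 ->
  (forall j, (j < 3)%N -> octic_deriv j X = 0) -> tri (X 0) (X 1) (X 2) = 0.
Proof.
move=> X3 X0 h; apply/eqP/negPn/negP => T0.
have grad0 k : (k < 3)%N -> peval (inv_at X) (nth (PC 0) plane_grad k) = 0.
  move=> lt_k; rewrite -(peqP _ (plane_gradE lt_k)) peval_subst -[RHS](critical_inv T0 h lt_k).
  apply: (@eq_peval_vars _ 4) => [|[|[|[|[|//]]]] _] //.
set p := inv_at X 0; set q := inv_at X 1; set r := inv_at X 2.
have [e1 e2 e3] := peval_plane_grad (inv_at X).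
rewrite (grad0 0%N) // -/p -/q -/r in e1; rewrite (grad0 1%N) // -/p -/q in e2.
rewrite (grad0 2%N) // -/p -/r in e3; move: e1 e2 e3 => /esym e1 /esym e2 /esym e3.
have [p0 q0 r0] := plane_invariants_zero e1 e2 e3.
(* The transpose of the Jacobian matrix, since Euler's relations sum over the variables. *)
pose m j k := peval X (pderiv j (basic_inv k)).
have := @cramer3 C m X; case=> [|k lt_k|x00 _ _]; last by rewrite x00 eqxx in X0.
  have -> : m 0 0 * (m 1 1 * m 2 2 - m 1 2 * m 2 1) + m 0 1 * (m 1 2 * m 2 0 - m 1 0 * m 2 2)
    + m 0 2 * (m 1 0 * m 2 1 - m 1 1 * m 2 0) = zr C (-96) * tri (X 0) (X 1) (X 2) ^+ 2.
    have e := peqP X jacobian3; rewrite peval_pdet3 in e.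
    have E : peval X (PM (PC (-96)) (PP (ptri (PV 0) (PV 1) (PV 2)) 2)) =
      zr C (-96) * peval X (ptri (PV 0) (PV 1) (PV 2)) ^+ 2 by [].
    rewrite E peval_ptri in e; transitivity
      (m 0 0 * (m 1 1 * m 2 2 - m 2 1 * m 1 2) + m 1 0 * (m 2 1 * m 0 2 - m 0 1 * m 2 2)
        + m 2 0 * (m 0 1 * m 1 2 - m 1 1 * m 0 2)); last exact: e.
    by move: m => m'; ring.
  by rewrite mulf_neq0 ?expf_neq0 //; exact: zr_neq0.
have := peqP X (inv_euler lt_k); rewrite [LHS]/= [RHS]/= => ->.
have -> : peval X (basic_inv k) = 0 by case: k lt_k => [|[|[|]]].
by rewrite mulr0.
Qed.

End Classification.

(** * Critical points on a coordinate line and the single orbit *)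

Section LinePoints.
Local Open Scope ring_scope.

Definition line_subst := nth (PC 0) [:: PV 0; PV 1].

(** The derivative in A of (A^2 + B^2)^2 (A^4 - 8 A^2 B^2 + B^4), the restriction of the octic to
    the line. *)
Definition line_deriv (A B : pexpr) :=
  PM (PM (PC 4) A) (PM (PA (PP A 2) (PP B 2))
    (PA (PM (PC 2) (PP A 4)) (PA (PM (PC (-11)) (PM (PP A 2) (PP B 2))) (PM (PC (-3)) (PP B 4))))).

Lemma line_deriv0 : peq 2 (psubst line_subst (pderiv 0 octic_expr)) (line_deriv (PV 0) (PV 1)).
Proof. by vm_compute. Qed.

Lemma line_deriv1 : peq 2 (psubst line_subst (pderiv 1 octic_expr)) (line_deriv (PV 1) (PV 0)).
Proof. by vm_compute. Qed.

#[local] Opaque octic_expr.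
Variable C : numClosedFieldType.

Lemma octic_deriv_line (e : pexpr) j (X : nat -> C) : peq 2 (psubst line_subst (pderiv j octic_expr)) e ->
  X 2 = 0 -> X 3 = 0 -> octic_deriv j X = peval X e.
Proof.
move=> je X2 X3; rewrite -(peqP X je) peval_subst.
apply: (@eq_peval_vars _ 4) => [|[|[|[|[|//]]]] _] //.
Qed.

Lemma peval_line_deriv (X : nat -> C) a b : peval X (line_deriv a b) =
  4%:R * peval X a * ((peval X a ^+ 2 + peval X b ^+ 2) *
   (2%:R * peval X a ^+ 4 - 11%:R * (peval X a ^+ 2 * peval X b ^+ 2) - 3%:R * peval X b ^+ 4)).
Proof.
have nat_zr n : n%:R = zr C (Z.of_nat n) by rewrite zr_nat.
rewrite !nat_zr /=; move: (peval X a) (peval X b) => x y.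
by rewrite (zrN _ 11) (zrN _ 3) !mulNr addrA.
Qed.

(** If a^2 + b^2 != 0, a zero coordinate forces the other to vanish too. Otherwise both quartic
    factors vanish; their difference is 5 (a^4 - b^4), so a^2 = b^2, and there the first one equals
    -12 b^4. *)
Lemma line_critical (a b : C) : a != 0 \/ b != 0 ->
  a * (octic_deriv 0 (quad a b 0 0)) = 0 -> b * (octic_deriv 1 (quad a b 0 0)) = 0 ->
  a ^+ 2 + b ^+ 2 = 0.
Proof.
move=> nz; rewrite (octic_deriv_line line_deriv0) // (octic_deriv_line line_deriv1) //.
rewrite !peval_line_deriv; move eX: (quad a b 0 0) => X.
have -> : peval X (PV 0) = a by rewrite -eX.
have -> : peval X (PV 1) = b by rewrite -eX.
move=> e0 e1 {eX}.
apply/eqP/negPn/negP => ab.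
have f0 : a ^+ 2 * (2%:R * a ^+ 4 - 11%:R * (a ^+ 2 * b ^+ 2) - 3%:R * b ^+ 4) = 0.
  apply: (mulfI ab); apply: (mulfI (_ : 4%:R != 0 :> C)); rewrite ?pnatr_eq0 // !mulr0 -[RHS]e0; ring.
have f1 : b ^+ 2 * (2%:R * b ^+ 4 - 11%:R * (b ^+ 2 * a ^+ 2) - 3%:R * a ^+ 4) = 0.
  rewrite addrC in ab.
  apply: (mulfI ab); apply: (mulfI (_ : 4%:R != 0 :> C)); rewrite ?pnatr_eq0 // !mulr0 -[RHS]e1; ring.
move: f0 f1 => /eqP; rewrite mulf_eq0 expf_eq0 /= => /orP[/eqP a0|/eqP f0].
  rewrite a0 !expr0n /= !mulr0 !subr0 mulrCA -exprD => /eqP.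
  rewrite mulf_eq0 pnatr_eq0 expf_eq0 /= => /eqP b0; move: ab; rewrite a0 b0 !expr0n.
  by rewrite addr0 eqxx.
move=> /eqP; rewrite mulf_eq0 expf_eq0 /= => /orP[/eqP b0|/eqP f1].
  move: f0; rewrite b0 !expr0n /= !mulr0 !subr0 => /eqP.
  rewrite mulf_eq0 pnatr_eq0 expf_eq0 /= => /eqP a0; move: ab; rewrite a0 b0 !expr0n.
  by rewrite addr0 eqxx.
have /eqP : (a ^+ 2 + b ^+ 2) * (5%:R * (a ^+ 2 - b ^+ 2)) = 0.
  by rewrite -[RHS](subrr 0) -{1}f0 -f1; ring.
rewrite mulf_eq0 (negPf ab) mulf_eq0 pnatr_eq0 /= => /eqP/subr0_eq e.
have /eqP : 12%:R * (b ^+ 2) ^+ 2 = 0.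
  have pow4 (x : C) : x ^+ 4 = (x ^+ 2) ^+ 2 by rewrite -exprM.
  by rewrite -[RHS]oppr0 -f0 !pow4 e; ring.
rewrite mulf_eq0 pnatr_eq0 expf_eq0 /= => /eqP b20.
by move: ab; rewrite e b20 addr0 eqxx.
Qed.

Variable w : C.
Hypothesis w_root : w ^+ 2 + w + 1 = 0.
Local Notation F24 := (F24 C).
Local Notation symmetry := (symmetry w).

Lemma move_third_zero a b c : singular_vec F24 (vec4 a b c 0) ->
  exists A, symmetry A /\ exists a' b', vec4 a b c 0 *m A = vec4 a' b' 0 0.
Proof.
move=> sx; have ss1 := symmetry_s1 w; have ss2 := symmetry_s2 w.
have [->|cn0] := eqVneq c 0.
  by exists 1%:M; split; [exact: symmetry_one|rewrite mulmx1; do 2!eexists].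
have [b0|bn0] := eqVneq b 0.
  by exists (s2 C); split=> //; rewrite mul_s2 b0 oppr0; do 2!eexists.
have [a0|an0] := eqVneq a 0.
  exists (s1 C *m s2 C); split; first exact: symmetry_mul.
  by rewrite mulmxA mul_s1 mul_s2 a0 !oppr0; do 2!eexists.
suff /(tri_move w_root)[A [sA _ _ [a' [b' e]]]] : tri (a ^+ 3) (b ^+ 3) (c ^+ 3) = 0.
  by exists A; split=> //; exists a', b'.
apply: (@plane_critical_tri _ (quad (a ^+ 3) (b ^+ 3) (c ^+ 3) (0 ^+ 3))).
- by rewrite /= expr0n.
- by rewrite /= expf_neq0.
move=> j lt_j; apply: (singular_octic_deriv sx) => //; first exact: ltnW.
by left; case: j lt_j => [|[|[|]]].
Qed.

Definition base_vec : 'rV[C]_4 := vec4 1 (- 'i) 0 0.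

(** The equation factors as b^3 = i a^3 or b^3 = -i a^3. As (-i)^3 = i, a cube root of unity in the
    second coordinate settles the first case, and exchanging a and b reduces the second to it. *)
Lemma line_vec_base a b : a != 0 \/ b != 0 -> a ^+ 6 + b ^+ 6 = 0 ->
  exists A, symmetry A /\ exists2 k, k != 0 & vec4 a b 0 0 *m A = k *: base_vec.
Proof.
move=> nz ab.
have a0 : a != 0.
  apply/eqP => a0; move: ab nz; rewrite a0 expr0n add0r => /eqP.
  by rewrite expf_eq0 /= => /eqP ->; rewrite eqxx => -[].
have b0 : b != 0.
  apply/eqP => b0; move/eqP: ab; rewrite b0 expr0n addr0 expf_eq0 /= => /eqP a0'.
  by rewrite a0' eqxx in a0.
have iC : ('i : C) ^+ 2 = -1 by exact: sqrCi.
have i3 : (- 'i : C) ^+ 3 = 'i by rewrite exprNn -signr_odd mulN1r exprS iC mulrN1 opprK.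
have direct c d : c != 0 -> d ^+ 3 = 'i * c ^+ 3 ->
    exists A, symmetry A /\ exists2 k, k != 0 & vec4 c d 0 0 *m A = k *: base_vec.
  move=> c0 e; have /cube_root_unity[z z3 e'] : (- 'i * c) ^+ 3 = d ^+ 3.
    by rewrite exprMn i3 e.
  exists (diag4 1 z 1 1); split; first by apply: symmetry_diag; rewrite ?expr1n.
  by exists c => //; rewrite mul_diag4 /base_vec scale_vec4 !mulr1 !mulr0 [d * z]mulrC -e' [c * _]mulrC.
have : (b ^+ 3 - 'i * a ^+ 3) * (b ^+ 3 + 'i * a ^+ 3) = 0.
  transitivity (b ^+ 6 - 'i ^+ 2 * a ^+ 6); first by ring.
  by rewrite iC mulN1r opprK addrC.
move/eqP; rewrite mulf_eq0 => /orP[/eqP/subr0_eq|/eqP/addr0_eq] e; first exact: direct.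
have [|A [sA [k k0 eA]]] := @direct b a b0.
  by rewrite -[b ^+ 3]opprK e mulrN mulrA -expr2 iC mulN1r opprK.
exists (s1 C *m A); split; first by apply: symmetry_mul => //; exact: symmetry_s1.
by exists k => //; rewrite mulmxA mul_s1 oppr0.
Qed.

Lemma singular_orbit x : singular_vec F24 x ->
  exists A, symmetry A /\ exists2 k, k != 0 & x *m A = k *: base_vec.
Proof.
move=> sx; have [A [sA [a [b [c eA]]]]] := move_fourth_zero w_root sx.
have := symmetry_singular w_root sA sx; rewrite eA => sA'.
have [B [sB [a' [b' eB]]]] := move_third_zero sA'.
have := symmetry_singular w_root sB sA'; rewrite eB => sB'.
have nz : a' != 0 \/ b' != 0.
  have [] := sB'; rewrite vec4_eq0 eqxx !andbT negb_and => /orP[] ? _ _; by [left|right].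
have h j : (j < 2)%N -> (quad a' b' 0 0 j) ^+ 3 *
    octic_deriv j (quad (a' ^+ 3) (b' ^+ 3) 0 0) = 0.
  move=> lt_j; have [->|nzj] := eqVneq (quad a' b' 0 0 j) 0.
    by rewrite expr0n mul0r.
  have := singular_octic_deriv sB' isT (leq_trans lt_j (isT : (2 <= 4)%N)) (or_introl nzj).
  by rewrite !expr0n /= => ->; rewrite mulr0.
have ab6 : a' ^+ 6 + b' ^+ 6 = 0.
  rewrite -[6%N]/(3 * 2)%N !exprM; apply: line_critical.
  - by rewrite !expf_eq0.
  - exact: (h 0%N).
  exact: (h 1%N).
have [D [sD eD]] := line_vec_base nz ab6.
exists (A *m B *m D); split; first by do 2!apply: symmetry_mul => //.
by rewrite !mulmxA eA eB.
Qed.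

End LinePoints.

(** * The list of 80 points and its verification over the integers with i and w *)

Section SingularList.
Local Open Scope ring_scope.

(* (a, b, c, d) stands for a + b i + (c + d i) w. *)
Definition gauss_eisenstein := (Z * Z * Z * Z)%type.

Definition kz (a b c d : Z) : gauss_eisenstein := (a, b, c, d).

Definition kadd (x y : gauss_eisenstein) : gauss_eisenstein :=
  let: (a, b, c, d) := x in let: (a', b', c', d') := y in
  kz (Z.add a a') (Z.add b b') (Z.add c c') (Z.add d d').

Definition kmul (x y : gauss_eisenstein) : gauss_eisenstein :=
  let: (a, b, c, d) := x in let: (a', b', c', d') := y in
  let pr := Z.sub (Z.mul a a') (Z.mul b b') in
  let pi := Z.add (Z.mul a b') (Z.mul b a') in
  let qr := Z.sub (Z.mul c c') (Z.mul d d') in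
  let qi := Z.add (Z.mul c d') (Z.mul d c') in
  let mr := Z.sub (Z.add (Z.mul a c') (Z.mul c a')) (Z.add (Z.mul b d') (Z.mul d b')) in
  let mi := Z.add (Z.add (Z.mul a d') (Z.mul d a')) (Z.add (Z.mul b c') (Z.mul c b')) in
  kz (Z.sub pr qr) (Z.sub pi qi) (Z.sub mr qr) (Z.sub mi qi).

Definition keq (x y : gauss_eisenstein) : bool :=
  let: (a, b, c, d) := x in let: (a', b', c', d') := y in
  [&& Z.eqb a a', Z.eqb b b', Z.eqb c c' & Z.eqb d d'].

Definition k0 := kz 0 0 0 0.

(* The product of the four conjugates is a nonzero integer. *)
Definition knz (x : gauss_eisenstein) : bool :=
  let: (a, b, c, d) := x in
  let y := kz a (Z.opp b) c (Z.opp d) in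
  let bar z := let: (a, b, c, d) := z : gauss_eisenstein in
    kz (Z.sub a c) (Z.sub b d) (Z.opp c) (Z.opp d) in
  let n := kmul (kmul x y) (bar (kmul x y)) in
  let: (e, f, g, h) := n in [&& ~~ Z.eqb e 0, Z.eqb f 0, Z.eqb g 0 & Z.eqb h 0].

Definition vz a0 a1 a2 a3 b0 b1 b2 b3 c0 c1 c2 c3 d0 d1 d2 d3 : seq gauss_eisenstein :=
  [:: kz a0 a1 a2 a3; kz b0 b1 b2 b3; kz c0 c1 c2 c3; kz d0 d1 d2 d3].

(** Each row is a vector x, four integers per coordinate; the listed point has the coordinates
    x_i^3. Row 0 is (1, -i, 0, 0). *)
Definition lifts : seq (seq gauss_eisenstein) :=
  [:: vz 1 0 0 0 0 (-1) 0 0 0 0 0 0 0 0 0 0;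
      vz 1 0 0 (-1) 0 (-1) 1 0 0 0 1 (-1) 0 0 0 0;
      vz 1 0 0 1 0 0 1 1 0 1 1 0 0 0 0 0;
      vz 0 0 1 1 0 1 1 0 1 0 0 1 0 0 0 0;
      vz 1 0 0 0 0 1 0 0 0 0 0 0 0 0 0 0;
      vz 1 0 0 0 0 0 0 0 0 (-1) 0 0 0 0 0 0;
      vz 1 0 0 1 0 1 1 0 0 0 1 1 0 0 0 0;
      vz 1 0 0 (-1) 0 0 1 (-1) 0 (-1) 1 0 0 0 0 0;
      vz 0 0 0 0 1 0 0 0 0 1 0 0 0 0 0 0;
      vz 0 0 1 1 1 0 0 1 0 1 1 0 0 0 0 0;
      vz 1 0 0 (-1) 0 1 (-1) 0 0 0 0 0 0 0 (-1) 1;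
      vz 1 0 0 1 0 0 (-1) (-1) 0 0 0 0 0 (-1) (-1) 0;
      vz 0 0 1 1 0 (-1) (-1) 0 0 0 0 0 (-1) 0 0 (-1);
      vz 1 0 0 0 0 0 0 0 0 1 0 0 0 0 0 0;
      vz 0 0 0 0 1 0 0 0 0 (-1) 0 0 0 0 0 0;
      vz 1 0 0 0 0 0 0 0 0 0 0 0 0 1 0 0;
      vz 1 0 0 1 0 (-1) (-1) 0 0 0 0 0 0 0 (-1) (-1);
      vz 1 0 0 (-1) 0 0 (-1) 1 0 0 0 0 0 1 (-1) 0;
      vz 0 0 0 0 1 0 0 0 0 0 0 0 0 1 0 0;
      vz 0 0 1 1 (-1) 0 0 (-1) 0 0 0 0 0 (-1) (-1) 0;
      vz 0 0 1 0 0 0 0 1 (-1) (-1) 0 0 1 (-1) 0 0;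
      vz 0 0 1 0 (-1) 1 0 0 0 0 0 (-1) (-1) (-1) 0 0;
      vz 1 1 0 0 0 0 (-1) 0 0 0 0 (-1) (-1) 1 0 0;
      vz 1 0 0 (-1) 0 0 0 0 0 1 (-1) 0 0 0 1 (-1);
      vz 1 0 0 1 (-1) 0 0 0 0 (-1) 0 0 (-1) 0 0 1;
      vz 1 0 0 0 0 1 0 0 (-1) 0 0 (-1) 1 0 0 (-1);
      vz 1 0 0 0 0 1 (-1) 0 0 (-1) 0 0 0 (-1) (-1) 0;
      vz 1 0 0 1 0 0 0 0 0 0 (-1) (-1) 0 1 1 0;
      vz 1 0 0 0 (-1) 0 0 1 0 (-1) 0 0 (-1) 0 0 (-1);
      vz 1 0 0 (-1) 0 1 0 0 (-1) 0 0 0 1 0 0 1;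
      vz 1 0 0 0 0 1 0 0 0 (-1) (-1) 0 0 (-1) 1 0;
      vz 0 0 1 1 0 0 0 0 0 (-1) (-1) 0 1 0 0 1;
      vz 1 0 0 0 0 0 0 0 0 0 0 0 0 (-1) 0 0;
      vz 0 0 0 0 1 0 0 0 0 0 0 0 0 (-1) 0 0;
      vz 1 0 0 0 0 0 1 0 0 0 1 0 0 1 0 (-1);
      vz 0 0 1 0 0 0 0 (-1) (-1) 1 0 0 1 1 0 0;
      vz 0 0 1 0 (-1) (-1) 0 0 0 0 0 1 (-1) 1 0 0;
      vz 1 1 0 0 0 0 0 (-1) 0 0 (-1) 0 1 (-1) 0 0;
      vz 1 0 0 1 0 0 0 0 0 (-1) (-1) 0 0 0 1 1;
      vz 1 0 0 (-1) (-1) 0 0 0 0 1 0 0 (-1) 0 0 (-1);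
      vz 1 0 0 0 0 (-1) 0 0 (-1) 0 0 1 1 0 0 1;
      vz 1 0 0 0 0 (-1) (-1) 0 0 1 0 0 0 1 (-1) 0;
      vz 1 0 0 (-1) 0 0 0 0 0 0 (-1) 1 0 (-1) 1 0;
      vz 0 0 0 0 0 0 0 0 1 0 0 0 0 (-1) 0 0;
      vz 1 0 0 0 (-1) 0 0 (-1) 0 1 0 0 (-1) 0 0 1;
      vz 1 0 0 1 0 (-1) 0 0 (-1) 0 0 0 1 0 0 (-1);
      vz 1 0 0 0 0 (-1) 0 0 0 1 (-1) 0 0 1 1 0;
      vz 0 0 1 1 0 0 0 0 (-1) 0 0 (-1) 0 1 1 0;
      vz 0 0 0 0 1 0 0 1 0 (-1) (-1) 0 0 0 (-1) (-1);
      vz 0 0 1 0 1 (-1) 0 0 1 1 0 0 0 0 0 1;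
      vz 1 1 0 0 0 0 1 0 1 (-1) 0 0 0 0 0 1;
      vz 0 0 0 0 1 0 0 (-1) 0 1 (-1) 0 0 0 (-1) 1;
      vz 0 0 0 0 0 0 1 1 (-1) 0 0 (-1) 0 (-1) (-1) 0;
      vz 1 0 0 1 1 0 0 0 1 0 0 (-1) 0 1 0 0;
      vz 1 0 0 0 0 (-1) 1 0 0 1 1 0 0 0 0 1;
      vz 0 0 0 0 1 0 0 1 0 0 (-1) (-1) 0 (-1) (-1) 0;
      vz 0 0 0 0 1 0 0 (-1) 0 0 (-1) 1 0 1 (-1) 0;
      vz 1 0 0 0 1 0 0 (-1) 1 0 0 1 0 1 0 0;
      vz 1 0 0 (-1) 0 (-1) 0 0 (-1) 0 0 (-1) 1 0 0 0;
      vz 0 0 0 0 0 0 1 1 0 (-1) (-1) 0 (-1) 0 0 (-1);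
      vz 1 0 0 0 0 0 1 0 0 0 1 0 0 (-1) 0 1;
      vz 0 0 0 0 0 0 0 0 1 0 0 0 0 1 0 0;
      vz 1 0 0 0 0 0 (-1) 0 0 (-1) 0 1 0 0 (-1) 0;
      vz 0 0 1 0 1 1 0 0 1 (-1) 0 0 0 0 0 (-1);
      vz 0 0 1 1 0 0 0 1 (-1) 1 0 0 1 0 0 0;
      vz 1 0 0 (-1) 1 0 0 0 1 0 0 1 0 (-1) 0 0;
      vz 1 0 0 0 0 1 1 0 0 (-1) 1 0 0 0 0 (-1);
      vz 1 0 0 0 1 0 0 1 1 0 0 (-1) 0 (-1) 0 0;
      vz 1 0 0 1 0 1 0 0 (-1) 0 0 1 1 0 0 0;
      vz 1 0 (-1) 0 0 1 0 0 0 0 0 (-1) 0 0 0 (-1);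
      vz 1 0 0 1 1 0 0 (-1) 1 0 0 0 0 (-1) 0 0;
      vz 1 0 0 1 (-1) 0 0 1 0 1 0 0 0 0 (-1) 0;
      vz 1 0 0 0 0 1 0 (-1) 0 0 (-1) 0 0 0 1 0;
      vz 0 0 1 1 0 0 1 (-1) 1 0 0 0 0 (-1) 0 0;
      vz 1 0 0 (-1) (-1) 0 0 (-1) 0 (-1) 0 0 (-1) 0 0 0;
      vz 0 0 1 1 (-1) 1 0 0 0 0 0 1 (-1) 0 0 0;
      vz 1 0 0 (-1) 1 0 0 1 1 0 0 0 0 1 0 0;
      vz 1 0 0 0 0 0 (-1) 0 0 1 0 (-1) 0 0 (-1) 0;
      vz 1 0 0 0 0 (-1) 0 1 0 0 (-1) 0 0 0 1 0;
      vz 1 0 (-1) 0 0 (-1) 0 0 0 1 0 0 0 0 0 1].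

(** Row m gives the indices of the images of point m under the nine twisted reflections and then the
    three signed permutations. The entries are only a certificate, checked by [moves_ok]. *)
Definition move_table : seq (seq nat) :=
  [:: [:: 1; 1; 1; 2; 2; 2; 3; 3; 3; 4; 5; 4]; [:: 6; 1; 4; 2; 5; 7; 8; 9; 3; 6; 7; 10];
      [:: 7; 1; 8; 2; 4; 9; 5; 6; 3; 9; 6; 11]; [:: 9; 1; 5; 2; 8; 6; 4; 7; 3; 7; 9; 12];
      [:: 6; 6; 6; 7; 7; 7; 9; 9; 9; 0; 13; 0]; [:: 7; 6; 9; 7; 6; 9; 7; 6; 9; 14; 0; 15];
      [:: 1; 6; 0; 7; 13; 2; 14; 3; 9; 1; 2; 16]; [:: 2; 6; 14; 7; 0; 3; 13; 1; 9; 3; 1; 17];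
      [:: 9; 6; 7; 7; 9; 6; 6; 7; 9; 13; 14; 18]; [:: 3; 6; 13; 7; 14; 1; 0; 2; 9; 2; 3; 19];
      [:: 20; 20; 20; 21; 21; 21; 22; 22; 22; 16; 23; 1];
      [:: 24; 24; 24; 25; 25; 25; 26; 26; 26; 19; 27; 2];
      [:: 28; 28; 28; 29; 29; 29; 30; 30; 30; 17; 31; 3];
      [:: 2; 1; 3; 2; 1; 3; 2; 1; 3; 8; 4; 32]; [:: 3; 1; 2; 2; 3; 1; 1; 2; 3; 5; 8; 33];
      [:: 34; 34; 34; 34; 34; 34; 34; 34; 34; 33; 32; 5];
      [:: 35; 35; 35; 36; 36; 36; 37; 37; 37; 10; 38; 6];
      [:: 39; 39; 39; 40; 40; 40; 41; 41; 41; 12; 42; 7];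
      [:: 34; 34; 34; 34; 34; 34; 34; 34; 34; 32; 43; 8];
      [:: 44; 44; 44; 45; 45; 45; 46; 46; 46; 11; 47; 9];
      [:: 35; 20; 16; 21; 23; 36; 48; 37; 22; 35; 36; 35];
      [:: 36; 20; 48; 21; 16; 37; 23; 35; 22; 37; 35; 49];
      [:: 37; 20; 23; 21; 48; 35; 16; 36; 22; 36; 37; 50];
      [:: 36; 35; 37; 36; 35; 37; 36; 35; 37; 51; 10; 42];
      [:: 44; 24; 19; 25; 27; 45; 52; 46; 26; 44; 45; 53];
      [:: 45; 24; 52; 25; 19; 46; 27; 44; 26; 46; 44; 40];
      [:: 46; 24; 27; 25; 52; 44; 19; 45; 26; 45; 46; 54];
      [:: 45; 44; 46; 45; 44; 46; 45; 44; 46; 55; 11; 38];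
      [:: 39; 28; 17; 29; 31; 40; 56; 41; 30; 39; 40; 57];
      [:: 40; 28; 56; 29; 17; 41; 31; 39; 30; 41; 39; 58];
      [:: 41; 28; 31; 29; 56; 39; 17; 40; 30; 40; 41; 46];
      [:: 40; 39; 41; 40; 39; 41; 40; 39; 41; 59; 12; 47];
      [:: 60; 60; 60; 60; 60; 60; 60; 60; 60; 18; 15; 13];
      [:: 60; 60; 60; 60; 60; 60; 60; 60; 60; 15; 61; 14];
      [:: 60; 34; 33; 34; 32; 60; 43; 60; 34; 60; 60; 62];
      [:: 20; 35; 10; 36; 38; 21; 51; 22; 37; 20; 21; 20];
      [:: 21; 35; 51; 36; 10; 22; 38; 20; 37; 22; 20; 63];
      [:: 22; 35; 38; 36; 51; 20; 10; 21; 37; 21; 22; 64];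
      [:: 21; 20; 22; 21; 20; 22; 21; 20; 22; 48; 16; 27];
      [:: 28; 39; 12; 40; 42; 29; 59; 30; 41; 28; 29; 65];
      [:: 29; 39; 59; 40; 12; 30; 42; 28; 41; 30; 28; 25];
      [:: 30; 39; 42; 40; 59; 28; 12; 29; 41; 29; 30; 66];
      [:: 29; 28; 30; 29; 28; 30; 29; 28; 30; 56; 17; 23];
      [:: 60; 60; 60; 60; 60; 60; 60; 60; 60; 61; 18; 61];
      [:: 24; 44; 11; 45; 47; 25; 55; 26; 46; 24; 25; 67];
      [:: 25; 44; 55; 45; 11; 26; 47; 24; 46; 26; 24; 68];
      [:: 26; 44; 47; 45; 55; 24; 11; 25; 46; 25; 26; 30];
      [:: 25; 24; 26; 25; 24; 26; 25; 24; 26; 52; 19; 31];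
      [:: 37; 35; 36; 36; 37; 35; 35; 36; 37; 38; 51; 55];
      [:: 69; 70; 58; 65; 54; 62; 71; 72; 67; 64; 63; 21];
      [:: 72; 70; 54; 65; 71; 69; 58; 62; 67; 63; 73; 22];
      [:: 22; 20; 21; 21; 22; 20; 20; 21; 22; 23; 48; 56];
      [:: 46; 44; 45; 45; 46; 44; 44; 45; 46; 47; 55; 59];
      [:: 50; 62; 66; 72; 74; 49; 68; 75; 69; 67; 70; 24];
      [:: 63; 76; 72; 53; 69; 73; 62; 64; 57; 68; 66; 26];
      [:: 26; 24; 25; 25; 26; 24; 24; 25; 26; 27; 52; 48];
      [:: 41; 39; 40; 40; 41; 39; 39; 40; 41; 42; 59; 51];
      [:: 49; 62; 68; 72; 66; 75; 74; 50; 69; 65; 67; 28];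
      [:: 64; 76; 69; 53; 62; 63; 72; 73; 57; 66; 74; 29];
      [:: 30; 28; 29; 29; 30; 28; 28; 29; 30; 31; 56; 52];
      [:: 34; 60; 18; 60; 15; 34; 61; 34; 60; 34; 34; 77];
      [:: 34; 34; 34; 34; 34; 34; 34; 34; 34; 43; 33; 43];
      [:: 65; 64; 68; 63; 66; 67; 74; 70; 73; 77; 78; 34];
      [:: 79; 76; 68; 53; 66; 77; 74; 78; 57; 50; 49; 36];
      [:: 57; 68; 77; 66; 78; 76; 79; 53; 74; 49; 75; 37];
      [:: 64; 77; 54; 78; 71; 63; 58; 73; 79; 57; 76; 39];
      [:: 49; 70; 78; 65; 79; 75; 77; 50; 67; 58; 54; 41];
      [:: 63; 77; 58; 78; 54; 73; 71; 64; 79; 53; 57; 44];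
      [:: 50; 70; 79; 65; 77; 49; 78; 75; 67; 54; 71; 45];
      [:: 70; 64; 66; 63; 74; 65; 68; 67; 73; 78; 79; 79];
      [:: 73; 77; 71; 78; 58; 64; 54; 63; 79; 76; 53; 71];
      [:: 73; 76; 62; 53; 72; 64; 69; 63; 57; 74; 68; 70];
      [:: 70; 63; 68; 73; 66; 65; 74; 67; 64; 79; 77; 78];
      [:: 76; 74; 77; 68; 78; 53; 79; 57; 66; 75; 50; 75];
      [:: 75; 70; 77; 65; 78; 50; 79; 49; 67; 71; 58; 76];
      [:: 67; 54; 69; 71; 62; 70; 72; 65; 58; 73; 64; 73];
      [:: 75; 62; 74; 72; 68; 50; 66; 49; 69; 70; 65; 74];
      [:: 53; 50; 58; 49; 54; 57; 71; 76; 75; 62; 72; 60];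
      [:: 76; 49; 58; 75; 54; 53; 71; 57; 50; 69; 62; 72];
      [:: 54; 76; 50; 53; 49; 71; 75; 58; 57; 72; 69; 69]]%N.
Definition lift_at m := nth [::] lifts m.
Definition kcube x := kmul (kmul x x) x.
Definition cubes_at m := map kcube (lift_at m).

Definition kpow_w t := nth k0 [:: kz 1 0 0 0; kz 0 0 1 0; kz (-1) 0 (-1) 0] t.

(* Three times the reflection of the lift, twisted by (1, w^t1, w^t2, 1) with t = 3 t1 + t2. *)
Definition reflected t (u : seq gauss_eisenstein) : seq gauss_eisenstein :=
  let a := nth k0 u 0 in let b := kmul (kpow_w (t %/ 3)) (nth k0 u 1) in
  let c := kmul (kpow_w (t %% 3)) (nth k0 u 2) in
  let s := kmul (kz (-1) 0 1 0) (kadd (kadd a b) c) in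
  let f x := kadd (kmul (kz 3 0 0 0) x) s in
  [:: f a; f b; f c; kmul (kz 3 0 0 0) (nth k0 u 3)].

Definition kneg x := kmul (kz (-1) 0 0 0) x.

Definition signed_perm j (u : seq gauss_eisenstein) : seq gauss_eisenstein :=
  let e := nth k0 u in
  nth [::] [:: [:: e 1; e 0; e 2; kneg (e 3)]; [:: e 0; e 2; e 1; kneg (e 3)];
               [:: kneg (e 0); e 1; e 3; e 2]] j.

Definition proportional (u v : seq gauss_eisenstein) : bool :=
  all (fun i => all (fun j => keq (kmul (nth k0 u i) (nth k0 v j)) (kmul (nth k0 u j) (nth k0 v i)))
    (iota 0 i)) (iota 0 4).

Definition target m t := nth 0%N (nth [::] move_table m) t.

(** A reflection acts on the lift, whose image is then cubed. The signed permutations commute with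
    cubing and act on the cubes directly. *)
Definition move_ok m t := (target m t < 80)%N &&
  proportional (if (t < 9)%N then map kcube (reflected t (lift_at m))
                else signed_perm (t - 9) (cubes_at m)) (cubes_at (target m t)).

Definition pivot m := find knz (cubes_at m).

Lemma moves_ok : all (fun m => all (move_ok m) (iota 0 12)) (iota 0 80).
Proof. by vm_compute. Qed.

(** The least index from which m is reached in one move. That it is smaller than m allows induction
    from point 0. *)
Definition parent m := find (fun p => m \in nth [::] move_table p) (iota 0 80).

Lemma reachable : all (fun m => (parent m < m)%N) (iota 1 79).
Proof. by vm_compute. Qed.

Lemma pivots_ok : all (fun m => [&& (size (lift_at m) == 4)%N, (pivot m < 4)%N &
  all (fun x => keq x k0 || knz x) (lift_at m)]) (iota 0 80).
Proof. by vm_compute. Qed.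

(** A nonzero 2 by 2 minor shows that two points are distinct. *)
Definition apart m n := has (fun i => has (fun j =>
  knz (kadd (kmul (nth k0 (cubes_at m) i) (nth k0 (cubes_at n) j))
            (kneg (kmul (nth k0 (cubes_at m) j) (nth k0 (cubes_at n) i))))) (iota 0 i)) (iota 0 4).

Lemma apart_ok : all (fun m => all (fun n => apart m n) (iota 0 m)) (iota 0 80).
Proof. by vm_compute. Qed.

Variable C : numClosedFieldType.
Variable w : C.
Hypothesis w_root : w ^+ 2 + w + 1 = 0.
Local Notation F24 := (F24 C).
Local Notation symmetry := (symmetry w).

Definition kphi (x : gauss_eisenstein) : C := let: (a, b, c, d) := x in
  zr C a + zr C b * 'i + (zr C c + zr C d * 'i) * w.

Lemma kphiD x y : kphi (kadd x y) = kphi x + kphi y.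
Proof.
by case: x y => [[[a b] c] d] [[[a' b'] c'] d']; rewrite /= !zrD; ring.
Qed.

(** The two sides differ by multiples of w^2 + w + 1 and i^2 + 1, added explicitly as P and Q. *)
Lemma kphiM x y : kphi (kmul x y) = kphi x * kphi y.
Proof.
case: x y => [[[a b] c] d] [[[a' b'] c'] d']; rewrite /= /Z.sub !(zrD, zrN, zrM).
have i2 : ('i : C) ^+ 2 = -1 by exact: sqrCi.
move: ('i : C) i2 => i i2.
set A := zr C a; set B := zr C b; set D := zr C c; set E := zr C d.
set A' := zr C a'; set B' := zr C b'; set D' := zr C c'; set E' := zr C d'.
pose P := (D * D' + D * E' * i + E * D' * i + i ^+ 2 * E * E').
pose Q := B * B' + (B * E' + E * B') * w - (1 + w) * (E * E').
rewrite -[RHS](subr0) -[X in _ = _ - X](mulr0 P) -w_root.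
rewrite -[RHS](subr0) -[X in _ = _ - X](mulr0 Q) -[in X in _ = _ - X](subrr (-1)).
by rewrite -{1}i2 /P /Q; ring.
Qed.

End SingularList.

(** * The list is stable under the symmetries *)

Section SingularListProof.
Local Open Scope ring_scope.
#[local] Opaque octic_expr.
Variable C : numClosedFieldType.
Variable w : C.
Hypothesis w_root : w ^+ 2 + w + 1 = 0.
Local Notation F24 := (F24 C).
Local Notation symmetry := (symmetry w).
Local Notation kphi := (kphi w).

Lemma kphi_eisenstein a b : kphi (kz a 0 b 0) = zr C a + zr C b * w.
Proof. by rewrite /= !zr0 !mul0r !addr0. Qed.

Lemma kphi_int a : kphi (kz a 0 0 0) = zr C a.
Proof. by rewrite kphi_eisenstein zr0 mul0r addr0. Qed.

Lemma kphi0 : kphi k0 = 0. Proof. exact: kphi_int. Qed.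

Lemma kphiN x : kphi (kneg x) = - kphi x.
Proof. by rewrite /kneg kphiM // kphi_int (zrN _ 1) zr1 mulN1r. Qed.

Lemma keqP x y : keq x y -> x = y.
Proof.
case: x y => [[[a b] c] d] [[[a' b'] c'] d'] /and4P[].
by move=> /Z.eqb_eq -> /Z.eqb_eq -> /Z.eqb_eq -> /Z.eqb_eq ->.
Qed.

Lemma knzP x : knz x -> kphi x != 0.
Proof.
case: x => [[[a b] c] d]; rewrite /knz.
set y := kz a _ c _; set z := kmul (kmul _ y) _.
case ez: z => [[[e f] g] h] /and4P[e0 /Z.eqb_eq f0 /Z.eqb_eq g0 /Z.eqb_eq h0].
apply: contraNneq (zr_neq0 C (negbTE e0)) => x0.
have : kphi z = 0 by rewrite /z kphiM // kphiM // x0 !mul0r.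
by rewrite ez f0 g0 h0 kphi_int => ->.
Qed.

Definition kvec (u : seq gauss_eisenstein) (i : nat) : C := kphi (nth k0 u i).

Lemma kcubeE x : kphi (kcube x) = kphi x ^+ 3.
Proof. by rewrite /kcube !kphiM // !exprS expr0 mulr1 mulrA. Qed.

Lemma kvec_cubes u i : kvec (map kcube u) i = kvec u i ^+ 3.
Proof.
rewrite /kvec; have [lt_i|le_i] := ltnP i (size u).
  by rewrite (nth_map k0) // kcubeE.
by rewrite !nth_default ?size_map // kphi0 expr0n.
Qed.

Lemma proportionalP u v i j : proportional u v -> (i < 4)%N -> (j < 4)%N ->
  kvec u i * kvec v j = kvec u j * kvec v i.
Proof.
move=> /allP uv; wlog lt_ji : i j / (j < i)%N => [h lt_i lt_j|lt_i lt_j].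
  have [lt|lt|->//] := ltngtP j i; first exact: h.
  by symmetry; apply: h.
have := uv i; rewrite mem_iota => /(_ lt_i)/allP/(_ j).
by rewrite mem_iota => /(_ lt_ji)/keqP; rewrite /kvec -!kphiM // => ->.
Qed.

Definition cubes m i : C := kvec (cubes_at m) i.
Definition lift_vec m : 'rV[C]_4 :=
  vec4 (kvec (lift_at m) 0) (kvec (lift_at m) 1) (kvec (lift_at m) 2) (kvec (lift_at m) 3).

Lemma coords_lift m i : (i < 4)%N -> coords (lift_vec m) i = kvec (lift_at m) i.
Proof. by move=> lt_i; rewrite coords_vec4 //; case: i lt_i => [|[|[|[|]]]]. Qed.

Lemma cubesE m i : cubes m i = kvec (lift_at m) i ^+ 3.
Proof. exact: kvec_cubes. Qed.

Lemma pivotP m : (m < 80)%N -> (pivot m < 4)%N /\ cubes m (pivot m) != 0.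
Proof.
move=> lt_m; have := allP pivots_ok m; rewrite mem_iota => /(_ lt_m)/and3P[/eqP sz lt _].
split=> //; apply: knzP; apply: nth_find; rewrite has_find.
by rewrite -/(pivot m) size_map sz.
Qed.

Lemma proportional_cubes u m : (m < 80)%N -> proportional u (cubes_at m) ->
  exists c, forall i, (i < 4)%N -> kvec u i = c * cubes m i.
Proof.
move=> lt_m uv; have [lt_p nz] := pivotP lt_m.
exists (kvec u (pivot m) / cubes m (pivot m)) => i lt_i.
apply: (mulIf nz); rewrite [RHS]mulrAC divfK //.
exact: proportionalP uv _ _.
Qed.

Definition listed_cubes (X : nat -> C) := exists2 m, (m < 80)%N &
  exists c, forall i, (i < 4)%N -> X i = c * cubes m i.

Definition cubes_of (x : 'rV[C]_4) i := coords x i ^+ 3.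

Lemma cubes_of_scale a (v : 'rV[C]_4) i : cubes_of (a *: v) i = a ^+ 3 * cubes_of v i.
Proof. by rewrite /cubes_of /coords mxE exprMn. Qed.

Lemma cubes_of_diag a b c d (v : 'rV[C]_4) i : a ^+ 3 = 1 -> b ^+ 3 = 1 -> c ^+ 3 = 1 ->
  d ^+ 3 = 1 -> (i < 4)%N -> cubes_of (v *m diag4 a b c d) i = cubes_of v i.
Proof.
move=> ha hb hc hd lt_i; have [x [y [z [t ->]]]] := vec4P v.
rewrite mul_diag4 /cubes_of !coords_vec4 //.
by case: i lt_i => [|[|[|[|//]]]] _; rewrite /quad /= exprMn ?ha ?hb ?hc ?hd mulr1.
Qed.

Lemma moveP m t : (m < 80)%N -> (t < 12)%N -> move_ok m t.
Proof.
move=> lt_m lt_t; have := allP moves_ok m; rewrite mem_iota => /(_ lt_m)/allP/(_ t).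
by rewrite mem_iota; apply.
Qed.

Lemma cube_unity z : z ^+ 3 = 1 -> exists2 t, (t < 3)%N & z = kphi (kpow_w t).
Proof.
move=> z3; have : (z - 1) * ((z - w) * (z - w ^+ 2)) = 0.
  transitivity (z ^+ 3 - 1 - (w ^+ 3 - 1) + (w ^+ 2 + w + 1) * (w * z - z ^+ 2)); first by ring.
  by rewrite z3 (w_cube w_root) w_root !subrr mul0r addr0.
have w2 : w ^+ 2 = - 1 - w by apply/eqP; rewrite -subr_eq0 opprD !opprK addrA addrAC w_root.
move/eqP; rewrite !mulf_eq0 !subr_eq0 => /orP[/eqP ->|/orP[]/eqP ->].
- by exists 0%N; rewrite // kphi_int zr1.
- by exists 1%N; rewrite // kphi_eisenstein zr1 zr0 mul1r add0r.
by exists 2%N; rewrite // kphi_eisenstein (zrN _ 1) zr1 mulN1r.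
Qed.

Lemma reflected_vec u a b c d t t' t'' : (t' < 3)%N -> (t'' < 3)%N -> t = (3 * t' + t'')%N ->
  a = kvec u 0 -> b = kphi (kpow_w t') * kvec u 1 -> c = kphi (kpow_w t'') * kvec u 2 ->
  d = kvec u 3 ->
  forall i, (i < 4)%N -> kvec (reflected t u) i = 3%:R * coords (vec4 a b c d *m refl w) i.
Proof.
move=> lt' lt'' tE aE bE cE dE i lt_i.
have [q r] : (t %/ 3)%N = t' /\ (t %% 3)%N = t''.
  by rewrite tE mulnC divnMDl // divn_small // addn0 modnMDl modn_small.
rewrite mul_vec4_mat4 coords_vec4 // /=; set v := _ / _.
have wE : w = 1 + 3%:R * v by rewrite /v mulrC divfK ?natr3_neq0 // addrC subrK.
have k3 : kphi (kz 3 0 0 0) = 3%:R.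
  by rewrite kphi_int -[3%:R]zr_nat.
have kw : kphi (kz (-1) 0 1 0) = 3%:R * v.
  by rewrite kphi_eisenstein (zrN _ 1) zr1 mul1r {1}wE addKr.
have fE y s : kphi (kadd (kmul (kz 3 0 0 0) y) s) = 3%:R * kphi y + kphi s.
  by rewrite kphiD kphiM // k3.
have sE x y z : kphi (kmul (kz (-1) 0 1 0) (kadd (kadd x y) z)) =
    3%:R * v * (kphi x + kphi y + kphi z) by rewrite kphiM // kw !kphiD.
rewrite /kvec /reflected q r {q r}.
have bE' : b = kphi (kmul (kpow_w t') (nth k0 u 1)) by rewrite kphiM.
have cE' : c = kphi (kmul (kpow_w t'') (nth k0 u 2)) by rewrite kphiM.
rewrite /kvec in aE dE; case: i lt_i => [|[|[|[|//]]]] _.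
- apply: etrans (fE _ _) _; rewrite sE -bE' -cE' -aE /quad /=; ring.
- by apply: etrans (fE _ _) _; rewrite sE -bE' -cE' -aE /quad /=; ring.
- by apply: etrans (fE _ _) _; rewrite sE -bE' -cE' -aE /quad /=; ring.
by apply: etrans (kphiM _ _ _) _; rewrite // k3 -dE /quad /=; ring.
Qed.

(** The cubes determine x up to a scalar and cube roots of unity. One root is absorbed in the scalar
    and the one on the fourth coordinate commutes with [refl], so the nine twists of the lift in the
    table cover all cases. *)
Lemma listed_refl x : listed_cubes (cubes_of x) -> listed_cubes (cubes_of (x *m refl w)).
Proof.
move=> [m lt_m [c xc]]; pose k := 3.-root c.
have k3 : k ^+ 3 = c by rewrite rootCK.
have xi i : (i < 4)%N -> exists2 z, z ^+ 3 = 1 & coords x i = z * (k * kvec (lift_at m) i).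
  by move=> lt_i; apply: cube_root_unity; rewrite exprMn k3 -cubesE -xc.
have [[z0 z03 e0] [z1 z13 e1]] := (xi 0%N isT, xi 1%N isT).
have [[z2 z23 e2] [z3 z33 e3]] := (xi 2%N isT, xi 3%N isT).
have z0n0 : z0 != 0 by apply/eqP => z00; move/eqP: z03; rewrite z00 expr0n eq_sym oner_eq0.
have unity z : z ^+ 3 = 1 -> (z / z0) ^+ 3 = 1 by move=> z3'; rewrite expr_div_n z3' z03 divr1.
have [t1 lt1 E1] := cube_unity (unity _ z13); have [t2 lt2 E2] := cube_unity (unity _ z23).
pose t := (3 * t1 + t2)%N.
have lt_t : (t < 9)%N by rewrite /t; move: lt1 lt2; clear; case: t1 => [|[|[|]]]; case: t2 => [|[|[|]]].
have := moveP lt_m (leq_trans lt_t (isT : (9 <= 12)%N)).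
rewrite /move_ok lt_t => /andP[lt_n /(proportional_cubes lt_n)[c' rc]].
exists (target m t) => //; exists ((k * z0 / 3%:R) ^+ 3 * c') => i lt_i.
pose y : 'rV[C]_4 := vec4 (kvec (lift_at m) 0) (kphi (kpow_w t1) * kvec (lift_at m) 1)
  (kphi (kpow_w t2) * kvec (lift_at m) 2) (kvec (lift_at m) 3).
have xE : x = (k * z0) *: (y *m diag4 1 1 1 (z3 / z0)).
  rewrite (vec4_eta x) e0 e1 e2 e3 mul_diag4 scale_vec4 -E1 -E2.
  have twist z u : z * (k * u) = k * z0 * (z / z0 * u) by field.
  by congr vec4; rewrite ?mulr1; [ring|exact: twist|exact: twist|rewrite twist [_ * (z3 / z0)]mulrC].
have comm : diag4 1 1 1 (z3 / z0) *m refl w = refl w *m diag4 1 1 1 (z3 / z0).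
  apply: eq_mulmx_vec4 => a b c0 d; rewrite !mulmxA mul_diag4 !mulr1.
  have [u [d1 [d2 E]]] := mean_vec4 a b c0 (d * (z3 / z0)); rewrite E.
  have [_ _ _ _] := vec4_eq E; have [-> -> -> _] := vec4_eq E.
  by rewrite !mul_refl mul_diag4 !mulr1.
rewrite -mulrA -rc // kvec_cubes -exprMn xE -scalemxAl -mulmxA comm mulmxA.
rewrite cubes_of_scale cubes_of_diag ?expr1n ?unity // /cubes_of -exprMn; congr (_ ^+ _).
rewrite (@reflected_vec _ _ _ _ _ _ t1 t2 lt1 lt2 erefl erefl erefl erefl erefl) //.
by field.
Qed.

Lemma eq_listed X Y : (forall i, (i < 4)%N -> X i = Y i) -> listed_cubes X -> listed_cubes Y.
Proof.
by move=> XY [m lt_m [c Xc]]; exists m => //; exists c => i lt_i; rewrite -XY // Xc.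
Qed.

Definition sign_mx j : 'M[C]_4 := nth 1%:M [:: s1 C; s2 C; s3 C] j.

Lemma symmetry_sign j : (j < 3)%N -> symmetry (sign_mx j).
Proof.
case: j => [|[|[|//]]] _; [exact: symmetry_s1|exact: symmetry_s2|exact: symmetry_s3].
Qed.

Lemma cubes_sign j m x c i : (j < 3)%N -> (i < 4)%N ->
  (forall k, (k < 4)%N -> cubes_of x k = c * cubes m k) ->
  cubes_of (x *m sign_mx j) i = c * kvec (signed_perm j (cubes_at m)) i.
Proof.
have cubeN y : (- y) ^+ 3 = - y ^+ 3 :> C by rewrite exprNn -signr_odd mulN1r.
move=> lt_j lt_i xc; have [x0 [x1 [x2 [x3 ex]]]] := vec4P x.
have [c0 [c1 [c2 c3]]] := (xc 0%N isT, (xc 1%N isT, (xc 2%N isT, xc 3%N isT))).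
move: c0 c1 c2 c3; rewrite ex /cubes_of !coords_vec4 // /quad /= => c0 c1 c2 c3.
case: j lt_j => [|[|[|//]]] _; rewrite /sign_mx [nth _ _ _]/= ?mul_s1 ?mul_s2 ?mul_s3 coords_vec4 //;
  by case: i lt_i => [|[|[|[|//]]]] _; rewrite /kvec /quad /= -?/(kneg _) ?kphiN ?cubeN ?c0 ?c1 ?c2 ?c3 ?mulrN.
Qed.

Lemma cubes_sign_target j m x c : (j < 3)%N -> (m < 80)%N ->
  (forall k, (k < 4)%N -> cubes_of x k = c * cubes m k) ->
  (target m (9 + j) < 80)%N /\ exists c', forall i, (i < 4)%N ->
    cubes_of (x *m sign_mx j) i = c' * cubes (target m (9 + j)) i.
Proof.
move=> lt_j lt_m xc; have lt_t : (9 + j < 12)%N by rewrite ltn_add2l.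
have := moveP lt_m lt_t; rewrite /move_ok addKn (_ : (9 + j < 9)%N = false); last by rewrite ltnNge leq_addr.
set u := signed_perm _ _; rewrite [if false then _ else u]/=.
move=> /andP[lt_n /(proportional_cubes lt_n)[c' sc]]; split=> //.
by exists (c * c') => i lt_i; rewrite (cubes_sign lt_j lt_i xc) sc // mulrA.
Qed.

Lemma listed_symmetry A x : symmetry A -> listed_cubes (cubes_of x) ->
  listed_cubes (cubes_of (x *m A)).
Proof.
have sign j y : (j < 3)%N -> listed_cubes (cubes_of y) -> listed_cubes (cubes_of (y *m sign_mx j)).
  move=> lt_j [m lt_m [c yc]]; have [lt_n [c' h]] := cubes_sign_target lt_j lt_m yc.
  by exists (target m (9 + j)) => //; exists c'.
move=> sA; elim: sA x => [|a b c d ha hb hc hd||||A1 A2 _ I1 _ I2] x lx.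
- exact: listed_refl.
- apply: eq_listed lx => i lt_i; by rewrite cubes_of_diag.
- exact: (sign 0%N).
- exact: (sign 1%N).
- exact: (sign 2%N).
by rewrite mulmxA; exact/I2/I1.
Qed.

Lemma base_vec_lift : base_vec C = lift_vec 0.
Proof.
rewrite /base_vec /lift_vec /kvec /lift_at /=.
by rewrite !(zrN _ 1) !zr1 !zr0 !mul0r !addr0 mul0r !addr0 add0r mulN1r.
Qed.

(** A singular point is the image of the base point, entry 0 of the list, under a symmetry. *)
Lemma singular_listed x : singular_vec F24 x -> listed_cubes (cubes_of x).
Proof.
move=> /(singular_orbit w_root)[A [sA [k k0 xA]]].
have [B [sB AB _]] := symmetry_inv w_root sA.
rewrite -(mulmx1 x) -AB mulmxA xA; apply: listed_symmetry => //.
exists 0%N => //; exists (k ^+ 3) => i lt_i; rewrite cubes_of_scale // base_vec_lift.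
by rewrite /cubes_of coords_lift // cubesE.
Qed.

End SingularListProof.

(** * Singular points of g[k] for k > 1 *)

Section SingularPoints.
Local Open Scope ring_scope.
#[local] Opaque octic_expr.
Variable C : numClosedFieldType.
Variable w : C.
Hypothesis w_root : w ^+ 2 + w + 1 = 0.
Local Notation F24 := (F24 C).
Local Notation symmetry := (symmetry w).
Local Notation kphi := (kphi w).
Local Notation cubes := (cubes w).
Local Notation lift_vec := (lift_vec w).
Local Notation listed_cubes := (listed_cubes w).

Lemma evalv_inj (f g : poly4 C) : (forall x, evalv f x = evalv g x) -> f = g.
Proof.
move=> fg; apply/eqP; rewrite -subr_eq0; apply/negP => /negP /mpoly_nonzero_eval[y].
have yE h : evalv h (\row_i y i) = meval y h by apply: meval_eq => i; rewrite mxE.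
by rewrite mevalB -!yE fg subrr eqxx.
Qed.

Lemma singular_scale d (f : poly4 C) k x : homogeneous d f -> k != 0 ->
  singular_vec f x -> singular_vec f (k *: x).
Proof.
move=> hf k0 [x0 fx dfx]; split.
- by rewrite scaler_eq0 negb_or k0.
- by rewrite (evalvZ _ _ hf) fx mulr0.
move=> i; have fE : mx_subst k%:M f = k ^+ d *: f.
  apply: evalv_inj => y; rewrite evalv_mx_subst tr_scalar_mx mul_mx_scalar (evalvZ _ _ hf).
  by rewrite /evalv mevalZ.
apply: (mulfI k0); rewrite mulr0; have := mderiv_mx_subst k%:M f x i.
rewrite fE mderivZ /evalv mevalZ -/(evalv _ _) dfx mulr0 tr_scalar_mx mul_mx_scalar => ->.
rewrite (bigD1 i) //= mxE eqxx mulr1n big1 ?addr0 // => j ji.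
by rewrite mxE (negPf ji) mulr0n mul0r.
Qed.

Lemma coords_eq0 (x : 'rV[C]_4) : (x == 0) = [forall i : 'I_4, coords x i == 0].
Proof.
apply/eqP/forallP => [-> i|h]; first by rewrite /coords mxE.
by apply/rowP => i; have /eqP := h i; rewrite /coords inord_val mxE.
Qed.

(** Equal cubes mean equality up to a diagonal symmetry of cube roots of unity; a cube root of c
    takes care of the scalar. *)
Lemma singular_cubes x y c : singular_vec F24 x -> y != 0 ->
  (forall i, (i < 4)%N -> cubes_of x i = c * cubes_of y i) -> singular_vec F24 y.
Proof.
move=> sx y0 xy; pose k := 3.-root c.
have k3 : k ^+ 3 = c by rewrite rootCK.
have xi i : (i < 4)%N -> exists2 z, z ^+ 3 = 1 & coords x i = z * (k * coords y i).
  by move=> lt_i; apply: cube_root_unity; rewrite exprMn k3 -xy.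
have [[z0 u0 e0] [z1 u1 e1]] := (xi 0%N isT, xi 1%N isT).
have [[z2 u2 e2] [z3 u3 e3]] := (xi 2%N isT, xi 3%N isT).
have xE : x = (k *: y) *m diag4 z0 z1 z2 z3.
  by rewrite (vec4_eta y) scale_vec4 mul_diag4 [LHS]vec4_eta e0 e1 e2 e3; congr vec4; rewrite mulrC.
have k0 : k != 0.
  by have [+ _ _] := sx; apply: contra_neq => k0; rewrite xE k0 scale0r mul0mx.
have sD : symmetry (diag4 z0 z1 z2 z3) by exact: symmetry_diag.
have [B [sB AB _]] := symmetry_inv w_root sD.
have -> : y = k^-1 *: (x *m B).
  by rewrite xE -mulmxA AB mulmx1 scalerA mulVf // scale1r.
apply: (singular_scale (homogeneous_octic_pow C 3)); first by rewrite invr_eq0.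
exact: (symmetry_singular w_root sB sx).
Qed.

Lemma line_octic : peq 2 (psubst line_subst octic_expr)
  (PM (PP (PA (PP (PV 0) 2) (PP (PV 1) 2)) 2)
     (PA (PP (PV 0) 4) (PA (PM (PC (-8)) (PM (PP (PV 0) 2) (PP (PV 1) 2))) (PP (PV 1) 4)))).
Proof. by vm_compute. Qed.

(** Along the line g is divisible by the square of A^2 + B^2, which vanishes at the cubes (1, i). In
    the normal directions the factor x_j^2 of the derivative of g[3] vanishes. *)
Lemma singular_base : singular_vec F24 (base_vec C).
Proof.
have iC : ('i : C) ^+ 2 = -1 by exact: sqrCi.
have i3 : (- 'i : C) ^+ 3 = 'i by rewrite exprNn -signr_odd mulN1r exprS iC mulrN1 opprK.
pose X : nat -> C := quad 1 'i 0 0.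
have XE i : (i < 4)%N -> coords_pow 3 (base_vec C) i = X i.
  move=> lt_i; rewrite /coords_pow coords_vec4 //.
  by case: i lt_i => [|[|[|[|//]]]] _; rewrite /X /quad /= ?expr1n ?i3 ?expr0n.
split; first by rewrite vec4_eq0 oner_eq0.
- rewrite evalv_octic_pow (eq_octic_at XE) /octic_at.
  transitivity (peval X (psubst line_subst octic_expr)).
    rewrite peval_subst; apply: (@eq_peval_vars _ 4) => [|[|[|[|[|//]]]] _] //.
  by rewrite (peqP X line_octic) /= /X /quad /= expr1n iC subrr expr0n mul0r.
move=> j; rewrite evalv_mderiv_octic_pow.
have -> : octic_deriv j (coords_pow 3 (base_vec C)) = octic_deriv j X.
  by apply: (@eq_peval_vars _ 4) => [|i lt_i]; [apply: pvars_pderiv; exact: octic_vars|exact: XE].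
have lX a b : peval X (line_deriv a b) = 0 \/ peval X a ^+ 2 + peval X b ^+ 2 != 0.
  rewrite peval_line_deriv; have [->|] := eqVneq (_ + _) 0; last by right.
  by left; rewrite mul0r mulr0.
have [j0|j1|j23] : [\/ j = 0%N :> nat, j = 1%N :> nat | (1 < j)%N].
  by case: (j : nat) => [|[|n]]; [constructor 1|constructor 2|constructor 3].
- rewrite j0 (octic_deriv_line line_deriv0) //.
  have [->|/eqP[]] := lX (PV 0) (PV 1); first by rewrite mulr0.
  by rewrite /X /quad /= expr1n iC subrr.
- rewrite j1 (octic_deriv_line line_deriv1) //.
  have [->|/eqP[]] := lX (PV 1) (PV 0); first by rewrite mulr0.
  by rewrite /X /quad /= expr1n iC addNr.
rewrite coords_vec4 //; have -> : quad 1 (- 'i) 0 0 j = 0 :> C.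
  by case: (j : nat) j23 (ltn_ord j) => [|[|[|[|n]]]].
by rewrite expr0n mulr0 mul0r.
Qed.

Lemma lift_vec_neq0 m : (m < 80)%N -> lift_vec m != 0.
Proof.
move=> lt_m; have [lt_p nz] := pivotP w_root lt_m; apply: contra_neq nz => e.
by rewrite cubesE // -coords_lift // e /coords mxE expr0n.
Qed.

Lemma cubes_of_lift m i : (i < 4)%N -> cubes_of (lift_vec m) i = cubes m i.
Proof. by move=> lt_i; rewrite /cubes_of coords_lift // cubesE. Qed.

Lemma rows_ok : all (fun r => size r == 12)%N move_table.
Proof. by vm_compute. Qed.

(** Induction along [parent]: the lift has, up to a scalar, the cubes of the image of a singular
    point under a symmetry. *)
Lemma singular_lift m : (m < 80)%N -> singular_vec F24 (lift_vec m).
Proof.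
elim/ltn_ind: m => -[|m] IH lt_m; first by rewrite -base_vec_lift //; exact: singular_base.
have lt_p : (parent m.+1 < m.+1)%N.
  by have /allP := reachable; apply; rewrite mem_iota.
have lt_p80 := ltn_trans lt_p lt_m; set p := parent m.+1 in lt_p lt_p80.
have : m.+1 \in nth [::] move_table p.
  have hp : has (fun p => m.+1 \in nth [::] move_table p) (iota 0 80).
    by rewrite has_find size_iota.
  by have := nth_find 0%N hp; rewrite nth_iota.
move=> /(nthP 0%N)[t lt_t tE].
have {}lt_t : (t < 12)%N.
  apply: leq_trans lt_t _; have [le|lt] := leqP (size move_table) p.
    by rewrite nth_default.
  by rewrite (eqP (allP rows_ok _ (mem_nth _ lt))).
have sp := IH p lt_p lt_p80.
have tgt : target p t = m.+1 by exact: tE.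
have [lt_t9|le_9t] := ltnP t 9.
  have := moveP lt_p80 lt_t; rewrite /move_ok lt_t9 tgt lt_m => /(proportional_cubes w_root lt_m).
  move=> [c rc].
  pose z1 := kphi (kpow_w (t %/ 3)); pose z2 := kphi (kpow_w (t %% 3)).
  have lt1 : (t %/ 3 < 3)%N by rewrite ltn_divLR.
  have lt2 : (t %% 3 < 3)%N by rewrite ltn_mod.
  have cube t' : (t' < 3)%N -> kphi (kpow_w t') ^+ 3 = 1.
    case: t' => [|[|[|//]]] _; rewrite /kpow_w [nth _ _ _]/= kphi_eisenstein ?(zrN _ 1) ?zr1 ?zr0.
    - by rewrite mul0r addr0 expr1n.
    - by rewrite mul1r add0r (w_cube w_root).
    have -> : -1 + -1 * w = w ^+ 2.
      by transitivity (w ^+ 2 - (w ^+ 2 + w + 1)); [ring|rewrite w_root subr0].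
    by rewrite exprAC (w_cube w_root) expr1n.
  have sy : singular_vec F24 (lift_vec p *m diag4 1 z1 z2 1 *m refl w).
    apply: (symmetry_singular w_root (symmetry_refl w)); apply: (symmetry_singular w_root _ sp).
    by apply: symmetry_diag; rewrite ?expr1n ?cube.
  have tE' : t = (3 * (t %/ 3) + t %% 3)%N by rewrite mulnC -divn_eq.
  apply: (singular_cubes (c := c / 3%:R ^+ 3) sy (lift_vec_neq0 lt_m)) => i lt_i.
  rewrite cubes_of_lift //; have := rc i lt_i; rewrite kvec_cubes //.
  rewrite (@reflected_vec _ _ w_root _ _ (z1 * kvec w (lift_at p) 1) (z2 * kvec w (lift_at p) 2) _ _
    (t %/ 3) (t %% 3) lt1 lt2 tE' erefl erefl erefl erefl) // exprMn.
  rewrite /lift_vec mul_diag4 !mulr1 [_ * z1]mulrC [_ * z2]mulrC /cubes_of => e.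
  rewrite mulrAC -e mulrAC mulfV ?mul1r // expf_neq0 // natr3_neq0 //.
have lt_j : (t - 9 < 3)%N by rewrite ltn_subLR.
have := @cubes_sign_target _ _ w_root (t - 9) p (lift_vec p) 1 lt_j lt_p80.
rewrite subnKC // tgt; case=> [i lt_i|_ [c hc]]; first by rewrite cubes_of_lift // mul1r.
apply: (singular_cubes (c := c) (symmetry_singular w_root (symmetry_sign w lt_j) sp)) => [|i lt_i].
  exact: lift_vec_neq0.
by rewrite hc // cubes_of_lift.
Qed.

Lemma octic_deriv_eq (X Y : nat -> C) j : (forall i, (i < 4)%N -> X i = Y i) ->
  octic_deriv j X = octic_deriv j Y.
Proof. by apply: eq_peval_vars; apply: pvars_pderiv; exact: octic_vars. Qed.

(** For k > 1 the factors x_i^(k-1) and x_i^k vanish together, so the condition can be stated by the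
    k-th powers alone. *)
Lemma singular_powE k x : (1 < k)%N -> singular_vec (subst_pow k (octic C)) x <->
  [/\ x != 0, octic_at (coords_pow k x) = 0 &
    forall i, (i < 4)%N -> coords_pow k x i * octic_deriv i (coords_pow k x) = 0].
Proof.
move=> k1; have k0 := ltnW k1; rewrite /singular_vec evalv_octic_pow.
have km : (0 < k.-1)%N by case: k k1 {k0} => [|[|]].
split=> -[x0 fx h]; (split; [exact: x0|exact: fx|move=> i {fx}]).
  move=> lt_i; have := h (inord i); rewrite evalv_mderiv_octic_pow inordK; last exact: lt_i.
  move: (octic_deriv _ _) => D /eqP; rewrite !mulf_eq0 pnatr_eq0 (gtn_eqF k0) /= => /orP[|/eqP->].
    by rewrite expf_eq0 km /= /coords_pow => /eqP->; rewrite expr0n gtn_eqF // mul0r.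
  by rewrite mulr0.
rewrite evalv_mderiv_octic_pow; have := h i (ltn_ord i); move: (octic_deriv _ _) => D {h} /eqP.
rewrite mulf_eq0 expf_eq0 k0 /= => /orP[/eqP->|/eqP->]; last by rewrite mulr0.
by rewrite expr0n gtn_eqF // mulr0 mul0r.
Qed.

Definition cube_roots (X : nat -> C) : 'rV[C]_4 :=
  vec4 (3.-root (X 0)) (3.-root (X 1)) (3.-root (X 2)) (3.-root (X 3)).

Lemma cubes_of_roots X i : (i < 4)%N -> cubes_of (cube_roots X) i = X i.
Proof.
move=> lt_i; rewrite /cubes_of coords_vec4 //.
by case: i lt_i => [|[|[|[|//]]]] _; rewrite /quad /= rootCK.
Qed.

Lemma cube_roots_neq0 k x : (0 < k)%N -> x != 0 -> cube_roots (coords_pow k x) != 0.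
Proof.
move=> k0; apply: contra_neq => e; apply/eqP; rewrite coords_eq0; apply/forallP => i.
have := cubes_of_roots (coords_pow k x) (ltn_ord i); rewrite e /cubes_of /coords mxE expr0n /=.
by move=> /esym/eqP; rewrite /coords_pow expf_eq0 k0.
Qed.

(** The hypotheses involve only the k-th powers. Cube roots of these give a vector with the same
    powers for exponent 3, hence a singular point of g[3]. *)
Lemma log_singular_listed k x : (0 < k)%N -> x != 0 -> octic_at (coords_pow k x) = 0 ->
  (forall i, (i < 4)%N -> coords_pow k x i * octic_deriv i (coords_pow k x) = 0) ->
  listed_cubes (coords_pow k x).
Proof.
move=> k0 x0 fx h; set y := cube_roots (coords_pow k x).
have yE i : (i < 4)%N -> coords_pow 3 y i = coords_pow k x i by exact: cubes_of_roots.
have : singular_vec F24 y.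
  apply/(singular_powE _ (isT : (1 < 3)%N)); split; first exact: cube_roots_neq0.
    rewrite (eq_octic_at yE); exact: fx.
  by move=> i lt_i {fx}; rewrite (yE i lt_i) (octic_deriv_eq _ yE); exact: h.
by move=> /(singular_listed w_root); apply: eq_listed.
Qed.

Lemma listed_singular k x : (1 < k)%N -> x != 0 -> listed_cubes (coords_pow k x) ->
  singular_vec (subst_pow k (octic C)) x.
Proof.
move=> k1 x0 [m lt_m [c xc]]; set y := cube_roots (coords_pow k x).
have yE i : (i < 4)%N -> coords_pow 3 y i = coords_pow k x i by exact: cubes_of_roots.
have y0 : y != 0 by apply: cube_roots_neq0 => //; exact: ltnW.
have c0 : c != 0.
  apply: contra_neq y0 => c0; apply/eqP; rewrite coords_eq0; apply/forallP => i.
  have := yE i (ltn_ord i); rewrite xc // c0 mul0r /coords_pow => /eqP.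
  by rewrite expf_eq0.
have : singular_vec F24 y.
  apply: (singular_cubes (c := c^-1) (singular_lift lt_m) y0) => i lt_i.
  by rewrite cubes_of_lift // cubes_of_roots // xc // mulKf.
move=> /(singular_powE _ (isT : (1 < 3)%N))[_ fy hy]; apply/(singular_powE _ k1).
split; [exact: x0|rewrite -(eq_octic_at yE); exact: fy|].
by move=> i lt_i {fy}; rewrite -(yE i lt_i) -(octic_deriv_eq _ yE); exact: hy.
Qed.

Lemma singular_pow_listed k x : (1 < k)%N -> singular_vec (subst_pow k (octic C)) x <->
  x != 0 /\ listed_cubes (coords_pow k x).
Proof.
move=> k1; split=> [/(singular_powE _ k1)[x0 fx h]|[x0 lx]]; last exact: listed_singular.
split; [exact: x0|exact: (log_singular_listed (ltnW k1) x0 fx h)].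
Qed.

End SingularPoints.

(** * Singular points of g itself have no zero coordinate *)

Section TorusPoints.
Local Open Scope ring_scope.
#[local] Opaque octic_expr.
Variable C : numClosedFieldType.
Variable w : C.
Hypothesis w_root : w ^+ 2 + w + 1 = 0.
Local Notation F24 := (F24 C).

Definition line_normal2 := plist [:: mono (-60) 6 1 0 0; mono (-60) 1 6 0 0; mono 2240 5 2 0 0;
  mono 2240 2 5 0 0; mono 10180 4 3 0 0; mono 10180 3 4 0 0].

Definition line_normal3 := plist [:: mono (-60) 6 1 0 0; mono 60 1 6 0 0; mono (-2240) 5 2 0 0;
  mono 2240 2 5 0 0; mono 10180 4 3 0 0; mono (-10180) 3 4 0 0].

Lemma line_deriv2 : peq 4 (psubst line_subst (pderiv 2 octic_expr)) line_normal2.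
Proof. by vm_compute. Qed.

Lemma line_deriv3 : peq 4 (psubst line_subst (pderiv 3 octic_expr)) line_normal3.
Proof. by vm_compute. Qed.

(* On the line, modulo A^2 + B^2, the normal derivatives are 8000 B^6 (B - A) and
   8000 B^6 (A + B). *)
Lemma line_normal2E : peq 4 line_normal2
  (PA (PM (PC 8000) (PM (PP (PV 1) 6) (psub (PV 1) (PV 0))))
    (PM (PA (PP (PV 0) 2) (PP (PV 1) 2)) (plist [:: mono (-60) 4 1 0 0; mono 60 2 3 0 0;
      mono (-60) 0 5 0 0; mono 2240 3 2 0 0; mono (-2240) 1 4 0 0; mono 2240 0 5 0 0;
      mono 10180 2 3 0 0; mono (-10180) 0 5 0 0; mono 10180 1 4 0 0]))).
Proof. by vm_compute. Qed.

Lemma line_normal3E : peq 4 line_normal3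
  (PA (PM (PC 8000) (PM (PP (PV 1) 6) (PA (PV 1) (PV 0))))
    (PM (PA (PP (PV 0) 2) (PP (PV 1) 2)) (plist [:: mono (-60) 4 1 0 0; mono 60 2 3 0 0;
      mono (-60) 0 5 0 0; mono (-2240) 3 2 0 0; mono 2240 1 4 0 0; mono 2240 0 5 0 0;
      mono 10180 2 3 0 0; mono (-10180) 0 5 0 0; mono (-10180) 1 4 0 0]))).
Proof. by vm_compute. Qed.

Lemma line_point_nonzero (a b : C) : a != 0 \/ b != 0 -> a ^+ 2 + b ^+ 2 = 0 -> b != 0.
Proof.
move=> nz e; apply/eqP => b0; move: e nz; rewrite b0 expr0n addr0 => /eqP.
by rewrite expf_eq0 /= => /eqP->; rewrite eqxx => -[].
Qed.

(** If b = a or b = -a, then a^2 = b^2 and a^2 + b^2 = 0 force b = 0, so the normal derivatives 8000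
    b^6 (b - a) and 8000 b^6 (a + b) do not vanish. *)
Lemma octic_deriv_line_normal (a b : C) : a != 0 \/ b != 0 -> a ^+ 2 + b ^+ 2 = 0 ->
  octic_deriv 2 (quad a b 0 0) != 0 /\ octic_deriv 3 (quad a b 0 0) != 0.
Proof.
move=> nz e; have b0 := line_point_nonzero nz e.
have ab s : s ^+ 2 = 1 -> b + s * a != 0.
  move=> s2; apply: contra_neq b0 => /addr0_eq ba; apply/eqP.
  have ab2 : a ^+ 2 = b ^+ 2 by rewrite -[a ^+ 2]mul1r -s2 -exprMn -ba sqrrN.
  have : 2%:R * b ^+ 2 = 0 by rewrite -[RHS]e ab2; ring.
  by move/eqP; rewrite mulf_eq0 pnatr_eq0 expf_eq0.
have lineE j e' : peq 4 (psubst line_subst (pderiv j octic_expr)) e' ->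
    octic_deriv j (quad a b 0 0) = peval (quad a b 0 0) e'.
  move=> je; rewrite -(peqP (quad a b 0 0) je) peval_subst.
  by apply: (@eq_peval_vars _ 4) => [|[|[|[|[|//]]]] _] //.
have evE q r : peval (quad a b 0 0) (PA (PM (PC 8000) (PM (PP (PV 1) 6) q))
    (PM (PA (PP (PV 0) 2) (PP (PV 1) 2)) r)) = zr C 8000 * (b ^+ 6 * peval (quad a b 0 0) q).
  move: (peval_psub (C := C)) => _; rewrite [LHS]/= /quad /= e mul0r addr0 //.
rewrite (lineE 2 _ line_deriv2) (lineE 3 _ line_deriv3).
rewrite (peqP _ line_normal2E) (peqP _ line_normal3E) !evE peval_psub /=.
have z8 := @zr_neq0 C 8000 erefl.
split; rewrite !mulf_neq0 ?expf_neq0 //.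
  by have := ab (-1); rewrite mulN1r sqrrN expr1n => /(_ erefl).
by have := ab 1; rewrite mul1r expr1n => /(_ erefl).
Qed.

Lemma octic_sign_mx j x : (j < 3)%N -> evalv (subst_pow 1 (octic C)) (x *m sign_mx C j) =
  evalv (subst_pow 1 (octic C)) x.
Proof.
have [a [b [c [d ->]]]] := vec4P x; case: j => [|[|[|//]]] _; rewrite /sign_mx [nth _ _ _]/=.
- by rewrite mul_s1 !evalv_octic_vec4 !expr1 octic_sign1.
- by rewrite mul_s2 !evalv_octic_vec4 !expr1 octic_sign2.
by rewrite mul_s3 !evalv_octic_vec4 !expr1 octic_sign3.
Qed.

Local Notation sing x := (singular_vec (subst_pow 1 (octic C)) x).

Lemma singular_sign j x : (j < 3)%N -> sing x -> sing (x *m sign_mx C j).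
Proof.
move=> lt_j; apply: singular_mulmx; first exact/(symmetry_unit w_root)/symmetry_sign.
by move=> y; exact: octic_sign_mx.
Qed.

Lemma singular_octic_deriv1 a b c d j : sing (vec4 a b c d) -> (j < 4)%N ->
  octic_deriv j (quad a b c d) = 0.
Proof.
move=> sx lt_j; have := singular_octic_deriv sx isT lt_j (or_intror erefl).
by rewrite !expr1.
Qed.

Lemma singular_octic_line a b : ~ sing (vec4 a b 0 0).
Proof.
move=> sx; have nz : a != 0 \/ b != 0.
  have [] := sx; rewrite vec4_eq0 eqxx !andbT negb_and => /orP[] ? _ _; by [left|right].
have D j : (j < 4)%N -> octic_deriv j (quad a b 0 0) = 0 by exact: singular_octic_deriv1.
have [/eqP[]] := octic_deriv_line_normal nz (line_critical nz
   (etrans (congr1 _ (D 0%N isT)) (mulr0 a)) (etrans (congr1 _ (D 1%N isT)) (mulr0 b))).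
exact: D.
Qed.

(** The derivative normal to the plane is a polynomial in the invariants and the last coordinate,
    all preserved by the symmetry of [tri_move]. So its value at (a, b, c, 0) equals that at a
    critical point of the line, where it is nonzero. *)
Lemma singular_octic_plane a b c : ~ sing (vec4 a b c 0).
Proof.
move=> sx; have [c0|cn0] := eqVneq c 0.
  by move: sx; rewrite c0; exact: singular_octic_line.
have [b0|bn0] := eqVneq b 0.
  by have := singular_sign (isT : (1 < 3)%N) sx; rewrite mul_s2 b0 oppr0; exact: singular_octic_line.
have [a0|an0] := eqVneq a 0.
  have := singular_sign (isT : (1 < 3)%N) (singular_sign (isT : (0 < 3)%N) sx).
  by rewrite mul_s1 mul_s2 a0 !oppr0; exact: singular_octic_line.
have D j : (j < 4)%N -> octic_deriv j (quad a b c 0) = 0 by exact: singular_octic_deriv1.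
have tri0 : tri a b c = 0.
  apply: (@plane_critical_tri _ (quad a b c 0)) => // j lt_j; exact/D/ltnW.
pose x' := 3.-root a; pose y' := 3.-root b; pose z' := 3.-root c.
have [xa yb zc] : [/\ x' ^+ 3 = a, y' ^+ 3 = b & z' ^+ 3 = c] by rewrite /x' /y' /z' !rootCK.
have [|A [sA invA fixA [a' [b' eA]]]] := @tri_move _ _ w_root x' y' z'; first by rewrite xa yb zc.
have sy : singular_vec F24 (vec4 x' y' z' 0).
  have XE i : (i < 4)%N -> coords_pow 3 (vec4 x' y' z' 0) i = quad a b c 0 i.
    move=> lt_i; rewrite /coords_pow coords_vec4 //.
    by case: i lt_i => [|[|[|[|//]]]] _; rewrite /quad /= ?xa ?yb ?zc ?expr0n.
  apply/(singular_powE _ (isT : (1 < 3)%N)); split.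
  - by rewrite vec4_eq0; apply/negP => /and4P[/eqP x0]; move: an0; rewrite -xa x0 expr0n eqxx.
  - rewrite (eq_octic_at XE); have [_ fx _] := sx; rewrite evalv_octic_vec4 !expr1 in fx; exact: fx.
  by move=> i lt_i; rewrite (octic_deriv_eq _ XE) D // mulr0.
have := symmetry_singular w_root sA sy; rewrite eA => sA'.
have nz : a' != 0 \/ b' != 0.
  have [] := sA'; rewrite vec4_eq0 eqxx !andbT negb_and => /orP[] ? _ _; by [left|right].
have XE' i : (i < 4)%N -> coords_pow 3 (vec4 a' b' 0 0) i = quad (a' ^+ 3) (b' ^+ 3) 0 0 i.
  move=> lt_i; rewrite /coords_pow coords_vec4 //.
  by case: i lt_i => [|[|[|[|//]]]] _; rewrite /quad /= ?expr0n.
have h j : (j < 4)%N -> quad (a' ^+ 3) (b' ^+ 3) 0 0 j * octic_deriv j (quad (a' ^+ 3) (b' ^+ 3) 0 0) = 0.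
  move=> lt_j; have /(singular_powE _ (isT : (1 < 3)%N))[_ _ /(_ j lt_j)] := sA'.
  by rewrite XE' // (octic_deriv_eq _ XE').
have nz3 : a' ^+ 3 != 0 \/ b' ^+ 3 != 0 by rewrite !expf_eq0.
have [_ /eqP[]] := octic_deriv_line_normal nz3 (line_critical nz3 (h 0%N isT) (h 1%N isT)).
apply: (mulfI (@zr_neq0 C 288 erefl)); rewrite mulr0.
transitivity (zr C 288 * octic_deriv 3 (quad a b c 0)); last by rewrite D // mulr0.
rewrite !octic_deriv3_inv; apply: (@eq_peval_vars _ 4) => // i lt_i.
have := invA (vec4 x' y' z' 0) 0 i lt_i; rewrite /plane_inv eA !coords_vec4 // /quad /=.
have z3 : (0 : C) ^+ 3 = 0 by rewrite expr0n.
by rewrite xa yb zc z3 => h'; exact: h'.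
Qed.

Lemma singular_octic_torus x i : sing x -> (i < 4)%N -> coords x i != 0.
Proof.
have [a [b [c [d ->]]]] := vec4P x => sx lt_i; apply/eqP; rewrite coords_vec4 //.
have s1x := singular_sign (isT : (0 < 3)%N) sx.
have s2x := singular_sign (isT : (1 < 3)%N) sx.
have s12x := singular_sign (isT : (1 < 3)%N) s1x.
move: (singular_sign (isT : (2 < 3)%N) sx) (singular_sign (isT : (2 < 3)%N) s2x)
  (singular_sign (isT : (2 < 3)%N) s12x).
rewrite /sign_mx [nth _ _ 2]/= [nth _ _ 1]/= [nth _ _ 0]/= mul_s1 !mul_s2 !mul_s3.
case: i lt_i => [|[|[|[|//]]]] _ p1 p2 p3; rewrite /quad /= => e.
- by move: p3; rewrite e; exact: singular_octic_plane.
- by move: p2; rewrite e; exact: singular_octic_plane.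
- by move: p1; rewrite e; exact: singular_octic_plane.
by move: sx; rewrite e; exact: singular_octic_plane.
Qed.

(** Listed points satisfy x_i D_i g = 0; where no coordinate vanishes this is singularity. *)
Lemma singular_octic_listed x : singular_vec (subst_pow 1 (octic C)) x <->
  [/\ x != 0, listed_cubes w (coords_pow 1 x) & forall i, (i < 4)%N -> coords x i != 0].
Proof.
split=> [sx|[x0 [m lt_m [c xc]] nz]].
  have D i : (i < 4)%N -> octic_deriv i (coords_pow 1 x) = 0.
    move=> lt_i; have := sx; rewrite (vec4_eta x) => /singular_octic_deriv1/(_ lt_i) <-.
    apply: octic_deriv_eq => j lt_j; rewrite /coords_pow expr1.
    by case: j lt_j => [|[|[|[|//]]]] _; rewrite /coords !mxE inordK.
  have [x0 fx _] := sx; split; [exact: x0| |by move=> i lt_i; exact: singular_octic_torus].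
  rewrite evalv_octic_pow in fx; apply: (@log_singular_listed _ _ w_root 1 x isT x0 fx) => i lt_i.
  by rewrite (D i lt_i) mulr0.
have lx : listed_cubes w (coords_pow 1 x) by exists m => //; exists c.
(* Square roots of the coordinates, to use the criterion established for k = 2. *)
have [r rE] : exists r : 'rV[C]_4, forall i, (i < 4)%N -> coords_pow 2 r i = coords_pow 1 x i.
  exists (vec4 (2.-root (coords x 0)) (2.-root (coords x 1)) (2.-root (coords x 2)) (2.-root (coords x 3))).
  move=> i lt_i; rewrite /coords_pow expr1 coords_vec4 //.
  by case: i lt_i => [|[|[|[|//]]]] _; rewrite /quad /= rootCK.
have r0 : r != 0.
  apply: contra_neq (nz 0%N isT) => r0; have := rE 0%N isT; rewrite r0 /coords_pow /coords mxE expr0n.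
  by rewrite expr1.
have /(singular_powE _ (isT : (1 < 2)%N))[_ fr hr] : singular_vec (subst_pow 2 (octic C)) r.
  apply/(singular_pow_listed w_root _ (isT : (1 < 2)%N)); split; first exact: r0.
  by apply: eq_listed lx => i lt_i; rewrite (rE i lt_i).
split; first exact: x0.
  rewrite evalv_octic_pow -(eq_octic_at rE); exact: fr.
move=> i; rewrite evalv_mderiv_octic_pow -(octic_deriv_eq _ rE).
have := hr i (ltn_ord i) => {fr}; move: (octic_deriv _ _) => D /eqP; rewrite mulf_eq0 (rE i (ltn_ord i)).
by rewrite /coords_pow expr1 (negPf (nz i (ltn_ord i))) /= => /eqP->; rewrite mulr0.
Qed.

End TorusPoints.

(** * Counting the points over the list *)

Section SingularCount.
Local Open Scope ring_scope.
Local Open Scope classical_set_scope.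
Local Open Scope card_scope.
#[local] Opaque octic_expr.
Variable C : numClosedFieldType.
Variable w : C.
Hypothesis w_root : w ^+ 2 + w + 1 = 0.
Local Notation cubes := (cubes w).

(** A point of projective space, being a line in the vector space, contains the zero vector, where
    the derivatives must vanish as well. *)
Lemma octic_deriv_zero (j : 'I_4) : octic_deriv j (fun=> 0 : C) = 0.
Proof.
transitivity (peval (fun i => zr C ((fun=> Z0) i)) (pderiv j octic_expr)).
  exact: eq_peval.
rewrite peval_zeval (_ : zeval _ _ = Z0) //.
by case: j => -[|[|[|[|//]]]] ?; vm_compute.
Qed.

Lemma singular_locusE k v : (0 < k)%N -> v != 0 ->
  singular_locus (subst_pow k (octic C)) (proj_point v) <-> singular_vec (subst_pow k (octic C)) v.
Proof.
move=> k0 v0; have hf := homogeneous_octic_pow C k; split=> [[zv dv]|sv].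
  split; [exact: v0|exact/(vanishes_pointE hf v0)|move=> i].
  by apply: dv; exact: point_mem.
split; first by apply/(vanishes_pointE hf v0); have [] := sv.
move=> i x; rewrite val_point // => /vlineP[a ->]; have [->|a0] := eqVneq a 0.
  rewrite scale0r evalv_mderiv_octic_pow.
  have -> : octic_deriv i (coords_pow k (0 : 'rV[C]_4)) = octic_deriv i (fun=> 0 : C).
    by apply: octic_deriv_eq => j _; rewrite /coords_pow /coords mxE expr0n gtn_eqF.
  by rewrite octic_deriv_zero mulr0.
by have [_ _] := singular_scale hf a0 sv; apply.
Qed.

Lemma roots_exist k (a : C) : exists s : seq C,
  [/\ uniq s, size s = (if a == 0 then 1%N else k.+1) & forall x, (x \in s) = (x ^+ k.+1 == a)].
Proof.
have [->|a0] := eqVneq a 0.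
  by exists [:: 0]; split=> // x; rewrite inE expf_eq0.
have [r rE] := closed_field_poly_normal ('X^(k.+1) - 1 : {poly C}).
have lead1 : lead_coef ('X^(k.+1) - 1 : {poly C}) = 1 by rewrite lead_coefXnsubC.
rewrite lead1 scale1r in rE.
have ur : uniq r.
  by rewrite -separable_prod_XsubC -rE separable_Xn_sub_1 // pnatr_eq0.
have sr : size r = k.+1.
  by have := size_prod_XsubC r (fun z : C => z); rewrite -rE size_XnsubC // => -[].
have memr x : (x \in r) = (x ^+ k.+1 == 1).
  by rewrite -root_prod_XsubC -rE rootE hornerD hornerN hornerXn -polyC1 hornerC subr_eq0.
pose y := k.+1.-root a; have yk : y ^+ k.+1 = a by rewrite rootCK.
have y0 : y != 0 by apply: contra_neq a0 => y0; rewrite -yk y0 expr0n.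
exists (map ( *%R y) r); split.
- by rewrite map_inj_uniq //; exact: mulfI.
- by rewrite size_map.
move=> x; apply/mapP/idP => [[z + ->]|xk].
  by rewrite memr exprMn yk => /eqP->; rewrite mulr1.
exists (y^-1 * x); last by rewrite mulVKf.
by rewrite memr exprMn exprVn yk (eqP xk) mulVf.
Qed.

Definition roots k a : seq C := sval (cid (roots_exist k.-1 a)).

Lemma rootsP k a : (0 < k)%N -> [/\ uniq (roots k a), size (roots k a) = (if a == 0 then 1%N else k) &
  forall x, (x \in roots k a) = (x ^+ k == a)].
Proof. by case: k => // k _; rewrite /roots; case: cid. Qed.

Definition normal_cubes m i := cubes m i / cubes m (pivot m).

(** The pivot coordinate is set to 1 and the others run through k-th roots, so each projective point
    over the m-th entry has exactly one representative. *)
Definition choices k m i := if i == pivot m then [:: 1] else roots k (normal_cubes m i).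

Definition listed_points k m : seq 'rV[C]_4 :=
  [seq vec4 q.1.1.1 q.1.1.2 q.1.2 q.2 | q <-
    [seq (p, d) | p <- [seq (p, c) | p <- [seq (a, b) | a <- choices k m 0, b <- choices k m 1],
        c <- choices k m 2], d <- choices k m 3]].

Lemma mem_listed_points k m x : x \in listed_points k m <->
  forall i, (i < 4)%N -> coords x i \in choices k m i.
Proof.
split=> [/mapP[q + ->] i lt_i|h].
  move=> /allpairsP[[p d] /= [+ d3 ->]] => /allpairsP[[p' c] /= [+ c3 ->]].
  move=> /allpairsP[[a b] /= [a3 b3 ->]] /=; rewrite coords_vec4 //.
  by case: i lt_i => [|[|[|[|//]]]].
apply/mapP; exists (coords x 0, coords x 1, coords x 2, coords x 3); last exact: vec4_eta.
by do 3!(apply: allpairs_f; last exact: h); exact: h.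
Qed.

Lemma choicesP k m i x : (0 < k)%N -> (m < 80)%N -> (x \in choices k m i) =
  (x ^+ k == normal_cubes m i) && ((i == pivot m) ==> (x == 1)).
Proof.
move=> k0 lt_m; have [_ nz] := pivotP w_root lt_m; rewrite /choices.
have [->|_] := eqVneq i (pivot m); last by have [_ _ ->] := rootsP (normal_cubes m i) k0; rewrite andbT.
rewrite inE /normal_cubes divff //=; have [->|_] := eqVneq x 1; first by rewrite expr1n eqxx.
by rewrite andbF.
Qed.

Lemma uniq_choices k m i : (0 < k)%N -> uniq (choices k m i).
Proof. by move=> k0; rewrite /choices; case: eqP => // _; have [] := rootsP (normal_cubes m i) k0. Qed.

Lemma uniq_listed_points k m : (0 < k)%N -> uniq (listed_points k m).
Proof.
have uniq_pairs (S T : eqType) (s : seq S) (t : seq T) : uniq s -> uniq t ->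
    uniq [seq (x, y) | x <- s, y <- t].
  by move=> us ut; apply: allpairs_uniq => // -[x y] [x' y'] _ _ /= ->.
move=> k0; rewrite map_inj_uniq => [|[[[a b] c] d] [[[a' b'] c'] d'] /= /vec4_eq[-> -> -> ->] //].
by do 3!(apply: (uniq_pairs); last exact: uniq_choices); exact: uniq_choices.
Qed.

Definition nonzero_at m i := ~~ keq (nth k0 (lift_at m) i) k0.

(* One less than the number of nonzero coordinates. *)
Definition support_dim m := count (fun i => (i != pivot m) && nonzero_at m i) (iota 0 4).

Lemma nonzero_cubes m i : (m < 80)%N -> (i < 4)%N -> (cubes m i != 0) = nonzero_at m i.
Proof.
move=> lt_m lt_i; have := allP pivots_ok m; rewrite mem_iota => /(_ lt_m)/and3P[/eqP sz _ /allP h].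
rewrite cubesE // expf_eq0 /= /nonzero_at /kvec.
have lt_s : (i < size (lift_at m))%N by rewrite sz.
have /orP[e|nz] := h _ (mem_nth k0 lt_s).
  by rewrite e (keqP e) kphi0 eqxx.
have nz' := knzP w_root nz; rewrite nz'; symmetry.
by apply/negP => /keqP e; rewrite e kphi0 eqxx in nz'.
Qed.

Lemma nonzero_pivot m : (m < 80)%N -> nonzero_at m (pivot m).
Proof. by move=> lt_m; have [lt_p nz] := pivotP w_root lt_m; rewrite -nonzero_cubes. Qed.

Lemma size_choices k m i : (0 < k)%N -> (m < 80)%N -> (i < 4)%N ->
  size (choices k m i) = (if (i != pivot m) && nonzero_at m i then k else 1)%N.
Proof.
move=> k0 lt_m lt_i; rewrite /choices; case: eqP => //= _; have [_ -> _] := rootsP (normal_cubes m i) k0.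
have [_ nz] := pivotP w_root lt_m.
by rewrite -nonzero_cubes // /normal_cubes mulf_eq0 invr_eq0 (negPf nz) orbF; case: eqP.
Qed.

Lemma size_listed_points k m : (0 < k)%N -> (m < 80)%N ->
  size (listed_points k m) = (k ^ support_dim m)%N.
Proof.
move=> k0 lt_m; rewrite size_map !size_allpairs !size_choices // /support_dim /=.
by do 4!case: (_ && _); rewrite /= ?muln1 ?mul1n ?expn0 ?expn1 ?expnS ?expn0 ?muln1 ?mulnA.
Qed.

Lemma listed_pointP k m x : (0 < k)%N -> (m < 80)%N -> x \in listed_points k m ->
  coords x (pivot m) = 1 /\ forall i, (i < 4)%N -> coords_pow k x i = normal_cubes m i.
Proof.
move=> k0 lt_m /mem_listed_points h; have [lt_p _] := pivotP w_root lt_m.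
split=> [|i lt_i]; last by have := h i lt_i; rewrite choicesP // => /andP[/eqP].
by have := h _ lt_p; rewrite choicesP // eqxx /= => /andP[_ /eqP].
Qed.

Lemma listed_point_neq0 k m x : (0 < k)%N -> (m < 80)%N -> x \in listed_points k m -> x != 0.
Proof.
move=> k0 lt_m /(listed_pointP k0 lt_m)[x1 _]; apply: contra_neq (oner_neq0 C) => x0.
by rewrite -x1 x0 /coords mxE.
Qed.

Lemma listed_point_support k m x i : (0 < k)%N -> (m < 80)%N -> x \in listed_points k m ->
  (i < 4)%N -> (coords x i != 0) = nonzero_at m i.
Proof.
move=> k0 lt_m /(listed_pointP k0 lt_m)[_ h] lt_i; have [_ nz] := pivotP w_root lt_m.
have : (coords_pow k x i == 0) = (normal_cubes m i == 0) by rewrite h.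
rewrite /coords_pow expf_eq0 k0 /= => ->.
by rewrite /normal_cubes mulf_eq0 invr_eq0 (negPf nz) orbF nonzero_cubes.
Qed.

Lemma listed_point_count k m x : (0 < k)%N -> (m < 80)%N -> x \in listed_points k m ->
  count (fun i => coords x i != 0) (iota 0 4) = (support_dim m).+1.
Proof.
move=> k0 lt_m xin; have [lt_p _] := pivotP w_root lt_m; have := nonzero_pivot lt_m.
rewrite /support_dim /= !(listed_point_support k0 lt_m xin) //.
by case: (pivot m) lt_p => [|[|[|[|//]]]] _; case: (nonzero_at m 0); case: (nonzero_at m 1);
  case: (nonzero_at m 2); case: (nonzero_at m 3).
Qed.

Lemma listed_point_listed k m x : (0 < k)%N -> (m < 80)%N -> x \in listed_points k m ->
  listed_cubes w (coords_pow k x).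
Proof.
move=> k0 lt_m /(listed_pointP k0 lt_m)[_ h]; exists m => //; exists (cubes m (pivot m))^-1.
by move=> i lt_i; rewrite h // mulrC.
Qed.

(** Proportional vectors have proportional k-th powers, hence come from entries that are not
    [apart], so m = n; the pivot coordinate 1 then fixes the scalar. *)
Lemma listed_points_inj k m n x y a : (0 < k)%N -> (m < 80)%N -> (n < 80)%N ->
  x \in listed_points k m -> y \in listed_points k n -> x = a *: y -> m = n /\ x = y.
Proof.
move=> k0 lt_m lt_n xin yin xy.
have [x1 xm] := listed_pointP k0 lt_m xin; have [y1 yn] := listed_pointP k0 lt_n yin.
have [_ nzm] := pivotP w_root lt_m; have [_ nzn] := pivotP w_root lt_n.
have xa i : coords x i = a * coords y i by rewrite xy /coords mxE.
have prop i : (i < 4)%N -> cubes m i = cubes m (pivot m) * a ^+ k / cubes n (pivot n) * cubes n i.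
  move=> lt_i; have := xm i lt_i; rewrite /coords_pow xa exprMn [coords y i ^+ k](yn i lt_i).
  rewrite /normal_cubes => e; rewrite -[LHS](divfK nzm) -e; field; exact: nzn.
have no_apart m' n' c : (forall i, (i < 4)%N -> cubes m' i = c * cubes n' i) -> ~ apart m' n'.
  move=> mn /hasP[i]; rewrite mem_iota => lt_i /hasP[j]; rewrite mem_iota => lt_ji /(knzP w_root).
  have lt_j : (j < 4)%N by exact: ltn_trans lt_ji lt_i.
  rewrite kphiD kphiN // !kphiM // -!/(kvec _ _ _) -!/(cubes _ _) (mn i lt_i) (mn j lt_j).
  by move/eqP; apply; ring.
have mn : m = n.
  have [lt|lt|//] := ltngtP m n; last first.
    by case: (no_apart _ _ _ prop); have := allP apart_ok m; rewrite mem_iota => /(_ lt_m)/allP; apply; rewrite mem_iota.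
  have a0 : a != 0.
    apply: contra_neq (oner_neq0 C) => a0; by rewrite -x1 xa a0 mul0r.
  case: (no_apart n m (cubes m (pivot m) * a ^+ k / cubes n (pivot n))^-1) => [i lt_i|].
    by rewrite (prop i lt_i) mulKf // !mulf_neq0 ?invr_eq0 ?expf_neq0.
  by have := allP apart_ok n; rewrite mem_iota => /(_ lt_n)/allP; apply; rewrite mem_iota.
split; first exact: mn.
have a1 : a = 1 by have := xa (pivot m); rewrite x1 {1}mn y1 mulr1.
by rewrite xy a1 scale1r.
Qed.

Definition with_support e := [seq m <- iota 0 80 | support_dim m == e].

Lemma mem_with_support e m : (m \in with_support e) = (m < 80)%N && (support_dim m == e).
Proof. by rewrite mem_filter mem_iota andbC. Qed.

Lemma uniq_with_support e : uniq (with_support e).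
Proof. by rewrite filter_uniq // iota_uniq. Qed.

#[local] Opaque with_support.

(* Sealed: unfolding these lists makes conversion diverge. *)
Lemma sealed_points : {s : nat -> nat -> seq 'rV[C]_4 |
  forall k e, s k e = [seq x | m <- with_support e, x <- listed_points k m]}.
Proof. by exists (fun k e => [seq x | m <- with_support e, x <- listed_points k m]). Qed.

Definition points := sval sealed_points.

Lemma pointsE k e : points k e = [seq x | m <- with_support e, x <- listed_points k m].
Proof. exact: (svalP sealed_points). Qed.

Lemma pointsP k e x : x \in points k e -> exists m, [/\ (m < 80)%N, support_dim m = e &
  x \in listed_points k m].
Proof.
rewrite pointsE => /allpairsPdep[m [y [+ yin ->]]]; rewrite mem_with_support => /andP[lt_m /eqP sm].
by exists m.
Qed.

Lemma mem_points k m x : (m < 80)%N -> x \in listed_points k m -> x \in points k (support_dim m).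
Proof.
move=> lt_m xin; rewrite pointsE; apply/allpairsPdep; exists m, x; split=> //.
by rewrite mem_with_support eqxx lt_m.
Qed.

Lemma size_points k e : (0 < k)%N -> size (points k e) = (size (with_support e) * k ^ e)%N.
Proof.
move=> k0; rewrite pointsE size_allpairs_dep.
have : {in with_support e, forall m, (m < 80)%N && (support_dim m == e)}.
  by move=> m; rewrite mem_with_support.
elim: (with_support e) => //= m s IH h; rewrite mulSn IH => [|n ns]; last first.
  by apply: h; rewrite inE ns orbT.
have /andP[lt_m /eqP sm] := h m (mem_head _ _).
by rewrite size_listed_points // sm.
Qed.

Lemma points_inj k e e' x y a : (0 < k)%N -> x \in points k e -> y \in points k e' ->
  x = a *: y -> e = e' /\ x = y.
Proof.
move=> k0 /pointsP[m [lt_m <- xin]] /pointsP[n [lt_n <- yin]] xy.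
by have [-> ->] := listed_points_inj k0 lt_m lt_n xin yin xy.
Qed.

Lemma uniq_points k e : (0 < k)%N -> uniq (points k e).
Proof.
move=> k0; have gen s : uniq s -> {in s, forall m, (m < 80)%N} ->
    uniq [seq x | m <- s, x <- listed_points k m].
  elim: s => //= m s IH /andP[ms us] h; have lt_m := h m (mem_head _ _).
  have hs n : n \in s -> (n < 80)%N by move=> ns; apply: h; rewrite inE ns orbT.
  rewrite cat_uniq map_id uniq_listed_points // IH // andbT; apply/hasPn => x.
  move=> /allpairsPdep[n [y [ns yin ->]]]; apply/negP => yin'.
  have [nm _] := listed_points_inj k0 (hs n ns) lt_m yin yin' (esym (scale1r _)).
  by rewrite -nm ns in ms.
rewrite pointsE; apply: gen; first exact: uniq_with_support.
by move=> m; rewrite mem_with_support => /andP[].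
Qed.

Lemma points_neq0 k e x : (0 < k)%N -> x \in points k e -> x != 0.
Proof. by move=> k0 /pointsP[m [lt_m _]]; exact: listed_point_neq0. Qed.

Lemma points_count k e x : (0 < k)%N -> x \in points k e ->
  count (fun i => coords x i != 0) (iota 0 4) = e.+1.
Proof. by move=> k0 /pointsP[m [lt_m <-]]; exact: listed_point_count. Qed.

Lemma size_with_support : [/\ size (with_support 3) = 44%N, size (with_support 2) = 24%N &
  size (with_support 1) = 12%N].
Proof. by vm_compute. Qed.

Lemma support_dims_range : all (fun m => support_dim m \in [:: 3; 2; 1]%N) (iota 0 80).
Proof. by vm_compute. Qed.

Lemma listed_cubes_points k x : (0 < k)%N -> x != 0 -> listed_cubes w (coords_pow k x) ->
  exists e y, [/\ (e \in [:: 3; 2; 1]%N), y \in points k e & proj_point x = proj_point y].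
Proof.
move=> k0 x0 [m lt_m [c xc]]; have [lt_p nz] := pivotP w_root lt_m.
have c0 : c != 0.
  apply: contra_neq x0 => c0; apply/eqP; rewrite coords_eq0; apply/forallP => i.
  by have := xc i (ltn_ord i); rewrite c0 mul0r => /eqP; rewrite /coords_pow expf_eq0 k0.
have xp0 : coords x (pivot m) != 0.
  have : coords_pow k x (pivot m) != 0 by rewrite xc // mulf_neq0.
  by rewrite /coords_pow expf_eq0 k0.
pose y := (coords x (pivot m))^-1 *: x.
have yE i : coords y i = (coords x (pivot m))^-1 * coords x i by rewrite /coords mxE.
have yin : y \in listed_points k m.
  apply/mem_listed_points => i lt_i; rewrite choicesP // yE exprMn exprVn.
  rewrite [coords x i ^+ k](xc i lt_i) [coords x (pivot m) ^+ k](xc _ lt_p).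
  apply/andP; split; last by apply/implyP => /eqP ->; rewrite mulVf.
  by apply/eqP; rewrite /normal_cubes; field; rewrite c0 nz.
exists (support_dim m), y; split; last 2 first.
- exact: mem_points.
- apply/eq_point => //; first exact: (listed_point_neq0 k0 lt_m yin).
  by exists (coords x (pivot m)); rewrite scalerA divff // scale1r.
by have := allP support_dims_range m; rewrite mem_iota; apply.
Qed.

Definition point_set (s : seq 'rV[C]_4) : set (P3 C) := [set p | exists2 x, x \in s & p = proj_point x].

Lemma card_point_set (s : seq 'rV[C]_4) : uniq s -> {in s, forall x, x != 0} ->
  {in s &, forall x y, forall a, x = a *: y -> x = y} -> point_set s #= `I_(size s).
Proof.
move=> us s0 sinj; have -> : point_set s = (fun i => proj_point (nth 0 s i)) @` `I_(size s).
  apply/seteqP; split=> [p [x xs ->]|p [i lt_i <-]]; last by exists (nth 0 s i) => //; exact: mem_nth.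
  by exists (index x s); rewrite /= ?index_mem // nth_index.
apply: inj_card_eq => i j; rewrite !inE /= => lt_i lt_j.
have si := mem_nth 0 lt_i; have sj := mem_nth 0 lt_j.
move=> /(eq_point (s0 _ si) (s0 _ sj))[a e]; apply/eqP.
by rewrite -(nth_uniq 0 lt_i lt_j us); apply/eqP/(sinj _ _ si sj a).
Qed.

Lemma card_points k e : (0 < k)%N -> point_set (points k e) #= `I_(size (points k e)).
Proof.
move=> k0; apply: card_point_set => [|x|x y xin yin a xy]; first exact: uniq_points.
  exact: points_neq0.
by have [] := points_inj k0 xin yin xy.
Qed.

Definition all_points k := points k 3 ++ points k 2 ++ points k 1.

Lemma mem_all_points k x : x \in all_points k -> exists2 e, (e \in [:: 3; 2; 1]%N) & x \in points k e.
Proof.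
by rewrite /all_points !mem_cat => /or3P[]h; [exists 3%N|exists 2%N|exists 1%N].
Qed.

Lemma in_all_points k x e : (e \in [:: 3; 2; 1]%N) -> x \in points k e -> x \in all_points k.
Proof.
rewrite /all_points !inE => /or3P[]/eqP->; move: (points k 3) (points k 2) (points k 1) => p3 p2 p1 h.
- by rewrite mem_cat h.
- by rewrite !mem_cat h orbT.
by rewrite !mem_cat h !orbT.
Qed.

Lemma card_all_points k : (0 < k)%N -> point_set (all_points k) #= `I_(44 * k ^ 3 + 24 * k ^ 2 + 12 * k)%N.
Proof.
move=> k0; have -> : (44 * k ^ 3 + 24 * k ^ 2 + 12 * k)%N = size (all_points k).
  have [e3 e2 e1] := size_with_support.
  have p3 := size_points 3 k0; have p2 := size_points 2 k0; have p1 := size_points 1 k0.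
  rewrite e3 in p3; rewrite e2 in p2; rewrite e1 expn1 in p1; rewrite -p3 -p2 -p1 /all_points.
  by move: (points k 3) (points k 2) (points k 1) => q3 q2 q1; rewrite !size_cat addnA.
apply: card_point_set => [|x /mem_all_points[e _]|x y /mem_all_points[e _ xin] /mem_all_points[e' _ yin] a xy].
- have disj e e' : e != e' -> forall x, x \in points k e -> x \notin points k e'.
    move=> ne x xin; apply/negP => yin.
    by have [e0 _] := points_inj k0 xin yin (esym (scale1r x)); rewrite e0 eqxx in ne.
  have [u3 u2 u1] : [/\ uniq (points k 3), uniq (points k 2) & uniq (points k 1)].
    by split; exact: uniq_points.
  have [d2 d1] := (disj 2%N 3%N isT, disj 1%N 3%N isT); have d12 := disj 1%N 2%N isT.
  rewrite /all_points; move: (points k 3) (points k 2) (points k 1) u3 u2 u1 d2 d1 d12.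
  move=> p3 p2 p1 u3 u2 u1 d2 d1 d12; rewrite !cat_uniq u3 u2 u1 /= andbT; apply/andP; split.
    by apply/hasPn => x; rewrite mem_cat => /orP[]; [exact: d2|exact: d1].
  by apply/hasPn => x; exact: d12.
- exact: points_neq0.
by have [] := points_inj k0 xin yin xy.
Qed.

Lemma singular_locus_points k : (1 < k)%N ->
  singular_locus (subst_pow k (octic C)) = point_set (all_points k).
Proof.
move=> k1; have k0 := ltnW k1; apply/seteqP; split=> p.
  have [x x0 ->] := pointP p; move=> /(singular_locusE k0 x0)/(singular_pow_listed w_root _ k1)[_ lx].
  have [e [y [ein yin ->]]] := listed_cubes_points k0 x0 lx; exists y; last by [].
  exact: in_all_points ein yin.
move=> [x /mem_all_points[e _ xin] ->]; have x0 := points_neq0 k0 xin.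
apply/(singular_locusE k0 x0)/(singular_pow_listed w_root _ k1); split; first exact: x0.
by have [m [lt_m _ xm]] := pointsP xin; exact: listed_point_listed xm.
Qed.

Lemma singular_locus_octic : singular_locus (subst_pow 1 (octic C)) = point_set (points 1 3).
Proof.
have k0 : (0 < 1)%N by []; apply/seteqP; split=> p.
  have [x x0 ->] := pointP p; move=> /(singular_locusE k0 x0)/(singular_octic_listed w_root)[_ lx nz].
  have [e [y [ein yin exy]]] := listed_cubes_points k0 x0 lx; rewrite exy; exists y => //.
  suff e3 : e = 3%N by move: yin; rewrite e3.
  apply/succn_inj; rewrite -(points_count k0 yin).
  have /(eq_point x0 (points_neq0 k0 yin))[a xy] := exy.
  have ny i : (i < 4)%N -> coords y i != 0.
    by move=> /nz; rewrite xy /coords mxE mulf_eq0 negb_or => /andP[].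
  by rewrite /= !ny.
move=> [x xin ->]; have x0 := points_neq0 k0 xin.
apply/(singular_locusE k0 x0)/(singular_octic_listed w_root); split; first exact: x0.
  by have [m [lt_m _ xm]] := pointsP xin; exact: listed_point_listed xm.
have := points_count k0 xin; rewrite /=.
by do 4!(case: eqP => [_|/eqP ?]); move=> // _ [|[|[|[|]]]].
Qed.

End SingularCount.

(** * The germ of g at a point of the coordinate line *)

Section LineGerm.
Local Open Scope ring_scope.
Local Open Scope classical_set_scope.

(** A term in the chart where the first coordinate is 1, with one factor of the third or fourth
    coordinate divided out. Affine coordinates are numbered from 0, so exponents move down by one
    place. *)
Definition shift_term (zt : Z * signed_exponents) (third : bool) : pexpr :=
  let: (z, (s, (a, b, c, d))) := zt in
  term_expr z (s, if third then (b, c.-1, 0, 0) else (b, c, d.-1, 0))%N.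

Definition fourth_part : pexpr :=
  foldr (fun zt e => if (0 < zt.2.2.2)%N then PA (shift_term zt false) e else e) (PC 0) octic_terms.

Definition third_part : pexpr :=
  foldr (fun zt e => if (zt.2.2.2 == 0) && (0 < zt.2.2.1.2)%N then PA (shift_term zt true) e else e)
    (PC 0) octic_terms.

Definition affine_subst := nth (PV 2) [:: PC 1; PV 0; PV 1].

Definition line_part : pexpr := PM (PP (PA (PP (PV 0) 2) (PC 1)) 2)
  (PA (PP (PV 0) 4) (PA (PM (PC (-8)) (PP (PV 0) 2)) (PC 1))).

Lemma octic_parts : peq 4 (psubst affine_subst octic_expr)
  (PA line_part (PA (PM (PV 1) third_part) (PM (PV 2) fourth_part))).
Proof. by vm_compute. Qed.

Definition first_only := nth (PC 0) [:: PV 0].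
Definition line_affine := nth (PC 0) [:: PC 1; PV 0].

Lemma third_part_line : peq 4 (psubst first_only third_part) (psubst line_affine line_normal2).
Proof. by vm_compute. Qed.

Lemma fourth_part_line : peq 4 (psubst first_only fourth_part) (psubst line_affine line_normal3).
Proof. by vm_compute. Qed.

Lemma third_part_pvars : pvars 4 third_part. Proof. by vm_compute. Qed.

Lemma fourth_part_pvars : pvars 4 fourth_part. Proof. by vm_compute. Qed.

(** [third_part] collects only terms free of the last coordinate. Thus the decomposition is
    triangular and a change of the last coordinate does not disturb it. *)
Lemma third_part_vars : peq 4 (psubst (nth (PC 0) [:: PV 0; PV 1]) third_part) third_part.
Proof. by vm_compute. Qed.

#[local] Opaque octic_expr third_part fourth_part.
Variable C : numClosedFieldType.
Local Notation U := 'rV[C]_3.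

(** Separate exponents allow the coordinates to be raised to powers one at a time and also cover
    mixed forms. *)
Definition octic_chart a b c : set U :=
  [set v | octic_at (quad 1 (v 0 0 ^+ a) (v 0 1 ^+ b) (v 0 2%:R ^+ c)) = 0].

Lemma set_coord_row3 (x y z t : C) :
  (set_coord 0 (row3 x y z) t = row3 t y z) * (set_coord 1 (row3 x y z) t = row3 x t z) *
  (set_coord 2%:R (row3 x y z) t = row3 x y t).
Proof. by do ![split]; apply/rowP; apply: ord3P; rewrite !mxE. Qed.

Lemma row3_cases (v : U) : exists x y z, v = row3 x y z.
Proof. by do 3!eexists; exact: row3P. Qed.

Lemma octic_chart_power0 e b c x y z : (0 < e)%N -> x != 0 ->
  loc_iso (octic_chart e b c) (row3 x y z) (octic_chart 1 b c) (row3 (x ^+ e) y z).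
Proof.
move=> e0 x0; have := @loc_iso_power C e e0 0 (octic_chart e b c) (row3 x y z) (octic_chart 1 b c).
rewrite !row3E !set_coord_row3; apply=> //; apply: filterE => v.
have [v0 [v1 [v2 ->]]] := row3_cases v.
by rewrite !row3E !set_coord_row3 /octic_chart /= !row3E expr1.
Qed.

Lemma octic_chart_power1 e a c x y z : (0 < e)%N -> y != 0 ->
  loc_iso (octic_chart a e c) (row3 x y z) (octic_chart a 1 c) (row3 x (y ^+ e) z).
Proof.
move=> e0 x0; have := @loc_iso_power C e e0 1 (octic_chart a e c) (row3 x y z) (octic_chart a 1 c).
rewrite !row3E !set_coord_row3; apply=> //; apply: filterE => v.
have [v0 [v1 [v2 ->]]] := row3_cases v.
by rewrite !row3E !set_coord_row3 /octic_chart /= !row3E expr1.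
Qed.

Lemma octic_chart_power2 e a b x y z : (0 < e)%N -> z != 0 ->
  loc_iso (octic_chart a b e) (row3 x y z) (octic_chart a b 1) (row3 x y (z ^+ e)).
Proof.
move=> e0 x0; have := @loc_iso_power C e e0 2%:R (octic_chart a b e) (row3 x y z) (octic_chart a b 1).
rewrite !row3E !set_coord_row3; apply=> //; apply: filterE => v.
have [v0 [v1 [v2 ->]]] := row3_cases v.
by rewrite !row3E !set_coord_row3 /octic_chart /= !row3E expr1.
Qed.

Lemma octic_chart_powers k x y z : (0 < k)%N -> x != 0 -> y != 0 -> z != 0 ->
  loc_iso (octic_chart k k k) (row3 x y z) (octic_chart 1 1 1) (row3 (x ^+ k) (y ^+ k) (z ^+ k)).
Proof.
move=> k0 x0 y0 z0; apply: loc_iso_trans (octic_chart_power0 _ _ _ _ k0 x0) _.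
by apply: loc_iso_trans (octic_chart_power1 _ _ _ _ k0 y0) _; exact: octic_chart_power2.
Qed.

Variables (h : C) (e3 e4 : nat).
Hypotheses (h2 : h ^+ 2 = -1) (e3_gt0 : (0 < e3)%N) (e4_gt0 : (0 < e4)%N).

Local Notation X i := (mpolyX C (mnm1 (i : 'I_3))).
Local Notation ev x P := (meval (fun i => x 0 i) P).

Definition shifted_env : nat -> mpoly 3 C :=
  nth 0 [:: X 0 + mpolyC 3 h; X 1 ^+ e3; X 2%:R ^+ e4].
Definition unit3 := peval shifted_env third_part.
Definition unit4 := peval shifted_env fourth_part.
(** As h^2 = -1, (x + h)^2 + 1 = x (x + 2 h); its square splits off x^2 and leaves this cofactor. *)
Definition unit2 := (X 0 + mpolyC 3 (2%:R * h)) ^+ 2 *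
  ((X 0 + mpolyC 3 h) ^+ 4 - mpolyC 3 8%:R * (X 0 + mpolyC 3 h) ^+ 2 + 1).

Definition point_env (x y z : C) : nat -> C := nth 0 [:: x + h; y ^+ e3; z ^+ e4].

Lemma ev_part x y z e : pvars 4 e ->
  ev (row3 x y z) (peval shifted_env e) = peval (point_env x y z) e.
Proof.
move=> pv; rewrite (rmorph_peval (meval _)); apply: (eq_peval_vars pv) => -[|[|[|[|//]]]] _ /=.
- by rewrite mevalD mevalXU mevalC row3E.
- by rewrite rmorphXn /= mevalXU row3E.
- by rewrite rmorphXn /= mevalXU row3E.
by rewrite meval0.
Qed.

Lemma ev_unit2 x y z : ev (row3 x y z) unit2 =
  (x + 2%:R * h) ^+ 2 * ((x + h) ^+ 4 - 8%:R * (x + h) ^+ 2 + 1).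
Proof.
have XE : meval (fun i => row3 x y z 0 i) (X 0) = x by rewrite mevalXU row3E.
have evX p n : meval (fun i => row3 x y z 0 i) (p ^+ n) = meval (fun i => row3 x y z 0 i) p ^+ n.
  exact: rmorphXn.
have evN p : meval (fun i => row3 x y z 0 i) (- p) = - meval (fun i => row3 x y z 0 i) p.
  exact: rmorphN.
by rewrite /unit2 !(evX, evN, mevalM, mevalD, mevalC, meval1, XE).
Qed.

Lemma octic_shifted x y z : octic_at (quad 1 (x + h) (y ^+ e3) (z ^+ e4)) =
  x ^+ 2 * ev (row3 x y z) unit2 + y ^+ e3 * ev (row3 x y z) unit3 + z ^+ e4 * ev (row3 x y z) unit4.
Proof.
have v3 := third_part_pvars; have v4 := fourth_part_pvars; rewrite ev_unit2 /unit3 /unit4 (ev_part _ _ _ v3) (ev_part _ _ _ v4).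
transitivity (peval (point_env x y z) (psubst affine_subst octic_expr)).
  by rewrite peval_subst; apply: (eq_peval_vars octic_vars) => -[|[|[|[|//]]]].
rewrite (peqP _ octic_parts); move: third_part fourth_part => t3 t4 /=.
rewrite addrA; congr (_ + _ + _); have -> : zr C (-8) = - 8%:R by rewrite (zrN _ 8) -[8%:R]zr_nat.
have -> : (x + h) ^+ 2 + 1 = x * (x + 2%:R * h).
  by transitivity ((x + h) ^+ 2 - h ^+ 2); [rewrite h2 opprK|ring].
by rewrite exprMn mulNr addrA -mulrA; congr (_ * (_ * _)); ring.
Qed.

Lemma third_indep x y z z' :
  peval (point_env x y z) third_part = peval (point_env x y z') third_part.
Proof.
have e1 := peqP (point_env x y z) third_part_vars.
have e2 := peqP (point_env x y z') third_part_vars.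
apply: etrans (esym e1) (etrans _ e2); move: third_part => t {e1 e2}.
by rewrite !peval_subst; apply: eq_peval => -[|[|i]]; rewrite /= ?nth_nil.
Qed.

Lemma part_at_zero j e f : peq 4 (psubst line_subst (pderiv j octic_expr)) e ->
  peq 4 (psubst first_only f) (psubst line_affine e) -> pvars 4 f ->
  octic_deriv j (quad 1 h 0 0) != 0 -> peval (point_env 0 0 0) f != 0.
Proof.
move=> je fe pv; apply: contra_neq => f0.
have ze n : (0 < n)%N -> (0 : C) ^+ n = 0 by move=> n0; rewrite expr0n gtn_eqF.
have F : peval (fun i => peval (fun=> h) (first_only i)) f = peval (point_env 0 0 0) f.
  apply: (eq_peval_vars pv) => i _; case: i => [|[|[|i]]]; rewrite /point_env.
  - by rewrite /= add0r.
  - by rewrite /= ze.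
  - by rewrite /= ze.
  by rewrite /= !nth_nil.
have e0 : peval (fun i => peval (fun=> h) (line_affine i)) e = 0.
  have := peqP (fun=> h) fe; rewrite !peval_subst => fe'.
  by apply: etrans (esym fe') _; apply: etrans F f0.
have pve : pvars 4 e.
  by move: je; rewrite /peq => /andP[+ _]; rewrite /psub [pvars _ _]/= => /andP[].
transitivity (peval (quad 1 h 0 0) e).
  apply: etrans (peqP (quad 1 h 0 0) je); apply: etrans (esym (peval_subst _ _ _)).
  apply: (@eq_peval_vars _ 4); first by apply: pvars_pderiv; exact: octic_vars.
  by case=> [|[|[|[|i]]]].
rewrite -[RHS]e0; apply: (eq_peval_vars pve) => i _; case: i => [|[|[|[|i]]]] //.
Qed.

Lemma units_neq0 : [/\ ev (0 : U) unit2 != 0, ev (0 : U) unit3 != 0 & ev (0 : U) unit4 != 0].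
Proof.
have row0 : (0 : U) = row3 0 0 0 by apply/rowP; apply: ord3P; rewrite !mxE.
have h0 : h != 0 by apply: contra_eq_neq h2 => ->; rewrite expr0n eq_sym oppr_eq0 oner_eq0.
have v3 := third_part_pvars; have v4 := fourth_part_pvars; rewrite row0 ev_unit2 /unit3 /unit4 (ev_part _ _ _ v3) (ev_part _ _ _ v4) !add0r.
have nz : 1 != 0 :> C \/ h != 0 by right.
have [|n2 n3] := octic_deriv_line_normal nz; first by rewrite expr1n h2 subrr.
split; last 2 first.
- exact: (part_at_zero line_deriv2 third_part_line v3 n2).
- exact: (part_at_zero line_deriv3 fourth_part_line v4 n3).
clear v3 v4 n2 n3 nz row0.
have h4 : h ^+ 4 = 1.
  by transitivity ((h ^+ 2) ^+ 2); [ring|rewrite h2 sqrrN expr1n].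
rewrite h4 h2 exprMn h2.
have -> : 2%:R ^+ 2 * -1 * (1 - 8%:R * -1 + 1) = - 40%:R :> C by ring.
by rewrite oppr_eq0 pnatr_eq0.
Qed.

Definition normal_germ : set U := [set v | v 0 0 ^+ 2 + v 0 1 ^+ e3 + v 0 2%:R ^+ e4 = 0].

(** The three units are absorbed starting from the last coordinate: [unit3] and [unit2] do not
    involve it, and [unit2] involves only the first. In this order no step spoils the units still to
    be absorbed. *)
Lemma line_germ : loc_iso (octic_chart 1 e3 e4) (row3 h 0 0) normal_germ 0.
Proof.
have row0 : (0 : U) = row3 0 0 0 by apply/rowP; apply: ord3P; rewrite !mxE.
pose T (v : U) := (v 0 0 ^+ 2 * ev v unit2, v 0 1 ^+ e3 * ev v unit3, v 0 2%:R ^+ e4 * ev v unit4).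
pose S4 : set U := [set v | (T v).1.1 + (T v).1.2 + (T v).2 = 0].
pose S3 : set U := [set v | (T v).1.1 + (T v).1.2 + v 0 2%:R ^+ e4 = 0].
pose S2 : set U := [set v | (T v).1.1 + v 0 1 ^+ e3 + v 0 2%:R ^+ e4 = 0].
apply: (@loc_iso_trans _ S4 0).
  apply: (@loc_iso_coord C 0 (fun v => v 0 0 - h) (fun v => v 0 0 + h)).
  - by apply: filterE => v; apply: differentiableB; [exact: differentiable_coord|exact: differentiable_cst].
  - by apply: filterE => v; apply: differentiableD; [exact: differentiable_coord|exact: differentiable_cst].
  - by rewrite row3E set_coord_row3 subrr row0.
  - by rewrite row3E mxE add0r.
  - by apply: filterE => v; rewrite set_coord_same subrK.
  - by apply: filterE => v; rewrite set_coord_same addrK.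
  apply: filterE => v; have [x [y [z ->]]] := row3_cases v.
  rewrite row3E set_coord_row3 /octic_chart /S4 /T /= !row3E expr1.
  by rewrite -octic_shifted subrK.
have S43 : loc_iso S4 0 S3 0.
  apply: (@loc_iso_unit C e4 e4_gt0 2%:R unit4 0); [by rewrite mxE|by have [] := units_neq0|].
  move=> v t et; have [x [y [z vE]]] := row3_cases v; rewrite vE in et *.
  rewrite row3E set_coord_row3 /S4 /S3 /T /= !row3E exprMn et !ev_unit2 /unit3 !(ev_part _ _ _ third_part_pvars).
  by rewrite (third_indep x y (z * t) z).
have S32 : loc_iso S3 0 S2 0.
  apply: (@loc_iso_unit C e3 e3_gt0 1 unit3 0); [by rewrite mxE|by have [] := units_neq0|].
  move=> v t et; have [x [y [z vE]]] := row3_cases v; rewrite vE in et *.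
  by rewrite row3E set_coord_row3 /S3 /S2 /T /= !row3E exprMn et !ev_unit2.
have S21 : loc_iso S2 0 normal_germ 0.
  apply: (@loc_iso_unit C 2 isT 0 unit2 0); [by rewrite mxE|by have [] := units_neq0|].
  move=> v t et; have [x [y [z vE]]] := row3_cases v; rewrite vE in et *.
  by rewrite row3E set_coord_row3 /S2 /normal_germ /T /= !row3E exprMn et.
exact: loc_iso_trans S43 (loc_iso_trans S32 S21).
Qed.

End LineGerm.

(** * Types of the singular points *)

Section SingularGerms.
Local Open Scope ring_scope.
Local Open Scope classical_set_scope.
#[local] Opaque octic_expr.
Variable C : numClosedFieldType.
Local Notation U := 'rV[C]_3.
Variable w : C.
Hypothesis w_root : w ^+ 2 + w + 1 = 0.
Local Notation F24 := (F24 C).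

Lemma chart0 (x y z : C) : chart 0 (row3 x y z) = vec4 1 x y z.
Proof.
apply/rowP => i; rewrite !mxE; case: unliftP => [j ->|->] //.
by rewrite mxE; case: j => -[|[|[|//]]] lt.
Qed.

Lemma octic_chartE k : [set y | evalv (subst_pow k (octic C)) (chart 0 y) = 0] = @octic_chart C k k k.
Proof.
apply/seteqP; split=> v; have [x [y [z ->]]] := row3_cases v;
  by rewrite /octic_chart /= chart0 !row3E evalv_octic_vec4 expr1n.
Qed.

Lemma chart_of (x : 'rV[C]_4) : x != 0 -> exists i a k, k != 0 /\ x = k *: chart i a.
Proof.
move=> x0; have [i xi] : exists i, x 0 i != 0.
  apply/existsP; apply: contraR x0 => /existsPn h; apply/eqP/rowP => i.
  by have := h i; rewrite negbK mxE => /eqP.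
by exists i, (dehomog i x), (x 0 i); split=> //; rewrite chart_dehomog // scalerA divff // scale1r.
Qed.

Definition mat3 (l : seq (seq C)) : 'M[C]_3 := \matrix_(i, j) nth 0 (nth [::] l i) j.

Lemma mul_row3_mat3 x y z l0 l1 l2 : row3 x y z *m mat3 [:: l0; l1; l2] =
  row3 (x * nth 0 l0 0 + y * nth 0 l1 0 + z * nth 0 l2 0)
    (x * nth 0 l0 1 + y * nth 0 l1 1 + z * nth 0 l2 1)
    (x * nth 0 l0 2 + y * nth 0 l1 2 + z * nth 0 l2 2).
Proof.
apply/rowP => j; rewrite mxE !big_ord_recr big_ord0 /= add0r !mxE /=.
by case: j => -[|[|[|//]]] lt.
Qed.

Lemma eq_mulmx_row3 (A B : 'M[C]_3) : (forall x y z, row3 x y z *m A = row3 x y z *m B) -> A = B.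
Proof.
move=> h; apply/row_matrixP => i; rewrite !rowE.
by have [x [y [z ->]]] := row3_cases (delta_mx 0 i : U).
Qed.

(** With Y = b (y - z) and Z = c (y + z), the values c^3 = 1/4 and b^2 c = 3/4 turn Y^2 Z + Z^3 into
    y^3 + z^3. *)
Lemma D4_normal : loc_iso (@normal_germ C 3 3) 0 (D4_germ C) 0.
Proof.
pose c := 3.-root (4%:R^-1 : C); have c3 : c ^+ 3 = 4%:R^-1 by rewrite rootCK.
have c0 : c != 0.
  by apply/eqP => c0; move: c3; rewrite c0 expr0n => /esym/eqP; rewrite invr_eq0 pnatr_eq0.
pose b := sqrtC (3%:R * 4%:R^-1 / c); have b2 : b ^+ 2 = 3%:R * 4%:R^-1 / c by rewrite sqrtCK.
have b0 : b != 0.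
  apply/eqP => b0; move: b2; rewrite b0 expr0n => /esym/eqP.
  by rewrite !mulf_eq0 !invr_eq0 !pnatr_eq0 (negPf c0).
have two : 2%:R != 0 :> C by rewrite pnatr_eq0.
apply: (@loc_iso_linear C _ _ (mat3 [:: [:: 1; 0; 0]; [:: 0; b; c]; [:: 0; - b; c]])
  (mat3 [:: [:: 1; 0; 0]; [:: 0; (2%:R * b)^-1; - (2%:R * b)^-1]; [:: 0; (2%:R * c)^-1; (2%:R * c)^-1]])).
- apply: eq_mulmx_row3 => x y z; rewrite mulmxA mulmx1 !mul_row3_mat3 /=.
  by congr row3; field; rewrite ?b0 ?c0 ?two.
- apply: eq_mulmx_row3 => x y z; rewrite mulmxA mulmx1 !mul_row3_mat3 /=.
  by congr row3; field; rewrite ?b0 ?c0 ?two.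
move=> v; have [x [y [z ->]]] := row3_cases v.
rewrite /normal_germ /D4_germ /= mul_row3_mat3 /= !row3E !mulr0 !mulr1 !addr0 !add0r.
suff -> : x ^+ 2 + (y * b + z * - b) ^+ 2 * (y * c + z * c) + (y * c + z * c) ^+ 3 =
  x ^+ 2 + y ^+ 3 + z ^+ 3 by [].
have e1 : b ^+ 2 * c = 3%:R / 4%:R by rewrite b2 divfK.
transitivity (x ^+ 2 + (b ^+ 2 * c) * ((y - z) ^+ 2 * (y + z)) + c ^+ 3 * (y + z) ^+ 3); first by ring.
by rewrite e1 c3; field.
Qed.

Lemma A2_normal : loc_iso (@normal_germ C 3 2) 0 (A_germ C 2) 0.
Proof.
set M := mat3 [:: [:: 1; 0; 0]; [:: 0; 0; 1]; [:: 0; 1; 0]].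
have ME x y z : row3 x y z *m M = row3 x z y.
  by rewrite mul_row3_mat3 /= !mulr0 !mulr1 ?addr0 ?add0r.
have MM : M *m M = 1%:M by apply: eq_mulmx_row3 => x y z; rewrite mulmxA mulmx1 !ME.
apply: (@loc_iso_linear C _ _ M M MM MM) => v; have [x [y [z ->]]] := row3_cases v.
by rewrite ME /normal_germ /A_germ /= !row3E addrAC.
Qed.

Lemma A1_normal : loc_iso (@normal_germ C 2 2) 0 (A_germ C 1) 0.
Proof.
by apply: (@loc_iso_linear C _ _ 1%:M 1%:M); rewrite ?mulmx1 // => x; rewrite mulmx1.
Qed.

Lemma D4_line_germ (h : C) : h ^+ 6 = -1 -> loc_iso (@octic_chart C 3 3 3) (row3 h 0 0) (D4_germ C) 0.
Proof.
move=> h6; have h0 : h != 0.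
  by apply: contra_eq_neq h6 => ->; rewrite expr0n eq_sym oppr_eq0 oner_eq0.
apply: loc_iso_trans (octic_chart_power0 _ _ _ _ (isT : (0 < 3)%N) h0) _.
apply: loc_iso_trans (@line_germ C _ 3 3 _ isT isT) D4_normal.
by rewrite -exprM.
Qed.

Lemma D4_F24 i (a : U) : singular_vec F24 (chart i a) ->
  loc_iso [set y | evalv F24 (chart i y) = 0] a (D4_germ C) 0.
Proof.
move=> sx; have [A [sA [k k0 xA]]] := singular_orbit w_root sx.
have [B [sB AB BA]] := symmetry_inv w_root sA.
have hF := homogeneous_octic_pow C 3.
have := @loc_iso_projective C [set x | evalv F24 x = 0] [set x | evalv F24 x = 0] A B i 0 a
  (row3 (- 'i) 0 0) k AB BA; rewrite chart0 => /(_ _ _ k0 xA) P.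
apply: loc_iso_trans (P _ _) _ => [c x c0|x|].
- rewrite /= (evalvZ _ _ hF); split=> [/eqP|->]; last by rewrite mulr0.
  by rewrite mulf_eq0 expf_eq0 (negPf c0) andbF => /eqP.
- by rewrite /= (symmetry_F24 w_root).
rewrite /= octic_chartE; apply: D4_line_germ.
rewrite (_ : (- 'i : C) ^+ 6 = (('i ^+ 2) ^+ 3)); last by ring.
by rewrite sqrCi; ring.
Qed.

(** Off the coordinate planes powers are local isomorphisms, so the germ of g[k] at x is that of g
    at the k-th powers and also that of g[3] at their cube roots, where the orbit of the base point
    applies. *)
Lemma D4_torus k x : (0 < k)%N -> x != 0 -> (forall i, (i < 4)%N -> coords x i != 0) ->
  listed_cubes w (coords_pow k x) -> has_germ (zeros (subst_pow k (octic C))) (proj_point x) (D4_germ C).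
Proof.
move=> k0 x0 nz [m lt_m [c xc]]; have x00 := nz 0%N isT.
pose a i := coords x i / coords x 0.
have a0 i : (i < 4)%N -> a i != 0 by move=> lt_i; rewrite mulf_neq0 ?invr_eq0 ?nz.
have xE : x = coords x 0 *: chart 0 (row3 (a 1%N) (a 2%N) (a 3%N)).
  rewrite chart0 scale_vec4 mulr1 {1}[x]vec4_eta /a; congr vec4; by rewrite mulrCA divff ?mulr1.
apply: (has_germ_loc_iso (homogeneous_octic_pow C k) x00 xE); rewrite octic_chartE.
apply: loc_iso_trans (octic_chart_powers k0 (a0 1%N isT) (a0 2%N isT) (a0 3%N isT)) _.
pose r i := 3.-root (a i ^+ k); have r3 i : r i ^+ 3 = a i ^+ k by rewrite rootCK.
have r0 i : (i < 4)%N -> r i != 0.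
  by move=> lt_i; have := expf_neq0 k (a0 i lt_i); rewrite -r3 expf_eq0.
rewrite -!r3; apply: loc_iso_trans (loc_iso_sym (octic_chart_powers (isT : (0 < 3)%N) (r0 1%N isT) (r0 2%N isT) (r0 3%N isT))) _.
rewrite -octic_chartE; apply: D4_F24; rewrite chart0.
apply/(singular_pow_listed w_root _ (isT : (1 < 3)%N)); split; first by rewrite vec4_eq0 oner_eq0.
exists m => //; exists (c / coords x 0 ^+ k) => i lt_i.
rewrite mulrAC -(xc i lt_i) /coords_pow coords_vec4 //.
case: i lt_i => [|[|[|[|//]]]] _; rewrite /quad /= ?r3 /a ?expr_div_n //.
by rewrite expr1n divff // expf_neq0.
Qed.

(* Lifts of the generators of W1 to symmetries of g[2]. *)
Definition lift1 : 'M[C]_4 := s1 C *m diag4 1 1 1 'i.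
Definition lift2 : 'M[C]_4 := s2 C *m diag4 1 1 1 'i.
Definition lift3 : 'M[C]_4 := s3 C *m diag4 'i 1 1 1.

Definition pow2_symmetry (M : 'M[C]_4) := exists N, [/\ M *m N = 1%:M, N *m M = 1%:M &
  forall x, evalv (subst_pow 2 (octic C)) (x *m M) = evalv (subst_pow 2 (octic C)) x].

Lemma pow2_symmetry_mul A B : pow2_symmetry A -> pow2_symmetry B -> pow2_symmetry (A *m B).
Proof.
move=> [A' [AA' A'A fA]] [B' [BB' B'B fB]]; exists (B' *m A'); split.
- by rewrite mulmxA -(mulmxA A) BB' mulmx1.
- by rewrite mulmxA -(mulmxA B') A'A mulmx1.
by move=> x; rewrite mulmxA fB fA.
Qed.

Lemma pow2_symmetry_lift s a d : s *m s = 1%:M -> a ^+ 4 = 1 -> d ^+ 4 = 1 ->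
  (forall x, evalv (subst_pow 2 (octic C)) (x *m (s *m diag4 a 1 1 d)) = evalv (subst_pow 2 (octic C)) x) ->
  pow2_symmetry (s *m diag4 a 1 1 d).
Proof.
move=> ss a4 d4 fs; exists (diag4 (a ^+ 3) 1 1 (d ^+ 3) *m s).
split; last exact: fs.
  by rewrite mulmxA -(mulmxA s) mul_diag4_diag4 !mulr1 -!exprS a4 d4 diag4_1 mulmx1.
by rewrite mulmxA -(mulmxA _ s s) ss mulmx1 mul_diag4_diag4 !mulr1 -!exprSr a4 d4 diag4_1.
Qed.

Lemma lifts_symmetry : [/\ pow2_symmetry lift1, pow2_symmetry lift2 & pow2_symmetry lift3].
Proof.
have i4 : ('i : C) ^+ 4 = 1 by rewrite -[4%N]/(2 * 2)%N exprM sqrCi sqrrN expr1n.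
split; apply: pow2_symmetry_lift; rewrite ?expr1n ?s1_involution ?s2_involution ?s3_involution // => x;
  have [a [b [c [d ->]]]] := vec4P x; rewrite mulmxA ?mul_s1 ?mul_s2 ?mul_s3 mul_diag4 !evalv_octic_vec4.
- by rewrite !mulr1 exprMn sqrCi sqrrN mulrN1 octic_sign1.
- by rewrite !mulr1 exprMn sqrCi sqrrN mulrN1 octic_sign2.
by rewrite !mulr1 exprMn sqrCi sqrrN mulrN1 octic_sign3.
Qed.

Definition germ_at2 x (Y : set U) := has_germ (zeros (subst_pow 2 (octic C))) (proj_point x) Y.

Lemma germ_transport x M (Y : set U) a k : x != 0 -> pow2_symmetry M -> k != 0 ->
  x *m M = k *: chart 0 a ->
  loc_iso [set y | evalv (subst_pow 2 (octic C)) (chart 0 y) = 0] a Y 0 -> germ_at2 x Y.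
Proof.
move=> x0 [N [MN NM fM]] k0 yE germ; have hf := homogeneous_octic_pow C 2.
have [i [b [l [l0 xE]]]] := chart_of x0.
apply: (has_germ_loc_iso hf l0 xE); apply: loc_iso_trans germ.
apply: (@loc_iso_projective C [set x | evalv (subst_pow 2 (octic C)) x = 0]
  [set x | evalv (subst_pow 2 (octic C)) x = 0] M N i 0 b a (l^-1 * k) MN NM).
- move=> c z c0; rewrite /= (evalvZ _ _ hf); split=> [/eqP|->]; last by rewrite mulr0.
  by rewrite mulf_eq0 expf_eq0 (negPf c0) andbF => /eqP.
- by move=> z; rewrite /= fM.
- by rewrite mulf_neq0 ?invr_eq0.
by rewrite -scalerA -yE xE -scalemxAl scalerA mulVf // scale1r.
Qed.

Lemma pow2_symmetry1 : pow2_symmetry 1%:M.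
Proof. by exists 1%:M; rewrite mulmx1; split=> // x; rewrite mulmx1. Qed.

Lemma move_lifts (P : 'rV[C]_4 -> Prop) a b c d :
  let Q x := exists M, pow2_symmetry M /\ P (x *m M) in
  [/\ Q (vec4 b a c (- d * 'i)) -> Q (vec4 a b c d), Q (vec4 a c b (- d * 'i)) -> Q (vec4 a b c d) &
     Q (vec4 (- a * 'i) b d c) -> Q (vec4 a b c d)].
Proof.
have [l1 l2 l3] := lifts_symmetry; move=> Q.
have step L y : pow2_symmetry L -> vec4 a b c d *m L = y -> Q y -> Q (vec4 a b c d).
  by move=> sL e [M [sM PM]]; exists (L *m M); rewrite mulmxA e; split=> //; exact: pow2_symmetry_mul.
split; [apply: (step lift1)|apply: (step lift2)|apply: (step lift3)] => //.
- by rewrite mulmxA mul_s1 mul_diag4 !mulr1.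
- by rewrite mulmxA mul_s2 mul_diag4 !mulr1.
by rewrite mulmxA mul_s3 mul_diag4 !mulr1.
Qed.

(** The lifts exchange coordinates up to units, so zeros are pushed to the end one exchange at a
    time. *)
Lemma pow2_line_move x : count (fun i => coords x i != 0) (iota 0 4) = 2%N ->
  exists M, pow2_symmetry M /\ exists a b, [/\ a != 0, b != 0 & x *m M = vec4 a b 0 0].
Proof.
pose P (y : 'rV[C]_4) := exists a b, [/\ a != 0, b != 0 & y = vec4 a b 0 0].
pose Q y := exists M, pow2_symmetry M /\ P (y *m M).
have i0 : ('i : C) != 0 by exact: neq0Ci.
have ni (a : C) : a != 0 -> - a * 'i != 0 by move=> a0; rewrite mulf_neq0 ?oppr_eq0.
have zi : - 0 * 'i = 0 :> C by rewrite oppr0 mul0r.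
have c01 a b : a != 0 -> b != 0 -> Q (vec4 a b 0 0).
  by move=> a0 b0; exists 1%:M; split; [exact: pow2_symmetry1|rewrite mulmx1; exists a, b].
have c02 a c : a != 0 -> c != 0 -> Q (vec4 a 0 c 0).
  by move=> a0 b0; have [_ h _] := move_lifts P a 0 c 0; apply: h; rewrite zi; exact: c01.
have c03 a d : a != 0 -> d != 0 -> Q (vec4 a 0 0 d).
  by move=> a0 b0; have [_ _ h] := move_lifts P a 0 0 d; apply: h; apply: c02 => //; exact: ni.
have c12 b c : b != 0 -> c != 0 -> Q (vec4 0 b c 0).
  by move=> a0 b0; have [h _ _] := move_lifts P 0 b c 0; apply: h; rewrite zi; exact: c02.
have c13 b d : b != 0 -> d != 0 -> Q (vec4 0 b 0 d).
  by move=> a0 b0; have [_ _ h] := move_lifts P 0 b 0 d; apply: h; rewrite zi; exact: c12.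
have c23 c d : c != 0 -> d != 0 -> Q (vec4 0 0 c d).
  by move=> a0 b0; have [_ h _] := move_lifts P 0 0 c d; apply: h; apply: c13 => //; exact: ni.
have [a [b [c [d ->]]]] := vec4P x; rewrite /= !coords_vec4 // /quad /=.
have [->|a0] := eqVneq a 0; have [->|b0] := eqVneq b 0; have [->|cn0] := eqVneq c 0;
  have [->|dn0] := eqVneq d 0 => //= _.
- exact: c23.
- exact: c13.
- exact: c12.
- exact: c03.
- exact: c02.
exact: c01.
Qed.

Lemma pow2_plane_move x : count (fun i => coords x i != 0) (iota 0 4) = 3%N ->
  exists M, pow2_symmetry M /\
    exists a b c, [/\ a != 0, b != 0, c != 0 & x *m M = vec4 a b c 0].
Proof.
pose P (y : 'rV[C]_4) := exists a b c, [/\ a != 0, b != 0, c != 0 & y = vec4 a b c 0].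
pose Q y := exists M, pow2_symmetry M /\ P (y *m M).
have i0 : ('i : C) != 0 by exact: neq0Ci.
have ni (a : C) : a != 0 -> - a * 'i != 0 by move=> a0; rewrite mulf_neq0 ?oppr_eq0.
have zi : - 0 * 'i = 0 :> C by rewrite oppr0 mul0r.
have c3 a b c : a != 0 -> b != 0 -> c != 0 -> Q (vec4 a b c 0).
  by move=> a0 b0 c0; exists 1%:M; split; [exact: pow2_symmetry1|rewrite mulmx1; exists a, b, c].
have c2 a b d : a != 0 -> b != 0 -> d != 0 -> Q (vec4 a b 0 d).
  move=> a0 b0 c0; have [_ _ h] := move_lifts P a b 0 d; apply: h; apply: c3 => //; exact: ni.
have c1 a c d : a != 0 -> c != 0 -> d != 0 -> Q (vec4 a 0 c d).
  move=> a0 b0 c0; have [_ h _] := move_lifts P a 0 c d; apply: h; apply: c2 => //; exact: ni.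
have c0 b c d : b != 0 -> c != 0 -> d != 0 -> Q (vec4 0 b c d).
  move=> a0 b0 c0; have [h _ _] := move_lifts P 0 b c d; apply: h; apply: c1 => //; exact: ni.
have [a [b [c [d ->]]]] := vec4P x; rewrite /= !coords_vec4 // /quad /=.
have [->|a0] := eqVneq a 0; have [->|b0] := eqVneq b 0; have [->|cn0] := eqVneq c 0;
  have [->|dn0] := eqVneq d 0 => //= _.
- exact: c0.
- exact: c1.
- exact: c2.
exact: c3.
Qed.

Lemma pow2_symmetry_singular x M : pow2_symmetry M -> singular_vec (subst_pow 2 (octic C)) x ->
  singular_vec (subst_pow 2 (octic C)) (x *m M).
Proof. by move=> [N [MN NM fM]]; apply: singular_mulmx fM; have [] := mulmx1_unit MN. Qed.

Lemma singular_line k a b : (0 < k)%N -> a != 0 -> b != 0 ->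
  singular_vec (subst_pow k (octic C)) (vec4 a b 0 0) -> ((b / a) ^+ k) ^+ 2 = -1.
Proof.
move=> k0 a0 b0 sx; have zk : (0 : C) ^+ k = 0 by rewrite expr0n gtn_eqF.
have nz : a ^+ k != 0 \/ b ^+ k != 0 by left; exact: expf_neq0.
have d0 := singular_octic_deriv sx k0 (isT : (0 < 4)%N) (or_introl a0).
have d1 := singular_octic_deriv sx k0 (isT : (1 < 4)%N) (or_introl b0).
rewrite !zk in d0 d1.
have e : (a ^+ k) ^+ 2 + (b ^+ k) ^+ 2 = 0.
  by apply: line_critical nz _ _; [rewrite d0 mulr0|rewrite d1 mulr0].
have ak : a ^+ k != 0 by exact: expf_neq0.
clear sx nz d0 d1; rewrite !expr_div_n; apply: (mulIf (expf_neq0 2 ak)).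
rewrite divfK ?expf_neq0 // mulN1r.
by apply/eqP; rewrite -addr_eq0 addrC e.
Qed.

Lemma A1_line2 x : singular_vec (subst_pow 2 (octic C)) x ->
  count (fun i => coords x i != 0) (iota 0 4) = 2%N -> germ_at2 x (A_germ C 1).
Proof.
move=> sx /pow2_line_move[M [sM [a [b [a0 b0 xM]]]]].
have sy := pow2_symmetry_singular sM sx; rewrite xM in sy.
have h2 := singular_line (isT : (0 < 2)%N) a0 b0 sy.
have h0 : b / a != 0 by rewrite mulf_neq0 ?invr_eq0.
have [x0 _ _] := sx; apply: (@germ_transport _ M _ (row3 (b / a) 0 0) a) => //.
  by rewrite xM chart0 scale_vec4 mulr1 !mulr0 mulrCA divff // mulr1.
rewrite octic_chartE; apply: loc_iso_trans (octic_chart_power0 _ _ _ _ (isT : (0 < 2)%N) h0) _.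
exact: loc_iso_trans (@line_germ C _ 2 2 h2 isT isT) A1_normal.
Qed.

Lemma octic_atZ (k a b c d : C) : octic_at (quad (k * a) (k * b) (k * c) (k * d)) =
  k ^+ 8 * octic_at (quad a b c d).
Proof.
have := evalvZ k (vec4 a b c d) (homogeneous_octic_pow C 1).
by rewrite scale_vec4 !evalv_octic_vec4 !expr1 muln1.
Qed.

(** The symmetry from [tri_move] preserves g(x_0^3, x_1^3, x_2^3, t) for every t. Homogenizing z^2
    as x_3^2 x_0 introduces the linear form x_0, which the symmetry changes. At the new point on the
    line the changed form is still a unit and is absorbed into the squared last coordinate. *)
Lemma cusp_germ r s : r != 0 -> s != 0 -> singular_vec F24 (vec4 1 r s 0) ->
  loc_iso (octic_chart 3 3 2) (row3 r s 0) (A_germ C 2) 0.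
Proof.
move=> r0 s0 sx.
have T : tri (1 ^+ 3) (r ^+ 3) (s ^+ 3) = 0.
  have := @plane_critical_tri C (quad (1 ^+ 3) (r ^+ 3) (s ^+ 3) (0 ^+ 3)); apply.
  - by rewrite /quad /= expr0n.
  - by rewrite /quad /= expr1n oner_neq0.
  move=> j lt_j; apply: (singular_octic_deriv sx) => //; first exact: ltnW.
  by left; case: j lt_j => [|[|[|//]]] _; rewrite /quad /= ?oner_neq0.
have [A [sA Ainv A3 [a' [b' /(_ 0) A0]]]] := tri_move w_root T.
have [N [sN AN NA]] := symmetry_inv w_root sA.
have sy := symmetry_singular w_root sA sx; rewrite A0 in sy.
have zk : (0 : C) ^+ 3 = 0 by rewrite expr0n.
have [a0 b0] : a' != 0 /\ b' != 0.
  have [y0 fy dy] := sy.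
  have nz : a' ^+ 3 != 0 \/ b' ^+ 3 != 0.
    have [a0|a0] := eqVneq a' 0; last by left; rewrite expf_neq0.
    have [b0|b0] := eqVneq b' 0; last by right; rewrite expf_neq0.
    by move: y0; rewrite a0 b0 vec4_eq0 !eqxx.
  have dj j : (j < 2)%N -> quad (a' ^+ 3) (b' ^+ 3) 0 0 j * octic_deriv j (quad (a' ^+ 3) (b' ^+ 3) 0 0) = 0.
    move=> lt_j; have [z0|z0] := eqVneq (quad a' b' 0 0 j) 0.
      rewrite [X in X * _](_ : _ = 0) ?mul0r //; move: z0.
      by case: j lt_j => [|[|//]] _; rewrite /quad /= => ->.
    have := singular_octic_deriv sy (isT : (0 < 3)%N) (leq_trans lt_j (isT : (2 <= 4)%N)) (or_introl z0).
    by rewrite !zk => ->; rewrite mulr0.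
  have e := line_critical nz (dj 0%N isT) (dj 1%N isT).
  split; apply/eqP => z0; move: e nz; rewrite z0 zk expr0n /= ?add0r ?addr0 => /eqP;
    by rewrite expf_eq0 /= => /eqP ->; rewrite eqxx => -[].
have h2 := singular_line (isT : (0 < 3)%N) a0 b0 sy.
have h0 : b' / a' != 0 by rewrite mulf_neq0 ?invr_eq0.
(* The factor [l] makes the last argument homogeneous of degree 3 like the others; Z' is Z
   transported by A. *)
pose form (l : 'rV[C]_4 -> C) : set 'rV[C]_4 := [set x | octic_at (quad (coords x 0 ^+ 3)
  (coords x 1 ^+ 3) (coords x 2 ^+ 3) (coords x 3 ^+ 2 * l x)) = 0].
pose Z := form (fun x => coords x 0); pose Z' := form (fun x => coords (x *m N) 0).
have coordsZ c (x : 'rV[C]_4) i : coords (c *: x) i = c * coords x i by rewrite /coords mxE.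
have cone c x : c != 0 -> Z' (c *: x) <-> Z' x.
  move=> c0; rewrite /Z' /form /= -scalemxAl !coordsZ !exprMn.
  rewrite (_ : c ^+ 2 * _ * _ = c ^+ 3 * (coords x 3 ^+ 2 * coords (x *m N) 0)); last by ring.
  rewrite octic_atZ; move: (octic_at _) => t; split=> [/eqP|->]; last by rewrite mulr0.
  by rewrite mulf_eq0 !expf_eq0 (negPf c0) andbF => /eqP.
have ZZ x : Z x <-> Z' (x *m A).
  rewrite /Z /Z' /form /= A3 -mulmxA AN mulmx1; move: (_ * coords x 0) => t.
  suff -> : octic_at (quad (coords (x *m A) 0 ^+ 3) (coords (x *m A) 1 ^+ 3) (coords (x *m A) 2 ^+ 3) t) =
    octic_at (quad (coords x 0 ^+ 3) (coords x 1 ^+ 3) (coords x 2 ^+ 3) t) by [].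
  by apply: octic_inv_eq => i lt_i; exact: Ainv.
have e : chart 0 (row3 r s 0) *m A = a' *: chart 0 (row3 (b' / a') 0 0).
  by rewrite !chart0 A0 scale_vec4 mulr1 mulr0 mulrCA divff // mulr1.
have step1 := @loc_iso_projective C Z Z' A N 0 0 _ _ a' AN NA cone ZZ a0 e.
have ZEv x y z (v := vec4 1 x y z) : octic_at (quad (coords v 0 ^+ 3) (coords v 1 ^+ 3) (coords v 2 ^+ 3)
    (coords v 3 ^+ 2 * coords v 0)) = octic_at (quad 1 (x ^+ 3) (y ^+ 3) (z ^+ 2)).
  apply: eq_octic_at => k lt_k; rewrite /v !coords_vec4; [|exact: isT..].
  by case: k lt_k => [|[|[|[|]]]] // _; rewrite /quad /= ?expr1n ?mulr1.
have ZE : octic_chart 3 3 2 = [set y | Z (chart 0 y)].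
  apply/seteqP; split=> v; have [x [y [z ->]]] := row3_cases v;
  rewrite /octic_chart /Z /form /= chart0 !row3E ZEv => h; exact: h.
rewrite ZE; apply: loc_iso_trans step1 _.
apply: (@loc_iso_trans C (octic_chart 3 3 2) (row3 (b' / a') 0 0)).
  have c0 (x : 'rV[C]_4) : coords x 0 = x 0 0.
    by rewrite /coords; congr (x _ _); apply/val_inj; rewrite /= inordK.
  (* The unit is the linear form (x N)_0, whose value at the new point is 1 / a'. *)
  apply: (@loc_iso_unit C 2 isT 2%:R (chart_form 0 N 0)); first by rewrite row3E.
    rewrite chart_formE.
    have -> : chart 0 (row3 (b' / a') 0 0) *m N = a'^-1 *: vec4 1 r s 0.
      have := congr1 (fun v => a'^-1 *: (v *m N)) e; rewrite -mulmxA AN mulmx1 !chart0.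
      by rewrite -scalemxAl scalerA mulVf // scale1r => <-.
    by rewrite mxE -c0 coords_vec4 // /quad /= mulr1 invr_eq0.
  move=> v t; have [x [y [z ->]]] := row3_cases v; rewrite chart_formE => et.
  rewrite /Z' /form /octic_chart /= row3E set_coord_row3 !row3E (c0 (_ *m N)) -et -exprMn.
  rewrite chart0; set u := vec4 1 x y z.
  have -> : octic_at (quad (coords u 0 ^+ 3) (coords u 1 ^+ 3) (coords u 2 ^+ 3) ((coords u 3 * t) ^+ 2)) =
      octic_at (quad 1 (x ^+ 3) (y ^+ 3) ((z * t) ^+ 2)); last by split=> h; exact: h.
  apply: eq_octic_at => k lt_k; rewrite /u !coords_vec4; [|exact: isT..].
  by case: k lt_k => [|[|[|[|]]]] // _; rewrite /quad /= ?expr1n.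
apply: loc_iso_trans (octic_chart_power0 _ _ _ _ (isT : (0 < 3)%N) h0) _.
exact: loc_iso_trans (@line_germ C _ 3 2 h2 isT isT) A2_normal.
Qed.

(** In the two nonzero affine coordinates squares are replaced by cubes through local isomorphisms;
    the last coordinate, which is zero at the point, keeps its exponent 2. *)
Lemma A2_plane2 x : singular_vec (subst_pow 2 (octic C)) x ->
  count (fun i => coords x i != 0) (iota 0 4) = 3%N -> germ_at2 x (A_germ C 2).
Proof.
move=> sx /pow2_plane_move[M [sM [a [b [c [a0 b0 c0 xM]]]]]].
have sy := pow2_symmetry_singular sM sx; rewrite xM in sy.
have p0 : b / a != 0 by rewrite mulf_neq0 ?invr_eq0.
have q0 : c / a != 0 by rewrite mulf_neq0 ?invr_eq0.
have xE : vec4 a b c 0 = a *: chart 0 (row3 (b / a) (c / a) 0).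
  by rewrite chart0 scale_vec4 mulr1 !mulr0 ![a * (_ / _)]mulrCA divff // !mulr1.
have [x0 _ _] := sx; apply: (@germ_transport _ M _ (row3 (b / a) (c / a) 0) a) => //.
  by rewrite xM.
have [_ [m lt_m [l lE]]] := (singular_pow_listed w_root _ (isT : (1 < 2)%N)).1 sy.
pose r := 3.-root ((b / a) ^+ 2); pose s := 3.-root ((c / a) ^+ 2).
have r3 : r ^+ 3 = (b / a) ^+ 2 by rewrite rootCK.
have s3 : s ^+ 3 = (c / a) ^+ 2 by rewrite rootCK.
have r0 : r != 0 by have := expf_neq0 2 p0; rewrite -r3 expf_eq0.
have s0 : s != 0 by have := expf_neq0 2 q0; rewrite -s3 expf_eq0.
rewrite octic_chartE; apply: loc_iso_trans (octic_chart_power0 _ _ _ _ (isT : (0 < 2)%N) p0) _.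
apply: loc_iso_trans (octic_chart_power1 _ _ _ _ (isT : (0 < 2)%N) q0) _.
rewrite -r3 -s3.
apply: loc_iso_trans (loc_iso_sym (octic_chart_power1 _ _ _ _ (isT : (0 < 3)%N) s0)) _.
apply: loc_iso_trans (loc_iso_sym (octic_chart_power0 _ _ _ _ (isT : (0 < 3)%N) r0)) _.
apply: cusp_germ r0 s0 _.
apply/(singular_pow_listed w_root _ (isT : (1 < 3)%N)); split; first by rewrite vec4_eq0 oner_eq0.
exists m => //; exists (l / a ^+ 2) => i lt_i; have := lE i lt_i.
rewrite mulrAC => <-; rewrite /coords_pow !coords_vec4 //.
case: i lt_i => [|[|[|[|//]]]] _; rewrite /quad /= ?r3 ?s3 ?expr_div_n //.
- by rewrite expr1n divff // expf_neq0.
by rewrite !expr0n /= mul0r.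
Qed.

End SingularGerms.

(** * Automorphisms of a surface and its singular points *)

Section Automorphisms.
Local Open Scope ring_scope.
Local Open Scope classical_set_scope.
Local Open Scope card_scope.
Variable C : numClosedFieldType.

Lemma evalvD (f g : poly4 C) x : evalv (f + g) x = evalv f x + evalv g x.
Proof. exact: mevalD. Qed.
Lemma evalvB (f g : poly4 C) x : evalv (f - g) x = evalv f x - evalv g x.
Proof. exact: mevalB. Qed.
Lemma evalvM (f g : poly4 C) x : evalv (f * g) x = evalv f x * evalv g x.
Proof. exact: mevalM. Qed.

Definition comp_forms (F : 'I_4 -> poly4 C) (f : poly4 C) : poly4 C :=
  comp_mpoly [tuple F i | i < 4] f.
Definition eval_forms (F : 'I_4 -> poly4 C) (x : 'rV[C]_4) : 'rV[C]_4 := \row_i evalv (F i) x.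

Lemma evalv_comp_forms F f x : evalv (comp_forms F f) x = evalv f (eval_forms F x).
Proof.
rewrite /evalv /comp_forms comp_mpoly_meval; apply: meval_eq => i.
by rewrite tnth_mktuple mxE.
Qed.

Lemma mderiv_var (l m : 'I_4) : mderiv l (mpolyX C (mnm1 m)) = mpolyC 4 (m == l)%:R.
Proof.
rewrite mderivX mnm1E; have [<-|_] := eqVneq m l; last by rewrite scale0r mpolyC0.
rewrite scale1r mpolyC1 -mpolyX0; congr (mpolyX _ _); apply/mnmP => j.
by rewrite !mnmE subnn.
Qed.

Lemma mderiv_comp_forms F f x i : evalv (mderiv i (comp_forms F f)) x =
  \sum_j evalv (mderiv j f) (eval_forms F x) * evalv (mderiv i (F j)) x.
Proof.
elim/mpoly_ring_ind: f => [c|k|p q ep eq|p q ep eq].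
- rewrite /comp_forms comp_mpolyC mderivC /evalv meval0 big1 // => j _.
  by rewrite mderivC meval0 mul0r.
- rewrite (bigD1 k) //= mderiv_var eqxx /evalv mevalC mul1r big1 ?addr0 => [|j jk]; last first.
    by rewrite mderiv_var eq_sym (negPf jk) mevalC mul0r.
  by rewrite /comp_forms comp_mpolyXU -tnth_nth tnth_mktuple.
- have -> : comp_forms F (p + q) = comp_forms F p + comp_forms F q by exact: rmorphD.
  rewrite mderivD evalvD ep eq -big_split; apply: eq_bigr => j _.
  by rewrite mderivD evalvD mulrDl.
have -> : comp_forms F (p * q) = comp_forms F p * comp_forms F q by exact: rmorphM.
rewrite mderivM evalvD !evalvM ep eq !evalv_comp_forms.
rewrite mulr_suml mulr_sumr -big_split; apply: eq_bigr => j _ /=.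
by rewrite mderivM evalvD !evalvM; ring.
Qed.

Lemma euler_monomial (m : multinom 4) (x : 'rV[C]_4) :
  \sum_i x 0 i * evalv (mderiv i (mpolyX C m)) x = (mdeg m)%:R * evalv (mpolyX C m) x.
Proof.
rewrite mdegE natr_sum mulr_suml; apply: eq_bigr => i _; rewrite /evalv mderivX mevalZ.
have [->|m0] := eqVneq (m i) 0%N; first by rewrite !mul0r mulr0.
rewrite mulrCA; congr (_ * _); have <- := mevalXU (fun i => x 0 i) i; rewrite -mevalM -mpolyXD.
congr (meval _ (mpolyX _ _)); apply/mnmP => j; rewrite mnmDE mnmBE mnm1E.
by have [<-|_] := eqVneq i j; rewrite ?subn0 // subnKC // lt0n.
Qed.

Lemma euler d (f : poly4 C) (x : 'rV[C]_4) : homogeneous d f ->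
  \sum_i x 0 i * evalv (mderiv i f) x = d%:R * evalv f x.
Proof.
move=> /dhomogP hf.
have dE i : mderiv i f = \sum_(m <- msupp f) mcoeff m f *: mderiv i (mpolyX C m).
  by rewrite {1}[f]mpolyE raddf_sum; apply: eq_bigr => m _; exact: mderivZ.
have fE : evalv f x = \sum_(m <- msupp f) mcoeff m f * evalv (mpolyX C m) x.
  by rewrite {1}[f]mpolyE /evalv raddf_sum; apply: eq_bigr => m _; exact: mevalZ.
transitivity (\sum_i \sum_(m <- msupp f) mcoeff m f * (x 0 i * evalv (mderiv i (mpolyX C m)) x)).
  apply: eq_bigr => i _; rewrite dE /evalv raddf_sum mulr_sumr; apply: eq_bigr => m _.
  by rewrite mulrCA; congr (_ * _); exact: mevalZ.
rewrite exchange_big fE mulr_sumr; apply: eq_big_seq => m mf.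
have <- : mdeg m = d by exact: hf.
by rewrite -mulr_sumr euler_monomial mulrCA.
Qed.

Lemma homogeneous_var (a : 'I_4) : homogeneous 1 (mpolyX C (mnm1 a)).
Proof. by rewrite /homogeneous dhomogX /= mdeg1. Qed.

Lemma evalv_var a x : evalv (mpolyX C (mnm1 a)) x = x 0 a.
Proof. exact: mevalXU. Qed.

Lemma evalvC (c : C) x : evalv (mpolyC 4 c) x = c.
Proof. exact: mevalC. Qed.

Lemma neq0_coord (x : 'rV[C]_4) : x != 0 -> exists i, x 0 i != 0.
Proof.
move=> x0; apply/existsP; apply: contraR x0 => /existsPn h; apply/eqP/rowP => i.
by have := h i; rewrite negbK mxE => /eqP.
Qed.

Variables (f : poly4 C) (d : nat).
Hypotheses (d0 : (0 < d)%N) (hf : homogeneous d f).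
Hypothesis divf : forall h, (forall x, x != 0 -> evalv f x = 0 -> evalv h x = 0) ->
  exists q, h = q * f.
Hypothesis locE : forall v, v != 0 -> singular_locus f (proj_point v) <-> singular_vec f v.

Lemma evalv0 e (h : poly4 C) : (0 < e)%N -> homogeneous e h -> evalv h 0 = 0.
Proof.
move=> e0 hh; rewrite -(scale0r (0 : 'rV[C]_4)) (evalvZ _ _ hh).
by rewrite expr0n gtn_eqF // mul0r.
Qed.

Lemma zero_point (x : zeros f) v : v != 0 -> val x = proj_point v -> evalv f v = 0.
Proof.
by move=> v0 xv; have := set_valP x; rewrite xv => h; apply/(vanishes_pointE hf v0).
Qed.

Lemma point_zero v : v != 0 -> evalv f v = 0 -> exists x : zeros f, val x = proj_point v.
Proof.
move=> v0 fv; have zv : zeros f (proj_point v) by apply/(vanishes_pointE hf v0).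
by exists (exist (fun p : P3 C => p \in zeros f) (proj_point v) (mem_set zv)).
Qed.

Lemma regular_vec (phi : zeros f -> zeros f) (x : zeros f) v : regular_map phi -> v != 0 ->
  val x = proj_point v -> exists e F, [/\ (0 < e)%N, forall i, homogeneous e (F i),
    eval_forms F v != 0 & forall (y : zeros f) u, u != 0 -> val y = proj_point u ->
      eval_forms F u != 0 -> val (phi y) = proj_point (eval_forms F u)].
Proof.
move=> reg v0 xv; have [e [F [hF [i nz] P]]] := reg x.
have [a va] := neq0_coord v0.
(* Multiplication by a coordinate that is nonzero at v makes the degree positive, as Euler's formula
   and vanishing at 0 require later. *)
pose F' j := F j * mpolyX C (mnm1 a).
have F'E u : eval_forms F' u = u 0 a *: eval_forms F u.
  by apply/rowP => j; rewrite !mxE evalvM evalv_var mulrC.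
have Fi u j : evalv (F j) u != 0 -> eval_forms F u != 0.
  by apply: contra_neq => /rowP/(_ j); rewrite !mxE.
exists (e + 1)%N, F'; split=> [|j||y u u0 yu]; first by rewrite addn1.
- exact: homogeneousM (hF j) (homogeneous_var a).
- rewrite F'E scaler_eq0 negb_or va (Fi _ i) //; apply/eqP => Fv; apply: nz.
  by rewrite xv; apply/(vanishes_pointE (hF i) v0).
rewrite F'E => nzF; apply: mem_point => //; apply: memvZ.
move: nzF; rewrite scaler_eq0 negb_or => /andP[_ /neq0_coord[j]]; rewrite mxE => Fj.
apply: P; last by rewrite yu; exact: point_mem.
exists j => /(_ u); rewrite yu => /(_ (point_mem u0)) Fu0.
by rewrite Fu0 eqxx in Fj.
Qed.

Lemma multiple_singular h v i : (forall x, x != 0 -> evalv f x = 0 -> evalv h x = 0) ->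
  singular_vec f v -> evalv (mderiv i h) v = 0.
Proof.
move=> /divf[q ->] [_ fv dfv]; rewrite mderivM evalvD !evalvM fv dfv.
by rewrite !mulr0 addr0.
Qed.

(** At a singular point every polynomial vanishing on the surface has zero gradient. Applied to the
    relations expressing that the inverse undoes the map, this makes the Jacobian J of the forms F
    invertible at v; applied to f composed with F, it gives J times the gradient of f at w equal to
    0. *)
Lemma automorphism_singular (phi : zeros f -> zeros f) (x : zeros f) : automorphisms (zeros f) phi ->
  singular_locus f (val x) -> singular_locus f (val (phi x)).
Proof.
move=> [rphi [psi [rpsi K _]]]; have [v v0 xv] := pointP (val x); rewrite xv => /(locE v0) sv.
have [e [F [e0 hF Fv FP]]] := regular_vec rphi v0 xv.
have xw := FP _ _ v0 xv Fv; rewrite xw; set w := eval_forms F v in Fv xw *.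
have [e' [G [e'0 hG Gw GP]]] := regular_vec rpsi Fv xw.
have [c GwE] : exists c, eval_forms G w = c *: v.
  by apply/(eq_point Gw v0); rewrite -(GP _ _ Fv xw Gw) K.
have c0 : c != 0 by apply: contra_neq Gw => c0; rewrite GwE c0 scale0r.
(* The minors of x and G(F(x)): on the surface these two vectors are proportional. *)
pose h i j := comp_forms F (G i) * mpolyX C (mnm1 j) - comp_forms F (G j) * mpolyX C (mnm1 i).
have hv i j u : u != 0 -> evalv f u = 0 -> evalv (h i j) u = 0.
  move=> u0 fu; rewrite evalvB !evalvM !evalv_comp_forms !evalv_var; set t := eval_forms F u.
  have GE l : evalv (G l) t = eval_forms G t 0 l by rewrite mxE.
  rewrite !GE; have [->|Gt] := eqVneq (eval_forms G t) 0; first by rewrite !mxE !mul0r subrr.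
  have t0 : t != 0.
    apply: contra_neq Gt => t0; apply/rowP => l; rewrite !mxE t0; exact: evalv0 e'0 (hG l).
  have [y yu] := point_zero u0 fu; have yt := FP y u u0 yu t0.
  have yG := GP _ _ t0 yt Gt; rewrite K yu in yG.
  have [k ->] := (eq_point u0 Gt).1 yG; rewrite !mxE; ring.
pose J : 'M[C]_4 := \matrix_(l, m) evalv (mderiv l (F m)) v.
have dcomp g l : evalv (mderiv l (comp_forms F g)) v = (J *m \col_m evalv (mderiv m g) w) l 0.
  by rewrite mderiv_comp_forms mxE; apply: eq_bigr => m _; rewrite !mxE mulrC.
(* A kernel vector u of J is proportional to v by the gradients of the minors, but v J is the degree
   times F(v) by Euler's formula, which is nonzero. *)
have uJ : J \in unitmx.
  rewrite unitmxE unitfE; apply/negP => /det0P[u u0 uJ].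
  have prop i j : v 0 i * u 0 j = v 0 j * u 0 i.
    set Gi := J *m \col_m evalv (mderiv m (G i)) w; set Gj := J *m \col_m evalv (mderiv m (G j)) w.
    have E : v 0 j *: Gi + (c * v 0 i) *: delta_mx j 0 - (v 0 i *: Gj + (c * v 0 j) *: delta_mx i 0) = 0 :> 'cV[C]_4.
      apply/colP => l; have := multiple_singular l (hv i j) sv.
      rewrite /h mderivB evalvB !mderivM !evalvD !evalvM !dcomp !evalv_comp_forms !evalv_var.
      rewrite !mderiv_var !evalvC -/w => E'.
      have GE l' : evalv (G l') w = c * v 0 l' by have /rowP/(_ l') := GwE; rewrite !mxE.
      move: E'; rewrite !GE ![(_ == l)]eq_sym -/Gi -/Gj; move: Gi Gj => Gi' Gj' E'.
      by rewrite [RHS]mxE -[RHS]E' !mxE !eqxx !andbT; ring.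
    have uG g : u *m (J *m g) = 0 :> 'M[C]_1 by rewrite mulmxA uJ mul0mx.
    have := congr1 (mulmx u) E; rewrite mulmx0 mulmxBr !mulmxDr -!scalemxAr !uG !scaler0 !add0r.
    rewrite -!colE => /matrixP/(_ 0 0); rewrite !mxE => /eqP; rewrite subr_eq0 => /eqP.
    by rewrite -!mulrA => /(mulfI c0).
  have [a va] := neq0_coord v0.
  have uE : u = (u 0 a / v 0 a) *: v.
    apply/rowP => j; rewrite mxE; apply: (mulfI va).
    by rewrite prop mulrA mulrCA divff // mulr1 mulrC.
  have k0 : u 0 a / v 0 a != 0 by apply: contra_neq u0 => k0; rewrite uE k0 scale0r.
  have vJ : v *m J = 0.
    have /eqP := uJ; rewrite uE -scalemxAl scaler_eq0 (negPf k0) => /eqP; exact.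
  have /eqP := Fv; apply; apply/rowP => m.
  have /rowP/(_ m) := vJ; rewrite !mxE.
  under eq_bigr do rewrite mxE; rewrite (euler _ (hF m)) => /eqP.
  by rewrite mulf_eq0 pnatr_eq0 (gtn_eqF e0) => /eqP.
apply/(locE Fv); split=> // [|i]; first exact: zero_point Fv xw.
have : \col_m evalv (mderiv m f) w = 0.
  rewrite -[LHS](mulKmx uJ) (_ : J *m _ = 0) ?mulmx0 //; apply/colP => l.
  rewrite -dcomp [RHS]mxE; apply: multiple_singular sv => u u0 fu; rewrite evalv_comp_forms.
  have [->|t0] := eqVneq (eval_forms F u) 0; first exact: evalv0 d0 hf.
  have [y yu] := point_zero u0 fu; exact: zero_point t0 (FP y u u0 yu t0).
by move=> /colP/(_ i); rewrite !mxE.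
Qed.

Definition acts (M : 'M[C]_4) (phi : zeros f -> zeros f) :=
  forall (x : zeros f) (v : 'rV[C]_4), v \in val (val x) -> v *m M \in val (val (phi x)).

Lemma unit_mulmx_neq0 (M : 'M[C]_4) (v : 'rV[C]_4) : M \in unitmx -> v != 0 -> v *m M != 0.
Proof. by move=> uM; apply: contra_neq => e; rewrite -(mulmxK uM v) e mul0mx. Qed.

Lemma acts_point M phi (x : zeros f) v : M \in unitmx -> acts M phi -> v != 0 ->
  val x = proj_point v -> val (phi x) = proj_point (v *m M).
Proof.
move=> uM aM v0 xv; apply: mem_point; first exact: unit_mulmx_neq0.
by apply: aM; rewrite xv; exact: point_mem.
Qed.

Lemma acts_exists M : M \in unitmx -> (forall x, evalv f (x *m M) = evalv f x) -> exists phi, acts M phi.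
Proof.
move=> uM fM; have h (x : zeros f) : exists y : zeros f, forall v, v \in val (val x) -> v *m M \in val (val y).
  have [v v0 xv] := pointP (val x); have vM := unit_mulmx_neq0 uM v0.
  have [|y yv] := point_zero vM; first by rewrite fM; exact: zero_point v0 xv.
  exists y => u; rewrite xv yv !val_point // => /vlineP[k ->]; rewrite -scalemxAl.
  by apply/vlineP; exists k.
by have [phi P] := choice h; exists phi.
Qed.

Lemma acts_regular M phi : M \in unitmx -> acts M phi -> regular_map phi.
Proof.
move=> uM aM x; pose F (i : 'I_4) : poly4 C := \sum_j M j i *: mpolyX C (mnm1 j).
have FE i v : evalv (F i) v = (v *m M) 0 i.
  rewrite mxE /evalv raddf_sum; apply: eq_bigr => j _.
  by rewrite mulrC; apply: etrans (mevalZ _ _ _) _; rewrite mevalXU.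
exists 1%N, F; split=> [i||y _ v vy].
- by apply: rpred_sum => j _; apply: rpredZ; exact: homogeneous_var.
- have [v v0 xv] := pointP (val x); have [i vi] := neq0_coord (unit_mulmx_neq0 uM v0).
  exists i => /(_ v); rewrite xv => /(_ (point_mem v0)); rewrite FE => vi0.
  by rewrite vi0 eqxx in vi.
have -> : \row_i evalv (F i) v = v *m M by apply/rowP => i; rewrite mxE FE.
exact: aM.
Qed.

Lemma acts_cancel M N phi psi : M *m N = 1%:M -> acts M phi -> acts N psi -> cancel phi psi.
Proof.
move=> MN aM aN x; have [v v0 xv] := pointP (val x); apply: val_inj; rewrite xv.
apply: mem_point => //; rewrite -[v]mulmx1 -MN mulmxA; apply: aN; apply: aM.
by rewrite xv; exact: point_mem.
Qed.

Lemma acts_automorphism M phi : M \in unitmx -> (forall x, evalv f (x *m M) = evalv f x) ->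
  acts M phi -> automorphisms (zeros f) phi.
Proof.
move=> uM fM aM; split; first exact: acts_regular aM.
have uN : invmx M \in unitmx by rewrite unitmx_inv.
have [|psi aN] := acts_exists uN; first by move=> x; rewrite -fM mulmxKV.
exists psi; split; first exact: acts_regular aN.
- exact: acts_cancel (mulmxV uM) aM aN.
exact: acts_cancel (mulVmx uM) aN aM.
Qed.

End Automorphisms.

(** * Transitivity and the number of automorphisms of Z(g[3]) *)

Section AutomorphismsF24.
Local Open Scope ring_scope.
Local Open Scope classical_set_scope.
Local Open Scope card_scope.
#[local] Opaque octic_expr.
Variable C : numClosedFieldType.
Variable w : C.
Hypothesis w_root : w ^+ 2 + w + 1 = 0.
Local Notation F24 := (F24 C).

Lemma symmetry_acts A : symmetry w A -> exists phi : zeros F24 -> zeros F24,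
  automorphisms (zeros F24) phi /\ acts A phi.
Proof.
move=> sA; have uA := symmetry_unit w_root sA; have hF : homogeneous (8 * 3) F24 := homogeneous_octic_pow C 3.
have fA x : evalv F24 (x *m A) = evalv F24 x by exact: (symmetry_F24 w_root).
have [phi aA] := acts_exists hF uA fA; exists phi; split=> //.
exact: (acts_automorphism hF uA fA aA).
Qed.

Lemma symmetry_transitive (x y : zeros F24) : singular_locus F24 (val x) -> singular_locus F24 (val y) ->
  exists phi : zeros F24 -> zeros F24, automorphisms (zeros F24) phi /\ phi x = y.
Proof.
have [v v0 xv] := pointP (val x); have [u u0 yu] := pointP (val y); rewrite xv yu.
move=> /(singular_locusE (isT : (0 < 3)%N) v0) sv /(singular_locusE (isT : (0 < 3)%N) u0) su.
have [A [sA [k k0 vA]]] := singular_orbit w_root sv.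
have [B [sB [l l0 uB]]] := singular_orbit w_root su.
have [B' [sB' BB' B'B]] := symmetry_inv w_root sB.
have [phi [aut aM]] := symmetry_acts (symmetry_mul sA sB'); exists phi; split=> //.
have uM := symmetry_unit w_root (symmetry_mul sA sB').
apply: val_inj; rewrite yu (acts_point uM aM v0 xv).
apply/eq_point => //; first exact: unit_mulmx_neq0.
exists (k / l); rewrite mulmxA vA -scalemxAl.
have -> : base_vec C = l^-1 *: (u *m B) by rewrite uB scalerA mulVf // scale1r.
by rewrite -scalemxAl -mulmxA BB' mulmx1 scalerA.
Qed.

Lemma w_power_inj a b : (a < 3)%N -> (b < 3)%N -> w ^+ a = w ^+ b -> a = b.
Proof.
have w1 : w != 1.
  apply/eqP => e; move: w_root; rewrite e expr1n => /eqP.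
  by rewrite (_ : 1 + 1 + 1 = 3%:R :> C) ?pnatr_eq0 //; ring.
have w3 := w_cube w_root.
have w0 : w != 0 by apply: contra_eq_neq w3 => ->; rewrite expr0n eq_sym oner_neq0.
have w2 : w ^+ 2 != 1 by apply: contra_neq w1 => e; rewrite -w3 exprS e mulr1.
have w12 : w ^+ 2 != w by apply: contra_neq w1 => e; apply: (mulfI w0); rewrite mulr1 -expr2.
case: a => [|[|[|//]]] _; case: b => [|[|[|//]]] _ //; rewrite ?expr0 ?expr1 => /eqP.
- by rewrite eq_sym (negPf w1).
- by rewrite eq_sym (negPf w2).
- by rewrite (negPf w1).
- by rewrite eq_sym (negPf w12).
- by rewrite (negPf w2).
by rewrite (negPf w12).
Qed.

(* The 18 symmetries fixing the point of base_vec. *)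
Definition stabilizer_mx j : 'M[C]_4 :=
  diag4 1 1 (w ^+ (j %% 3)) (w ^+ (j %/ 3 %% 3)) *m (if (j < 9)%N then 1%:M else s1 C *m s3 C).

Lemma symmetry_stabilizer j : symmetry w (stabilizer_mx j).
Proof.
have wk n : (w ^+ n) ^+ 3 = 1 by rewrite exprAC (w_cube w_root) expr1n.
apply: symmetry_mul; first by apply: symmetry_diag; rewrite ?expr1n ?wk.
case: ifP => _; first exact: symmetry_one.
by apply: symmetry_mul; [exact: symmetry_s1|exact: symmetry_s3].
Qed.

Lemma mul_stabilizer j a b c d : let c' := c * w ^+ (j %% 3) in let d' := d * w ^+ (j %/ 3 %% 3) in
  vec4 a b c d *m stabilizer_mx j = if (j < 9)%N then vec4 a b c' d' else vec4 (- b) a (- d') c'.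
Proof.
rewrite /stabilizer_mx mulmxA mul_diag4 !mulr1; case: ifP => _; first by rewrite mulmx1.
by rewrite mulmxA mul_s1 mul_s3.
Qed.

Lemma base_stabilizer j : exists2 k, k != 0 & base_vec C *m stabilizer_mx j = k *: base_vec C.
Proof.
rewrite /base_vec mul_stabilizer !mul0r; case: ifP => _.
  by exists 1; rewrite ?oner_neq0 // scale1r.
exists 'i; first exact: neq0Ci.
by rewrite opprK oppr0 scale_vec4 mulr1 mulrN -expr2 sqrCi opprK !mulr0.
Qed.

(** Two further points of the surface suffice: the place of the zero coordinates tells whether the
    signed permutation is present, and the ratios of the nonzero ones give the two exponents of
    w. *)
Lemma stabilizer_inj i j k l : (i < 18)%N -> (j < 18)%N ->
  vec4 1 0 (- 'i) 0 *m stabilizer_mx i = k *: (vec4 1 0 (- 'i) 0 *m stabilizer_mx j) ->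
  vec4 (- 1) 0 0 (- 'i) *m stabilizer_mx i = l *: (vec4 (- 1) 0 0 (- 'i) *m stabilizer_mx j) ->
  i = j.
Proof.
move=> lt_i lt_j; rewrite !mul_stabilizer !mul0r !oppr0.
have ni : - 'i != 0 :> C by rewrite oppr_eq0 neq0Ci.
have m3 n : (n %% 3 < 3)%N by rewrite ltn_mod.
suff E : (i < 9)%N = (j < 9)%N -> - 'i * w ^+ (i %% 3) = - 'i * w ^+ (j %% 3) ->
    - 'i * w ^+ (i %/ 3 %% 3) = - 'i * w ^+ (j %/ 3 %% 3) -> i = j.
  case: ifP E => i9; case: ifP => j9 E; rewrite !scale_vec4 ?mulr0 ?mulr1.
  - move=> /vec4_eq[<- _ e1 _] /vec4_eq[/esym e2 _ _ e3]; apply: E => //.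
      by rewrite e1 mul1r.
    by rewrite e3; move: e2; rewrite mulrN1 => /oppr_inj ->; rewrite mul1r.
  - by move=> /vec4_eq[/eqP]; rewrite oner_eq0.
  - move=> /vec4_eq[k0 /eqP]; by rewrite -k0 oner_eq0.
  move=> /vec4_eq[_ <- _ e1] /vec4_eq[_ /esym e2 e3 _]; apply: E => //.
    by rewrite e1 mul1r.
  move: e3; move: e2; rewrite mulrN1 => /oppr_inj ->; rewrite mul1r; exact: oppr_inj.
move=> e9 /(mulfI ni)/(w_power_inj (m3 _) (m3 _)) e1 /(mulfI ni)/(w_power_inj (m3 _) (m3 _)) e2.
by lia.
Qed.

(** For each of the n points one symmetry takes the base point there; preceded by the 18 stabilizing
    ones it gives n * 18 automorphisms. The image of the base point recovers the point, and
    [stabilizer_inj] the rest. *)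
Lemma aut_card (n : nat) (q : nat -> 'rV[C]_4) :
  (forall i, (i < n)%N -> singular_vec F24 (q i)) ->
  (forall i j, (i < n)%N -> (j < n)%N -> proj_point (q i) = proj_point (q j) -> i = j) ->
  `I_(n * 18) #<= automorphisms (zeros F24).
Proof.
move=> sq qinj; have [b0 fb _] : singular_vec F24 (base_vec C) by exact: singular_base.
have hF : homogeneous (8 * 3) F24 := homogeneous_octic_pow C 3.
have h i : exists A, (i < n)%N -> symmetry w A /\ exists2 k, k != 0 & base_vec C *m A = k *: q i.
  case: (boolP (i < n)%N) => [lt_i|]; last by exists 1%:M.
  have [A [sA [k k0 qA]]] := singular_orbit w_root (sq i lt_i).
  have [B [sB AB BA]] := symmetry_inv w_root sA; exists B => _; split=> //.
  exists k^-1; first by rewrite invr_eq0.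
  have -> : base_vec C = k^-1 *: (q i *m A) by rewrite qA scalerA mulVf // scale1r.
  by rewrite -scalemxAl -mulmxA AB mulmx1.
have [A AP] := choice h.
have div18 i : (i < n * 18)%N -> (i %/ 18 < n)%N by rewrite ltn_divLR.
pose M i := stabilizer_mx (i %% 18) *m A (i %/ 18)%N.
have sM i : (i < n * 18)%N -> symmetry w (M i).
  by move=> /div18/AP[sA _]; apply: symmetry_mul sA; exact: symmetry_stabilizer.
have h' i : exists phi : zeros F24 -> zeros F24, (i < n * 18)%N ->
    automorphisms (zeros F24) phi /\ acts (M i) phi.
  case: (boolP (i < n * 18)%N) => [lt_i|]; last by exists id.
  by have [phi P] := symmetry_acts (sM i lt_i); exists phi.
have [phi phiP] := choice h'.
have inj : {in `I_(n * 18) &, injective phi}.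
  move=> i j /set_mem/= lt_i /set_mem/= lt_j e.
  have [_ ai] := phiP i lt_i; have [_ aj] := phiP j lt_j.
  have ui := symmetry_unit w_root (sM i lt_i); have uj := symmetry_unit w_root (sM j lt_j).
  have pt v : v != 0 -> evalv F24 v = 0 -> exists k, v *m M i = k *: (v *m M j).
    move=> v0 fv; have [x xv] := point_zero hF v0 fv.
    apply/eq_point; [exact: unit_mulmx_neq0|exact: unit_mulmx_neq0|].
    by rewrite -(acts_point ui ai v0 xv) -(acts_point uj aj v0 xv) e.
  have baseM l : (l < n * 18)%N -> exists2 k, k != 0 & base_vec C *m M l = k *: q (l %/ 18)%N.
    move=> lt_l; have [k k0 bH] := base_stabilizer (l %% 18).
    have [_ [k' k'0 bA]] := AP _ (div18 _ lt_l).
    by exists (k * k'); rewrite ?mulf_neq0 // mulmxA bH -scalemxAl bA scalerA.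
  have [ki ki0 bi] := baseM i lt_i; have [kj kj0 bj] := baseM j lt_j.
  have eq18 : (i %/ 18 = j %/ 18)%N.
    apply: qinj; [exact: div18|exact: div18|].
    have [qi0 _ _] := sq _ (div18 _ lt_i); have [qj0 _ _] := sq _ (div18 _ lt_j).
    apply/(eq_point qi0 qj0); have [k] := pt _ b0 fb; rewrite bi bj => e'.
    exists (ki^-1 * (k * kj)); rewrite -!scalerA -e' scalerA mulVf //.
    by rewrite scale1r.
  have eqH v : v != 0 -> evalv F24 v = 0 ->
      exists k, v *m stabilizer_mx (i %% 18) = k *: (v *m stabilizer_mx (j %% 18)).
    move=> v0 fv; have [k] := pt v v0 fv; rewrite /M -eq18 !mulmxA => e'.
    have uA := symmetry_unit w_root (AP _ (div18 _ lt_i)).1.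
    by exists k; apply: (can_inj (mulmxK uA)); rewrite e' -scalemxAl.
  (* The two test points are images of the base point, hence lie on the surface. *)
  have s2base : vec4 1 0 (- 'i) 0 = base_vec C *m s2 C by rewrite mul_s2 oppr0.
  have s3base : vec4 (- 1) 0 0 (- 'i) = vec4 1 0 (- 'i) 0 *m s3 C by rewrite mul_s3.
  have f2 : evalv F24 (vec4 1 0 (- 'i) 0) = 0.
    by rewrite s2base; apply: etrans (symmetry_F24 w_root _ (symmetry_s2 w)) fb.
  have f3 : evalv F24 (vec4 (- 1) 0 0 (- 'i)) = 0.
    by rewrite s3base; apply: etrans (symmetry_F24 w_root _ (symmetry_s3 w)) f2.
  have [|k e2] := eqH _ _ f2; first by rewrite vec4_eq0 oner_eq0.
  have [|l e3] := eqH _ _ f3; first by rewrite vec4_eq0 oppr_eq0 oner_eq0.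
  have e18 := stabilizer_inj (ltn_pmod i (isT : (0 < 18)%N)) (ltn_pmod j (isT : (0 < 18)%N)) e2 e3.
  by rewrite (divn_eq i 18) (divn_eq j 18) eq18 e18.
rewrite -(card_le_eql (inj_card_eq inj)); apply: subset_card_le => _ [i /= lt_i <-].
by have [] := phiP i lt_i.
Qed.

End AutomorphismsF24.

(** * Finite sets of points have dimension 0 *)

Section FiniteDimension.
Local Open Scope ring_scope.
Local Open Scope classical_set_scope.
Variable C : numClosedFieldType.

Lemma form_through (v : 'rV[C]_4) (s : seq 'rV[C]_4) :
  {in s, forall u, u != 0 /\ ~ exists k, v = k *: u} ->
  exists e h, [/\ homogeneous e h, evalv h v != 0 & {in s, forall u, evalv h u = 0}].
Proof.
elim: s => [|u s IH] hs.
  exists 0%N, 1; split=> //; last by rewrite /evalv meval1 oner_neq0.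
  by rewrite /homogeneous -mpolyX0 dhomogX /= mdeg0.
have [|e [h [hh hv hu]]] := IH; first by move=> x xs; apply: hs; rewrite inE xs orbT.
have [u0 nu] := hs u (mem_head _ _); have [a ua] := neq0_coord u0.
have [j nj] : exists j, u 0 a * v 0 j - u 0 j * v 0 a != 0.
  apply/existsP; apply: contra_notT nu => /existsPn h0; exists (v 0 a / u 0 a).
  apply/rowP => j; rewrite mxE; apply: (mulfI ua); have := h0 j; rewrite negbK subr_eq0 => /eqP ->.
  by rewrite mulrA [u 0 a * _]mulrCA divff // mulr1 mulrC.
(* A linear form given by a 2 by 2 minor: it vanishes at u but not at v. *)
pose l : poly4 C := u 0 a *: mpolyX C (mnm1 j) - u 0 j *: mpolyX C (mnm1 a).
have lE x : evalv l x = u 0 a * x 0 j - u 0 j * x 0 a.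
  by rewrite evalvB; congr (_ - _); apply: etrans (mevalZ _ _ _) _; rewrite mevalXU.
have hl : homogeneous 1 l by apply: rpredB; apply: rpredZ; exact: homogeneous_var.
exists (1 + e)%N, (l * h); split; first exact: homogeneousM.
  by rewrite evalvM mulf_neq0 // lE.
move=> x; rewrite inE evalvM => /orP[/eqP->|/hu ->]; last by rewrite mulr0.
by rewrite lE [u 0 a * _]mulrC subrr mul0r.
Qed.

Lemma closed_point (p : P3 C) : zariski_closed [set p].
Proof.
exists [set h | (exists d, homogeneous d h) /\ vanishes_at h p]; split; first by move=> h [].
apply/seteqP; split=> [q -> h [] //|q /= hq].
have [v v0 pv] := pointP p; have [u u0 qu] := pointP q.
have [//|pq] := pselect (q = p); exfalso.
have [|e [h [hh hu hv]]] := @form_through u [:: v].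
  move=> x; rewrite inE => /eqP ->; split=> // uv; apply: pq.
  by rewrite pv qu; apply/(eq_point u0 v0).
have : vanishes_at h q.
  apply: hq; split; first by exists e.
  by rewrite pv; apply/(vanishes_pointE hh v0)/hv; rewrite inE.
by rewrite qu => /(vanishes_pointE hh u0) hu0; rewrite hu0 eqxx in hu.
Qed.

(** The set Y is covered by the point p and the zeros of a form that vanishes at the other points of
    s but not at p, so irreducibility leaves only p. *)
Lemma irreducible_finite (s : seq 'rV[C]_4) Y p q : {in s, forall x, x != 0} ->
  irreducible_closed Y -> Y `<=` point_set s -> Y p -> Y q -> q = p.
Proof.
move=> s0 [_ _ irrY] Ys Yp Yq; have [v vs pv] := Ys p Yp; have v0 := s0 v vs.
have [|e [h [hh hv hs]]] := @form_through v [seq u <- s | val (proj_point u) != val p].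
  move=> u; rewrite mem_filter => /andP[nu us]; split; first exact: s0.
  by move=> /(eq_point v0 (s0 u us)) e; rewrite pv e eqxx in nu.
have [|Y1|Yh] := irrY [set p] (zeros h) (closed_point p) (zeros_closed hh).
- move=> t Yt; have [u us tu] := Ys t Yt.
  have [tp|tp] := eqVneq (val t) (val p); first by left; apply: val_inj.
  right; rewrite tu; apply/(vanishes_pointE hh (s0 u us))/hs.
  by rewrite mem_filter us -tu tp.
- exact: Y1.
have := Yh p Yp; rewrite pv => /(vanishes_pointE hh v0) h0.
by rewrite h0 eqxx in hv.
Qed.

(** A chain of length 1 would have a single point as its larger member and so could not be
    strict. *)
Lemma zariski_dim_finite (s : seq 'rV[C]_4) : {in s, forall x, x != 0} -> s <> [::] ->
  zariski_dim (point_set s) 0.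
Proof.
move=> s0 sn; split; last first.
  move=> [Y [YP YY]]; have [[_ [q Y0q] _] _] := YP 0%N isT.
  have [irr1 Ys] := YP 1%N isT; have [Y01 nY] := YY 0%N isT; apply: nY => t Yt.
  by rewrite (irreducible_finite s0 irr1 Ys (Y01 _ Y0q) Yt).
case: s s0 sn => // v s s0 _; exists (fun=> [set proj_point v]); split=> // i _; split.
  split; [exact: closed_point|by exists (proj_point v)|move=> A B _ _ AB].
  by case: (AB _ erefl) => h; [left|right] => _ ->.
by move=> _ ->; exists v => //; exact: mem_head.
Qed.

End FiniteDimension.

(** * The surfaces Z(g[k]) and their singular loci *)

Section OcticSurfaces.
Local Open Scope ring_scope.
Local Open Scope classical_set_scope.
Local Open Scope card_scope.
#[local] Opaque octic_expr with_support.
Variable C : numClosedFieldType.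
Variable w : C.
Hypothesis w_root : w ^+ 2 + w + 1 = 0.
Local Notation g k := (subst_pow k (octic C)).

(** For k = 1 only the points without zero coordinate remain, that is, those of support dimension
    3. *)
Definition singular_points k := if k == 1%N then points w 1 3 else all_points w k.

Lemma singular_points_neq0 k : (0 < k)%N -> {in singular_points k, forall x, x != 0}.
Proof.
move=> k0 x; rewrite /singular_points; case: eqP => [_ h|_ /(mem_all_points) [e _ h]].
  exact: (points_neq0 w_root (isT : (0 < 1)%N) h).
exact: (points_neq0 w_root k0 h).
Qed.

Lemma singular_locusP k : (0 < k)%N -> singular_locus (g k) = point_set (singular_points k).
Proof.
move=> k0; rewrite /singular_points; case: eqP => [->|/eqP k1]; first exact: singular_locus_octic.
by apply: singular_locus_points => //; rewrite ltn_neqAle eq_sym k1.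
Qed.

Lemma points_singular_points k x : (0 < k)%N -> x \in points w k 3 -> x \in singular_points k.
Proof.
by move=> k0; rewrite /singular_points; case: eqP => [->//|_]; exact: in_all_points.
Qed.

Lemma mem_list_In (T : eqType) (x : T) s : x \in s -> List.In x s.
Proof.
elim: s => // y s IH; rewrite inE => /orP[/eqP->|/IH h]; first by left.
by right.
Qed.

Lemma singular_vec_isolated k x : (0 < k)%N -> x != 0 -> evalv (g k) x = 0 ->
  (forall i, evalv (mderiv i (g k)) x = 0) ->
  exists2 y, List.In y (singular_points k) & exists a, x = a *: y.
Proof.
move=> k0 x0 fx dx.
have : singular_locus (g k) (proj_point x) by apply/(singular_locusE k0 x0); split.
rewrite (singular_locusP k0) => -[y ys xy]; exists y; first exact: mem_list_In.
by apply/(eq_point x0 (singular_points_neq0 k0 ys)).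
Qed.

Lemma octic_pow_axis k : (0 < k)%N -> evalv (g k) (row4 (fun=> 0) 1) != 0.
Proof. by move=> k0; rewrite octic_pow_e4 // oner_neq0. Qed.

Lemma irreducible_octic_pow k : (0 < k)%N -> irreducible_surface (g k) (8 * k).
Proof.
move=> k0; have d0 : (0 < 8 * k)%N by rewrite muln_gt0.
apply: (isolated_irreducible_surface d0 (homogeneous_octic_pow C k) (octic_pow_axis k0)).
by move=> x; exact: singular_vec_isolated.
Qed.

Lemma octic_pow_divides k h : (0 < k)%N -> (forall x, x != 0 -> evalv (g k) x = 0 -> evalv h x = 0) ->
  exists q, h = q * g k.
Proof.
move=> k0; have d0 : (0 < 8 * k)%N by rewrite muln_gt0.
apply: (vanishing_divides d0 (homogeneous_octic_pow C k) (octic_pow_axis k0)).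
by move=> x; exact: singular_vec_isolated.
Qed.

Lemma points_listed k e x : (0 < k)%N -> x \in points w k e -> listed_cubes w (coords_pow k x).
Proof.
move=> k0 /pointsP[m [lt_m _ xin]]; exact: (listed_point_listed w_root k0 lt_m xin).
Qed.

Lemma points_D4 k x : (0 < k)%N -> x \in points w k 3 ->
  has_germ (zeros (g k)) (proj_point x) (D4_germ C).
Proof.
move=> k0 xin; have cx := points_count w_root k0 xin.
apply: (D4_torus w_root k0); [exact: (points_neq0 w_root k0 xin)| |exact: points_listed xin].
move=> i lt_i; have /allP : all (fun i => coords x i != 0) (iota 0 4) by rewrite all_count cx.
by move=> /(_ i); apply; rewrite mem_iota.
Qed.

Lemma points_D4_type k : (0 < k)%N -> point_set (points w k 3) `<=` singularities_of_type (D4_germ C) (g k).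
Proof.
move=> k0 _ [x xin ->]; split; last exact: points_D4.
by rewrite singular_locusP //; exists x => //; exact: points_singular_points.
Qed.

Lemma size_pointsE k e n : (0 < k)%N -> size (with_support e) = n ->
  size (points w k e) = (n * k ^ e)%N.
Proof. by move=> k0 <-; exact: size_points. Qed.

Lemma card_points3 k : (0 < k)%N -> point_set (points w k 3) #= `I_(44 * k ^ 3)%N.
Proof.
move=> k0; have [e3 _ _] := size_with_support.
have := card_points w_root 3 k0; rewrite (size_pointsE k0 e3) => card; exact: card.
Qed.

Lemma octic_D4 : singular_locus (g 1) `<=` singularities_of_type (D4_germ C) (g 1).
Proof. by rewrite singular_locusP //; exact: points_D4_type. Qed.

Lemma octic_pow_D4 k : (0 < k)%N -> `I_(44 * k ^ 3)%N #<= singularities_of_type (D4_germ C) (g k).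
Proof.
by move=> k0; rewrite -(card_le_eql (card_points3 k0)); apply: subset_card_le; exact: points_D4_type.
Qed.

Lemma octic_pow_dim k : (0 < k)%N -> zariski_dim (singular_locus (g k)) 0.
Proof.
move=> k0; rewrite singular_locusP //; apply: zariski_dim_finite; first exact: singular_points_neq0.
have : (0 < size (points w k 3))%N.
  have [e3 _ _] := size_with_support; rewrite (size_pointsE k0 e3).
  by rewrite muln_gt0 expn_gt0 k0.
case e : (points w k 3) => [//|x s] _ sp; have xin : x \in points w k 3 by rewrite e mem_head.
by have := points_singular_points k0 xin; rewrite sp.
Qed.

Definition germ_type e : set 'rV[C]_3 :=
  if e == 3%N then D4_germ C else if e == 2%N then A_germ C 2 else A_germ C 1.

Lemma points_germ e x : (e \in [:: 3; 2; 1])%N -> x \in points w 2 e ->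
  has_germ (zeros (g 2)) (proj_point x) (germ_type e).
Proof.
move=> es xin; have k0 : (0 < 2)%N by []; have cx := points_count w_root k0 xin.
have sx : singular_vec (g 2) x.
  apply/(singular_pow_listed w_root _ (isT : (1 < 2)%N)); split; last exact: points_listed xin.
  exact: (points_neq0 w_root k0 xin).
move: es xin cx; rewrite !inE => /or3P[]/eqP -> xin cx; rewrite /germ_type /=.
- exact: points_D4.
- exact: (A2_plane2 w_root sx cx).
exact: (A1_line2 sx cx).
Qed.

Lemma germ_type_inj e e' : (e \in [:: 3; 2; 1])%N -> (e' \in [:: 3; 2; 1])%N ->
  germ_iso (germ_type e) 0 (germ_type e') 0 -> e = e'.
Proof.
rewrite !inE => /or3P[]/eqP -> /or3P[]/eqP ->; rewrite /germ_type //= => iso; exfalso.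
- exact: (@A2_not_D4 C (germ_iso_sym iso)).
- exact: (@A1_not_D4 C (germ_iso_sym iso)).
- exact: (@A2_not_D4 C iso).
- exact: (@A2_not_A1 C iso).
- exact: (@A1_not_D4 C iso).
exact: (@A2_not_A1 C (germ_iso_sym iso)).
Qed.

Lemma singular_locus2 : singular_locus (g 2) = point_set (all_points w 2).
Proof. exact: singular_locus_points. Qed.

(** Every singular point of g[2] has the germ attached to its support dimension. Since the three
    germs are pairwise not isomorphic, having a given germ determines that dimension. *)
Lemma germ_type_points e : (e \in [:: 3; 2; 1])%N ->
  singularities_of_type (germ_type e) (g 2) = point_set (points w 2 e).
Proof.
move=> es; apply/seteqP; split=> [p [+ pe]|_ [x xin ->]].
  rewrite singular_locus2 => -[x /mem_all_points[e' es' xin] px]; rewrite px in pe *.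
  have iso := has_germ_unique (homogeneous_octic_pow C 2) pe (points_germ es' xin).
  by rewrite (germ_type_inj es es' iso); exists x.
split; last exact: points_germ.
by rewrite singular_locus2; exists x => //; exact: in_all_points xin.
Qed.

Lemma card_germ_type e : (e \in [:: 3; 2; 1])%N ->
  singularities_of_type (germ_type e) (g 2) #= `I_(size (with_support e) * 2 ^ e)%N.
Proof.
move=> es; rewrite germ_type_points // -(size_points w_root _ (isT : (0 < 2)%N)).
exact: card_points.
Qed.

Lemma singular_locus2_types : singular_locus (g 2) `<=`
  singularities_of_type (A_germ C 1) (g 2) `|` singularities_of_type (A_germ C 2) (g 2) `|`
  singularities_of_type (D4_germ C) (g 2).
Proof.
move=> p; rewrite singular_locus2 => -[x /mem_all_points[e es xin] ->].
have : singularities_of_type (germ_type e) (g 2) (proj_point x).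
  by rewrite germ_type_points //; exists x.
move: es; rewrite !inE => /or3P[]/eqP ->; rewrite /germ_type /= => h; first by right.
- by left; right.
by left; left.
Qed.

Lemma F24_D4 : singular_locus (g 3) `<=` singularities_of_type (D4_germ C) (g 3).
Proof.
move=> p sp; split=> //; have [x x0 px] := pointP p; rewrite px in sp *.
have sx := (singular_locusE (isT : (0 < 3)%N) x0).1 sp.
have [i [a [k [k0 xE]]]] := chart_of x0.
apply: (has_germ_loc_iso (homogeneous_octic_pow C 3) k0 xE); apply: (D4_F24 w_root).
have -> : chart i a = k^-1 *: x by rewrite xE scalerA mulVf // scale1r.
by apply: singular_scale sx; rewrite ?invr_eq0 //; exact: homogeneous_octic_pow.
Qed.

Lemma uniq_all_points k : (0 < k)%N -> uniq (all_points w k).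
Proof.
move=> k0; rewrite /all_points !cat_uniq !(uniq_points w_root _ k0) /= andbT.
have dis e e' : e != e' -> ~~ has (mem (points w k e)) (points w k e').
  move=> ee; apply/hasPn => x xin; apply/negP => xin'.
  have [e0 _] := points_inj w_root k0 xin' xin (esym (scale1r x)).
  by rewrite e0 eqxx in ee.
by rewrite has_cat !negb_or !dis.
Qed.

Lemma size_all_points k : (0 < k)%N ->
  size (all_points w k) = (44 * k ^ 3 + 24 * k ^ 2 + 12 * k)%N.
Proof.
move=> k0; have [e3 e2 e1] := size_with_support.
have p3 := size_pointsE k0 e3; have p2 := size_pointsE k0 e2; have p1 := size_pointsE k0 e1.
rewrite expn1 in p1; rewrite /all_points; clear e3 e2 e1.
move: (points w k 3) (points w k 2) (points w k 1) p3 p2 p1 => q3 q2 q1 p3 p2 p1.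
by rewrite !size_cat p3 p2 p1 addnA.
Qed.

Lemma F24_automorphisms : `I_(1440 * 18)%N #<= automorphisms (zeros (g 3)).
Proof.
have k0 : (0 < 3)%N by [].
have sz : size (all_points w 3) = 1440%N by rewrite size_all_points.
apply: (aut_card w_root (q := nth 0 (all_points w 3))) => [i lt_i|i j lt_i lt_j].
  have [e es xin] : exists2 e, (e \in [:: 3; 2; 1])%N & nth 0 (all_points w 3) i \in points w 3 e.
    by apply: mem_all_points; rewrite mem_nth // sz.
  apply/(singular_pow_listed w_root _ (isT : (1 < 3)%N)); split; last exact: points_listed xin.
  exact: (points_neq0 w_root k0 xin).
have [] : nth 0 (all_points w 3) i \in all_points w 3 /\ nth 0 (all_points w 3) j \in all_points w 3.
  by rewrite !mem_nth ?sz.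
move=> /mem_all_points[e _ xi] /mem_all_points[e' _ xj].
move=> /(eq_point (points_neq0 w_root k0 xi) (points_neq0 w_root k0 xj))[a xy].
have [_ /eqP] := points_inj w_root k0 xi xj xy.
by rewrite nth_uniq ?sz // ?uniq_all_points // => /eqP.
Qed.

(** The first half concerns arbitrary automorphisms, not only linear ones, and rests on the fact
    that g[3] divides every polynomial vanishing on its zeros. *)
Lemma F24_transitive : automorphisms_transitive_on (zeros (g 3)) (singular_locus (g 3)).
Proof.
have k0 : (0 < 3)%N by []; split; last exact: (symmetry_transitive w_root).
move=> phi aut x; apply: (@automorphism_singular C (g 3) (8 * 3)) => //.
- exact: homogeneous_octic_pow.
- by move=> h; exact: octic_pow_divides.
by move=> v v0; exact: singular_locusE.
Qed.

End OcticSurfaces.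

(** * A primitive cube root of unity and the conclusion *)

Lemma exists_cube_root_unity (C : numClosedFieldType) : exists w : C, (w ^+ 2 + w + 1 = 0)%R.
Proof.
pose t : C := ('i * sqrtC 3%:R)%R; have t2 : (t ^+ 2 = - 3%:R)%R.
  by rewrite exprMn sqrCi sqrtCK mulN1r.
exists ((t - 1) / 2%:R)%R.
by transitivity ((t ^+ 2 + 3%:R) / 4%:R)%R; [field|rewrite t2 addNr mul0r].
Qed.

Local Open Scope classical_set_scope.
Local Open Scope card_scope.
Local Open Scope nat_scope.

Theorem theorem2 (R : realType) :
  let C := complexes R in
  let g := octic C in
  (* (a) *)
  (irreducible_surface g 8 /\
   singular_locus g #= `I_44 /\
   singular_locus g `<=` singularities_of_type (D4_germ C) g) /\
  (* (b) *)
  (forall k : nat, 1 <= k ->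
   irreducible_surface (subst_pow k g) (8 * k) /\
   zariski_dim (singular_locus (subst_pow k g)) 0 /\
   `I_(44 * k ^ 3) #<= singularities_of_type (D4_germ C) (subst_pow k g)) /\
  (* (c) *)
  (irreducible_surface (subst_pow 2 g) 16 /\
   singular_locus (subst_pow 2 g) #= `I_472 /\
   singularities_of_type (A_germ C 1) (subst_pow 2 g) #= `I_24 /\
   singularities_of_type (A_germ C 2) (subst_pow 2 g) #= `I_96 /\
   singularities_of_type (D4_germ C) (subst_pow 2 g) #= `I_352 /\
   singular_locus (subst_pow 2 g) `<=`
     singularities_of_type (A_germ C 1) (subst_pow 2 g) `|`
     singularities_of_type (A_germ C 2) (subst_pow 2 g) `|`
     singularities_of_type (D4_germ C) (subst_pow 2 g)) /\
  (* (d) *)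
  (irreducible_surface (subst_pow 3 g) 24 /\
   singular_locus (subst_pow 3 g) #= `I_1440 /\
   singular_locus (subst_pow 3 g) `<=`
     singularities_of_type (D4_germ C) (subst_pow 3 g) /\
   `I_25920 #<= automorphisms (zeros (subst_pow 3 g)) /\
   automorphisms_transitive_on (zeros (subst_pow 3 g))
     (singular_locus (subst_pow 3 g))).

Proof.
move=> C g; have [w w_root] := exists_cube_root_unity C.
have g1 : subst_pow 1 g = g by exact: subst_pow1.
have c2 := card_germ_type w_root; have [e3 e2 e1] := size_with_support.
split; [|split; [|split]].
- have irr := irreducible_octic_pow w_root (isT : 0 < 1).
  have D4 := octic_D4 w_root; have card := card_points3 w_root (isT : 0 < 1).
  have sing := singular_locus_octic w_root; rewrite -/g !g1 in irr D4 sing.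
  split; first exact: irr.
  by split; [rewrite sing; exact: card|exact: D4].
- move=> k k0; split; first exact: (irreducible_octic_pow w_root k0).
  by split; [exact: (octic_pow_dim w_root k0)|exact: (octic_pow_D4 w_root k0)].
- split; first exact: (irreducible_octic_pow w_root (isT : 0 < 2)).
  split; first by rewrite /g (singular_locus2 w_root); exact: (card_all_points w_root (isT : 0 < 2)).
  split; first by have := c2 1%N isT; rewrite e1.
  split; first by have := c2 2%N isT; rewrite e2.
  split; first by have := c2 3%N isT; rewrite e3.
  exact: (singular_locus2_types w_root).
split; first exact: (irreducible_octic_pow w_root (isT : 0 < 3)).
split.
  rewrite /g (singular_locus_points w_root (isT : 1 < 3)).
  exact: (card_all_points w_root (isT : 0 < 3)).
split; first exact: (F24_D4 w_root).
split; last exact: (F24_transitive w_root).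
(* The orbit of 1440 points times the 18 symmetries fixing one of them. *)
rewrite (_ : 25920 = 1440 * 18); first exact: (F24_automorphisms w_root).
by vm_compute.
Qed.
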